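(* Let $\{R^z\}_{z\in\mathbb{Z}^2}$ and $\{T^z\}_{z\in\mathbb{Z}^2}$ be measure-preserving $\mathbb{Z}^2$-actions on Lebesgue spaces such that the product action $\{R^z\times R^z\times T^z\times T^z\}_{z\in\mathbb{Z}^2}$ is totally ergodic. Suppose that: 1. the actions $\{\hat R^z\odot\hat R^z\}_{z\in\mathbb{Z}^2}$ and $\{\hat T^z\odot\hat T^z\}_{z\in\mathbb{Z}^2}$ have simple spectrum; 2. there are sequences $\{w_i\}$, $\{u_i\}$ in $\mathbb{Z}^2$ and numbers $a_1,a_2,b_1,b_2>0$ such that, in the weak operator topology as $i\to\infty$, $$\hat R^{w_i}\to a_1I+(1-a_1)\Theta,\qquad \hat T^{w_i}\to b_1\hat T^{(1,0)}+(1-b_1)\Theta,$$ $$\hat R^{u_i}\to a_2I+(1-a_2)\Theta,\qquad \hat T^{u_i}\to b_2\hat T^{(0,1)}+(1-b_2)\Theta.$$ Then the set of spectral multiplicities of the action $\{R^z\times R^z\times T^z\times T^z\}_{z\in\mathbb{Z}^2}$ is $\{2,4\}$.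
   Context: A $\mathbb{Z}^2$-action is a family $\{S^z\}_{z\in\mathbb{Z}^2}$ of measure-preserving automorphisms of a Lebesgue space (standard nonatomic probability space) $(Y,\nu)$ with $S^{z_1}\circ S^{z_2}=S^{z_1+z_2}$ for all $z_1,z_2\in\mathbb{Z}^2$. The automorphism $S^z$ induces the unitary operator $\hat S^z$ on $L_2(Y,\nu)$, $(\hat S^z f)(y)=f(S^z y)$. The action is totally ergodic if $S^z$ is ergodic for every $z\neq 0$. The Koopman operators of the product action $R^z\times R^z\times T^z\times T^z$ are $\hat R^z\otimes\hat R^z\otimes\hat T^z\otimes\hat T^z$. $I$ is the identity operator and $\Theta$ is the orthogonal projection onto the subspace of constants in the relevant $L_2$ space. $\hat S^z\odot\hat S^z$ denotes the restriction of $\hat S^z\otimes\hat S^z$ to the invariant subspace of symmetric functions $\{g\in L_2(Y\times Y,\nu\otimes\nu): g(x,y)=g(y,x)\}$. Simple spectrum of $\{\hat S^z\odot\hat S^z\}$ means that the orthogonal complement of the constants in this symmetric subspace is cyclic, i.e. is the closed linear span of the orbit of a single vector. The set of spectral multiplicities of an action is the set of essential values of the spectral multiplicity function of the associated unitary representation of $\mathbb{Z}^2$ on the orthogonal complement of the constants in $L_2$. *)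

(* Defs.v *)
From HB Require Import structures.
From mathcomp Require Import all_boot all_order all_algebra.
From mathcomp Require Import complex.
From mathcomp Require Import all_classical all_reals all_analysis.

Set Implicit Arguments.
Unset Strict Implicit.
Unset Printing Implicit Defensive.

Import Order.TTheory GRing.Theory Num.Theory.
Import numFieldNormedType.Exports.

Local Open Scope classical_set_scope.
Local Open Scope ring_scope.
Local Open Scope complex_scope.

Section LebesgueSpaces.
Context {R : realType} {d : measure_display} {X : measurableType d}.
Implicit Types (P : probability X R) (S : int * int -> X -> X).

(* P is isomorphic mod 0 to Lebesgue measure on [0, 1]. Images of measurable
   sets are only required to be Borel up to a null set, so that both standard
   Borel spaces and their completions (Rokhlin's Lebesgue spaces) qualify. *)
Definition lebesgue_space P : Prop :=
  exists (X0 : set X) (I0 : set R) (phi : X -> R),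
    [/\ measurable X0 /\ P X0 = 1%E,
        [/\ measurable I0, I0 `<=` `[0, 1] & lebesgue_measure I0 = 1%E],
        set_bij X0 I0 phi,
        forall B : set R, measurable B -> B `<=` I0 ->
          measurable (X0 `&` phi @^-1` B) /\
          P (X0 `&` phi @^-1` B) = lebesgue_measure B
      & forall A : set X, measurable A -> A `<=` X0 ->
          exists2 B : set R, measurable B &
            lebesgue_measure.-negligible ((phi @` A) `+` B)].

Definition measure_preserving P (f : X -> X) : Prop :=
  measurable_fun setT f /\
  forall A : set X, measurable A -> P (f @^-1` A) = P A.

(* Automorphisms and the group law are understood mod 0, as usual for maps of
   Lebesgue spaces. *)
Definition automorphism P (f : X -> X) : Prop :=
  measure_preserving P f /\
  exists2 g : X -> X, measure_preserving P g &
    {ae P, forall x, g (f x) = x /\ f (g x) = x}.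

Definition Z2_action P S : Prop :=
  (forall z, automorphism P (S z)) /\
  forall z1 z2, {ae P, forall x, S z1 (S z2 x) = S (z1 + z2) x}.

Definition ergodic P (f : X -> X) : Prop :=
  forall A : set X, measurable A -> P ((f @^-1` A) `+` A) = 0%E ->
    P A = 0%E \/ P A = 1%E.

Definition totally_ergodic P S : Prop := forall z, z != 0 -> ergodic P (S z).

End LebesgueSpaces.

Definition product_probability {R : realType} {d1 d2 : measure_display}
    {X : measurableType d1} {Y : measurableType d2}
    (P : probability X R) (Q : probability Y R) : probability (X * Y)%type R :=
  (P \x Q)%E.

Definition product_action {X Y : Type} (S : int * int -> X -> X)
    (T : int * int -> Y -> Y) (z : int * int) (p : X * Y) : X * Y :=
  (S z p.1, T z p.2).

(* Elements of the complex space L_2(X, mu) are represented by functions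
   X -> R[i], equality in L_2 being equality mu-almost everywhere. *)
Section L2.
Context {R : realType} {d : measure_display} {X : measurableType d}.
Variable mu : {measure set X -> \bar R}.
Implicit Types (f g h : X -> R[i]).

Definition cmeasurable f : Prop :=
  measurable_fun setT (fun x => complex.Re (f x)) /\
  measurable_fun setT (fun x => complex.Im (f x)).

Definition sqnormC (z : R[i]) : R := complex.Re z ^+ 2 + complex.Im z ^+ 2.

Definition sqnorm f : \bar R := (\int[mu]_x (sqnormC (f x))%:E)%E.

Definition L2 : set (X -> R[i]) :=
  [set f | cmeasurable f /\ (sqnorm f < +oo)%E].

Definition cintegral f : R[i] :=
  (\int[mu]_x complex.Re (f x)) +i* (\int[mu]_x complex.Im (f x)).

Definition inner f g : R[i] := cintegral (fun x => f x * (g x)^*).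

Definition orthocomp_constants : set (X -> R[i]) :=
  [set f | L2 f /\ forall c : R[i], inner f (cst c) = 0].

(* For a probability measure mu, 1 is a unit vector, so that f |-> <f, 1> 1 is
   the orthogonal projection onto the constants. *)
Definition Theta f : X -> R[i] := cst (inner f (cst 1)).

(* R[i]^o is R[i] with its usual topology. *)
Definition weak_operator_cvg (A : nat -> (X -> R[i]) -> X -> R[i])
    (B : (X -> R[i]) -> X -> R[i]) : Prop :=
  forall f g, L2 f -> L2 g ->
    (fun i => inner (A i f) g : R[i]^o) @ \oo --> (inner (B f) g : R[i]^o).

Definition closed_span (G : set (X -> R[i])) : set (X -> R[i]) :=
  [set f | L2 f /\ forall e : R, 0 < e ->
    exists (n : nat) (c : 'I_n -> R[i]) (g : 'I_n -> X -> R[i]),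
      (forall j, G (g j)) /\
      (sqnorm (fun x => f x - \sum_(j < n) c j * g j x)%R < e%:E)%E].

Implicit Types (H : set (X -> R[i])) (U : int * int -> (X -> R[i]) -> X -> R[i]).

Definition cyclic_on H U : Prop :=
  exists2 h, H h & H = closed_span (range (fun z => U z h)).

End L2.

Definition koopman {R : realType} {X : Type} (S : int * int -> X -> X)
    (z : int * int) (f : X -> R[i]) : X -> R[i] := f \o S z.

Section SymmetricSquare.
Context {R : realType} {d : measure_display} {X : measurableType d}.
Variable P : probability X R.

Definition symmetric_functions : set (X * X -> R[i]) :=
  [set g | L2 (product_probability P P) g /\
    {ae product_probability P P, forall p, g (p.1, p.2) = g (p.2, p.1)}].

(* Simple spectrum of the restriction of the Koopman representation of S x S
   to the symmetric functions. *)
Definition symmetric_square_simple_spectrum (S : int * int -> X -> X) : Prop :=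
  cyclic_on (product_probability P P)
    (symmetric_functions `&` orthocomp_constants (product_probability P P))
    (koopman (product_action S S)).

End SymmetricSquare.

(* The dual group of Z^2 is represented by the fundamental domain [0, 1[^2 of
   R^2 / Z^2, t being the character z |-> exp (2 i pi (z.1 t.1 + z.2 t.2)).
   Multiplicities lie in option nat, None being the infinite multiplicity. *)
Section SpectralMultiplicity.
Context {R : realType} {d : measure_display} {X : measurableType d}.
Variable mu : {measure set X -> \bar R}.
Implicit Types (H : set (X -> R[i])) (U : int * int -> (X -> R[i]) -> X -> R[i]).

Local Notation dual := (measurableTypeR R * measurableTypeR R)%type.

Implicit Types (sigma : {finite_measure set dual -> \bar R})
  (m : dual -> option nat)
  (F : nat -> dual -> R[i]).

Definition character (z : int * int) (t : dual) : R[i] :=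
  let a := 2 * pi * (z.1%:~R * t.1 + z.2%:~R * t.2) in cos a +i* sin a.

Definition below (n : nat) (k : option nat) : bool :=
  if k is Some k' then (n < k')%N else true.

Definition direct_integral_sqnorm sigma F : \bar R :=
  (\sum_(n <oo) sqnorm sigma (F n))%E.

(* The Hilbert space of square-integrable sections t |-> (F n t)_n of the field
   of spaces l_2({n | n < m t}), i.e. the direct integral over sigma of Hilbert
   spaces of dimension m t. *)
Definition direct_integral sigma m : set (nat -> dual -> R[i]) :=
  [set F | [/\ forall n, cmeasurable (F n),
               forall n, {ae sigma, forall t, ~~ below n (m t) -> F n t = 0}
             & (direct_integral_sqnorm sigma F < +oo)%E]].

(* Hahn-Hellinger: a unitary operator Phi from H onto the direct integral
   conjugates U z to multiplication by the character z. The measure sigma is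
   then of maximal spectral type and m is the multiplicity function. *)
Definition spectral_representation H U sigma m : Prop :=
  [/\ sigma (~` (`[0, 1[ `*` `[0, 1[)) = 0%E,
      forall k, measurable (m @^-1` [set k]),
      sigma (m @^-1` [set Some 0%N]) = 0%E
    & exists Phi : (X -> R[i]) -> nat -> dual -> R[i],
      [/\ forall f, H f -> direct_integral sigma m (Phi f),
          forall c f g, H f -> H g -> forall n, {ae sigma, forall t,
            Phi (fun x => c * f x + g x) n t = c * Phi f n t + Phi g n t},
          forall f, H f -> direct_integral_sqnorm sigma (Phi f) = sqnorm mu f,
          forall F, direct_integral sigma m F -> exists2 f, H f &
            forall n, {ae sigma, forall t, Phi f n t = F n t}
        & forall z f, H f -> forall n, {ae sigma, forall t,
            Phi (U z f) n t = character z t * Phi f n t}]].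

(* The essential values of the multiplicity function of the restriction of U to
   H; sigma is unique up to equivalence and m is unique up to a null set. *)
Definition spectral_multiplicities_on H U : set (option nat) :=
  [set k | exists sigma m,
    spectral_representation H U sigma m /\ (0 < sigma (m @^-1` [set k]))%E].

End SpectralMultiplicity.

Definition spectral_multiplicities {R : realType} {d : measure_display}
    {X : measurableType d} (P : probability X R) (S : int * int -> X -> X) :
    set (option nat) :=
  spectral_multiplicities_on P (orthocomp_constants P) (koopman S).

(* Main.v *)
(* By the symmetric square hypothesis and total ergodicity, L_2(X) is cyclic, so it is L_2 of a
   probability s on the torus (Herglotz) with the action by characters; likewise L_2(Y) and r. On
   L_2 of s * s * r * r, with points (x, x', y, y'), the product action is multiplication by the
   characters of x + x' + y + y', and its multiplicity function counts the points of the fibres of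
   this sum, the origin excluded (it carries the constants).

   The weak limits express a positive multiple of the character (1, 0), resp. (0, 1), of y + y' as a
   function of the total sum. Hence y + y', and then x + x', are functions of the total sum. Simple
   spectrum of the symmetric squares says that x + x' determines the pair (x, x') up to order, and
   y + y' determines (y, y') up to order. A fibre is thus obtained from one of its points by the flips
   of the two pairs. It has 4 points if x <> x' and y <> y', and 2 points if exactly one of the pairs
   is a tie, which only happens at x = x' = 0 or y = y' = 0, because s and r have no atoms off 0.
   Both cases have positive measure. *)

From HB Require Import structures.
Require Import Defs.
From mathcomp Require Import all_boot all_order all_algebra.
From mathcomp Require Import complex finmap.
From mathcomp Require Import all_classical all_reals all_analysis.
From mathcomp Require Import measurable_realfun.
From mathcomp Require Import ring lra zify.

Set Implicit Arguments.
Unset Strict Implicit.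
Unset Printing Implicit Defensive.

Import Order.TTheory GRing.Theory Num.Theory.
Import numFieldNormedType.Exports.

Local Open Scope classical_set_scope.
Local Open Scope ring_scope.
Local Open Scope complex_scope.
Local Open Scope ring_scope.

(** A multiplicity is an essential value in some spectral representation. One model shows that 2 and
    4 occur; that nothing else occurs needs any two models to agree, which is
    [spectral_multiplicity_unique]. There the mass of a vector over a set [A] is the same in both
    models, because trigonometric polynomials approximate the indicator of [A] in both at once, and
    counting orthogonal vectors in a fibre does the rest.

    Being a function of a sum always has the same source: an element of the closed span of the
    functions [character z (tau t) * H t] is of the form [G (tau t) * H t] ([cyclic_span_factor]).
    For the weak limits [H] is 1; for the symmetric squares [H] is the model of the cyclic vector.

    Pairs are recovered only up to order, so a lexicographic order supplies measurable
    representatives. The flips preserve both the measure and the total sum, which makes the image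
    measures of the sheets comparable. *)

Local Notation cRe := complex.Re.
Local Notation cIm := complex.Im.

(** * Square-integrable complex functions *)

Section ComplexNumbers.
Context {R : realType}.
Implicit Types z w : R[i].

Lemma cReM z w : cRe (z * w) = cRe z * cRe w - cIm z * cIm w.
Proof. by case: z => a b; case: w => c d. Qed.

Lemma cImM z w : cIm (z * w) = cRe z * cIm w + cIm z * cRe w.
Proof. by case: z => a b; case: w => c d. Qed.

Lemma cReD z w : cRe (z + w) = cRe z + cRe w.
Proof. by case: z => a b; case: w => c d. Qed.

Lemma cImD z w : cIm (z + w) = cIm z + cIm w.
Proof. by case: z => a b; case: w => c d. Qed.

Lemma cReN z : cRe (- z) = - cRe z.
Proof. by case: z. Qed.

Lemma cImN z : cIm (- z) = - cIm z.
Proof. by case: z. Qed.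

Lemma cReJ z : cRe z^* = cRe z.
Proof. by case: z. Qed.

Lemma cImJ z : cIm z^* = - cIm z.
Proof. by case: z. Qed.

Lemma ceqP z w : cRe z = cRe w -> cIm z = cIm w -> z = w.
Proof. by case: z => a b; case: w => c d /= -> ->. Qed.

Definition cE := (cReM, cImM, cReD, cImD, cReN, cImN, cReJ, cImJ).

Lemma cRe_sum I (r : seq I) (P : pred I) (F : I -> R[i]) :
  cRe (\sum_(i <- r | P i) F i) = \sum_(i <- r | P i) cRe (F i).
Proof. by apply: (big_morph _ cReD). Qed.

Lemma cIm_sum I (r : seq I) (P : pred I) (F : I -> R[i]) :
  cIm (\sum_(i <- r | P i) F i) = \sum_(i <- r | P i) cIm (F i).
Proof. by apply: (big_morph _ cImD). Qed.

Lemma sqnormC_ge0 z : 0 <= sqnormC z.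
Proof. by rewrite addr_ge0 ?sqr_ge0. Qed.

Lemma sqnormCM z w : sqnormC (z * w) = sqnormC z * sqnormC w.
Proof. rewrite /sqnormC !cE; ring. Qed.

Lemma sqnormCJ z : sqnormC z^* = sqnormC z.
Proof. rewrite /sqnormC !cE; ring. Qed.

Lemma sqnormCN z : sqnormC (- z) = sqnormC z.
Proof. rewrite /sqnormC !cE; ring. Qed.

Lemma sqnormC0 : sqnormC (0 : R[i]) = 0.
Proof. rewrite /sqnormC /=; ring. Qed.

Lemma sqnormC1 : sqnormC (1 : R[i]) = 1.
Proof. rewrite /sqnormC /=; ring. Qed.

Lemma sqnormC_real (a : R) : sqnormC a%:C = a ^+ 2.
Proof. rewrite /sqnormC /=; ring. Qed.

Lemma sqnormC_eq0 z : (sqnormC z == 0) = (z == 0).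
Proof.
apply/eqP/eqP => [h|->]; last exact: sqnormC0.
have h1 : cRe z ^+ 2 == 0.
  by rewrite eq_le sqr_ge0 andbT -h lerDl sqr_ge0.
have h2 : cIm z ^+ 2 == 0.
  by rewrite eq_le sqr_ge0 andbT -h lerDr sqr_ge0.
by apply: ceqP; apply/eqP; rewrite -sqrf_eq0.
Qed.

Lemma mulcJ z : z * z^* = (sqnormC z)%:C.
Proof. by apply: ceqP; rewrite !cE /sqnormC /=; ring. Qed.

Lemma sqnormCD_le z w : sqnormC (z + w) <= 2 * (sqnormC z + sqnormC w).
Proof.
rewrite -subr_ge0 (_ : _ - _ = sqnormC (z - w)) ?sqnormC_ge0//.
rewrite /sqnormC !cE; ring.
Qed.

Lemma sqnormCB_le z w : sqnormC (z - w) <= 2 * (sqnormC z + sqnormC w).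
Proof. by rewrite (le_trans (sqnormCD_le _ _))// sqnormCN. Qed.

Lemma norm_cRe_mulJ z w : `|cRe (z * w^*)| <= sqnormC z + sqnormC w.
Proof.
rewrite ler_norml !cE /sqnormC.
have := sqr_ge0 (cRe z + cRe w); have := sqr_ge0 (cRe z - cRe w).
have := sqr_ge0 (cIm z + cIm w); have := sqr_ge0 (cIm z - cIm w).
have := sqr_ge0 (cRe z); have := sqr_ge0 (cIm z).
have := sqr_ge0 (cRe w); have := sqr_ge0 (cIm w).
by move=> *; apply/andP; split; nra.
Qed.

Lemma norm_cIm_mulJ z w : `|cIm (z * w^*)| <= sqnormC z + sqnormC w.
Proof.
rewrite ler_norml !cE /sqnormC.
have := sqr_ge0 (cRe z + cIm w); have := sqr_ge0 (cRe z - cIm w).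
have := sqr_ge0 (cIm z + cRe w); have := sqr_ge0 (cIm z - cRe w).
have := sqr_ge0 (cRe z); have := sqr_ge0 (cIm z).
have := sqr_ge0 (cRe w); have := sqr_ge0 (cIm w).
by move=> *; apply/andP; split; nra.
Qed.

Lemma sqr_cRe_le z : cRe z ^+ 2 <= sqnormC z.
Proof. by rewrite lerDl sqr_ge0. Qed.

Lemma sqr_cIm_le z : cIm z ^+ 2 <= sqnormC z.
Proof. by rewrite lerDr sqr_ge0. Qed.

End ComplexNumbers.

Section ComplexMeasurable.
Context {R : realType} {d : measure_display} {X : measurableType d}.
Implicit Types f g : X -> R[i].

Lemma cmeasurable_cst (c : R[i]) : cmeasurable (cst c : X -> R[i]).
Proof. by split; exact: measurable_cst. Qed.

Lemma cmeasurableD f g : cmeasurable f -> cmeasurable g ->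
  cmeasurable (fun x => f x + g x).
Proof.
move=> [f1 f2] [g1 g2]; split.
  under eq_fun do rewrite cReD; exact: measurable_funD.
under eq_fun do rewrite cImD; exact: measurable_funD.
Qed.

Lemma cmeasurableM f g : cmeasurable f -> cmeasurable g ->
  cmeasurable (fun x => f x * g x).
Proof.
move=> [f1 f2] [g1 g2]; split.
  under eq_fun do rewrite cReM.
  by apply: measurable_funB; exact: measurable_funM.
under eq_fun do rewrite cImM.
by apply: measurable_funD; exact: measurable_funM.
Qed.

Lemma cmeasurableZ c f : cmeasurable f -> cmeasurable (fun x => c * f x).
Proof. by move=> mf; apply: cmeasurableM => //; exact: cmeasurable_cst. Qed.

Lemma cmeasurableN f : cmeasurable f -> cmeasurable (fun x => - f x).
Proof.
by move=> mf; under eq_fun do rewrite -mulN1r; exact: cmeasurableZ.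
Qed.

Lemma cmeasurableB f g : cmeasurable f -> cmeasurable g ->
  cmeasurable (fun x => f x - g x).
Proof. by move=> mf mg; apply: cmeasurableD => //; exact: cmeasurableN. Qed.

Lemma cmeasurableJ f : cmeasurable f -> cmeasurable (fun x => (f x)^*).
Proof.
move=> [f1 f2]; split.
  by under eq_fun do rewrite cReJ.
by under eq_fun do rewrite cImJ; exact: measurable_funN.
Qed.

Lemma cmeasurable_real (f : X -> R) : measurable_fun setT f ->
  cmeasurable (fun x => (f x)%:C).
Proof. by move=> mf; split => //=; exact: measurable_cst. Qed.

Lemma cmeasurable_sum I (r : seq I) (F : I -> X -> R[i]) :
  (forall i, cmeasurable (F i)) -> cmeasurable (fun x => \sum_(i <- r) F i x).
Proof.
move=> mF; elim: r => [|i r ih].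
  under eq_fun do rewrite big_nil; exact: cmeasurable_cst.
by under eq_fun do rewrite big_cons; exact: cmeasurableD.
Qed.

Lemma cmeasurable_comp d' (Y : measurableType d') (g : Y -> R[i]) (f : X -> Y) :
  cmeasurable g -> measurable_fun setT f -> cmeasurable (g \o f).
Proof.
by move=> [g1 g2] mf; split; [exact: (measurableT_comp g1)|
  exact: (measurableT_comp g2)].
Qed.

Lemma measurable_sqnormC f : cmeasurable f ->
  measurable_fun setT (fun x => sqnormC (f x)).
Proof. by move=> [f1 f2]; apply: measurable_funD; exact: measurable_funX. Qed.

Lemma measurable_sqnormCE f : cmeasurable f ->
  measurable_fun setT (fun x => (sqnormC (f x))%:E).
Proof. by move=> mf; apply/measurable_EFinP; exact: measurable_sqnormC. Qed.

Lemma measurable_ceq0 f : cmeasurable f -> measurable [set x | f x = 0].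
Proof.
move=> mf.
rewrite (_ : [set x | _] = (fun x => sqnormC (f x)) @^-1` [set 0]).
  rewrite -[X in measurable X]setTI.
  exact: (measurable_sqnormC mf).
apply/seteqP; split => x /=; first by move=> ->; exact: sqnormC0.
by move/eqP; rewrite sqnormC_eq0 => /eqP.
Qed.

End ComplexMeasurable.

Section L2Space.
Context {R : realType} {d : measure_display} {X : measurableType d}.
Variable mu : {measure set X -> \bar R}.
Implicit Types f g h : X -> R[i].

(** [fine] sends an infinite squared norm to 0, so this real number is meaningful only for [f] in
    [L2], as in [L2_sqnormE]. *)
Definition nrm2 f : R := fine (sqnorm mu f).

Lemma sqnorm_ge0 f : (0 <= sqnorm mu f)%E.
Proof. by apply: integral_ge0 => x _; rewrite lee_fin sqnormC_ge0. Qed.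

Lemma nrm2_ge0 f : 0 <= nrm2 f.
Proof. exact/fine_ge0/sqnorm_ge0. Qed.

Lemma L2_sqnormE f : L2 mu f -> sqnorm mu f = (nrm2 f)%:E.
Proof. by move=> [_ h]; rewrite fineK// ge0_fin_numE// sqnorm_ge0. Qed.

Lemma eq_sqnorm f g : cmeasurable f -> cmeasurable g ->
  {ae mu, forall x, f x = g x} -> sqnorm mu f = sqnorm mu g.
Proof.
move=> mf mg fg; apply: ge0_ae_eq_integral => //.
- exact: measurable_sqnormCE.
- exact: measurable_sqnormCE.
- by move=> x _; rewrite lee_fin sqnormC_ge0.
- by move=> x _; rewrite lee_fin sqnormC_ge0.
- by apply: filterS fg => x /= -> _.
Qed.

Lemma sqnorm_le f g : cmeasurable f -> cmeasurable g ->
  (forall x, sqnormC (f x) <= sqnormC (g x)) -> (sqnorm mu f <= sqnorm mu g)%E.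
Proof.
move=> mf mg fg; apply: ge0_le_integral => //.
- by move=> x _; rewrite lee_fin sqnormC_ge0.
- exact: measurable_sqnormCE.
- exact: measurable_sqnormCE.
- by move=> x _; rewrite lee_fin.
Qed.

Lemma sqnormZ c f : cmeasurable f ->
  sqnorm mu (fun x => c * f x) = ((sqnormC c)%:E * sqnorm mu f)%E.
Proof.
move=> mf; rewrite /sqnorm; under eq_integral do rewrite sqnormCM EFinM.
rewrite ge0_integralZl//.
- exact: measurable_sqnormCE.
- by move=> x _; rewrite lee_fin sqnormC_ge0.
- by rewrite lee_fin sqnormC_ge0.
Qed.

Lemma sqnormD_le f g : cmeasurable f -> cmeasurable g ->
  (sqnorm mu (fun x => (f x + g x)%R) <= 2%:E * (sqnorm mu f + sqnorm mu g))%E.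
Proof.
move=> mf mg; rewrite /sqnorm -ge0_integralD//; last 4 first.
- by move=> x _; rewrite lee_fin sqnormC_ge0.
- exact: measurable_sqnormCE.
- by move=> x _; rewrite lee_fin sqnormC_ge0.
- exact: measurable_sqnormCE.
rewrite -ge0_integralZl//; last 2 first.
- by apply: emeasurable_funD; exact: measurable_sqnormCE.
- by move=> x _; rewrite -EFinD lee_fin addr_ge0 ?sqnormC_ge0.
apply: ge0_le_integral => //.
- by move=> x _; rewrite lee_fin sqnormC_ge0.
- by apply: measurable_sqnormCE; exact: cmeasurableD.
- by apply: measurable_funeM; apply: emeasurable_funD; exact: measurable_sqnormCE.
- by move=> x _; rewrite -EFinD -EFinM lee_fin sqnormCD_le.
Qed.

Lemma sqnormN f : sqnorm mu (fun x => - f x) = sqnorm mu f.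
Proof. by rewrite /sqnorm; under eq_integral do rewrite sqnormCN. Qed.

Lemma sqnorm_sym f g :
  sqnorm mu (fun x => f x - g x) = sqnorm mu (fun x => g x - f x).
Proof.
by rewrite -sqnormN; congr sqnorm; apply/funext => x; rewrite opprB.
Qed.

Lemma sqnorm0_ae f : cmeasurable f -> sqnorm mu f = 0%E ->
  {ae mu, forall x, f x = 0}.
Proof.
move=> mf f0.
have /(ae_eq_integral_abs mu measurableT (measurable_sqnormCE mf)) :
    (\int[mu]_x `|(sqnormC (f x))%:E| = 0)%E.
  rewrite -{}f0; apply: eq_integral => x _.
  by rewrite gee0_abs// lee_fin sqnormC_ge0.
apply: filterS => x /(_ I) [] /eqP; by rewrite sqnormC_eq0 => /eqP.
Qed.

Lemma ae_sqnorm0 f : cmeasurable f -> {ae mu, forall x, f x = 0} ->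
  sqnorm mu f = 0%E.
Proof.
move=> mf f0; rewrite (eq_sqnorm mf (cmeasurable_cst 0) f0) /sqnorm.
by rewrite integral0_eq// => x _; rewrite sqnormC0.
Qed.

Lemma L2D f g : L2 mu f -> L2 mu g -> L2 mu (fun x => f x + g x).
Proof.
move=> [mf Lf] [mg Lg]; split; first exact: cmeasurableD.
apply: le_lt_trans (sqnormD_le mf mg) _.
by rewrite lte_mul_pinfty// lte_add_pinfty.
Qed.

Lemma L2Z c f : L2 mu f -> L2 mu (fun x => c * f x).
Proof.
move=> [mf Lf]; split; first exact: cmeasurableZ.
by rewrite sqnormZ// lte_mul_pinfty// lee_fin sqnormC_ge0.
Qed.

Lemma L2N f : L2 mu f -> L2 mu (fun x => - f x).
Proof. by move=> Lf; under eq_fun do rewrite -mulN1r; exact: L2Z. Qed.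

Lemma L2B f g : L2 mu f -> L2 mu g -> L2 mu (fun x => f x - g x).
Proof. by move=> Lf Lg; apply: L2D => //; exact: L2N. Qed.

Lemma L2lin c f g : L2 mu f -> L2 mu g -> L2 mu (fun x => c * f x + g x).
Proof. by move=> Lf Lg; apply: L2D => //; exact: L2Z. Qed.

Lemma L2_0 : L2 mu (cst 0).
Proof.
split; first exact: cmeasurable_cst.
by rewrite /sqnorm integral0_eq// => x _; rewrite sqnormC0.
Qed.

Lemma L2_sum I (r : seq I) (F : I -> X -> R[i]) :
  (forall i, L2 mu (F i)) -> L2 mu (fun x => \sum_(i <- r) F i x).
Proof.
move=> LF; elim: r => [|i r ih].
  under eq_fun do rewrite big_nil; exact: L2_0.
by under eq_fun do rewrite big_cons; exact: L2D.
Qed.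

Lemma L2J f : L2 mu f -> L2 mu (fun x => (f x)^*).
Proof.
move=> [mf Lf]; split; first exact: cmeasurableJ.
by rewrite /sqnorm; under eq_integral do rewrite sqnormCJ.
Qed.

Lemma L2_ae f g : L2 mu f -> cmeasurable g -> {ae mu, forall x, f x = g x} ->
  L2 mu g.
Proof. by move=> [mf Lf] mg fg; split => //; rewrite -(eq_sqnorm mf mg fg). Qed.

Lemma L2_bounded_mul (K : R) b f : cmeasurable b ->
  (forall x, sqnormC (b x) <= K) -> L2 mu f -> L2 mu (fun x => b x * f x).
Proof.
move=> mb bK [mf Lf]; split; first exact: cmeasurableM.
have [|K0] := leP K 0.
  move=> K0; rewrite (_ : (fun x => _) = cst 0); first by case: L2_0.
  apply/funext => x; apply/eqP; rewrite mulf_eq0 -sqnormC_eq0 eq_le sqnormC_ge0.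
  by rewrite (le_trans (bK x) K0).
apply: (@le_lt_trans _ _ (K%:E * sqnorm mu f)%E); last first.
  by rewrite lte_mul_pinfty// lee_fin ltW.
rewrite -ge0_integralZl//; last 3 first.
- exact: measurable_sqnormCE.
- by move=> x _; rewrite lee_fin sqnormC_ge0.
- by rewrite lee_fin ltW.
apply: ge0_le_integral => //.
- by move=> x _; rewrite lee_fin sqnormC_ge0.
- by apply: measurable_sqnormCE; exact: cmeasurableM.
- by apply: measurable_funeM; exact: measurable_sqnormCE.
- by move=> x _; rewrite -EFinM lee_fin sqnormCM ler_wpM2r ?sqnormC_ge0.
Qed.

Definition cintegrable (F : X -> R[i]) :=
  mu.-integrable setT (EFin \o (fun x => cRe (F x))) /\
  mu.-integrable setT (EFin \o (fun x => cIm (F x))).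

Lemma L2_integrable f : L2 mu f ->
  mu.-integrable setT (EFin \o (fun x => sqnormC (f x))).
Proof.
move=> [mf Lf]; apply/integrableP; split; first exact: measurable_sqnormCE.
by under eq_integral do rewrite gee0_abs ?lee_fin ?sqnormC_ge0//.
Qed.

Lemma L2_cintegrable f g : L2 mu f -> L2 mu g ->
  cintegrable (fun x => f x * (g x)^*).
Proof.
move=> Lf Lg.
have [m1 m2] := cmeasurableM Lf.1 (cmeasurableJ Lg.1).
have LfLg := integrableD measurableT (L2_integrable Lf) (L2_integrable Lg).
split; apply: le_integrable LfLg => //.
- exact/measurable_EFinP.
- move=> x _; rewrite /= !lee_fin (le_trans (norm_cRe_mulJ _ _))//.
  by rewrite ger0_norm// addr_ge0 ?sqnormC_ge0.
- exact/measurable_EFinP.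
- move=> x _; rewrite /= !lee_fin (le_trans (norm_cIm_mulJ _ _))//.
  by rewrite ger0_norm// addr_ge0 ?sqnormC_ge0.
Qed.

Lemma cintegralD F G : cintegrable F -> cintegrable G ->
  cintegral mu (fun x => F x + G x) = cintegral mu F + cintegral mu G.
Proof.
move=> [F1 F2] [G1 G2]; apply: ceqP; rewrite /cintegral cE /=.
  rewrite -RintegralD//; apply: eq_Rintegral => x _; exact: cReD.
rewrite -RintegralD//; apply: eq_Rintegral => x _; exact: cImD.
Qed.

Lemma integrable_lin (a b : R) (F G : X -> R) :
  mu.-integrable setT (EFin \o F) -> mu.-integrable setT (EFin \o G) ->
  mu.-integrable setT (EFin \o (fun x => a * F x + b * G x)).
Proof.
move=> iF iG.
have := integrableD measurableT (integrableZl measurableT a iF)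
  (integrableZl measurableT b iG).
by apply: eq_integrable.
Qed.

Lemma Rintegral_lin (a b : R) (F G : X -> R) :
  mu.-integrable setT (EFin \o F) -> mu.-integrable setT (EFin \o G) ->
  \int[mu]_x (a * F x + b * G x) = a * (\int[mu]_x F x) + b * (\int[mu]_x G x).
Proof.
move=> iF iG; rewrite RintegralD//.
- by rewrite !RintegralZl.
- by have := integrableZl measurableT a iF; apply: eq_integrable.
- by have := integrableZl measurableT b iG; apply: eq_integrable.
Qed.

Lemma cintegrableZ c F : cintegrable F -> cintegrable (fun x => c * F x).
Proof.
move=> [F1 F2]; split.
  apply: eq_integrable (integrable_lin (cRe c) (- cIm c) F1 F2) => // x _.
  by rewrite /= cReM mulNr.
apply: eq_integrable (integrable_lin (cRe c) (cIm c) F2 F1) => // x _.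
by rewrite /= cImM.
Qed.

Lemma cintegralZ c F : cintegrable F ->
  cintegral mu (fun x => c * F x) = c * cintegral mu F.
Proof.
move=> [F1 F2]; apply: ceqP; rewrite /cintegral cE /=.
  rewrite -mulNr -Rintegral_lin//; apply: eq_Rintegral => x _.
  by rewrite cReM mulNr.
by rewrite -Rintegral_lin//; apply: eq_Rintegral => x _; rewrite cImM.
Qed.

Lemma cintegralJ F : cintegrable F ->
  cintegral mu (fun x => (F x)^*) = (cintegral mu F)^*.
Proof.
move=> [F1 F2]; apply: ceqP; rewrite /cintegral cE /=.
  by apply: eq_Rintegral => x _; rewrite cReJ.
rewrite -mulN1r -RintegralZl//; apply: eq_Rintegral => x _.
by rewrite cImJ mulN1r.
Qed.

Lemma inner_linl c f g h : L2 mu f -> L2 mu g -> L2 mu h ->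
  inner mu (fun x => c * f x + g x) h = c * inner mu f h + inner mu g h.
Proof.
move=> Lf Lg Lh; rewrite /inner.
rewrite -cintegralZ; last exact: L2_cintegrable.
rewrite -cintegralD; last 2 first.
- by apply: cintegrableZ; exact: L2_cintegrable.
- exact: L2_cintegrable.
by congr cintegral; apply/funext => x; rewrite mulrDl mulrA.
Qed.

Lemma innerJ f g : L2 mu f -> L2 mu g -> inner mu g f = (inner mu f g)^*.
Proof.
move=> Lf Lg; rewrite /inner -cintegralJ; last exact: L2_cintegrable.
congr cintegral; apply/funext => x.
by apply: ceqP; rewrite !cE; ring.
Qed.

Lemma inner_linr c f g h : L2 mu f -> L2 mu g -> L2 mu h ->
  inner mu h (fun x => c * f x + g x) = c^* * inner mu h f + inner mu h g.
Proof.
move=> Lf Lg Lh; rewrite (innerJ (L2lin c Lf Lg) Lh) inner_linl// rmorphD rmorphM.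
by rewrite (innerJ Lf Lh) (innerJ Lg Lh).
Qed.

Lemma innerDl f g h : L2 mu f -> L2 mu g -> L2 mu h ->
  inner mu (fun x => f x + g x) h = inner mu f h + inner mu g h.
Proof.
move=> Lf Lg Lh; rewrite (_ : (fun x => f x + g x) = (fun x => 1 * f x + g x)).
  by rewrite inner_linl// mul1r.
by apply/funext => x; rewrite mul1r.
Qed.

Lemma inner0l h : inner mu (cst 0) h = 0.
Proof.
by apply: ceqP; rewrite /= (_ : (fun x => _) = cst 0) ?Rintegral_cst ?mul0r//;
  apply/funext => x; rewrite mul0r.
Qed.

Lemma inner0r h : inner mu h (cst 0) = 0.
Proof.
by apply: ceqP; rewrite /= (_ : (fun x => _) = cst 0) ?Rintegral_cst ?mul0r//;
  apply/funext => x; rewrite conjC0 mulr0.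
Qed.

Lemma innerZl c f h : L2 mu f -> L2 mu h ->
  inner mu (fun x => c * f x) h = c * inner mu f h.
Proof.
move=> Lf Lh; rewrite (_ : (fun x => c * f x) = (fun x => c * f x + (cst 0 : X -> R[i]) x)).
  by rewrite inner_linl ?inner0l ?addr0//; exact: L2_0.
by apply/funext => x; rewrite addr0.
Qed.

Lemma innerZr c f h : L2 mu f -> L2 mu h ->
  inner mu h (fun x => c * f x) = c^* * inner mu h f.
Proof.
move=> Lf Lh; rewrite (innerJ (L2Z c Lf) Lh) innerZl// rmorphM.
by rewrite (innerJ Lf Lh).
Qed.

Lemma innerDr f g h : L2 mu f -> L2 mu g -> L2 mu h ->
  inner mu h (fun x => f x + g x) = inner mu h f + inner mu h g.
Proof.
move=> Lf Lg Lh; rewrite (innerJ (L2D Lf Lg) Lh) innerDl// rmorphD.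
by rewrite (innerJ Lf Lh) (innerJ Lg Lh).
Qed.

Lemma innerNl f h : L2 mu f -> L2 mu h ->
  inner mu (fun x => - f x) h = - inner mu f h.
Proof.
move=> Lf Lh.
rewrite (_ : (fun x => - f x) = (fun x => -1 * f x)) ?innerZl ?mulN1r//.
by apply/funext => x; rewrite mulN1r.
Qed.

Lemma innerNr f h : L2 mu f -> L2 mu h ->
  inner mu h (fun x => - f x) = - inner mu h f.
Proof.
move=> Lf Lh; rewrite (innerJ (L2N Lf) Lh) innerNl// rmorphN.
by rewrite (innerJ Lf Lh).
Qed.

Lemma innerBl f g h : L2 mu f -> L2 mu g -> L2 mu h ->
  inner mu (fun x => f x - g x) h = inner mu f h - inner mu g h.
Proof. by move=> Lf Lg Lh; rewrite innerDl ?innerNl//; exact: L2N. Qed.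

Lemma innerBr f g h : L2 mu f -> L2 mu g -> L2 mu h ->
  inner mu h (fun x => f x - g x) = inner mu h f - inner mu h g.
Proof. by move=> Lf Lg Lh; rewrite innerDr ?innerNr//; exact: L2N. Qed.

Lemma inner_suml I (r : seq I) (F : I -> X -> R[i]) h :
  (forall i, L2 mu (F i)) -> L2 mu h ->
  inner mu (fun x => \sum_(i <- r) F i x) h = \sum_(i <- r) inner mu (F i) h.
Proof.
move=> LF Lh; elim: r => [|i r ih].
  by rewrite big_nil; under eq_fun do rewrite big_nil; rewrite inner0l.
rewrite big_cons -ih; under eq_fun do rewrite big_cons.
by rewrite innerDl//; exact: L2_sum.
Qed.

Lemma inner_sumr I (r : seq I) (F : I -> X -> R[i]) h :
  (forall i, L2 mu (F i)) -> L2 mu h ->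
  inner mu h (fun x => \sum_(i <- r) F i x) = \sum_(i <- r) inner mu h (F i).
Proof.
move=> LF Lh; rewrite (innerJ (L2_sum r LF) Lh) inner_suml// rmorph_sum.
by apply: eq_bigr => i _; rewrite (innerJ (LF i) Lh).
Qed.

Lemma inner_norm f : L2 mu f -> inner mu f f = (nrm2 f)%:C.
Proof.
move=> Lf; apply: ceqP; rewrite /=.
  by rewrite /nrm2 /sqnorm; congr fine; apply: eq_integral => x _; rewrite mulcJ.
rewrite (_ : (fun x => _) = cst 0) ?Rintegral_cst ?mul0r//.
by apply/funext => x; rewrite mulcJ.
Qed.

Lemma eq_inner f f' g g' : L2 mu f -> L2 mu f' -> L2 mu g -> L2 mu g' ->
  {ae mu, forall x, f x = f' x} -> {ae mu, forall x, g x = g' x} ->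
  inner mu f g = inner mu f' g'.
Proof.
move=> Lf Lf' Lg Lg' ff' gg'.
have [m1 m2] := cmeasurableM Lf.1 (cmeasurableJ Lg.1).
have [m1' m2'] := cmeasurableM Lf'.1 (cmeasurableJ Lg'.1).
apply: ceqP; rewrite /= /Rintegral; congr fine; apply: ae_eq_integral => //.
- exact/measurable_EFinP.
- exact/measurable_EFinP.
- by apply: filterS2 ff' gg' => x /= -> ->.
- exact/measurable_EFinP.
- exact/measurable_EFinP.
- by apply: filterS2 ff' gg' => x /= -> ->.
Qed.

Lemma nrm2_eq0 f : L2 mu f -> nrm2 f = 0 -> {ae mu, forall x, f x = 0}.
Proof. by move=> Lf f0; apply: sqnorm0_ae Lf.1 _; rewrite L2_sqnormE// f0. Qed.

Lemma nrm2_ae0 f : cmeasurable f -> {ae mu, forall x, f x = 0} -> nrm2 f = 0.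
Proof. by move=> mf f0; rewrite /nrm2 ae_sqnorm0. Qed.

Lemma nrm2B0 f g : L2 mu f -> L2 mu g ->
  nrm2 (fun x => f x - g x) = 0 -> {ae mu, forall x, f x = g x}.
Proof.
move=> Lf Lg /(nrm2_eq0 (L2B Lf Lg)); apply: filterS => x /eqP.
by rewrite subr_eq0 => /eqP.
Qed.

Lemma eq_nrm2 f g : cmeasurable f -> cmeasurable g ->
  {ae mu, forall x, f x = g x} -> nrm2 f = nrm2 g.
Proof. by move=> mf mg fg; rewrite /nrm2 (eq_sqnorm mf mg fg). Qed.

Lemma nrm2_lin c f g : L2 mu f -> L2 mu g ->
  nrm2 (fun x => c * f x + g x) =
  sqnormC c * nrm2 f + nrm2 g + 2 * cRe (c * inner mu f g).
Proof.
move=> Lf Lg; apply: complexI; rewrite -inner_norm; last exact: L2lin.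
rewrite inner_linl ?inner_linr//; try exact: L2lin.
rewrite (innerJ Lf Lg) !inner_norm//.
move: (inner mu f g) (nrm2 f) (nrm2 g) => [a b] p q {Lf Lg}.
by case: c => x y; apply: ceqP; rewrite !cE /= /sqnormC /=; ring.
Qed.

Lemma nrm2B f g : L2 mu f -> L2 mu g ->
  nrm2 (fun x => f x - g x) = nrm2 f + nrm2 g - 2 * cRe (inner mu f g).
Proof.
move=> Lf Lg.
rewrite (_ : (fun x => _) = (fun x => -1 * g x + f x)).
  rewrite nrm2_lin// sqnormCN sqnormC1 (innerJ Lf Lg) !cE /=; ring.
by apply/funext => x; rewrite mulN1r addrC.
Qed.

Lemma nrm2D f g : L2 mu f -> L2 mu g ->
  nrm2 (fun x => f x + g x) = nrm2 f + nrm2 g + 2 * cRe (inner mu f g).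
Proof.
move=> Lf Lg.
rewrite (_ : (fun x => _) = (fun x => 1 * f x + g x)).
  by rewrite nrm2_lin// sqnormC1 !mul1r.
by apply/funext => x; rewrite mul1r.
Qed.

Lemma nrm2Z c f : L2 mu f -> nrm2 (fun x => c * f x) = sqnormC c * nrm2 f.
Proof.
by move=> Lf; rewrite {1}/nrm2 sqnormZ ?fineM// ?L2_sqnormE//; case: Lf.
Qed.

Lemma nrm2D_le f g : L2 mu f -> L2 mu g ->
  nrm2 (fun x => f x + g x) <= 2 * (nrm2 f + nrm2 g).
Proof.
move=> Lf Lg; have := nrm2_ge0 (fun x => f x - g x).
rewrite nrm2B// nrm2D//; lra.
Qed.

Lemma nrm2_sym f g : nrm2 (fun x => f x - g x) = nrm2 (fun x => g x - f x).
Proof. by rewrite /nrm2 sqnorm_sym. Qed.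

Lemma nrm2B_le h f g : L2 mu f -> L2 mu g -> L2 mu h ->
  nrm2 (fun x => f x - g x) <=
  2 * (nrm2 (fun x => f x - h x) + nrm2 (fun x => h x - g x)).
Proof.
move=> Lf Lg Lh; apply: le_trans (nrm2D_le (L2B Lf Lh) (L2B Lh Lg)).
by under [in leRHS]eq_fun do rewrite addrA subrK.
Qed.

Lemma cauchy_schwarz f g : L2 mu f -> L2 mu g ->
  sqnormC (inner mu f g) <= nrm2 f * nrm2 g.
Proof.
move=> Lf Lg; set z := inner mu f g.
(* The squared norm of [- t * z^* * f + g] is a quadratic polynomial in the real [t], nonnegative
   everywhere. *)
have h t : 0 <= t ^+ 2 * sqnormC z * nrm2 f + nrm2 g - 2 * t * sqnormC z.
  have := nrm2_ge0 (fun x => (- t%:C * z^*) * f x + g x).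
  rewrite nrm2_lin// sqnormCM sqnormCJ sqnormCN sqnormC_real -/z.
  suff -> : cRe (- t%:C * z^* * z) = - (t * sqnormC z) by lra.
  by rewrite !cE /sqnormC /=; ring.
have z0 := sqnormC_ge0 z; have f0 := nrm2_ge0 f; have g0 := nrm2_ge0 g.
have [f00|f00] := eqVneq (nrm2 f) 0.
  have [->|zn0] := eqVneq (sqnormC z) 0; first by rewrite mulr_ge0.
  (* For a null [f] the polynomial is affine, and this [t] gives it the value -1. *)
  have := h ((nrm2 g + 1) / (2 * sqnormC z)).
  rewrite f00 mulr0 add0r.
  suff -> : 2 * ((nrm2 g + 1) / (2 * sqnormC z)) * sqnormC z = nrm2 g + 1 by lra.
  by field.
(* Otherwise this [t] minimises the polynomial. *)
have := h (nrm2 f)^-1.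
rewrite (_ : _ - _ = (nrm2 f * nrm2 g - sqnormC z) / nrm2 f); last by field.
by rewrite pmulr_lge0 ?subr_ge0// invr_gt0 lt_neqAle eq_sym f00.
Qed.

End L2Space.

(** * Closed subspaces *)

Section ClosedSubspaces.
Context {R : realType} {d : measure_display} {X : measurableType d}.
Variable mu : {measure set X -> \bar R}.
Implicit Types (f g h : X -> R[i]) (C : set (X -> R[i])).

(** Elements are functions, not classes. Closure in squared norm makes the set stable under almost
    everywhere equality ([closed_subspace_ae]), so that it behaves like a subspace of the
    quotient. *)
Definition closed_subspace C :=
  [/\ C `<=` L2 mu, C (cst 0),
      forall c f g, C f -> C g -> C (fun x => c * f x + g x)
    & forall f, L2 mu f -> (forall e : R, 0 < e ->
        exists2 g, C g & nrm2 mu (fun x => f x - g x) < e) -> C f].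

Lemma closed_subspaceD C f g : closed_subspace C -> C f -> C g ->
  C (fun x => f x + g x).
Proof.
move=> [_ _ lC _] Cf Cg; have := lC 1 _ _ Cf Cg.
by under eq_fun do rewrite mul1r.
Qed.

Lemma closed_subspaceZ C c f : closed_subspace C -> C f ->
  C (fun x => c * f x).
Proof.
move=> [_ C0 lC _] Cf; have := lC c _ _ Cf C0.
by under eq_fun do rewrite addr0.
Qed.

Lemma closed_subspaceB C f g : closed_subspace C -> C f -> C g ->
  C (fun x => f x - g x).
Proof.
move=> cC Cf Cg; apply: (closed_subspaceD cC Cf).
have := closed_subspaceZ (-1) cC Cg.
by under eq_fun do rewrite mulN1r.
Qed.

Lemma closed_subspace_sum C I (r : seq I) (F : I -> X -> R[i]) :
  closed_subspace C -> (forall i, C (F i)) -> C (fun x => \sum_(i <- r) F i x).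
Proof.
move=> cC CF; elim: r => [|i r ih].
  by under eq_fun do rewrite big_nil; case: cC.
under eq_fun do rewrite big_cons; exact: closed_subspaceD.
Qed.

Lemma closed_subspace_ae C f g : closed_subspace C -> C f -> cmeasurable g ->
  {ae mu, forall x, f x = g x} -> C g.
Proof.
move=> [CL _ _ clC] Cf mg fg; have Lg := L2_ae (CL _ Cf) mg fg.
apply: clC => // e e0; exists f => //.
rewrite nrm2_ae0 //; first by apply: cmeasurableB => //; case: (CL _ Cf).
by apply: filterS fg => x ->; rewrite subrr.
Qed.

Definition comb I (e : I -> X -> R[i]) (s : seq (R[i] * I)) : X -> R[i] :=
  fun x => \sum_(p <- s) p.1 * e p.2 x.

Lemma L2_comb I (e : I -> X -> R[i]) s : (forall i, L2 mu (e i)) ->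
  L2 mu (comb e s).
Proof. by move=> Le; apply: L2_sum => p; exact: L2Z. Qed.

Lemma comb_cat I (e : I -> X -> R[i]) s t x :
  comb e (s ++ t) x = comb e s x + comb e t x.
Proof. by rewrite /comb big_cat. Qed.

Definition comb_scale I (c : R[i]) (s : seq (R[i] * I)) :=
  [seq (c * p.1, p.2) | p <- s].

Lemma comb_scaleE I (e : I -> X -> R[i]) c s x :
  comb e (comb_scale c s) x = c * comb e s x.
Proof.
by rewrite /comb big_map mulr_sumr; apply: eq_bigr => p _; rewrite mulrA.
Qed.

Lemma combB I (e : I -> X -> R[i]) s t :
  (fun x => comb e s x - comb e t x) = comb e (s ++ comb_scale (-1) t).
Proof. by apply/funext => x; rewrite comb_cat comb_scaleE mulN1r. Qed.

Lemma inner_comb I (e : I -> X -> R[i]) s t : (forall i, L2 mu (e i)) ->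
  inner mu (comb e s) (comb e t) =
  \sum_(p <- s) \sum_(q <- t) p.1 * q.1^* * inner mu (e p.2) (e q.2).
Proof.
move=> Le; rewrite /comb inner_suml; [|by move=> p; exact: L2Z|exact: L2_comb].
apply: eq_bigr => p _; rewrite inner_sumr; [|by move=> q; exact: L2Z|exact: L2Z].
apply: eq_bigr => q _; rewrite innerZl//; last exact: L2Z.
by rewrite innerZr// mulrA.
Qed.

(** Lists of coefficients and indices replace families over ordinals: they concatenate and rescale
    without reindexing. *)
Lemma closed_spanP I (e : I -> X -> R[i]) f : (forall i, L2 mu (e i)) ->
  closed_span mu (range e) f <-> L2 mu f /\
  forall eps : R, 0 < eps -> exists s, nrm2 mu (fun x => f x - comb e s x) < eps.
Proof.
move=> Le; split=> -[Lf h]; split=> // eps /h.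
  move=> [n [c [g [Gg gs]]]].
  have /choice[i ig] : forall j : 'I_n, exists i, e i = g j.
    by move=> j; have [i _ ij] := Gg j; exists i.
  exists [seq (c j, i j) | j <- enum 'I_n].
  rewrite -lte_fin -L2_sqnormE; last by apply: L2B => //; exact: L2_comb.
  rewrite (_ : (fun x => _) = (fun x => f x - \sum_(j < n) c j * g j x)) //.
  apply/funext => x; congr (_ - _).
  by rewrite /comb big_map big_enum /=; apply: eq_bigr => j _; rewrite ig.
move=> [s hs].
exists (size s), (fun j => (tnth (in_tuple s) j).1),
  (fun j => e (tnth (in_tuple s) j).2); split; first by move=> j; exists (tnth (in_tuple s) j).2.
have Lfs : L2 mu (fun x => f x - comb e s x) by apply: L2B => //; exact: L2_comb.
rewrite (_ : (fun x => _) = (fun x => f x - comb e s x)); last first.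
  by apply/funext => x; rewrite /comb (big_tnth _ _ s).
by rewrite L2_sqnormE// lte_fin.
Qed.

Lemma closed_span_closed I (e : I -> X -> R[i]) : (forall i, L2 mu (e i)) ->
  closed_subspace (closed_span mu (range e)).
Proof.
move=> Le; split.
- by move=> f [].
- apply/closed_spanP => //; split; first exact: L2_0.
  move=> eps e0; exists [::]; rewrite nrm2_ae0//.
    by apply: cmeasurableB; [exact: cmeasurable_cst|case: (L2_comb [::] Le)].
  by apply: aeW => x; rewrite /comb big_nil subr0.
- move=> c f g /(closed_spanP _ Le)[Lf hf] /(closed_spanP _ Le)[Lg hg].
  apply/closed_spanP => //; split; first exact: L2lin.
  move=> eps e0.
  (* If [a] and [b] are the errors for [f] and [g], the error for [c * f + g] is at most
     [2 * (|c|^2 * a + b)]; the divisor absorbs both terms. *)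
  have c0 : 0 < 2 * (sqnormC c + 1) + 2 :> R by have := sqnormC_ge0 c; lra.
  have [s hs] := hf (eps / (2 * (sqnormC c + 1) + 2)) (divr_gt0 e0 c0).
  have [t ht] := hg (eps / (2 * (sqnormC c + 1) + 2)) (divr_gt0 e0 c0).
  exists (comb_scale c s ++ t).
  rewrite (_ : (fun x => _) = (fun x => c * (f x - comb e s x) + (g x - comb e t x))); last first.
    apply/funext => x; rewrite comb_cat comb_scaleE; ring.
  have Lfs : L2 mu (fun x => f x - comb e s x) by apply: L2B => //; exact: L2_comb.
  have Lgt : L2 mu (fun x => g x - comb e t x) by apply: L2B => //; exact: L2_comb.
  rewrite (le_lt_trans (nrm2D_le (L2Z c Lfs) Lgt))// nrm2Z//.
  set a := nrm2 mu _ in hs *; set b := nrm2 mu _ in ht *.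
  move: hs ht; rewrite !ltr_pdivlMr//.
  have := nrm2_ge0 mu (fun x => f x - comb e s x); rewrite -/a => a0.
  have := nrm2_ge0 mu (fun x => g x - comb e t x); rewrite -/b => b0.
  have := sqnormC_ge0 c; set k := sqnormC c => k0.
  nra.
- move=> f Lf h; apply/closed_spanP => //; split => // eps e0.
  have e4 : 0 < eps / 4 by lra.
  have [g /(closed_spanP _ Le)[Lg hg] fg] := h _ e4.
  have [s gs] := hg _ e4; exists s.
  rewrite (le_lt_trans (nrm2B_le Lf (L2_comb s Le) Lg))//; lra.
Qed.

Lemma closed_span_sub I (e : I -> X -> R[i]) i : (forall i, L2 mu (e i)) ->
  closed_span mu (range e) (e i).
Proof.
move=> Le; apply/closed_spanP => //; split=> // eps e0.
exists [:: (1, i)]; rewrite nrm2_ae0//.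
  by apply: cmeasurableB; [case: (Le i)|case: (L2_comb [:: (1, i)] Le)].
by apply: aeW => x; rewrite /comb big_seq1 mul1r subrr.
Qed.

Lemma closed_span_min I (e : I -> X -> R[i]) C : closed_subspace C ->
  (forall i, C (e i)) -> closed_span mu (range e) `<=` C.
Proof.
move=> cC Ce; have Le i : L2 mu (e i) by case: cC => + _ _ _; apply.
move=> f /(closed_spanP _ Le)[Lf h]; case: (cC) => _ _ _; apply => // eps /h[s hs].
exists (comb e s) => //; apply: closed_subspace_sum => // p.
exact: closed_subspaceZ.
Qed.

End ClosedSubspaces.

(** * Completeness and orthogonal projections *)

Section RieszFischer.
Context {R : realType} {d : measure_display} {X : measurableType d}.
Variable mu : {measure set X -> \bar R}.
Implicit Types (f g h : X -> R[i]) (C : set (X -> R[i])).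

Lemma is_cvg_geometric_increments (u : nat -> R) (M : R) :
  (forall n, `|u n.+1 - u n| <= M * 2^-1 ^+ n) -> cvgn u.
Proof.
move=> h; rewrite (_ : u = (fun n => u 0%N + series (telescope u) n)); last first.
  by apply/funext => n; rewrite -eq_sum_telescope.
apply: is_cvgD; first exact: is_cvg_cst.
apply: normed_cvg; apply: (@series_le_cvg _ _ (geometric M 2^-1)).
- by move=> n; exact: normr_ge0.
- by move=> n /=; apply: le_trans (h n).
- by move=> n; exact: h.
- by apply: is_cvg_geometric_series; rewrite ger0_norm; lra.
Qed.

(** Fatou's lemma for an almost everywhere limit. The bound is asked only from index [N] on because
    Cauchy estimates compare a fixed term with the later ones. *)
Lemma fatou_bound (f_ : nat -> X -> R) (F : X -> R) (N : nat) (c : \bar R) :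
  (forall n, measurable_fun setT (f_ n)) -> measurable_fun setT F ->
  (forall n x, 0 <= f_ n x) -> (forall x, 0 <= F x) ->
  {ae mu, forall x, f_ ^~ x @ \oo --> F x} ->
  (forall n, (N <= n)%N -> (\int[mu]_x (f_ n x)%:E <= c)%E) ->
  (\int[mu]_x (F x)%:E <= c)%E.
Proof.
move=> mf mF f0 F0 fF fc.
have mEf n : measurable_fun setT (EFin \o f_ n) by exact/measurable_EFinP.
rewrite (_ : (\int[mu]_x (F x)%:E)%E =
   (\int[mu]_x limn_einf (fun n => (f_ n x)%:E))%E); last first.
  apply: ge0_ae_eq_integral => //.
  - exact/measurable_EFinP.
  - under eq_fun do rewrite limn_einf_lim.
    have := measurable_fun_einfs mEf => mg.
    apply: (emeasurable_fun_cvg _ _ mg) => x _ /=.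
    exact: is_cvg_einfs.
  - by move=> x _; rewrite lee_fin.
  - move=> x _; rewrite limn_einf_lim; apply: lime_ge; first exact: is_cvg_einfs.
    by apply: nearW => n; apply: le_ereal_inf_tmp => _ [m _ <-]; rewrite lee_fin.
  - apply: filterS fF => x /= hx _.
    have /cvg_limn_einf_sup[-> _]// : (fun n => (f_ n x)%:E) @ \oo --> (F x)%:E.
    by apply: cvg_EFin => //; exact: nearW.
apply: (le_trans (fatou mu measurableT mEf _)).
  by move=> n x _; rewrite lee_fin.
rewrite limn_einf_lim; apply: lime_le; first exact: is_cvg_einfs.
exists N => // n /= Nn; apply: le_trans (fc _ Nn).
by apply: ereal_inf_lbound; exists n => /=.
Qed.

(** The rate [8^-1 ^+ n] leaves room for the weight [4 ^+ k]: the weighted squared increments have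
    integrals at most [2^-1 ^+ k], so their sum [S] is finite almost everywhere. There the
    increments themselves are at most a multiple of [2^-1 ^+ k], and the sequence converges
    pointwise. Fatou's lemma gives the rate back for the limit. *)
Theorem riesz_fischer (f_ : nat -> X -> R[i]) : (forall n, L2 mu (f_ n)) ->
  (forall n m, (n <= m)%N -> nrm2 mu (fun x => f_ n x - f_ m x) <= 8^-1 ^+ n) ->
  exists2 f, L2 mu f & forall n, nrm2 mu (fun x => f_ n x - f x) <= 8^-1 ^+ n.
Proof.
move=> Lf f_f.
pose D k x := 4 ^+ k * sqnormC (f_ k.+1 x - f_ k x).
have LD k : L2 mu (fun x => f_ k.+1 x - f_ k x) by exact: L2B.
have mD k : measurable_fun setT (D k).
  by apply: measurable_funM => //; apply: measurable_sqnormC; case: (LD k).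
have mED k : measurable_fun setT (EFin \o D k) by exact/measurable_EFinP.
have D0 k x : 0 <= D k x by rewrite mulr_ge0 ?exprn_ge0 ?sqnormC_ge0.
pose S x := (\sum_(k <oo) (D k x)%:E)%E.
have S0 x : (0 <= S x)%E by apply: nneseries_ge0 => k _ _; rewrite lee_fin.
have intD k : (\int[mu]_x (D k x)%:E <= (geometric 1 2^-1 k)%:E)%E.
  rewrite /D; under eq_integral do rewrite EFinM.
  rewrite ge0_integralZl//; last 2 first.
  - by apply: measurable_sqnormCE; case: (LD k).
  - by move=> x _; rewrite lee_fin sqnormC_ge0.
  have -> : (\int[mu]_x (sqnormC (f_ k.+1 x - f_ k x))%:E)%E =
      (nrm2 mu (fun x => f_ k x - f_ k.+1 x))%:E.
    by rewrite nrm2_sym -L2_sqnormE.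
  rewrite -EFinM lee_fin (le_trans (ler_wpM2l _ (f_f k k.+1 _)))//.
  by rewrite /= mul1r -exprMn (_ : 4 * 8^-1 = 2^-1 :> R)//; lra.
have mS : measurable_fun setT S.
  apply: (@emeasurable_fun_cvg _ _ _ _ (fun n x => (\sum_(0 <= k < n) (D k x)%:E)%E)).
    by move=> n; apply: emeasurable_sum => k; exact: mED.
  by move=> x _; apply: is_cvg_ereal_nneg_natsum_cond => k _ _; rewrite lee_fin.
have intS : (\int[mu]_x S x < +oo)%E.
  rewrite integral_nneseries//; last by move=> k x _; rewrite lee_fin.
  apply: (@le_lt_trans _ _ 2%:E); last by rewrite ltry.
  apply: lime_le.
    by apply: is_cvg_ereal_nneg_natsum_cond => k _ _; apply: integral_ge0 => x _; rewrite lee_fin.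
  apply: nearW => n.
  apply: (@le_trans _ _ (\sum_(0 <= k < n) (geometric 1 2^-1 k)%:E)%E).
    by apply: lee_sum => k _; exact: intD.
  rewrite sumEFin lee_fin.
  have h2 : 0 < 2^-1 :> R by lra.
  have h3 : `|2^-1| < 1 :> R by rewrite ger0_norm; lra.
  rewrite (le_trans (geometric_le_lim n ler01 h2 h3))//.
  by rewrite (_ : 1 - 2^-1 = 2^-1 :> R) ?invrK ?mul1r//; lra.
have iS : mu.-integrable setT S.
  apply/integrableP; split => //.
  by rewrite (eq_integral S)// => x _; rewrite gee0_abs.
pose E := [set x | (S x < +oo)%E].
have aeE : {ae mu, forall x, E x}.
  apply: filterS (integrable_ae measurableT iS) => x /(_ I).
  by rewrite /E /= ge0_fin_numE.
have DS x k : E x -> D k x <= fine (S x).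
  move=> Ex; rewrite -lee_fin fineK ?ge0_fin_numE//.
  apply: le_trans (nneseries_lim_ge k.+1 _); last by move=> i _; rewrite lee_fin.
  by rewrite big_nat_recr//= leeDr// sume_ge0// => i _; rewrite lee_fin.
have inc x k (p : R[i] -> R) : (forall z w, p (z - w) = p z - p w) ->
    (forall z, p z ^+ 2 <= sqnormC z) -> E x ->
    `|p (f_ k.+1 x) - p (f_ k x)| <= (1 + fine (S x)) * 2^-1 ^+ k.
  move=> pB p2 Ex; rewrite -pB.
  have s0 : 0 <= fine (S x) by exact: fine_ge0.
  have h4 := DS x k Ex.
  have h5 := p2 (f_ k.+1 x - f_ k x).
  set y := p _ in h5 *.
  have k0 : 0 < 2 ^+ k :> R by rewrite exprn_gt0.
  rewrite exprVn ler_pdivlMr//; set t := _ * 2 ^+ k.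
  have t2 : t ^+ 2 <= fine (S x).
    apply: le_trans h4; rewrite /t exprMn real_normK ?num_real// -exprM mulnC exprM.
    rewrite (_ : 2 ^+ 2 = 4 :> R) 1?mulrC ?ler_wpM2l ?exprn_ge0//; ring.
  nra.
have cRecvg x : E x -> (fun n => cRe (f_ n x)) @ \oo --> limn (fun n => cRe (f_ n x)).
  move=> Ex; apply: (@is_cvg_geometric_increments _ (1 + fine (S x))) => n.
  apply: inc => //; [|exact: sqr_cRe_le].
  by move=> z w; rewrite !cE.
have cImcvg x : E x -> (fun n => cIm (f_ n x)) @ \oo --> limn (fun n => cIm (f_ n x)).
  move=> Ex; apply: (@is_cvg_geometric_increments _ (1 + fine (S x))) => n.
  apply: inc => //; [|exact: sqr_cIm_le].
  by move=> z w; rewrite !cE.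
pose b x := (S x < +oo)%E.
have mb : measurable_fun setT b.
  apply: (@measurable_fun_bool _ _ _ _ true).
  rewrite (_ : b @^-1` [set true] = S @^-1` [set y | (y < +oo)%E]); last first.
    by apply/seteqP; split => x.
  exact: emeasurable_fun_infty_o.
(* The value 0 where [S] is infinite makes [f] an everywhere pointwise limit of truncated terms,
   hence measurable. *)
pose f x : R[i] := if b x then
  limn (fun n => cRe (f_ n x)) +i* limn (fun n => cIm (f_ n x)) else 0.
have mf : cmeasurable f.
  split.
    apply: (@measurable_fun_cvg _ _ _ _ (fun n x => if b x then cRe (f_ n x) else 0)).
      by move=> n; apply: measurable_fun_ifT => //; case: (Lf n) => -[].
    move=> x _; rewrite /f; case: ifP => [bx|_]; last exact: cvg_cst.
    exact: cRecvg.
  apply: (@measurable_fun_cvg _ _ _ _ (fun n x => if b x then cIm (f_ n x) else 0)).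
    by move=> n; apply: measurable_fun_ifT => //; case: (Lf n) => -[].
  move=> x _; rewrite /f; case: ifP => [bx|_]; last exact: cvg_cst.
  exact: cImcvg.
have bound n : (sqnorm mu (fun x => (f_ n x - f x)%R) <= (8^-1 ^+ n)%:E)%E.
  apply: (@fatou_bound (fun m x => sqnormC (f_ n x - f_ m x)) _ n).
  - by move=> m; apply: measurable_sqnormC; case: (L2B (Lf n) (Lf m)).
  - by apply: measurable_sqnormC; apply: cmeasurableB => //; case: (Lf n).
  - by move=> m x; exact: sqnormC_ge0.
  - by move=> x; exact: sqnormC_ge0.
  - apply: filterS aeE => x Ex; rewrite /sqnormC.
    have bx : b x by [].
    apply: cvgD; rewrite !expr2; apply: cvgM; rewrite !cE.
    + under eq_fun do rewrite !cE.
      by rewrite /f bx; apply: cvgB; [exact: cvg_cst|exact: cRecvg].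
    + under eq_fun do rewrite !cE.
      by rewrite /f bx; apply: cvgB; [exact: cvg_cst|exact: cRecvg].
    + under eq_fun do rewrite !cE.
      by rewrite /f bx; apply: cvgB; [exact: cvg_cst|exact: cImcvg].
    + under eq_fun do rewrite !cE.
      by rewrite /f bx; apply: cvgB; [exact: cvg_cst|exact: cImcvg].
  - move=> m nm; have := L2_sqnormE (L2B (Lf n) (Lf m)); rewrite /sqnorm => ->.
    by rewrite lee_fin f_f.
have Lff n : L2 mu (fun x => f_ n x - f x).
  split; first by apply: cmeasurableB => //; case: (Lf n).
  by rewrite (le_lt_trans (bound n))// ltry.
exists f; last by move=> n; rewrite -lee_fin -L2_sqnormE.
(* [f] is square integrable as the difference of [f_ 0] and [f_ 0 - f]. *)
have := L2B (Lf 0%N) (Lff 0%N).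
by under eq_fun do rewrite opprB addrC subrK.
Qed.

Lemma small_le0 (a K : R) : (forall n, a <= K * 8^-1 ^+ n) -> a <= 0.
Proof.
move=> h; have /cvg_lim <- // : (fun n : nat => K * 8^-1 ^+ n) @ \oo --> (0 : R).
  by apply: (@cvg_geometric R K 8^-1); rewrite ger0_norm; lra.
apply: limr_ge; last exact: nearW.
by apply/cvg_ex; exists 0; apply: (@cvg_geometric R K 8^-1); rewrite ger0_norm; lra.
Qed.

Lemma pow8_gt0 n : 0 < 8^-1 ^+ n :> R.
Proof. by rewrite exprn_gt0. Qed.

Lemma pow8_le n m : (n <= m)%N -> 8^-1 ^+ m <= 8^-1 ^+ n :> R.
Proof. by move=> nm; rewrite ler_wiXn2l//; lra. Qed.

Lemma pow8_small (e : R) : 0 < e -> exists n, 8^-1 ^+ n < e.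
Proof.
move=> e0; apply: contrapT => hn; move: e0; apply/negP; rewrite -leNgt.
apply: (@small_le0 e 1) => n; rewrite mul1r leNgt.
by apply/negP => en; apply: hn; exists n.
Qed.

(** Subtracting from [f] its component along [g] lowers the squared norm by [|<f, g>|^2 / |g|^2].
    This gain is at most [eps], since the squared norm of [f] is within [eps] of the lower bound
    [delta]. *)
Lemma near_minimizer_orth (delta eps : R) f g : L2 mu f -> L2 mu g ->
  (forall t : R[i], delta <= nrm2 mu (fun x => f x - t * g x)) ->
  nrm2 mu f <= delta + eps ->
  sqnormC (inner mu f g) <= eps * nrm2 mu g.
Proof.
move=> Lf Lg dmin fd; have g0 := nrm2_ge0 mu g.
have [gE|gn0] := eqVneq (nrm2 mu g) 0.
  by rewrite (le_trans (cauchy_schwarz Lf Lg))// gE !mulr0.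
have gp : 0 < nrm2 mu g by rewrite lt_neqAle eq_sym gn0.
set z := inner mu f g.
have := dmin ((nrm2 mu g)^-1%:C * z).
rewrite nrm2B//; last exact: L2Z.
rewrite nrm2Z// innerZr// -/z sqnormCM sqnormC_real.
have -> : cRe (((nrm2 mu g)^-1%:C * z)^* * z) = (nrm2 mu g)^-1 * sqnormC z.
  by rewrite rmorphM !cE /sqnormC /=; ring.
set k := nrm2 mu g in gn0 gp *; set q := sqnormC z => h.
have e1 : k^-1 ^+ 2 * q * k = k^-1 * q by field.
have : k^-1 * q <= eps by rewrite e1 in h; lra.
by rewrite ler_pdivrMl// mulrC.
Qed.

(** A minimising sequence of precision [8^-1 ^+ n / 4] has, by the parallelogram law at the
    midpoints, the rate required by [riesz_fischer]. Orthogonality holds up to an error along the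
    sequence, by [near_minimizer_orth], and exactly in the limit. *)
Theorem projection C f : closed_subspace mu C -> L2 mu f ->
  exists2 p, C p & forall g, C g -> inner mu (fun x => f x - p x) g = 0.
Proof.
move=> cC Lf; have [CL C0 lC clC] := cC.
pose E := [set nrm2 mu (fun x => f x - g x) | g in C].
have lE : lbound E 0 by move=> _ [g _ <-]; exact: nrm2_ge0.
have hE : has_inf E by split; [exists (nrm2 mu (fun x => f x - 0)), (cst 0)|exists 0].
have dlow g : C g -> inf E <= nrm2 mu (fun x => f x - g x).
  by move=> Cg; apply: ge_inf; [exists 0|exists g].
have /choice[p hp] n : exists g, C g /\
    nrm2 mu (fun x => f x - g x) <= inf E + 8^-1 ^+ n / 4.
  have e0 : 0 < 8^-1 ^+ n / 4 :> R by rewrite divr_gt0// pow8_gt0.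
  have [_ [g Cg <-] gE] := inf_adherent e0 hE.
  by exists g; split => //; exact: ltW.
have Cp n := (hp n).1; have Lp n := CL _ (Cp n).
have pp n m : (n <= m)%N -> nrm2 mu (fun x => p n x - p m x) <= 8^-1 ^+ n.
  move=> nm; have := dlow (fun x => 2^-1 * p n x + 2^-1 * p m x).
  have Cmid : C (fun x => 2^-1 * p n x + 2^-1 * p m x).
    exact: closed_subspaceD cC (closed_subspaceZ 2^-1 cC (Cp n))
      (closed_subspaceZ 2^-1 cC (Cp m)).
  move=> /(_ Cmid).
  have Lfn := L2B Lf (Lp n); have Lfm := L2B Lf (Lp m).
  rewrite (_ : (fun x => f x - _) =
     (fun x => 2^-1 * ((f x - p n x) + (f x - p m x)))); last first.
    by apply/funext => x; field.
  rewrite nrm2Z; last exact: L2D.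
  rewrite (_ : (fun x => p n x - p m x) =
     (fun x => (f x - p m x) - (f x - p n x))); last first.
    by apply/funext => x; ring.
  rewrite (_ : sqnormC 2^-1 = 4^-1 :> R); last first.
    rewrite (_ : 2^-1 = (2^-1 : R)%:C) ?sqnormC_real; first by field.
    by rewrite fmorphV rmorph_nat.
  rewrite (nrm2D Lfn Lfm) (nrm2B Lfm Lfn) (innerJ Lfn Lfm) cReJ.
  have := (hp n).2; have := (hp m).2; have := pow8_le nm.
  set A := nrm2 mu _; set B := nrm2 mu _; set c := cRe _.
  by move: (8^-1 ^+ n) (8^-1 ^+ m) (inf E) A B c => *; lra.
have [q Lq hq] := riesz_fischer Lp pp.
have Cq : C q.
  apply: clC => // e e0.
  have [n hn] := pow8_small e0.
  by exists (p n) => //; rewrite nrm2_sym (le_lt_trans (hq n)).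
exists q => // g Cg; have Lg := CL _ Cg.
apply/eqP; rewrite -sqnormC_eq0 eq_le sqnormC_ge0 andbT.
apply: (@small_le0 _ (4 * nrm2 mu g)) => n.
rewrite (_ : (fun x => f x - q x) =
   (fun x => (f x - p n x) + (p n x - q x))); last by apply/funext => x; ring.
have Lfn := L2B Lf (Lp n); have Lnq := L2B (Lp n) Lq.
rewrite innerDl// (le_trans (sqnormCD_le _ _))//.
have h1 := le_trans (cauchy_schwarz Lnq Lg) (ler_wpM2r (nrm2_ge0 mu g) (hq n)).
have h2 : sqnormC (inner mu (fun x => f x - p n x) g) <= 8^-1 ^+ n / 4 * nrm2 mu g.
  apply: (@near_minimizer_orth (inf E)) => //; last exact: (hp n).2.
  move=> t; under eq_fun do rewrite -addrA -opprD.
  by apply: dlow; exact: closed_subspaceD cC (Cp n) (closed_subspaceZ t cC Cg).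
have := pow8_gt0 n; have := nrm2_ge0 mu g; move: h1 h2.
by move: (8^-1 ^+ n) (nrm2 mu g) (sqnormC _) (sqnormC _) => *; nra.
Qed.

Lemma closed_subspace_total C : closed_subspace mu C ->
  (forall f, L2 mu f -> (forall g, C g -> inner mu f g = 0) -> nrm2 mu f = 0) ->
  L2 mu `<=` C.
Proof.
move=> cC h f Lf; have [p Cp fp] := projection cC Lf; have [CL _ _ _] := cC.
have Lp := CL _ Cp; have /(nrm2B0 Lf Lp) fpE := h _ (L2B Lf Lp) fp.
by apply: (closed_subspace_ae cC Cp Lf.1); apply: filterS fpE => x ->.
Qed.

(* Orthogonality to [g - p], where p is the projection of g on C, passes to the weak limit. *)
Lemma weak_closed C (g_ : nat -> X -> R[i]) g : closed_subspace mu C ->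
  (forall n, C (g_ n)) -> L2 mu g ->
  (forall f, L2 mu f -> forall e : R, 0 < e ->
     exists n, sqnormC (inner mu (g_ n) f - inner mu g f) < e) -> C g.
Proof.
move=> cC Cg Lg h; have [p Cp fp] := projection cC Lg; have [CL _ _ _] := cC.
have Lp := CL _ Cp; have Lgp := L2B Lg Lp.
have pg0 k : C k -> inner mu k (fun x => g x - p x) = 0.
  by move=> Ck; rewrite (innerJ Lgp (CL _ Ck)) fp// conjC0.
have g0 : inner mu g (fun x => g x - p x) = 0.
  apply/eqP; rewrite -sqnormC_eq0 eq_le sqnormC_ge0 andbT; apply/ler_addgt0Pr => e e0.
  have [n] := h _ Lgp e e0; rewrite pg0// sub0r sqnormCN add0r; exact: ltW.
have /(nrm2B0 Lg Lp) gpE : nrm2 mu (fun x => g x - p x) = 0.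
  by apply: complexI; rewrite -inner_norm// innerBl// g0 pg0// subr0.
by apply: (closed_subspace_ae cC Cp Lg.1); apply: filterS gpE => x ->.
Qed.

End RieszFischer.

(** * Unitary operators *)

(** A combination [s] of the generators is orthogonal to [f], so [|f - s|^2 = |f|^2 + |s|^2], and no
    combination comes closer to [f] than 0 does. *)
Lemma orth_total {R : realType} {d : measure_display} {X : measurableType d}
    (mu : {measure set X -> \bar R}) I (e : I -> X -> R[i]) f :
  (forall i, L2 mu (e i)) ->
  closed_span mu (range e) f -> (forall i, inner mu f (e i) = 0) ->
  nrm2 mu f = 0.
Proof.
move=> Le /(closed_spanP _ Le)[Lf hf] f0.
apply/eqP; rewrite eq_le nrm2_ge0 andbT leNgt; apply/negP => /hf[s].
rewrite (nrm2B Lf (L2_comb s Le)) (_ : inner mu f _ = 0) /=.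
  have := nrm2_ge0 mu (comb e s); lra.
rewrite /comb inner_sumr//; last by move=> p; exact: L2Z.
by rewrite big1// => p _; rewrite innerZr// f0 mulr0.
Qed.

Section Isometries.
Context {R : realType} {d d' : measure_display}.
Context {X : measurableType d} {Y : measurableType d'}.
Variables (mu : {measure set X -> \bar R}) (nu : {measure set Y -> \bar R}).

Lemma nrm2_comb_gram I (e : I -> X -> R[i]) (e' : I -> Y -> R[i]) s :
  (forall i, L2 mu (e i)) -> (forall i, L2 nu (e' i)) ->
  (forall i j, inner mu (e i) (e j) = inner nu (e' i) (e' j)) ->
  nrm2 mu (comb e s) = nrm2 nu (comb e' s).
Proof.
move=> Le Le' ee'; apply: complexI; rewrite -!inner_norm; [|exact: L2_comb..].
rewrite !inner_comb//; apply: eq_bigr => p _; apply: eq_bigr => q _.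
by rewrite ee'.
Qed.

(** The norm of a combination depends only on the Gram matrix, so combinations of [e] converging to
    [f] turn into a Cauchy sequence of combinations of [e'], whose limit is [F]. The recorded inner
    products determine [F] almost everywhere within the span. *)
Lemma gram_extension I (e : I -> X -> R[i]) (e' : I -> Y -> R[i]) f :
  (forall i, L2 mu (e i)) -> (forall i, L2 nu (e' i)) ->
  (forall i j, inner mu (e i) (e j) = inner nu (e' i) (e' j)) ->
  closed_span mu (range e) f ->
  exists F, [/\ closed_span nu (range e') F,
    forall i, inner nu F (e' i) = inner mu f (e i) & nrm2 nu F = nrm2 mu f].
Proof.
move=> Le Le' ee' /(closed_spanP _ Le)[Lf hf].
have /choice[s hs] n : exists s, nrm2 mu (fun x => f x - comb e s x) < 8^-1 ^+ n / 4.
  by apply: hf; rewrite divr_gt0// pow8_gt0.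
have Lc s0 : L2 mu (comb e s0) by exact: L2_comb.
have Lc' s0 : L2 nu (comb e' s0) by exact: L2_comb.
have cc n m : (n <= m)%N ->
    nrm2 nu (fun x => comb e' (s n) x - comb e' (s m) x) <= 8^-1 ^+ n.
  move=> nm; rewrite combB -(nrm2_comb_gram _ Le Le' ee') -combB.
  rewrite (le_trans (nrm2B_le (Lc _) (Lc _) Lf))// nrm2_sym.
  have := hs n; have := hs m; have := @pow8_le R _ _ nm.
  by move: (nrm2 _ _) (nrm2 _ _) => *; lra.
have [F LF hF] := riesz_fischer (fun n => Lc' (s n)) cc.
have LFn n := L2B LF (Lc' (s n)); have Lfn n := L2B Lf (Lc (s n)).
have hF' n : nrm2 nu (fun x => F x - comb e' (s n) x) <= 8^-1 ^+ n.
  by rewrite nrm2_sym.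
have hs' n : nrm2 mu (fun x => f x - comb e (s n) x) <= 8^-1 ^+ n.
  by apply: le_trans (ltW (hs n)) _; have := @pow8_gt0 R n; lra.
have inF i : inner nu F (e' i) = inner mu f (e i).
  apply/eqP; rewrite -subr_eq0 -sqnormC_eq0 eq_le sqnormC_ge0 andbT.
  apply: (@small_le0 _ _ (2 * (nrm2 nu (e' i) + nrm2 mu (e i)))) => n.
  rewrite (_ : _ - _ = inner nu (fun x => F x - comb e' (s n) x) (e' i) -
      inner mu (fun x => f x - comb e (s n) x) (e i)); last first.
    rewrite innerBl// innerBl//.
    suff -> : inner nu (comb e' (s n)) (e' i) = inner mu (comb e (s n)) (e i) by ring.
    rewrite /comb !inner_suml// ; [|by move=> ?; exact: L2Z..].
    by apply: eq_bigr => p _; rewrite !innerZl// ee'.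
  rewrite (le_trans (sqnormCB_le _ _))//.
  have := le_trans (cauchy_schwarz (LFn n) (Le' i)) (ler_wpM2r (nrm2_ge0 nu (e' i)) (hF' n)).
  have := le_trans (cauchy_schwarz (Lfn n) (Le i)) (ler_wpM2r (nrm2_ge0 mu (e i)) (hs' n)).
  move: (8^-1 ^+ n) (sqnormC _) (sqnormC _) => *; lra.
exists F; split => //.
- apply/closed_spanP => //; split => // eps /pow8_small[n hn].
  by exists (s n); exact: le_lt_trans (hF' n) hn.
- apply/eqP; rewrite eq_le -[X in X && _]subr_le0 -[X in _ && X]subr_le0.
  (* Both squared distances expand with the same cross terms and the same norms of combinations, so
     the difference of the two norms is a difference of two small errors. *)
  have key n : nrm2 nu F - nrm2 mu f =
      nrm2 nu (fun x => F x - comb e' (s n) x) - nrm2 mu (fun x => f x - comb e (s n) x).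
    rewrite (nrm2B LF (Lc' _)) (nrm2B Lf (Lc _)) (nrm2_comb_gram _ Le Le' ee').
    suff -> : inner nu F (comb e' (s n)) = inner mu f (comb e (s n)) by ring.
    rewrite /comb !inner_sumr//; [|by move=> ?; exact: L2Z..].
    by apply: eq_bigr => p _; rewrite !innerZr// inF.
  apply/andP; split.
    apply: (@small_le0 _ _ 1) => n; rewrite (key n) mul1r.
    have := hF' n; have := nrm2_ge0 mu (fun x => f x - comb e (s n) x); lra.
  apply: (@small_le0 _ _ 1) => n; rewrite -opprB (key n) mul1r.
  have := hs' n; have := nrm2_ge0 nu (fun x => F x - comb e' (s n) x); lra.
Qed.

End Isometries.

Section Unitary.
Context {R : realType} {d d' : measure_display}.
Context {X : measurableType d} {Y : measurableType d'}.
Variables (mu : {measure set X -> \bar R}) (nu : {measure set Y -> \bar R}).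

Definition unitary_iso (V : (X -> R[i]) -> Y -> R[i]) :=
  [/\ forall f, L2 mu f -> L2 nu (V f),
      forall f g, L2 mu f -> L2 mu g -> inner nu (V f) (V g) = inner mu f g
    & forall F, L2 nu F -> exists2 f, L2 mu f & {ae nu, forall y, V f y = F y}].

Section UnitaryTheory.
Variable V : (X -> R[i]) -> Y -> R[i].
Hypothesis uV : unitary_iso V.

Lemma unitary_L2 f : L2 mu f -> L2 nu (V f). Proof. by case: uV => + _ _; apply. Qed.

Lemma unitary_nrm2 f : L2 mu f -> nrm2 nu (V f) = nrm2 mu f.
Proof.
move=> Lf; apply: complexI; rewrite -!inner_norm//; last exact: unitary_L2.
by case: uV => _ + _; apply.
Qed.

(** Preserving inner products forces linearity: the squared norm of the defect expands into inner
    products, which cancel. *)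
Lemma unitary_lin c f g : L2 mu f -> L2 mu g ->
  {ae nu, forall y, V (fun x => c * f x + g x) y = c * V f y + V g y}.
Proof.
move=> Lf Lg; have [V2 Vi _] := uV; have Lh := L2lin c Lf Lg.
have LV := L2lin c (V2 _ Lf) (V2 _ Lg).
apply: (nrm2B0 (V2 _ Lh) LV).
rewrite (nrm2B (V2 _ Lh) LV) (unitary_nrm2 Lh).
rewrite (nrm2_lin _ (V2 _ Lf) (V2 _ Lg)) !unitary_nrm2//.
rewrite (inner_linr _ (V2 _ Lf) (V2 _ Lg) (V2 _ Lh)) !Vi//.
rewrite !inner_linl// (innerJ Lf Lg) !inner_norm// nrm2_lin//.
case: (inner mu f g) => a b; case: c {Lh LV} => p q.
by rewrite !cE /sqnormC /=; ring.
Qed.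

Lemma unitary_nrm2B f g : L2 mu f -> L2 mu g ->
  nrm2 nu (fun y => V f y - V g y) = nrm2 mu (fun x => f x - g x).
Proof.
move=> Lf Lg; have [V2 Vi _] := uV.
by rewrite (nrm2B (V2 _ Lf) (V2 _ Lg)) nrm2B// !unitary_nrm2// Vi.
Qed.

Lemma unitary_ae f g : L2 mu f -> L2 mu g -> {ae mu, forall x, f x = g x} ->
  {ae nu, forall y, V f y = V g y}.
Proof.
move=> Lf Lg fg; apply: (nrm2B0 (unitary_L2 Lf) (unitary_L2 Lg)).
rewrite unitary_nrm2B// nrm2_ae0//; first by case: (L2B Lf Lg).
by apply: filterS fg => x ->; rewrite subrr.
Qed.

Lemma unitary_inj f g : L2 mu f -> L2 mu g ->
  {ae nu, forall y, V f y = V g y} -> {ae mu, forall x, f x = g x}.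
Proof.
move=> Lf Lg fg; apply: nrm2B0 => //; rewrite -unitary_nrm2B// nrm2_ae0//.
  by case: (L2B (unitary_L2 Lf) (unitary_L2 Lg)).
by apply: filterS fg => x ->; rewrite subrr.
Qed.

End UnitaryTheory.

(** [V f] is chosen to have the inner products of [f] against the generators. Two elements of the
    span of [e'] with the same inner products agree almost everywhere, which yields linearity;
    polarisation of the norms then gives the inner products. *)
Lemma unitary_of_total I (e : I -> X -> R[i]) (e' : I -> Y -> R[i]) :
  (forall i, L2 mu (e i)) -> (forall i, L2 nu (e' i)) ->
  (forall i j, inner mu (e i) (e j) = inner nu (e' i) (e' j)) ->
  L2 mu `<=` closed_span mu (range e) ->
  exists V, [/\ forall f, L2 mu f -> L2 nu (V f),
    forall f g, L2 mu f -> L2 mu g -> inner nu (V f) (V g) = inner mu f g,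
    forall i, {ae nu, forall y, V (e i) y = e' i y}
  & forall f, L2 mu f -> closed_span nu (range e') (V f)].
Proof.
move=> Le Le' ee' tot.
have /choice[V hV] f : exists F, L2 mu f -> [/\ closed_span nu (range e') F,
    forall i, inner nu F (e' i) = inner mu f (e i) & nrm2 nu F = nrm2 mu f].
  have [Lf|nLf] := pselect (L2 mu f); last by exists (cst 0).
  by have [F hF] := gram_extension Le Le' ee' (tot _ Lf); exists F.
have cl := closed_span_closed Le'.
have LV f : L2 mu f -> L2 nu (V f) by move=> /hV[[]].
have uniq F G : closed_span nu (range e') F -> closed_span nu (range e') G ->
    (forall i, inner nu F (e' i) = inner nu G (e' i)) ->
    {ae nu, forall y, F y = G y}.
  move=> cF cG FG; have [LF _] := cF; have [LG _] := cG.
  apply: nrm2B0 => //; apply: (orth_total Le' (closed_subspaceB cl cF cG)) => i.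
  by rewrite innerBl// FG subrr.
have Vlin c f g : L2 mu f -> L2 mu g ->
    {ae nu, forall y, V (fun x => c * f x + g x) y = c * V f y + V g y}.
  move=> Lf Lg; have [c1 i1 _] := hV _ (L2lin c Lf Lg).
  have [c2 i2 _] := hV _ Lf; have [c3 i3 _] := hV _ Lg.
  apply: (uniq _ _ c1); first by case: cl => _ _ + _; apply.
  by move=> i; rewrite i1 !inner_linl ?i2 ?i3//; exact: LV.
exists V; split => //.
- move=> f g Lf Lg.
  have h c : cRe (c * inner nu (V f) (V g)) = cRe (c * inner mu f g).
    have [_ _ n1] := hV _ (L2lin c Lf Lg); have LVl := L2lin c (LV _ Lf) (LV _ Lg).
    have := eq_nrm2 (LV _ (L2lin c Lf Lg)).1 LVl.1 (Vlin c f g Lf Lg).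
    rewrite n1 (nrm2_lin c (LV _ Lf) (LV _ Lg)) nrm2_lin//.
    have [_ _ ->] := hV _ Lf; have [_ _ ->] := hV _ Lg; lra.
  apply: ceqP; first by have := h 1; rewrite !mul1r.
  (* The factor [i] turns the statement on real parts into one on imaginary parts. *)
  have := h 'i%C; rewrite !cReM /= !mul0r !mul1r !sub0r; exact: oppr_inj.
- move=> i; have [c1 i1 _] := hV _ (Le i).
  apply: uniq => //; first exact: closed_span_sub.
  by move=> j; rewrite i1 ee'.
- by move=> f /hV[].
Qed.

Lemma unitary_iso_of_total I (e : I -> X -> R[i]) (e' : I -> Y -> R[i]) :
  (forall i, L2 mu (e i)) -> (forall i, L2 nu (e' i)) ->
  (forall i j, inner mu (e i) (e j) = inner nu (e' i) (e' j)) ->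
  L2 mu `<=` closed_span mu (range e) ->
  L2 nu `<=` closed_span nu (range e') ->
  exists2 V, unitary_iso V & forall i, {ae nu, forall y, V (e i) y = e' i y}.
Proof.
move=> Le Le' ee' tot tot'.
have [V [V1 V2 V3 V4]] := unitary_of_total Le Le' ee' tot.
exists V => //; split => // F LF.
(* Surjectivity is the same extension performed from [e'] to [e]. *)
have ee'' i j : inner nu (e' i) (e' j) = inner mu (e i) (e j) by rewrite ee'.
have [f [[Lf _] fe _]] := gram_extension Le' Le ee'' (tot' _ LF).
exists f => //; apply: nrm2B0 => //; first exact: V1.
apply: (orth_total Le'); first exact: (tot' _ (L2B (V1 _ Lf) LF)).
move=> i; rewrite innerBl//; last exact: V1.
rewrite -fe -V2// -(eq_inner (V1 _ Lf) (V1 _ Lf) (V1 _ (Le i)) (Le' i))//.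
  by rewrite subrr.
exact: aeW.
Qed.

(** Linearity is an equality of functions, not an almost everywhere one. Koopman operators,
    multiplications and swaps satisfy it, and it spares an exceptional null set at each use. *)
Definition bounded_op {d0} {Z : measurableType d0} (la : {measure set Z -> \bar R})
    (A : (Z -> R[i]) -> Z -> R[i]) :=
  [/\ forall f, L2 la f -> L2 la (A f),
      forall c f g, A (fun x => c * f x + g x) = fun x => c * A f x + A g x
    & exists K, forall f, L2 la f -> nrm2 la (A f) <= K * nrm2 la f].

Lemma bounded_op_ae d0 (Z : measurableType d0) (la : {measure set Z -> \bar R})
    A f g : bounded_op la A -> L2 la f -> L2 la g ->
  {ae la, forall x, f x = g x} -> {ae la, forall x, A f x = A g x}.
Proof.
move=> [A2 Al [K AK]] Lf Lg fg; apply: nrm2B0; [exact: A2|exact: A2|].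
have fg0 : nrm2 la (fun x => -1 * g x + f x) = 0.
  apply: nrm2_ae0; first by case: (L2lin (-1) Lg Lf).
  by apply: filterS fg => x ->; rewrite mulN1r addNr.
apply/eqP; rewrite eq_le nrm2_ge0 andbT -[leRHS](mulr0 K) -fg0.
apply: le_trans (AK _ (L2lin (-1) Lg Lf)); rewrite Al.
by rewrite le_eqVlt; apply/orP; left; apply/eqP; congr nrm2; apply/funext => x; rewrite mulN1r addrC.
Qed.

(** The vectors on which [V A] and [B V] agree form a closed subspace, because the defect is linear
    and bounded; it contains a total family. *)
Lemma unitary_intertwine V A B I (e : I -> X -> R[i]) :
  unitary_iso V -> bounded_op mu A -> bounded_op nu B ->
  (forall i, L2 mu (e i)) -> L2 mu `<=` closed_span mu (range e) ->
  (forall i, {ae nu, forall y, V (A (e i)) y = B (V (e i)) y}) ->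
  forall f, L2 mu f -> {ae nu, forall y, V (A f) y = B (V f) y}.
Proof.
move=> uV bA bB Le tot VAB.
have [A2 Al [K AK]] := bA; have [B2 Bl [K' BK]] := bB.
have LV f : L2 mu f -> L2 nu (V f) by exact: (unitary_L2 uV).
pose C := [set f | L2 mu f /\ {ae nu, forall y, V (A f) y = B (V f) y}].
suff cC : closed_subspace mu C.
  by move=> f /tot/(closed_span_min cC (fun i => conj (Le i) (VAB i)))[].
have lin c f g : L2 mu f -> L2 mu g ->
    {ae nu, forall y, V (A (fun x => c * f x + g x)) y - B (V (fun x => c * f x + g x)) y
     = c * (V (A f) y - B (V f) y) + (V (A g) y - B (V g) y)}.
  move=> Lf Lg; rewrite Al.
  have h1 := unitary_lin uV c (A2 _ Lf) (A2 _ Lg).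
  have h2 := unitary_lin uV c Lf Lg.
  have := bounded_op_ae bB (LV _ (L2lin c Lf Lg)) (L2lin c (LV _ Lf) (LV _ Lg)) h2.
  rewrite Bl => h3; apply: filterS2 h1 h3 => y -> ->; ring.
split.
- by move=> f [].
- split; first exact: L2_0.
  have h := lin (-1) _ _ (L2_0 mu) (L2_0 mu).
  have e0 : (fun x : X => -1 * (cst 0 : X -> R[i]) x + (cst 0 : X -> R[i]) x) = cst 0.
    by apply/funext => x; rewrite mulr0 addr0.
  rewrite e0 in h; apply: filterS h => y.
  by rewrite mulN1r addNr => /eqP; rewrite subr_eq0 => /eqP.
- move=> c f g [Lf Cf] [Lg Cg]; split; first exact: L2lin.
  apply: filterS3 (lin c _ _ Lf Lg) Cf Cg => y E Ef Eg; move: E; rewrite Ef Eg.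
  by rewrite !subrr mulr0 addr0 => /eqP; rewrite subr_eq0 => /eqP.
- move=> f Lf h; split => //; have LVAf := LV _ (A2 _ Lf); have LBVf := B2 _ (LV _ Lf).
  apply: nrm2B0 => //.
  apply/eqP; rewrite eq_le nrm2_ge0 andbT leNgt; apply/negP => n0.
  (* The defect at [f] is at most [2 * (|K| + |K'|)] times the squared distance to a [g] without
     defect; the added 1 keeps the divisor positive. *)
  have K0 : 0 < 4 * (`|K| + `|K'| + 1) by rewrite mulr_gt0// ltr_wpDl ?addr_ge0.
  have [g [Lg Cg]] := h _ (divr_gt0 n0 K0); rewrite ltr_pdivlMr// ltNge => /negP; apply.
  have LVAg := LV _ (A2 _ Lg); have LBVg := B2 _ (LV _ Lg).
  have Lfg := L2B Lf Lg.
  have := nrm2D_le (L2B LVAf LVAg) (L2N (L2B LBVf LBVg)).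
  rewrite (_ : nrm2 nu (fun x => V (A f) x - V (A g) x + - (B (V f) x - B (V g) x)) =
     nrm2 nu (fun y => V (A f) y - B (V f) y)); last first.
    apply: eq_nrm2.
    + by case: (L2D (L2B LVAf LVAg) (L2N (L2B LBVf LBVg))).
    + by case: (L2B LVAf LBVf).
    + by apply: filterS Cg => y ->; ring.
  move=> h1; apply: (le_trans h1); rewrite /nrm2 sqnormN -!/(nrm2 _ _).
  rewrite (unitary_nrm2B uV (A2 _ Lf) (A2 _ Lg)).
  have opB d0 (Z : measurableType d0) (la : {measure set Z -> \bar R}) D p q :
    (forall c f g, D (fun x => c * f x + g x) = fun x => c * D f x + D g x :> R[i]) ->
      (fun x : Z => D p x - D q x) = D (fun x => p x - q x).
    move=> Dl; have := Dl (-1) q p.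
    rewrite (_ : (fun x => -1 * q x + p x) = (fun x => p x - q x)).
      by move=> ->; apply/funext => x; rewrite mulN1r addrC.
    by apply/funext => x; rewrite mulN1r addrC.
  rewrite (opB _ _ _ mu A f g Al) (opB _ _ _ nu B (V f) (V g) Bl).
  have := BK _ (L2B (LV _ Lf) (LV _ Lg)); rewrite (unitary_nrm2B uV Lf Lg).
  have := AK _ Lfg; have := nrm2_ge0 mu (fun x => f x - g x).
  set a := nrm2 mu _; set b := nrm2 mu _; set c := nrm2 nu _ => b0 ha hc.
  have := ler_norm K; have := ler_norm K'; nra.
Qed.

End Unitary.

(** * Density of trigonometric polynomials *)

Lemma aeS {R : realType} {d : measure_display} {X : measurableType d}
    (mu : {measure set X -> \bar R}) (P Q : X -> Prop) :
  (forall x, P x -> Q x) -> {ae mu, forall x, P x} -> {ae mu, forall x, Q x}.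
Proof. by move=> PQ; apply: filterS. Qed.

Section Characters.
Context {R : realType}.
Local Notation dual := (measurableTypeR R * measurableTypeR R)%type.
Implicit Types (z w : int * int) (t : dual).

Lemma sqnormC_character z t : sqnormC (character z t) = 1.
Proof. by rewrite /sqnormC /character /= cos2Dsin2. Qed.

Lemma characterD z w t : character (z + w) t = character z t * character w t.
Proof.
rewrite /character; set a := 2 * pi * (z.1%:~R * t.1 + z.2%:~R * t.2).
set b := 2 * pi * (w.1%:~R * t.1 + w.2%:~R * t.2).
rewrite (_ : 2 * pi * _ = a + b); last first.
  by rewrite /a /b /= !rmorphD /=; ring.
by apply: ceqP; rewrite !cE /= ?cosD ?sinD; ring.
Qed.

Lemma characterN z t : character (- z) t = (character z t)^*.
Proof.
rewrite /character (_ : 2 * pi * _ = - (2 * pi * (z.1%:~R * t.1 + z.2%:~R * t.2))).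
  by apply: ceqP; rewrite !cE /= ?cosN ?sinN.
by rewrite /= !rmorphN /=; ring.
Qed.

Lemma characterB z w t : character (z - w) t = character z t * (character w t)^*.
Proof. by rewrite characterD characterN. Qed.

Lemma character0 t : character 0 t = 1.
Proof.
rewrite /character /= !mul0r addr0 mulr0 cos0 sin0.
by apply: ceqP.
Qed.

Lemma character_at0 z : character z ((0, 0) : dual) = 1.
Proof.
rewrite /character /= !mulr0 addr0 mulr0 cos0 sin0.
by apply: ceqP.
Qed.

Lemma cmeasurable_character z : cmeasurable (@character R z).
Proof.
have ma : measurable_fun setT (fun t : dual => 2 * pi * (z.1%:~R * t.1 + z.2%:~R * t.2)).
  apply: measurable_funM; first exact: measurable_cst.
  by apply: measurable_funD; (apply: measurable_funM; first exact: measurable_cst).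
split; rewrite /character /=.
  apply: (measurableT_comp _ ma); apply: continuous_measurable_fun; exact: continuous_cos.
apply: (measurableT_comp _ ma); apply: continuous_measurable_fun; exact: continuous_sin.
Qed.

End Characters.

(** * Polynomial approximation of the sign *)

Section SignIteration.
Context {R : realType}.

(* The iterates of this polynomial converge to the sign of x on [-1, 1]: a bounded multiplier b of a
   closed subspace thus produces the multiplier [\1_[set x | 0 < b x]]. *)
Definition sign_step (x : R) : R := x * (3 - x ^+ 2) / 2.

Definition sign_iter n := iter n sign_step.

Lemma sign_iterN n x : sign_iter n (- x) = - sign_iter n x.
Proof.
elim: n => [//|n ih]; rewrite /sign_iter !iterS -!/(sign_iter _ _) ih /sign_step.
by rewrite sqrrN; ring.
Qed.

Lemma sign_iter0 n : sign_iter n 0 = 0.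
Proof. by elim: n => [//|n ih]; rewrite /sign_iter iterS -/(sign_iter n 0) ih /sign_step !mul0r. Qed.

(** At an iterate [u], [1 - sign_step u = (1 - u) * ((1 - u) * (2 + u) / 2)]. The second factor is
    at most [1 - u / 2], hence at most [1 - x / 2], because the iterates stay above [x]. *)
Lemma sign_iter_pos n x : 0 < x <= 1 ->
  x <= sign_iter n x <= 1 /\ 1 - sign_iter n x <= (1 - x / 2) ^+ n.
Proof.
move=> /andP[x0 x1]; elim: n => [|n [/andP[h1 h2] h3]].
  by rewrite /sign_iter /= lexx x1 expr0; split => //; lra.
rewrite /sign_iter iterS -/(sign_iter n x); move: (sign_iter n x) h1 h2 h3 => u h1 h2 h3.
have u0 : 0 < u by lra.
have e1 : 0 <= u * ((1 - u) * (1 + u)) by rewrite !mulr_ge0//; lra.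
have e2 : 0 <= (1 - u) * ((1 - u) * (2 + u)) by rewrite !mulr_ge0//; lra.
rewrite exprS /sign_step; split; first by apply/andP; split; lra.
rewrite (_ : 1 - _ = (1 - u) * ((1 - u) * (2 + u) / 2)); last by field.
rewrite mulrC ler_pM//; nra.
Qed.

Lemma sign_iter_bound n x : `|x| <= 1 -> `|sign_iter n x| <= 1.
Proof.
move=> x1; have [x0|x0|->] := ltgtP x 0; last by rewrite sign_iter0 normr0.
  rewrite -(opprK x) sign_iterN normrN.
  case: (@sign_iter_pos n (- x)) => [|/andP[h1 h2] _].
    by move: x1; rewrite ltr0_norm //; lra.
  by rewrite ger0_norm//; lra.
case: (@sign_iter_pos n x) => [|/andP[h1 h2] _].
  by move: x1; rewrite gtr0_norm //; lra.
by rewrite ger0_norm//; lra.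
Qed.

Lemma cvg_sign_iter_pos x : 0 < x <= 1 -> (fun n => sign_iter n x) @ \oo --> (1 : R).
Proof.
move=> x01; have /andP[x0 x1] := x01.
apply: (@squeeze_cvgr _ _ _ _ (fun n => 1 - (1 - x / 2) ^+ n) (cst 1)).
- by apply: nearW => n; have [/andP[h1 h2] h3] := sign_iter_pos n x01; apply/andP; split; rewrite /=; lra.
- rewrite -[X in _ --> X]subr0; apply: cvgB; first exact: cvg_cst.
  have := @cvg_geometric R 1 (1 - x / 2); rewrite /geometric /=.
  under eq_fun do rewrite mul1r; apply; rewrite ger0_norm; lra.
- exact: cvg_cst.
Qed.

Lemma cvg_sign_iter x : `|x| <= 1 -> (fun n => sign_iter n x) @ \oo --> Num.sg x.
Proof.
move=> x1; have [x0|x0|->] := ltgtP x 0.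
- rewrite ltr0_sg// -(opprK x); under eq_fun do rewrite sign_iterN.
  by apply: cvgN; apply: cvg_sign_iter_pos; move: x1; rewrite ltr0_norm //; lra.
- by rewrite gtr0_sg//; apply: cvg_sign_iter_pos; move: x1; rewrite gtr0_norm //; lra.
- by rewrite sgr0; under eq_fun do rewrite sign_iter0; exact: cvg_cst.
Qed.

End SignIteration.

(** * Multipliers of a closed subspace *)

Section Multipliers.
Context {R : realType} {d : measure_display} {X : measurableType d}.
Variable mu : {measure set X -> \bar R}.
Implicit Types (f g h : X -> R[i]) (C : set (X -> R[i])) (A B : set X).

Lemma closed_dominated_cvg C (f_ : nat -> X -> R[i]) f (G : X -> R) :
  closed_subspace mu C -> (forall n, C (f_ n)) -> cmeasurable f ->
  mu.-integrable setT (EFin \o G) ->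
  (forall n x, sqnormC (f_ n x) <= G x) ->
  (forall x, (fun n => sqnormC (f_ n x - f x)) @ \oo --> (0 : R)) ->
  C f.
Proof.
move=> cC Cf mf iG fG f_f; have [CL _ _ clC] := cC.
have mf_ n : cmeasurable (f_ n) by case: (CL _ (Cf n)).
have mD n : cmeasurable (fun x => f_ n x - f x) by exact: cmeasurableB.
(* Comparing [f] with a late term [f_ N] costs a factor 2. Together with the bound on [f_ n] this
   gives the factor 6 of the dominating function. *)
have fle x : sqnormC (f x) <= 2 * G x.
  apply/ler_addgt0Pl => e e0.
  have e2 : 0 < e / 2 by lra.
  have /cvgrPdist_lt/(_ _ e2)[N _ /(_ N (leqnn N))] := f_f x.
  rewrite sub0r normrN ger0_norm ?sqnormC_ge0// => h.
  have := sqnormCB_le (f_ N x) (f_ N x - f x); rewrite opprB addrC subrK.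
  by have := fG N x; lra.
have DG n x : sqnormC (f_ n x - f x) <= 6 * G x.
  by rewrite (le_trans (sqnormCB_le _ _))//; have := fG n x; have := fle x; lra.
have i6 : mu.-integrable setT (fun x => (6 * G x)%:E).
  by apply: eq_integrable (integrableZl measurableT 6 iG) => // x _; rewrite /= EFinM.
have h : (fun n => \int[mu]_x (sqnormC (f_ n x - f x))%:E)%E @ \oo -->
    (\int[mu]_x (cst 0%E x))%E.
  suff [] : [/\ mu.-integrable setT (cst 0%E : X -> \bar R),
      (fun n => \int[mu]_x `|(sqnormC (f_ n x - f x))%:E - cst 0%E x|)%E @ \oo --> 0%E
    & (fun n => \int[mu]_x (sqnormC (f_ n x - f x))%:E)%E @ \oo -->
      (\int[mu]_x (cst 0%E x))%E] by [].
  apply: (@dominated_convergence _ X R mu setT measurableT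
    (fun n x => (sqnormC (f_ n x - f x))%:E) (cst 0%E) (fun x => (6 * G x)%:E)).
  - by move=> n; exact: measurable_sqnormCE.
  - exact: measurable_cst.
  - by apply: aeW => x _; apply: cvg_EFin; [exact: nearW|exact: f_f].
  - exact: i6.
  - by apply: aeW => x n _; rewrite gee0_abs ?lee_fin ?sqnormC_ge0.
rewrite integral0 in h.
have Lf : L2 mu f.
  split => //; have /integrableP[_ i2] := integrableZl measurableT 2 iG.
  apply: le_lt_trans i2; apply: ge0_le_integral => //.
  - by move=> x _; rewrite lee_fin sqnormC_ge0.
  - exact: measurable_sqnormCE.
  - apply: measurableT_comp => //; apply: measurable_funeM.
    by case/integrableP: iG.
  - move=> x _; rewrite /= lee_fin (le_trans (fle x))//; exact: ler_norm.
apply: clC => // e e0.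
have /fine_cvgP[_ /cvgrPdist_lt/(_ _ e0)[N _ /(_ N (leqnn N))]] := h.
rewrite sub0r normrN /= => hN; exists (f_ N) => //.
rewrite nrm2_sym; apply: le_lt_trans hN; exact: ler_norm.
Qed.

Definition multiplier C (b : X -> R) :=
  [/\ measurable_fun setT b, exists K : R, forall x, `|b x| <= K
    & forall f, C f -> C (fun x => (b x)%:C * f x)].

Lemma multiplier_cst C (c : R) : closed_subspace mu C -> multiplier C (cst c).
Proof.
move=> cC; split; first exact: measurable_cst.
  by exists `|c|.
by move=> f Cf; exact: (closed_subspaceZ c%:C cC Cf).
Qed.

Lemma multiplierD C b b' : closed_subspace mu C -> multiplier C b ->
  multiplier C b' -> multiplier C (fun x => b x + b' x).
Proof.
move=> cC [mb [K bK] Cb] [mb' [K' bK'] Cb']; split; first exact: measurable_funD.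
  by exists (K + K') => x; rewrite (le_trans (ler_normD _ _))// lerD.
move=> f Cf; under eq_fun do rewrite rmorphD mulrDl.
exact: closed_subspaceD cC (Cb _ Cf) (Cb' _ Cf).
Qed.

Lemma multiplierM C b b' : closed_subspace mu C -> multiplier C b ->
  multiplier C b' -> multiplier C (fun x => b x * b' x).
Proof.
move=> cC [mb [K bK] Cb] [mb' [K' bK'] Cb']; split; first exact: measurable_funM.
  by exists (K * K') => x; rewrite normrM ler_pM.
move=> f Cf; under eq_fun do rewrite rmorphM -mulrA.
by apply: Cb; exact: Cb'.
Qed.

Lemma multiplier_lim C (b_ : nat -> X -> R) b (K : R) : closed_subspace mu C ->
  (forall n, multiplier C (b_ n)) -> (forall n x, `|b_ n x| <= K) ->
  (forall x, b_ ^~ x @ \oo --> b x) -> multiplier C b.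
Proof.
move=> cC Mb bK b_b; have [CL _ _ _] := cC.
have mb : measurable_fun setT b.
  apply: (@measurable_fun_cvg _ _ _ _ b_) => [n|x _]; last exact: b_b.
  by case: (Mb n).
split => //.
  exists K => x; have /cvg_lim <- // : (fun n => `|b_ n x|) @ \oo --> `|b x|.
    by apply: cvg_norm; exact: b_b.
  apply: limr_le; last exact: nearW.
  by apply/cvg_ex; exists `|b x|; apply: cvg_norm; exact: b_b.
move=> f Cf; have Lf := CL _ Cf; have K0 x : 0 <= K := le_trans (normr_ge0 _) (bK 0%N x).
apply: (closed_dominated_cvg (f_ := fun n x => (b_ n x)%:C * f x)
  (G := fun x => K ^+ 2 * sqnormC (f x))) => //.
- by move=> n; case: (Mb n) => _ _; apply.
- by apply: cmeasurableM; [exact: cmeasurable_real|case: Lf].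
- apply: eq_integrable (integrableZl measurableT (K ^+ 2) (L2_integrable Lf)) => //.
- move=> n x; rewrite sqnormCM sqnormC_real ler_wpM2r ?sqnormC_ge0//.
  by rewrite -[leLHS]real_normK ?num_real// lerXn2r ?nnegrE ?(K0 x).
- move=> x; rewrite (_ : (fun n => _) = (fun n => (b_ n x - b x) * (b_ n x - b x) * sqnormC (f x))).
    rewrite (_ : nbhs (0 : R) = nbhs ((b x - b x) * (b x - b x) * sqnormC (f x))).
      have h : (fun n => b_ n x - b x) @ \oo --> b x - b x.
        by apply: cvgB; [exact: b_b|exact: cvg_cst].
      by apply: cvgM; [exact: cvgM|exact: cvg_cst].
    by rewrite subrr !mul0r.
  by apply/funext => n; rewrite -mulrBl -rmorphB sqnormCM sqnormC_real expr2.
Qed.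

(** These sets form a sigma-algebra ([mset_sigma_algebra]), so invariance of [C] under all
    indicators reduces to a generating class. *)
Definition mset C A := measurable A /\ forall f, C f -> C (fun x => (\1_A x)%:C * f x).

Lemma mset_multiplier C A : mset C A <-> measurable A /\ multiplier C (\1_A).
Proof.
split=> [[mA h]|[mA [_ _ h]]]; split => //; split => //.
by exists 1 => x; rewrite indicE; case: (_ \in _); rewrite ?normr1 ?normr0.
Qed.

Lemma mset_gt0 C b : closed_subspace mu C -> multiplier C b ->
  mset C [set x | 0 < b x].
Proof.
move=> cC Mb; have [mb [K bK] _] := Mb.
have mA : measurable [set x | 0 < b x].
  rewrite (_ : [set _ | _] = b @^-1` `]0, +oo[%classic); last first.
    by apply/seteqP; split => x /=; rewrite in_itv/= andbT.
  by rewrite -[X in measurable X]setTI; exact: mb.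
apply/mset_multiplier; split => //.
(* Rescaling into [[-1, 1]], where the iteration converges; the added 1 keeps the factor
   positive. *)
pose c x := (`|K| + 1)^-1 * b x.
have K1 : 0 < `|K| + 1 by rewrite ltr_wpDl.
have c1 x : `|c x| <= 1.
  rewrite normrM (@ger0_norm _ (`|K| + 1)^-1) ?invr_ge0 ?(ltW K1)// ler_pdivrMl// mulr1.
  by rewrite (le_trans (bK x))// (le_trans (ler_norm K))// lerDl.
have Mc : multiplier C c by apply: multiplierM => //; exact: multiplier_cst.
have Ms n : multiplier C (fun x => sign_iter n (c x)).
  elim: n => [|n ih]; first exact: Mc.
  rewrite /sign_iter /= -/(sign_iter n) /sign_step.
  apply: multiplierM => //; last exact: multiplier_cst.
  apply: multiplierM => //; apply: multiplierD => //; first exact: multiplier_cst.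
  under eq_fun do rewrite -mulN1r; apply: multiplierM => //; first exact: multiplier_cst.
  under eq_fun do rewrite expr2; exact: multiplierM.
have Msg : multiplier C (fun x => Num.sg (c x)).
  apply: (multiplier_lim cC Ms (K := 1)) => [n x|x]; first exact: sign_iter_bound.
  exact: cvg_sign_iter.
(* Half of the sign plus its square is 1 on positive values and 0 elsewhere. *)
rewrite (_ : \1_ _ = (fun x => (cst 2^-1 x) * (Num.sg (c x) + Num.sg (c x) * Num.sg (c x)))).
  apply: multiplierM => //; first exact: multiplier_cst.
  by apply: multiplierD => //; exact: multiplierM.
apply/funext => x; rewrite indicE.
have -> : (x \in [set x | 0 < b x]) = (0 < c x).
  by rewrite mem_setE /c pmulr_rgt0 ?invr_gt0.
by rewrite /cst; case: sgrP => _ /=; field.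
Qed.

(** Intersections are compositions of multiplications and complements are differences from the
    identity. A countable union is the pointwise limit of the finite ones, whose indicators are
    bounded by 1. *)
Lemma mset_sigma_algebra C : closed_subspace mu C -> sigma_algebra setT (mset C).
Proof.
move=> cC; have [CL C0 _ _] := cC.
have mC A : mset C A -> mset C (~` A).
  move=> [mA CA]; split; first exact: measurableC.
  move=> f Cf; rewrite (_ : (fun x => _) = (fun x => f x - (\1_A x)%:C * f x)).
    exact: closed_subspaceB cC Cf (CA _ Cf).
  apply/funext => x; rewrite !indicE in_setC; case: (x \in A) => /=.
    by rewrite mul1r mul0r subrr.
  by rewrite mul1r mul0r subr0.
have mI A B : mset C A -> mset C B -> mset C (A `&` B).
  move=> [mA CA] [mB CB]; split; first exact: measurableI.
  move=> f Cf; have := CA _ (CB _ Cf).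
  rewrite (_ : (fun x => (\1_A x)%:C * _) = (fun x => (\1_(A `&` B) x)%:C * f x))//.
  by apply/funext => x; rewrite indicI /= rmorphM mulrA.
have mU A B : mset C A -> mset C B -> mset C (A `|` B).
  by move=> hA hB; rewrite -(setCK (A `|` B)) setCU; apply: (mC); apply: (mI); exact: mC.
have m0 : mset C set0.
  split => // f Cf; rewrite (_ : (fun x => _) = cst 0)//.
  by apply/funext => x; rewrite indic0 mul0r.
split => // [A|F mF]; first by rewrite setTD; exact: mC.
have mUF : measurable (\bigcup_n F n) by apply: bigcupT_measurable => n; case: (mF n).
apply/mset_multiplier; split => //.
pose G n := \big[setU/set0]_(i < n) F i.
have mG n : mset C (G n).
  by rewrite /G; elim/big_ind : _ => // *; exact: mU.
apply: (@multiplier_lim C (fun n => \1_(G n)) _ 1) => //.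
- by move=> n; have /mset_multiplier[] := mG n.
- by move=> n x; rewrite indicE; case: (_ \in _); rewrite ?normr1 ?normr0.
- move=> x; have [[N _ FN]|nF] := pselect ((\bigcup_n F n) x).
    rewrite [\1_ _ x]indicE mem_set; last by exists N.
    apply: cvg_near_cst; exists N.+1 => // n Nn; rewrite indicE mem_set //.
    by rewrite /G -bigcup_mkord; exists N.
  rewrite [\1_ _ x]indicE memNset//; apply: cvg_near_cst; apply: nearW => n.
  rewrite indicE memNset// /G -bigcup_mkord => -[i _ Fi].
  by apply: nF; exists i.
Qed.

Lemma mset_setC C A : closed_subspace mu C -> mset C A -> mset C (~` A).
Proof. by move=> cC mA; case: (mset_sigma_algebra cC) => _ + _; rewrite -setTD; apply. Qed.

Lemma mset_setU C A B : closed_subspace mu C -> mset C A -> mset C B ->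
  mset C (A `|` B).
Proof.
move=> cC mA mB; case: (mset_sigma_algebra cC) => m0 _; rewrite -bigcup2E.
by apply => -[|[|n]].
Qed.

Lemma mset_ae C A B : closed_subspace mu C -> mset C A -> measurable B ->
  {ae mu, forall x, A x <-> B x} -> mset C B.
Proof.
move=> cC [mA CA] mB AB; split => // f Cf; have [CL _ _ _] := cC.
apply: (closed_subspace_ae cC (CA _ Cf)).
  apply: cmeasurableM; last by case: (CL _ Cf).
  by apply: cmeasurable_real; exact: measurable_indic.
apply: filterS AB => x AB; rewrite !indicE.
suff -> : (x \in A) = (x \in B) by [].
by apply/idP/idP; rewrite !inE => /AB.
Qed.

End Multipliers.

Section L2Total.
Import HBNNSimple.
Context {R : realType} {d : measure_display} {X : measurableType d}.
Variable mu : {finite_measure set X -> \bar R}.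
Implicit Types (f g h : X -> R[i]) (C : set (X -> R[i])) (A B : set X).

Lemma L2_bounded f (K : R) : cmeasurable f -> (forall x, sqnormC (f x) <= K) -> L2 mu f.
Proof.
move=> mf fK; split => //.
apply: (@le_lt_trans _ _ (\int[mu]_x (cst K%:E x))%E).
  apply: ge0_le_integral => //.
  - by move=> x _; rewrite lee_fin sqnormC_ge0.
  - exact: measurable_sqnormCE.
  - by move=> x _; rewrite lee_fin.
by rewrite integral_cst// ltey_eq fin_numM// fin_num_measure.
Qed.

Lemma L2_cst (c : R[i]) : L2 mu (cst c).
Proof. by apply: (@L2_bounded _ (sqnormC c)) => //; exact: cmeasurable_cst. Qed.

Lemma cmeasurable_indic A : measurable A -> cmeasurable (fun x => (\1_A x)%:C : R[i]).
Proof. by move=> mA; apply: cmeasurable_real; exact: measurable_indic. Qed.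

Lemma L2_indic A : measurable A -> L2 mu (fun x => (\1_A x)%:C).
Proof.
move=> mA; apply: (@L2_bounded _ 1); first exact: cmeasurable_indic.
by move=> x; rewrite sqnormC_real indicE; case: (_ \in _); rewrite ?expr1n ?expr0n ?ler01.
Qed.

(** Simple functions increasing to a nonnegative function are dominated by it; positive and negative
    parts, then real and imaginary parts, cover the general case. *)
Lemma L2_total_indic C : closed_subspace mu C ->
  (forall A, measurable A -> C (fun x => (\1_A x)%:C)) -> L2 mu `<=` C.
Proof.
move=> cC CA; have [CL C0 _ _] := cC.
have pos (f : X -> R) : measurable_fun setT f -> (forall x, 0 <= f x) ->
    L2 mu (fun x => (f x)%:C) -> C (fun x => (f x)%:C).
  move=> mf f0 Lf; have mEf : measurable_fun setT (EFin \o f) by exact/measurable_EFinP.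
  pose g := nnsfun_approx measurableT mEf.
  have Cg n : C (fun x => (g n x)%:C).
    have -> : (fun x => (g n x)%:C) = (fun x => \sum_(y <- fset_set (range (g n)))
        y%:C * (\1_(g n @^-1` [set y]) x)%:C).
      apply/funext => x; rewrite fimfunE fsbig_finite//= rmorph_sum.
      by apply: eq_bigr => y _; rewrite rmorphM.
    apply: (closed_subspace_sum _ cC) => y.
    by apply: (closed_subspaceZ y%:C cC); exact: CA.
  have cvgg x : (fun n => g n x) @ \oo --> f x.
    have := cvg_nnsfun_approx measurableT mEf (fun x _ => f0 x : (0 <= (f x)%:E)%E) (I : setT x).
    by move/fine_cvgP => [].
  have gf n x : g n x <= f x.
    have ndg := @nd_nnsfun_approx _ _ _ _ measurableT _ mEf.
    have nd : nondecreasing_seq (fun n => g n x).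
      by move=> m p mp; have /lefP := ndg _ _ mp; exact.
    have cg : cvgn (fun n => g n x) by apply/cvg_ex; exists (f x); exact: cvgg.
    have -> : f x = limn (fun n => g n x) by apply/esym/cvg_lim => //; exact: cvgg.
    exact: nondecreasing_cvgn_le.
  have g0 n x : 0 <= g n x by rewrite /g.
  apply: (closed_dominated_cvg cC (f_ := fun n x => (g n x)%:C)
    (G := fun x => sqnormC (f x)%:C)) => //.
  - exact: L2_integrable.
  - by move=> n x; rewrite !sqnormC_real lerXn2r ?nnegrE.
  - move=> x; rewrite (_ : (fun n => _) = (fun n => (g n x - f x) * (g n x - f x))).
      rewrite (_ : nbhs (0 : R) = nbhs ((f x - f x) * (f x - f x))).
        have h : (fun n => g n x - f x) @ \oo --> f x - f x.
          by apply: cvgB; [exact: cvgg|exact: cvg_cst].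
        exact: cvgM.
      by rewrite subrr !mul0r.
    by apply/funext => n; rewrite -rmorphB sqnormC_real expr2.
have real (f : X -> R) : L2 mu (fun x => (f x)%:C) -> C (fun x => (f x)%:C).
  move=> Lf; have mf : measurable_fun setT f by case: Lf => -[].
  have Lp (g : X -> R) : measurable_fun setT g -> (forall x, g x ^+ 2 <= f x ^+ 2) ->
      L2 mu (fun x => (g x)%:C).
    move=> mg gf; split; first exact: cmeasurable_real.
    apply: le_lt_trans (Lf.2); apply: sqnorm_le; [exact: cmeasurable_real|exact: cmeasurable_real|].
    by move=> x; rewrite !sqnormC_real.
  rewrite (_ : (fun x => _) = (fun x => (Num.max (f x) 0)%:C - (Num.max (- f x) 0)%:C)).
    apply: (closed_subspaceB cC); apply: pos.
    + exact: measurable_maxr.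
    + by move=> x; rewrite le_max lexx orbT.
    + apply: Lp; first exact: measurable_maxr.
      by move=> x; case: (leP (f x) 0) => h; rewrite ?expr0n ?sqr_ge0 ?lexx.
    + by apply: measurable_maxr => //; exact: measurable_funN.
    + by move=> x; rewrite le_max lexx orbT.
    + apply: Lp; first by apply: measurable_maxr => //; exact: measurable_funN.
      by move=> x; case: (leP (- f x) 0) => h; rewrite ?expr0n ?sqr_ge0 ?sqrrN ?lexx.
  apply/funext => x; rewrite -rmorphB; congr (_%:C).
  by case: (leP (f x) 0) => h; case: (leP (- f x) 0) => h'; rewrite ?subr0 ?sub0r ?opprK//; lra.
move=> f Lf; have [mf1 mf2] := Lf.1.
rewrite (_ : f = (fun x => 'i%C * (cIm (f x))%:C + (cRe (f x))%:C)); last first.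
  by apply/funext => x; apply: ceqP; rewrite !cE /=; ring.
case: cC => _ _ + _; apply; apply: real.
  split; first exact: cmeasurable_real.
  apply: le_lt_trans (Lf.2); apply: sqnorm_le; [exact: cmeasurable_real|exact: Lf.1|].
  by move=> x; rewrite sqnormC_real sqr_cIm_le.
split; first exact: cmeasurable_real.
apply: le_lt_trans (Lf.2); apply: sqnorm_le; [exact: cmeasurable_real|exact: Lf.1|].
by move=> x; rewrite sqnormC_real sqr_cRe_le.
Qed.

End L2Total.

(** * Arcs of the circle described by a cosine *)

Section CosineArcs.
Context {R : realType}.
Implicit Types r s t : R.

Lemma cos_2piB t : cos (2 * pi * (1 - t)) = cos (2 * pi * t) :> R.
Proof.
rewrite mulrBr mulr1 cosB (_ : 2 * pi = pi *+ 2) ?mulr2n; last by ring.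
by rewrite -mulr2n cos2pi sin2pi mul1r mul0r addr0.
Qed.

Lemma cos_2pi_lt r s : 0 <= r -> r < s -> s < 1 - r ->
  cos (2 * pi * s) < cos (2 * pi * r) :> R.
Proof.
have p0 := pi_gt0 R; move=> r0 rs s1.
have [s2|s2] := leP s 2^-1.
  by rewrite ltr_cos ?ltr_pM2l// ?in_itv /= ?mulr_gt0//; apply/andP; split; nra.
rewrite -(cos_2piB s) ltr_cos ?ltr_pM2l// ?in_itv /= ?mulr_gt0//; first lra.
  by apply/andP; split; nra.
by apply/andP; split; nra.
Qed.

(** The open arc from 0 to [a] is centred at [a / 2], and the cosine of the distance to the centre
    exceeds its value at the endpoints exactly inside. An interval of a coordinate thus becomes the
    positivity set of a trigonometric polynomial. *)
Lemma cos_arc a t : 0 < a < 1 -> 0 <= t < 1 ->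
  (cos (2 * pi * (a / 2)) < cos (2 * pi * (t - a / 2))) = (0 < t < a).
Proof.
move=> /andP[a0 a1] /andP[t0 t1].
have -> : cos (2 * pi * (t - a / 2)) = cos (2 * pi * `|t - a / 2|).
  have [h|h] := leP 0 (t - a / 2); first by rewrite ger0_norm.
  by rewrite ltr0_norm// mulrN cosN.
have [h|h|h] := ltgtP `|t - a / 2| (a / 2).
- rewrite cos_2pi_lt//; last by lra.
  by move: h; rewrite ltr_norml => /andP[h1 h2]; apply/esym/andP; split; lra.
- have hh : `|t - a / 2| < 1 - a / 2 by rewrite ltr_norml; apply/andP; split; lra.
  rewrite ltNge ltW ?cos_2pi_lt//=; last by lra.
  apply/esym/negbTE/negP => /andP[h1 h2]; move: h; rewrite ltNge => /negP; apply.
  by rewrite ler_norml; apply/andP; split; lra.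
- rewrite h ltxx; apply/esym/negbTE/negP => /andP[h1 h2].
  have : `|t - a / 2| < a / 2 by rewrite ltr_norml; apply/andP; split; lra.
  by rewrite h ltxx.
Qed.

End CosineArcs.

(** * From invariance under characters to invariance under indicators *)

Section TrigonometricDensity.
Context {R : realType} {d : measure_display} {X : measurableType d}.
Local Notation dual := (measurableTypeR R * measurableTypeR R)%type.
Variables (mu : {measure set X -> \bar R}) (tau : X -> dual).
Local Notation square := (`[0%R, 1%R[%classic `*` `[0%R, 1%R[%classic : set dual).
Hypothesis mtau : measurable_fun setT tau.
Hypothesis ae_square : {ae mu, forall x, square (tau x)}.

Variable C : set (X -> R[i]).
Hypothesis cC : closed_subspace mu C.
Hypothesis chiC : forall z f, C f -> C (fun x => character z (tau x) * f x).

Lemma multiplier_cos z : multiplier C (fun x => cRe (character z (tau x))).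
Proof.
split; first by case: (cmeasurable_comp (@cmeasurable_character R z) mtau).
  by exists 1 => t; exact: cos_max.
move=> f Cf.
have := closed_subspaceZ 2^-1 cC (closed_subspaceD cC (chiC z Cf) (chiC (- z) Cf)).
rewrite (_ : (fun t => 2^-1 * _) = (fun x => (cRe (character z (tau x)))%:C * f x))//.
apply/funext => t; rewrite characterN -mulrDl mulrA; congr (_ * _).
rewrite (_ : 2^-1 = (2^-1 : R)%:C); first by apply: ceqP; rewrite !cE /=; field.
by rewrite fmorphV rmorph_nat.
Qed.

Lemma multiplier_sin z : multiplier C (fun x => cIm (character z (tau x))).
Proof.
split; first by case: (cmeasurable_comp (@cmeasurable_character R z) mtau).
  by exists 1 => t; exact: sin_max.
move=> f Cf.
have := closed_subspaceZ (0 -i* 2^-1) cC (closed_subspaceB cC (chiC z Cf) (chiC (- z) Cf)).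
rewrite (_ : (fun t => _ * _) = (fun x => (cIm (character z (tau x)))%:C * f x))//.
apply/funext => t; rewrite characterN -mulrBl mulrA; congr (_ * _).
by apply: ceqP; rewrite !cE /=; field.
Qed.

Lemma mset_coord (p : X -> R) (z : int * int) : measurable_fun setT p ->
  (forall x, square (tau x) -> 0 <= p x < 1) ->
  (forall x, character z (tau x) = cos (2 * pi * p x) +i* sin (2 * pi * p x)) ->
  forall a : R, mset C [set t | p t < a].
Proof.
move=> mp p01 zp a.
have [m0 mC mU] := mset_sigma_algebra cC.
have mpa : measurable [set t | p t < a].
  rewrite (_ : [set _ | _] = p @^-1` `]-oo, a[%classic); last first.
    by apply/seteqP; split => t /=; rewrite in_itv/=.
  by rewrite -[X in measurable X]setTI; exact: mp.
have Mc : multiplier C (fun t => cos (2 * pi * p t)).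
  by have := multiplier_cos z; under eq_fun do rewrite zp /=.
have Ms : multiplier C (fun t => sin (2 * pi * p t)).
  by have := multiplier_sin z; under eq_fun do rewrite zp /=.
have [a0|a0] := leP a 0.
  apply: (mset_ae cC m0 mpa); apply: (aeS _ ae_square) => t /p01 /andP[pt _].
  by split => //= h; have := le_lt_trans pt h; rewrite ltNge a0.
have [a1|a1] := leP 1 a.
  apply: (mset_ae cC (mC _ m0) mpa); apply: (aeS _ ae_square) => t /p01 /andP[_ pt].
  by split=> [_|_]; [exact: lt_le_trans pt a1|split].
have MN (b : X -> R) : multiplier C b -> multiplier C (fun t => - b t).
  move=> Mb; under eq_fun do rewrite -mulN1r.
  exact: (multiplierM cC (multiplier_cst (-1) cC) Mb).
have mE1 : mset C [set t | 0 < 1 - cos (2 * pi * p t)].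
  exact: (mset_gt0 cC (multiplierD cC (multiplier_cst 1 cC) (MN _ Mc))).
have mE2 : mset C [set t | 0 < cos (2 * pi * (p t - a / 2)) - cos (2 * pi * (a / 2))].
  apply: (mset_gt0 cC); apply: (multiplierD cC); last exact: (multiplier_cst (- cos (2 * pi * (a / 2))) cC).
  rewrite (_ : (fun t => _) = (fun t => cos (2 * pi * p t) * cst (cos (2 * pi * (a / 2))) t
     + sin (2 * pi * p t) * cst (sin (2 * pi * (a / 2))) t)).
    exact: (multiplierD cC (multiplierM cC Mc (multiplier_cst _ cC))
      (multiplierM cC Ms (multiplier_cst _ cC))).
  by apply/funext => t; rewrite mulrBr cosB.
(* The interval [p t < a] is the open arc together with its endpoint [p t = 0], which is where
   [1 - cos] fails to be positive. *)
have m12 : mset C (~` [set t | 0 < 1 - cos (2 * pi * p t)] `|`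
    [set t | 0 < cos (2 * pi * (p t - a / 2)) - cos (2 * pi * (a / 2))]).
  exact: (mset_setU cC (mset_setC cC mE1) mE2).
apply: (mset_ae cC m12 mpa); apply: (aeS _ ae_square) => t /p01 pt.
have a01 : 0 < a < 1 by rewrite a0.
rewrite /= !subr_gt0 (cos_arc a01 pt); have /andP[pt0 pt1] := pt.
split=> [[/negP|/andP[_ ->]//]|pa].
  rewrite -leNgt => h; apply: le_lt_trans a0; rewrite leNgt; apply/negP => pp.
  move: h; apply/negP; rewrite -ltNge -[ltRHS]cos0 -(mulr0 (2 * pi)).
  by apply: cos_2pi_lt => //; lra.
have [->|pn0] := eqVneq (p t) 0; first by left; rewrite mulr0 cos0 ltxx.
by right; rewrite pa andbT lt_neqAle eq_sym pn0.
Qed.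

(** The map [tau] allows two uses: on the dual itself, and on [dual * nat], where [tau] forgets the
    layer. Half-lines in each of the two coordinates generate the Borel sets. *)
Lemma mset_total A : measurable A -> mset C (tau @^-1` A).
Proof.
have mfst : measurable_fun setT (fun x => (tau x).1).
  exact: (measurableT_comp (@measurable_fst _ _ (measurableTypeR R) (measurableTypeR R)) mtau).
have msnd : measurable_fun setT (fun x => (tau x).2).
  exact: (measurableT_comp (@measurable_snd _ _ (measurableTypeR R) (measurableTypeR R)) mtau).
have [m0 mC mU] := mset_sigma_algebra cC.
have coord (p : X -> measurableTypeR R) z : measurable_fun setT p ->
    (forall x, square (tau x) -> 0 <= p x < 1) ->
    (forall x, character z (tau x) = cos (2 * pi * p x) +i* sin (2 * pi * p x)) ->
    forall A1, measurable A1 -> mset C (p @^-1` A1).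
  move=> mp p01 zp A1; have := mset_coord mp p01 zp => h.
  rewrite [measurable]RGenInftyO.measurableE => mA1.
  suff : <<s @RGenInftyO.G R >> `<=` [set B | mset C (p @^-1` B)] by apply.
  apply: smallest_sub.
    split => //=.
    - by move=> B mB; rewrite setTD preimage_setC -setTD; exact: mC.
    - by move=> F mF; rewrite preimage_bigcup; exact: mU.
  move=> _ [a ->] /=; suff -> : p @^-1` `]-oo, a[%classic = [set t | p t < a] by exact: h.
  by apply/seteqP; split => t /=; rewrite in_itv/=.
have f1 : forall A1 : set (measurableTypeR R), measurable A1 ->
    mset C ((fun x => (tau x).1) @^-1` A1).
  apply: (coord (fun x => (tau x).1) (1, 0)) => //.
  - by move=> x [/=]; rewrite in_itv.
  - by move=> x; rewrite /character /= mul0r addr0 mul1r.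
have f2 : forall A1 : set (measurableTypeR R), measurable A1 ->
    mset C ((fun x => (tau x).2) @^-1` A1).
  apply: (coord (fun x => (tau x).2) (0, 1)) => //.
  - by move=> x [/=] _; rewrite in_itv.
  - by move=> x; rewrite /character /= mul0r add0r mul1r.
move=> mA.
suff : (measurable : set (set dual)) `<=` [set A | mset C (tau @^-1` A)] by apply.
apply: smallest_sub.
  split => //=.
  - by move=> B mB; rewrite setTD preimage_setC -setTD; exact: mC.
  - by move=> F mF; rewrite preimage_bigcup; exact: mU.
move=> B [[B1 mB1 <-]|[B2 mB2 <-]]; rewrite setTI.
  exact: f1.
exact: f2.
Qed.

End TrigonometricDensity.

Section CharactersTotal.
Context {R : realType}.
Local Notation dual := (measurableTypeR R * measurableTypeR R)%type.
Variable sigma : {finite_measure set dual -> \bar R}.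
Local Notation square := (`[0%R, 1%R[%classic `*` `[0%R, 1%R[%classic : set dual).
Hypothesis sigma_square : sigma (~` square) = 0%E.

Lemma measurable_square : measurable (square : set dual).
Proof. by apply: measurableX; exact: measurable_itv. Qed.

Lemma ae_square : {ae sigma, forall t, square t}.
Proof.
exists (~` square); split => //.
by apply: measurableC; exact: measurable_square.
Qed.

Lemma character_invariant_total C : closed_subspace sigma C ->
  (forall z f, C f -> C (fun t => character z t * f t)) -> C (cst 1) ->
  L2 sigma `<=` C.
Proof.
move=> cC chiC C1; apply: L2_total_indic => // A mA.
have [_ /(_ _ C1)] := mset_total (@measurable_id _ _ setT) ae_square cC chiC mA.
by under eq_fun do rewrite mulr1.
Qed.

Lemma L2_character z : L2 sigma (character z).
Proof.
apply: (@L2_bounded _ _ _ _ _ 1); first exact: cmeasurable_character.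
by move=> t; rewrite sqnormC_character.
Qed.

Lemma L2_characterM z f : L2 sigma f -> L2 sigma (fun t => character z t * f t).
Proof.
apply: (@L2_bounded_mul _ _ _ _ 1); first exact: cmeasurable_character.
by move=> t; rewrite sqnormC_character.
Qed.

Lemma characters_total : L2 sigma `<=` closed_span sigma (range (@character R)).
Proof.
apply: character_invariant_total.
- exact: (closed_span_closed L2_character).
- move=> z f /(closed_spanP _ L2_character)[Lf hf].
  apply/(closed_spanP _ L2_character); split; first exact: L2_characterM.
  move=> eps /hf[s hs]; exists [seq (p.1, z + p.2) | p <- s].
  apply: le_lt_trans hs; rewrite le_eqVlt; apply/orP; left; apply/eqP.
  rewrite /nrm2 /sqnorm; congr fine; apply: eq_integral => t _.
  rewrite (_ : _ - _ = character z t * (f t - comb (@character R) s t)).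
    by rewrite sqnormCM sqnormC_character mul1r.
  rewrite mulrBr /comb big_map mulr_sumr; congr (_ - _); apply: eq_bigr => p _.
  by rewrite /= characterD mulrCA.
- have := closed_span_sub 0 L2_character.
  by rewrite (_ : character 0 = cst 1)//; apply/funext => t; rewrite character0.
Qed.

End CharactersTotal.

(** * Uniqueness of the multiplicity function *)

Lemma cReZ {R : realType} (a : R) (z : R[i]) : cRe (a%:C * z) = a * cRe z.
Proof. by rewrite cReM /= mul0r subr0. Qed.

Lemma sqnormC_lin {R : realType} (c x y : R[i]) :
  sqnormC (c * x + y) = sqnormC c * sqnormC x + sqnormC y + 2 * cRe (c * (x * y^*)).
Proof. by rewrite /sqnormC !cE; ring. Qed.

Lemma ae_forall_ord {R : realType} {d : measure_display} {X : measurableType d}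
    (mu : {measure set X -> \bar R}) N (P : nat -> X -> Prop) :
  (forall n : 'I_N, {ae mu, forall x, P n x}) ->
  {ae mu, forall x, forall n : 'I_N, P n x}.
Proof.
move=> h; have : {ae mu, forall x, forall n : nat, (n < N)%N -> P n x}.
  apply: ae_foralln => n; have [nN|Nn] := ltnP n N.
    by apply: aeS (h (Ordinal nN)) => x /=.
  by apply: aeW => x nN; move: Nn; rewrite leqNgt => /negP.
by apply: aeS => x hx n; apply: hx.
Qed.

Section MeasureTools.
Context {R : realType} {d d' : measure_display} {X : measurableType d} {Y : measurableType d'}.

Definition image_measure (mu : {measure set X -> \bar R}) (f : X -> Y)
    (mf : measurable_fun setT f) : {measure set Y -> \bar R} :=
  measure_function_pushforward__canonical__measure_function_Measure mu mf.

Section FiniteMeasureOf.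
Variables (mu : {measure set X -> \bar R}) (muT : fin_num_fun mu).

(** A fresh name for [mu], to which [muT] attaches the structure of a finite measure. *)
Definition finite_copy : set X -> \bar R := mu.

Let finite_copy0 : finite_copy set0 = 0%E. Proof. exact: measure0. Qed.
Let finite_copy_ge0 A : (0 <= finite_copy A)%E. Proof. exact: measure_ge0. Qed.
Let finite_copy_additive : semi_sigma_additive finite_copy.
Proof. exact: measure_semi_sigma_additive. Qed.

HB.instance Definition _ := isMeasure.Build _ _ _ finite_copy
  finite_copy0 finite_copy_ge0 finite_copy_additive.

HB.instance Definition _ := Measure_isFinite.Build _ _ _ finite_copy muT.

Definition finite_measure_of : {finite_measure set X -> \bar R} := finite_copy.

End FiniteMeasureOf.

Lemma sqnorm_image (mu : {measure set X -> \bar R}) (f : X -> Y)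
    (mf : measurable_fun setT f) g : cmeasurable g ->
  sqnorm (image_measure mu mf) g = sqnorm mu (g \o f).
Proof.
move=> mg; rewrite /sqnorm.
rewrite (@ge0_integral_pushforward _ _ X Y _ f mf mu setT (fun y => (sqnormC (g y))%:E)) //.
- exact: measurable_sqnormCE.
- by move=> y _; rewrite lee_fin sqnormC_ge0.
Qed.

Lemma sqnorm_add (mu nu : {measure set X -> \bar R}) g : cmeasurable g ->
  sqnorm (measure_add mu nu) g = (sqnorm mu g + sqnorm nu g)%E.
Proof.
move=> mg; rewrite /sqnorm ge0_integral_measure_add//.
- by move=> y _; rewrite lee_fin sqnormC_ge0.
- exact: measurable_sqnormCE.
Qed.

Lemma sqnorm_mseries (mu : nat -> {measure set X -> \bar R}) g : cmeasurable g ->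
  sqnorm (mseries mu 0) g = (\sum_(n <oo) sqnorm (mu n) g)%E.
Proof.
move=> mg; rewrite /sqnorm ge0_integral_measure_series//.
- by move=> y _; rewrite lee_fin sqnormC_ge0.
- exact: measurable_sqnormCE.
Qed.

End MeasureTools.

Section NormLimits.
Context {R : realType} {d : measure_display} {X : measurableType d}.
Implicit Types mu nu : {measure set X -> \bar R}.

(** A triangle inequality for squared norms whose constant on [g] can be taken arbitrarily close to
    1: the cross term satisfies [2 * Re <g, f - g> <= t * |g|^2 + t^-1 * |f - g|^2]. *)
Lemma nrm2_approx_le mu (f g : X -> R[i]) (t : R) : 0 < t ->
  L2 mu f -> L2 mu g ->
  nrm2 mu f <= (1 + t) * nrm2 mu g + (1 + t^-1) * nrm2 mu (fun x => f x - g x).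
Proof.
move=> t0 Lf Lg; have Lfg := L2B Lf Lg.
have := nrm2_ge0 mu (fun x => (t%:C) * g x - (f x - g x)).
have Ltg := L2Z t%:C Lg.
rewrite (nrm2B Ltg Lfg) nrm2Z// sqnormC_real innerZl// => h1.
have -> : nrm2 mu f = nrm2 mu (fun x => g x + (f x - g x)).
  by congr nrm2; apply/funext => x; rewrite addrC subrK.
rewrite (nrm2D Lg Lfg).
move: h1; rewrite cReZ.
set a := nrm2 mu g; set b := nrm2 mu _; set c := cRe _ => h1.
have : 2 * c <= t * a + t^-1 * b.
  have -> : t * a + t^-1 * b = (t ^+ 2 * a + b) / t by field; rewrite gt_eqF.
  rewrite ler_pdivlMr//; lra.
lra.
Qed.

Lemma nrm2_approx_eq mu nu f : L2 mu f -> L2 nu f ->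
  (forall eps : R, 0 < eps -> exists g, [/\ L2 mu g, L2 nu g,
     nrm2 mu (fun x => f x - g x) < eps, nrm2 nu (fun x => f x - g x) < eps
   & nrm2 mu g = nrm2 nu g]) ->
  nrm2 mu f = nrm2 nu f.
Proof.
have aux (la ka : {measure set X -> \bar R}) : L2 la f -> L2 ka f ->
  (forall eps : R, 0 < eps -> exists g, [/\ L2 la g, L2 ka g,
     nrm2 la (fun x => f x - g x) < eps, nrm2 ka (fun x => f x - g x) < eps
   & nrm2 la g = nrm2 ka g]) ->
  nrm2 la f <= nrm2 ka f.
  move=> Lf Lf' h; rewrite leNgt; apply/negP.
  set a := nrm2 la f; set b := nrm2 ka f => ba.
  have b0 : 0 <= b by exact: nrm2_ge0.
  (* [t] is so small that [(1 + t)^2 * b] exceeds [b] by at most half of [a - b]; the remaining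
     error [e * k] is a quarter of it, and [a] cannot be reached. *)
  pose t := (a - b) / (6 * (b + 1) + (a - b)).
  have den0 : 0 < 6 * (b + 1) + (a - b) by lra.
  have t0 : 0 < t by rewrite divr_gt0// subr_gt0.
  have t1 : t < 1 by rewrite ltr_pdivrMr//; lra.
  have tb : 6 * t * (b + 1) <= a - b.
    rewrite /t -mulrA mulrAC mulrA ler_pdivrMr//.
    have := sqr_ge0 (a - b); nra.
  pose k := (1 + t) * (1 + t^-1) + (1 + t^-1).
  have ti : 0 < t^-1 by rewrite invr_gt0.
  have k0 : 0 < k by rewrite /k addr_gt0// ?mulr_gt0//; lra.
  have e0 : 0 < (a - b) / (4 * k) by rewrite divr_gt0 ?mulr_gt0 ?subr_gt0.
  have [g [Lg Lg' h1 h2 hE]] := h _ e0.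
  have := nrm2_approx_le t0 Lf Lg.
  have Lfg' : nrm2 ka (fun x => f x - g x) = nrm2 ka (fun x => g x - f x) by exact: nrm2_sym.
  have := nrm2_approx_le t0 Lg' Lf'; rewrite -Lfg' -/a -/b hE.
  move: h1 h2; set e := (a - b) / (4 * k) => h1 h2.
  set p := nrm2 la _ in h1 *; set q := nrm2 ka _ in h2 *; set r := nrm2 ka g.
  have ek : e * k = (a - b) / 4 by rewrite /e; field; rewrite gt_eqF.
  move=> i1 i2.
  have i3 : a <= (1 + t) * ((1 + t) * b + (1 + t^-1) * e) + (1 + t^-1) * e.
    apply: le_trans i2 _; apply: lerD; last by rewrite ler_pM2l ?ltW//; lra.
    rewrite ler_pM2l; last lra.
    by apply: le_trans i1 _; rewrite lerD2l ler_pM2l ?ltW//; lra.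
  have i4 : a <= (1 + t) * (1 + t) * b + e * k.
    by apply: le_trans i3 _; rewrite /k; lra.
  have : t * t <= t by nra.
  nra.
move=> Lf Lf' h; apply/eqP; rewrite eq_le aux//=; apply: aux => // eps /h[g [*]].
by exists g; split.
Qed.

End NormLimits.

Section DirectIntegralSpace.
Context {R : realType}.
Local Notation dual := (measurableTypeR R * measurableTypeR R)%type.

Lemma measurable_fun_natP d (T : measurableType d) d' (T' : measurableType d')
    (f : T * nat -> T') :
  (forall k, measurable_fun setT (fun t => f (t, k))) -> measurable_fun setT f.
Proof.
move=> mf _ B mB; rewrite setTI.
rewrite (_ : f @^-1` B = \bigcup_k (((fun t => f (t, k)) @^-1` B) `*` [set k])).
  apply: bigcupT_measurable => k; apply: measurableX => //.
  by rewrite -[X in measurable X]setTI; exact: mf.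
apply/seteqP; split => [[t k] fB|[t k] [k' _ [/= + ->]]//].
by exists k.
Qed.

Lemma cmeasurable_natP d (T : measurableType d) (f : T * nat -> R[i]) :
  (forall k, cmeasurable (fun t => f (t, k))) -> cmeasurable f.
Proof. by move=> mf; split; apply: measurable_fun_natP => k; case: (mf k). Qed.

Lemma measurable_pair_nat d (T : measurableType d) (k : nat) :
  measurable_fun setT (fun t : T => (t, k)).
Proof. exact: measurable_fun_pair. Qed.

(* A sequence of functions on the dual is a single function on [dual * nat]; the k-th copy of s is
   carried by the layer [p k]. *)
Definition layers (p : nat -> nat) (s : {measure set dual -> \bar R}) :
    {measure set (dual * nat) -> \bar R} :=
  mseries (fun k => image_measure s (measurable_pair_nat (p k))) 0.

Lemma sqnorm_layers p (s : {finite_measure set dual -> \bar R}) G : cmeasurable G ->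
  sqnorm (layers p s) G = direct_integral_sqnorm s (fun k t => G (t, p k)).
Proof.
move=> mG; rewrite /layers sqnorm_mseries// /direct_integral_sqnorm.
by apply: eq_eseriesr => k _; rewrite sqnorm_image.
Qed.

End DirectIntegralSpace.

(** * Comparison of two spectral representations *)

Section SpectralMeasureUniqueness.
Context {R : realType} {d : measure_display} {X : measurableType d}.
Variable mu : {measure set X -> \bar R}.
Local Notation dual := (measurableTypeR R * measurableTypeR R)%type.
Local Notation square := (`[0%R, 1%R[%classic `*` `[0%R, 1%R[%classic : set dual).
Variables (H : set (X -> R[i])) (U : int * int -> (X -> R[i]) -> X -> R[i]).
Hypothesis HL : H `<=` L2 mu.
Hypothesis Hlin : forall c f g, H f -> H g -> H (fun x => c * f x + g x).
Hypothesis HU : forall z f, H f -> H (U z f).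

(** The clauses on [Phi] in [spectral_representation], with [H] and [U] fixed by the section, so
    that two models of one representation can be put side by side. *)
Definition intertwiner (sigma : {finite_measure set dual -> \bar R})
    (m : dual -> option nat) (Phi : (X -> R[i]) -> nat -> dual -> R[i]) :=
  [/\ forall f, H f -> direct_integral sigma m (Phi f),
      forall c f g, H f -> H g -> forall n, {ae sigma, forall t,
        Phi (fun x => c * f x + g x) n t = c * Phi f n t + Phi g n t},
      forall f, H f -> direct_integral_sqnorm sigma (Phi f) = sqnorm mu f,
      forall F, direct_integral sigma m F -> exists2 f, H f &
        forall n, {ae sigma, forall t, Phi f n t = F n t}
    & forall z f, H f -> forall n, {ae sigma, forall t,
        Phi (U z f) n t = character z t * Phi f n t}].

Definition Ucomb f (s : seq (R[i] * (int * int))) := comb (fun z => U z f) s.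

Lemma H_comb f s : H f -> H (Ucomb f s).
Proof.
move=> Hf; elim: s => [|p s ih].
  have := Hlin (-1) Hf Hf; rewrite (_ : (fun x => _) = Ucomb f [::])//.
  by apply/funext => x; rewrite /Ucomb /comb big_nil mulN1r addNr.
rewrite (_ : Ucomb f _ = (fun x => p.1 * U p.2 f x + Ucomb f s x)).
  by apply: Hlin => //; exact: HU.
by apply/funext => x; rewrite /Ucomb /comb big_cons.
Qed.

Lemma intertwiner_comb (sigma : {finite_measure set dual -> \bar R}) m Phi f s n : intertwiner sigma m Phi -> H f ->
  {ae sigma, forall t, Phi (Ucomb f s) n t = comb (@character R) s t * Phi f n t}.
Proof.
move=> [_ Pl _ _ PU] Hf; elim: s => [|p s ih].
  have := Pl (-1) _ _ Hf Hf n; rewrite (_ : (fun x => _) = Ucomb f [::]).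
    by apply: aeS => t ->; rewrite /comb big_nil mul0r mulN1r addNr.
  by apply/funext => x; rewrite /Ucomb /comb big_nil mulN1r addNr.
rewrite (_ : Ucomb f _ = (fun x => p.1 * U p.2 f x + Ucomb f s x)).
  have h1 := Pl p.1 _ _ (HU p.2 Hf) (H_comb s Hf) n.
  have h2 := PU p.2 _ Hf n.
  move: h1 h2 ih; apply: filterS3 => t -> -> ->.
  by rewrite /comb big_cons mulrDl mulrA.
by apply/funext => x; rewrite /Ucomb /comb big_cons.
Qed.

Lemma ae_layers p (s : {finite_measure set dual -> \bar R}) (P : dual -> Prop) : measurable [set t | P t] ->
  {ae s, forall t, P t} -> {ae layers p s, forall x, P x.1}.
Proof.
move=> mP Ps; have mB : measurable (~` [set x : dual * nat | P x.1]).
  apply: measurableC; have := @measurable_fst _ _ dual nat.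
  by move=> /(_ measurableT _ mP); rewrite setTI.
exists (~` [set x : dual * nat | P x.1]); split => //.
rewrite /layers /= /mseries eseries0// => k _ _.
have mC : measurable (~` [set t | P t]) by exact: measurableC.
by case: Ps => N [mN N0 PN]; apply: (subset_measure0 _ _ _ N0).
Qed.

(* Trigonometric polynomials approximate [\1_A] simultaneously in both models of f, carried by the
   even and the odd layers, and their norms can be computed in H. *)
Lemma intertwiner_sqnorm (sigma sigma' : {finite_measure set dual -> \bar R})
    m Phi m' Phi' f (A : set dual) :
  sigma (~` square) = 0%E -> sigma' (~` square) = 0%E ->
  intertwiner sigma m Phi -> intertwiner sigma' m' Phi' -> H f -> measurable A ->
  direct_integral_sqnorm sigma (fun n t => (\1_A t)%:C * Phi f n t) =
  direct_integral_sqnorm sigma' (fun n t => (\1_A t)%:C * Phi' f n t).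
Proof.
move=> sq sq' iP iP' Hf mA.
have [Pd _ Pn _ _] := iP; have [Pd' _ Pn' _ _] := iP'.
have mPhi n : cmeasurable (Phi f n) by case: (Pd f Hf).
have mPhi' n : cmeasurable (Phi' f n) by case: (Pd' f Hf).
pose e0 (x : dual * nat) := if odd x.2 then Phi' f x.2./2 x.1 else Phi f x.2./2 x.1.
have me0 : cmeasurable e0.
  by apply: cmeasurable_natP => k; rewrite /e0 /=; case: (odd k).
pose m1 := layers double sigma; pose m2 := layers (fun k => k.*2.+1) sigma'.
pose M := measure_add m1 m2.
have n1 (b : dual -> R[i]) : cmeasurable b -> sqnorm m1 (fun x => b x.1 * e0 x) =
    direct_integral_sqnorm sigma (fun n t => b t * Phi f n t).
  move=> mb; rewrite sqnorm_layers; last first.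
    by apply: cmeasurableM => //; exact: (cmeasurable_comp mb).
  congr direct_integral_sqnorm; apply/funext => n; apply/funext => t.
  by rewrite /e0 /= odd_double doubleK.
have n2 (b : dual -> R[i]) : cmeasurable b -> sqnorm m2 (fun x => b x.1 * e0 x) =
    direct_integral_sqnorm sigma' (fun n t => b t * Phi' f n t).
  move=> mb; rewrite sqnorm_layers; last first.
    by apply: cmeasurableM => //; exact: (cmeasurable_comp mb).
  congr direct_integral_sqnorm; apply/funext => n; apply/funext => t.
  by rewrite /e0 /= odd_double /= uphalf_double.
have mch z : cmeasurable (fun x : dual * nat => character z x.1 : R[i]).
  by apply: (cmeasurable_comp (@cmeasurable_character R z)); exact: measurable_fst.
have Hs s : direct_integral_sqnorm sigma (fun n t => comb (@character R) s t * Phi f n t)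
   = sqnorm mu (Ucomb f s).
  rewrite -Pn; last exact: H_comb.
  apply: eq_eseriesr => n _; apply: eq_sqnorm.
  - apply: cmeasurableM => //; apply: cmeasurable_sum => p; apply: cmeasurableZ.
    exact: cmeasurable_character.
  - by case: (Pd _ (H_comb s Hf)).
  - by apply: aeS (intertwiner_comb s n iP Hf) => t ->.
have Hs' s : direct_integral_sqnorm sigma' (fun n t => comb (@character R) s t * Phi' f n t)
   = sqnorm mu (Ucomb f s).
  rewrite -Pn'; last exact: H_comb.
  apply: eq_eseriesr => n _; apply: eq_sqnorm.
  - apply: cmeasurableM => //; apply: cmeasurable_sum => p; apply: cmeasurableZ.
    exact: cmeasurable_character.
  - by case: (Pd' _ (H_comb s Hf)).
  - by apply: aeS (intertwiner_comb s n iP' Hf) => t ->.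
have mcomb s : cmeasurable (comb (@character R) s).
  apply: cmeasurable_sum => p; apply: cmeasurableZ; exact: cmeasurable_character.
have L1 s : L2 m1 (fun x => comb (@character R) s x.1 * e0 x).
  split; first by apply: cmeasurableM => //; exact: (cmeasurable_comp (mcomb s)).
  by rewrite n1// Hs; case: (HL (H_comb s Hf)).
have L2' s : L2 m2 (fun x => comb (@character R) s x.1 * e0 x).
  split; first by apply: cmeasurableM => //; exact: (cmeasurable_comp (mcomb s)).
  by rewrite n2// Hs'; case: (HL (H_comb s Hf)).
have LM g : L2 M g <-> L2 m1 g /\ L2 m2 g.
  split=> [[mg]|[[mg g1] [_ g2]]].
    rewrite /M sqnorm_add// => gy; split; split => //; apply: le_lt_trans gy.
      by rewrite leeDl// sqnorm_ge0.
    by rewrite leeDr// sqnorm_ge0.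
  by split => //; rewrite /M sqnorm_add// lte_add_pinfty.
pose e z (x : dual * nat) := character z x.1 * e0 x.
have combe s : comb e s = fun x => comb (@character R) s x.1 * e0 x.
  apply/funext => x; rewrite /comb mulr_suml; apply: eq_bigr => p _.
  by rewrite /e mulrA.
have Le z : L2 M (e z).
  have h : e z = (fun x => comb (@character R) [:: (1, z)] x.1 * e0 x).
    by apply/funext => x; rewrite /e /comb big_seq1 mul1r.
  by rewrite h; apply/LM.
have cC := closed_span_closed Le; set C := closed_span M (range e) in cC.
have chiC z g : C g -> C (fun x => character z x.1 * g x).
  move=> /(closed_spanP _ Le)[Lg hg]; apply/(closed_spanP _ Le); split.
    by apply: (@L2_bounded_mul _ _ _ _ 1) => // x; rewrite sqnormC_character.
  move=> eps /hg[s hs]; exists [seq (p.1, z + p.2) | p <- s].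
  apply: le_lt_trans hs; rewrite le_eqVlt; apply/orP; left; apply/eqP.
  rewrite /nrm2 /sqnorm; congr fine; apply: eq_integral => x _.
  rewrite (_ : _ - _ = character z x.1 * (g x - comb e s x)).
    by rewrite sqnormCM sqnormC_character mul1r.
  rewrite mulrBr /comb big_map mulr_sumr; congr (_ - _); apply: eq_bigr => p _.
  by rewrite /= /e characterD; ring.
have aeM : {ae M, forall x, square x.1}.
  have h1 := ae_layers double (@measurable_square R) (ae_square sq).
  have h2 := ae_layers (fun k => k.*2.+1) (@measurable_square R) (ae_square sq').
  have mB : measurable (~` [set x : dual * nat | square x.1]).
    apply: measurableC; have := @measurable_fst _ _ dual nat.
    by move=> /(_ measurableT _ (@measurable_square R)); rewrite setTI.
  exists (~` [set x : dual * nat | square x.1]); split => //.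
  rewrite /M measure_addE -[RHS]adde0; congr (_ + _)%E.
    by apply/eqP; rewrite -measure_le0; move/(negligibleP _ mB): h1 => ->.
  by apply/eqP; rewrite -measure_le0; move/(negligibleP _ mB): h2 => ->.
have Ce0 : C e0.
  have := closed_span_sub 0 Le; rewrite (_ : e 0 = e0)//.
  by apply/funext => x; rewrite /e character0 mul1r.
have [_ /(_ _ Ce0) CA] := mset_total (@measurable_fst _ _ dual nat) aeM cC chiC mA.
have mIA : cmeasurable (fun t : dual => (\1_A t)%:C : R[i]) by exact: cmeasurable_indic.
set g0 := fun x : dual * nat => _ in CA.
have [/LM[Lg1 Lg2] hg] := (closed_spanP _ Le).1 CA.
have g0E : g0 = fun x => (fun t => (\1_A t)%:C) x.1 * e0 x by [].
rewrite -n1// -n2// (_ : (fun x => _) = g0)// (L2_sqnormE Lg1) (L2_sqnormE Lg2).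
congr (_%:E); apply: nrm2_approx_eq => // eps /hg[s hs].
exists (comb e s); rewrite combe; split => //.
- apply: le_lt_trans hs; rewrite combe -lee_fin.
  have L := L2B Lg1 (L1 s); have L' := L2B Lg2 (L2' s).
  rewrite -!L2_sqnormE//; last by apply/LM; split.
  by rewrite /M sqnorm_add ?leeDl ?sqnorm_ge0//; case: L.
- apply: le_lt_trans hs; rewrite combe -lee_fin.
  have L := L2B Lg1 (L1 s); have L' := L2B Lg2 (L2' s).
  rewrite -!L2_sqnormE//; last by apply/LM; split.
  by rewrite /M sqnorm_add ?leeDr ?sqnorm_ge0//; case: L.
- by rewrite /nrm2 n1// n2// Hs Hs'.
Qed.

(** If no vector were null, the Gram matrix of the family would be diagonal and invertible of size
    [j.+1], although it factors through dimension [j]. *)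
Lemma orthogonal_family_dim j (v : 'I_j.+1 -> 'I_j -> R[i]) :
  (forall a b, a != b -> \sum_n v a n * (v b n)^* = 0) ->
  exists a, \sum_n sqnormC (v a n) = 0.
Proof.
move=> vo; apply: contrapT => h.
pose V := \matrix_(a < j.+1, n < j) v a n.
pose W := \matrix_(n < j, a < j.+1) (v a n)^*.
pose D := \row_(a < j.+1) ((\sum_n sqnormC (v a n))%:C : R[i]).
have VW : V *m W = diag_mx D.
  apply/matrixP => a b; rewrite !mxE; have [<-|ab] := eqVneq a b.
    rewrite mulr1n rmorph_sum; apply: eq_bigr => n _.
    by rewrite !mxE mulcJ.
  rewrite mulr0n -[RHS](vo _ _ ab); apply: eq_bigr => n _; by rewrite !mxE.
have uD : diag_mx D \in unitmx.
  rewrite unitmxE det_diag unitfE; apply/prodf_neq0 => a _; rewrite mxE.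
  by apply/eqP => /complexI a0; apply: h; exists a.
have := mxrankM_maxl V W; rewrite VW mxrank_unit// => /leq_trans /(_ (rank_leq_col V)).
by rewrite ltnn.
Qed.

Lemma sum_lin3 j (k l : R) (A B C : 'I_j -> R) :
  \sum_n (k * A n + B n + l * C n) = k * (\sum_n A n) + \sum_n B n + l * (\sum_n C n).
Proof. by rewrite !big_split /= -!mulr_sumr. Qed.

Lemma finite_eseries (u : nat -> \bar R) N : (forall k, (0 <= u k)%E) ->
  (forall k, (N <= k)%N -> u k = 0%E) ->
  (\sum_(k <oo) u k = \sum_(k < N) u k)%E.
Proof.
move=> u0 uN; rewrite (nneseries_split 0 N)//.
by rewrite eseries0 ?adde0 ?add0n ?big_mkord// => k Nk _; exact: uN.
Qed.

Lemma sqnorm_indicM (s : {finite_measure set dual -> \bar R}) A (F : dual -> R[i]) :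
  measurable A -> cmeasurable F ->
  sqnorm s (fun t => (\1_A t)%:C * F t) = (\int[s]_(t in A) (sqnormC (F t))%:E)%E.
Proof.
move=> mA mF; rewrite /sqnorm [RHS]integral_mkcond; apply: eq_integral => t _.
rewrite patchE indicE; case: ifPn => tA /=; first by rewrite mul1r.
by rewrite mul0r sqnormC0.
Qed.

(** Over [E] these sections are orthonormal as [a] varies; they test how many dimensions a model has
    there. *)
Definition layer_section (E : set dual) (a : nat) (n : nat) (t : dual) : R[i] :=
  if n == a then (\1_E t)%:C else 0.

Lemma direct_integral_layer (s : {finite_measure set dual -> \bar R}) m E a :
  measurable E -> (forall t, E t -> below a (m t)) ->
  direct_integral s m (layer_section E a).
Proof.
move=> mE Em; split.
- move=> n; rewrite /layer_section; case: eqP => _; first exact: cmeasurable_indic.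
  exact: cmeasurable_cst.
- move=> n; apply: aeW => t; rewrite /layer_section; case: eqP => // -> h.
  by rewrite indicE memNset// => /Em tE; rewrite tE in h.
- rewrite /direct_integral_sqnorm (@finite_eseries _ a.+1); last 2 first.
  + by move=> k; exact: sqnorm_ge0.
  + move=> k ak; rewrite /layer_section gtn_eqF//; by case: (@L2_0 R _ _ s) => _ _; apply: ae_sqnorm0 (cmeasurable_cst 0) (aeW _ _).
  apply: lte_sum_pinfty => k _; rewrite /layer_section; case: eqP => _.
    by case: (L2_indic s mE).
  by case: (L2_0 s).
Qed.

Lemma direct_integral_sqnorm_layers (s : {finite_measure set dual -> \bar R}) A
    (F : nat -> dual -> R[i]) N :
  measurable A -> (forall n, cmeasurable (F n)) ->
  (forall n, (N <= n)%N -> {ae s, forall t, A t -> F n t = 0}) ->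
  direct_integral_sqnorm s (fun n t => (\1_A t)%:C * F n t) =
  (\int[s]_(t in A) (\sum_(n < N) sqnormC (F n t))%R%:E)%E.
Proof.
move=> mA mF FN; rewrite /direct_integral_sqnorm (@finite_eseries _ N); last 2 first.
- by move=> k; exact: sqnorm_ge0.
- move=> k Nk; apply: ae_sqnorm0.
    by apply: cmeasurableM => //; exact: cmeasurable_indic.
  apply: aeS (FN k Nk) => t h; rewrite indicE.
  by have [/set_mem/h ->|_] := boolP (t \in A); rewrite ?mulr0 ?mul0r.
under eq_bigr do rewrite sqnorm_indicM//.
rewrite -ge0_integral_sum//.
- by apply: eq_integral => t _; rewrite sumEFin.
- by move=> n; apply: (measurable_funS measurableT) => //; exact: measurable_sqnormCE.
- by move=> n t _; rewrite lee_fin sqnormC_ge0.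
Qed.

Section Comparison.
Variables (sigma sigma' : {finite_measure set dual -> \bar R}).
Variables (m m' : dual -> option nat) (Phi Phi' : (X -> R[i]) -> nat -> dual -> R[i]).
Hypothesis sq : sigma (~` square) = 0%E.
Hypothesis sq' : sigma' (~` square) = 0%E.
Hypothesis iP : intertwiner sigma m Phi.
Hypothesis iP' : intertwiner sigma' m' Phi'.

(** Take the vector whose second model is the unit section over [E] in direction 0. Its mass over
    [E] is [sigma' E] in that model, while in the first it is an integral over a null set. *)
Lemma spectral_type_dominated (E : set dual) : measurable E ->
  (forall t, E t -> m' t <> Some 0%N) -> sigma E = 0%E -> sigma' E = 0%E.
Proof.
move=> mE Em E0; have [_ _ _ Ps' _] := iP'; have [Pd _ _ _ _] := iP.
have Eb t : E t -> below 0 (m' t).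
  by move=> /Em; case: (m' t) => [[|k]|].
have [f Hf fE] := Ps' _ (direct_integral_layer sigma' mE Eb).
have := intertwiner_sqnorm sq sq' iP iP' Hf mE.
have mPf n : cmeasurable (Phi f n) by case: (Pd f Hf).
rewrite (_ : direct_integral_sqnorm sigma _ = 0%E); last first.
  rewrite /direct_integral_sqnorm eseries0// => n _ _.
  rewrite sqnorm_indicM//; apply: null_set_integral => //.
  by apply: (measurable_funS measurableT) => //; exact: measurable_sqnormCE.
rewrite (_ : direct_integral_sqnorm sigma' _ = sigma' E)//.
have [mPf' _ _] : direct_integral sigma' m' (Phi' f) by case: iP' => + _ _ _ _; apply.
rewrite (@direct_integral_sqnorm_layers _ _ _ 1%N)//.
- under eq_integral do rewrite big_ord1.
  rewrite -[RHS]mul1e -integral_cst//; apply: ae_eq_integral => //.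
  + by apply: (measurable_funS measurableT) => //; exact: measurable_sqnormCE.
  + apply: aeS (fE 0%N) => t -> tE.
    by rewrite /layer_section /= indicE mem_set// sqnormC1.
- move=> n n1; apply: aeS (fE n) => t -> _.
  by rewrite /layer_section; case: n n1.
Qed.

(* Over E, the j + 1 constant sections of the second model have images in the first one that are
   pointwise orthogonal in a space of dimension j. *)
Lemma multiplicity_le (E : set dual) j : measurable E ->
  (forall t, E t -> m t = Some j) -> (forall t, E t -> below j (m' t)) ->
  sigma' E = 0%E.
Proof.
move=> mE Em Em'; have [Pd Pl _ _ _] := iP; have [Pd' Pl' _ Ps' _] := iP'.
have Ea (a : 'I_j.+1) t : E t -> below a (m' t).
  move=> /Em'; case: (m' t) => //= k; apply: leq_trans; by rewrite ltnS -ltnS.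
have /choice[f hf] (a : 'I_j.+1) : exists f, H f /\ forall n,
    {ae sigma', forall t, Phi' f n t = layer_section E a n t}.
  by have [f Hf fE] := Ps' _ (direct_integral_layer sigma' mE (@Ea a)); exists f.
have Hf a := (hf a).1.
pose N g t := \sum_(n < j) sqnormC (Phi g n t).
have mPhi g n : H g -> cmeasurable (Phi g n) by move=> /Pd[].
have mPhi' g n : H g -> cmeasurable (Phi' g n) by move=> /Pd'[].
have mN g : H g -> measurable_fun setT (N g).
  by move=> Hg; apply: measurable_sum => n; apply: measurable_sqnormC; exact: mPhi.
have N0 g t : 0 <= N g t by apply: sumr_ge0 => n _; exact: sqnormC_ge0.
have intN g A : H g -> measurable A -> A `<=` E ->
    direct_integral_sqnorm sigma (fun n t => (\1_A t)%:C * Phi g n t) =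
    (\int[sigma]_(t in A) (N g t)%:E)%E.
  move=> Hg mA AE; apply: direct_integral_sqnorm_layers => //.
    by move=> n; exact: mPhi.
  move=> n jn; have [_ /(_ n) h _] := Pd g Hg; apply: aeS h => t + /AE/Em tj.
  by rewrite tj /= -leqNgt; apply.
have key g (c : R) A : H g -> measurable A -> A `<=` E ->
    (forall n, (j.+1 <= n)%N -> {ae sigma', forall t, A t -> Phi' g n t = 0}) ->
    {ae sigma', forall t, A t -> \sum_(n < j.+1) sqnormC (Phi' g n t) = c} ->
    (\int[sigma]_(t in A) (N g t)%:E = c%:E * sigma' A)%E.
  move=> Hg mA AE gn gc; rewrite -intN//.
  rewrite (intertwiner_sqnorm sq sq' iP iP' Hg mA).
  rewrite (@direct_integral_sqnorm_layers _ _ _ j.+1)//; last by move=> n; exact: mPhi'.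
  rewrite -integral_cst//; apply: ae_eq_integral => //.
    apply: (measurable_funS measurableT) => //; apply/measurable_EFinP.
    by apply: measurable_sum => n; apply: measurable_sqnormC; exact: mPhi'.
  by apply: aeS gc => t h /h ->.
have sum_layer (a : 'I_j.+1) t : E t ->
    \sum_(n < j.+1) sqnormC (layer_section E a n t) = 1 :> R.
  move=> tE; rewrite (bigD1 a)//= big1 => [|n na].
    by rewrite /layer_section eqxx indicE mem_set// sqnormC1 addr0.
  by rewrite /layer_section -val_eqE in na *; rewrite (negbTE na) sqnormC0.
have layer0 (a : 'I_j.+1) n t : (j.+1 <= n)%N -> layer_section E a n t = 0.
  by move=> jn; rewrite /layer_section gtn_eqF// (leq_trans (ltn_ord a)).
have key1 a A : measurable A -> A `<=` E ->
    (\int[sigma]_(t in A) (N (f a) t)%:E = sigma' A)%E.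
  move=> mA AE; rewrite (key _ 1) ?mul1e//.
    by move=> n jn; apply: aeS ((hf a).2 n) => t -> _; exact: layer0.
  have h : {ae sigma', forall t, forall n : 'I_j.+1, Phi' (f a) n t = layer_section E a n t}.
    apply: (ae_forall_ord (P := fun n t => Phi' (f a) n t = layer_section E a n t)) => n.
    exact: (hf a).2.
  apply: aeS h => t h /AE tE; rewrite -[RHS](sum_layer a t tE).
  by apply: eq_bigr => n _; rewrite h.
have key2 (a b : 'I_j.+1) c A : a != b -> measurable A -> A `<=` E ->
    (\int[sigma]_(t in A) (N (fun x => (c * f a x + f b x)%R) t)%:E
     = (sqnormC c + 1)%:E * sigma' A)%E.
  move=> ab mA AE; have Hl := Hlin c (Hf a) (Hf b).
  have lE n : {ae sigma', forall t, Phi' (fun x => c * f a x + f b x) n t =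
      c * layer_section E a n t + layer_section E b n t}.
    have h1 := Pl' c _ _ (Hf a) (Hf b) n.
    by move: h1 ((hf a).2 n) ((hf b).2 n); apply: filterS3 => t -> -> ->.
  apply: key => //.
    by move=> n jn; apply: aeS (lE n) => t -> _; rewrite !layer0// mulr0 addr0.
  have h : {ae sigma', forall t, forall n : 'I_j.+1,
      Phi' (fun x => c * f a x + f b x) n t =
      c * layer_section E a n t + layer_section E b n t}.
    by apply: (ae_forall_ord (P := fun n t => Phi' (fun x => c * f a x + f b x) n t =
      c * layer_section E a n t + layer_section E b n t)) => n; exact: lE.
  apply: aeS h => t h /AE tE; under eq_bigr do rewrite h.
  rewrite -[sqnormC c]mulr1 -{1}(sum_layer a t tE) -(sum_layer b t tE) mulr_sumr.
  rewrite -big_split /=; apply: eq_bigr => n _.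
  rewrite sqnormC_lin (_ : layer_section E a n t * _ = 0) ?mulr0 ?addr0 ?mulr0//.
  rewrite /layer_section; case: eqP => [na|_]; last by rewrite mul0r.
  by case: eqP => [nb|_]; rewrite ?conjC0 ?mulr0//; move: ab; rewrite -val_eqE /= -na -nb eqxx.
have orth (a b : 'I_j.+1) : a != b ->
    {ae sigma, forall t, E t -> \sum_(n < j) Phi (f a) n t * (Phi (f b) n t)^* = 0}.
  move=> ab.
  (* The densities of [c * f a + f b] and [|c|^2] times that of [f a] plus that of [f b] have equal
     integrals over every measurable subset of [E], so they agree almost everywhere; their
     difference is twice the cross term. *)
  have reS c : {ae sigma, forall t, E t ->
      cRe (c * \sum_(n < j) Phi (f a) n t * (Phi (f b) n t)^*) = 0}.
    have Hl := Hlin c (Hf a) (Hf b).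
    have mNl := mN _ Hl; have mNa := mN _ (Hf a); have mNb := mN _ (Hf b).
    have mE' (g : dual -> R) : measurable_fun setT g -> measurable_fun E (EFin \o g).
      by move=> mg; apply: (measurable_funS measurableT) => //; exact/measurable_EFinP.
    have h1 : ae_eq sigma E (EFin \o N (fun x => c * f a x + f b x))
       (fun t => ((sqnormC c)%:E * (N (f a) t)%:E + (N (f b) t)%:E)%E).
      apply: integral_ae_eq => //.
      - apply/integrableP; split; first exact: mE'.
        under eq_integral do rewrite gee0_abs ?lee_fin//.
        by rewrite key2// ltey_eq fin_numM// fin_num_measure.
      - by apply: emeasurable_funD; [apply: measurable_funeM|]; exact: mE'.
      - move=> A AE mA; rewrite key2//.
        have mA' (g : dual -> R) : measurable_fun setT g -> measurable_fun A (EFin \o g).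
          by move=> mg; apply: (measurable_funS measurableT) => //; exact/measurable_EFinP.
        rewrite ge0_integralD//.
        + rewrite ge0_integralZl//.
          * by rewrite !key1// EFinD ge0_muleDl ?mul1e// lee_fin sqnormC_ge0.
          * exact: mA'.
          * by move=> t _; rewrite lee_fin.
          * by rewrite lee_fin sqnormC_ge0.
        + by move=> t _; rewrite mule_ge0 ?lee_fin ?sqnormC_ge0.
        + by apply: measurable_funeM; exact: mA'.
        + by move=> t _; rewrite lee_fin.
        + exact: mA'.
    have h2 : {ae sigma, forall t, forall n : 'I_j, Phi (fun x => c * f a x + f b x) n t =
        c * Phi (f a) n t + Phi (f b) n t}.
      apply: (ae_forall_ord (P := fun n t => Phi (fun x => c * f a x + f b x) n t =
        c * Phi (f a) n t + Phi (f b) n t)) => n.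
      exact: Pl.
    move: h1 h2; apply: filterS2 => t h1 h2 /h1 [].
    rewrite {1}/N; under eq_bigr do rewrite h2 sqnormC_lin.
    rewrite (sum_lin3 _ _ (fun n => sqnormC (Phi (f a) n t))
      (fun n => sqnormC (Phi (f b) n t))).
    rewrite -cRe_sum -mulr_sumr -/(N (f a) t) -/(N (f b) t).
    by move: (N _ _) (N _ _) (cRe _) => p q r; lra.
  move: (reS 1) (reS 'i%C); apply: filterS2 => t h1 h2 tE.
  move: (h1 tE) (h2 tE); rewrite mul1r; move: (\sum_(n < j) _) => z h3 h4.
  by apply: ceqP => //; move: h4; rewrite cReM /= mul0r mul1r sub0r => /eqP; rewrite oppr_eq0 => /eqP.
have orthall : {ae sigma, forall t, forall a b : 'I_j.+1, a != b -> E t ->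
    \sum_(n < j) Phi (f a) n t * (Phi (f b) n t)^* = 0}.
  pose g (k : nat) := f (inord k).
  have h : {ae sigma, forall t, forall (a : 'I_j.+1), forall b : 'I_j.+1,
      (inord a : 'I_j.+1) != (inord b : 'I_j.+1) -> E t ->
    \sum_(n < j) Phi (g a) n t * (Phi (g b) n t)^* = 0}.
    apply: (ae_forall_ord (P := fun a t => forall b : 'I_j.+1,
      (inord a : 'I_j.+1) != (inord b : 'I_j.+1) -> E t ->
      \sum_(n < j) Phi (g a) n t * (Phi (g b) n t)^* = 0)) => a.
    apply: (ae_forall_ord (P := fun b t =>
      (inord a : 'I_j.+1) != (inord b : 'I_j.+1) -> E t ->
      \sum_(n < j) Phi (g a) n t * (Phi (g b) n t)^* = 0)) => b.
    have [ab|ab] := eqVneq (inord a : 'I_j.+1) (inord b : 'I_j.+1).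
      by apply: aeW => t.
    by apply: aeS (orth _ _ ab) => t h _ /h.
  by apply: aeS h => t h a b ab tE; have := h a b; rewrite /g !inord_val; apply.
case: orthall => Bad [mBad Bad0 subBad].
pose Z (a : 'I_j.+1) := E `&` [set t | N (f a) t = 0].
have mZ a : measurable (Z a).
  apply: measurableI => //; rewrite (_ : [set _ | _] = N (f a) @^-1` [set 0])//.
  by rewrite -[X in measurable X]setTI; exact: mN.
(* The [sigma'] mass of [Z a] is the integral of a density that vanishes there. *)
have Z0 a : sigma' (Z a) = 0%E.
  rewrite -(key1 a)//; last by move=> t [].
  by rewrite integral0_eq// => t [_ /= ->].
(* [Bad] is null for [sigma]; [key1] carries this to [sigma'] inside [E]. *)
have B0 : sigma' (E `&` Bad) = 0%E.
  have EB : measurable (E `&` Bad) by exact: measurableI.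
  rewrite -(key1 ord0 _ EB); last by move=> t [].
  apply: null_set_integral => //.
    apply: (measurable_funS measurableT) => //; apply/measurable_EFinP; exact: mN.
  by apply: (subset_measure0 _ _ _ Bad0).
have aeB : {ae sigma', forall t, ~ (E `&` Bad) t}.
  by exists (E `&` Bad); split=> [| |t /contrapT//]; first exact: measurableI.
have aeZ : {ae sigma', forall t, forall a : 'I_j.+1, ~ Z (inord a) t}.
  apply: (ae_forall_ord (P := fun a t => ~ Z (inord a) t)) => a.
  by exists (Z (inord a)); split; [exact: mZ|exact: Z0|move=> t /contrapT].
suff h : {ae sigma', forall t, ~ E t}.
  apply/(negligibleP _ mE); apply: negligibleS h => t tE /=.
  by rewrite /setC /=; apply.
move: aeB aeZ; apply: filterS2 => t tB tZ tE.
(* Among [j.+1] pairwise orthogonal vectors in dimension [j] one vanishes, so the point lies in one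
   of the null sets [Z a]. *)
have [a a0] : exists a, \sum_(n < j) sqnormC (Phi (f a) n t) = 0.
  apply: (@orthogonal_family_dim j (fun a n => Phi (f a) n t)) => a b ab.
  apply: contrapT => nab; apply: tB; split => //; apply: subBad => h.
  by apply: nab; exact: h.
by apply: (tZ a); rewrite inord_val; split.
Qed.

End Comparison.
(** The level set [E] is cut according to the value of [m']. Where [m'] is [k] the hypothesis
    applies, and where [m'] exceeds [k], [multiplicity_le] makes the piece null for [sigma']; both
    facts pass to [sigma] by domination. Where [m'] is below [k], [multiplicity_le] with the models
    exchanged speaks of [sigma] directly. *)
Theorem spectral_multiplicity_unique
    (sigma sigma' : {finite_measure set dual -> \bar R}) m m' k :
  spectral_representation mu H U sigma m ->
  spectral_representation mu H U sigma' m' ->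
  sigma' (m' @^-1` [set k]) = 0%E -> sigma (m @^-1` [set k]) = 0%E.
Proof.
move=> [sq mm m0 [Phi iP]] [sq' mm' m0' [Phi' iP']] k0.
have [->//|kn0] := eqVneq k (Some 0%N).
pose E := m @^-1` [set k]; have mE : measurable E by exact: mm.
have EmN t : E t -> m t <> Some 0%N by move=> -> /eqP; rewrite (negbTE kn0).
(* An enumeration of the possible values of [m'], the infinite one first. *)
pose J n : option nat := if n is n'.+1 then Some n' else None.
pose F n := E `&` m' @^-1` [set J n].
have mF n : measurable (F n) by apply: measurableI => //; exact: mm'.
have dom n : sigma' (F n) = 0%E -> sigma (F n) = 0%E.
  by apply: (spectral_type_dominated sq' sq iP' iP) => // t [/EmN].
have F0 n : sigma (F n) = 0%E.
  have [Jk|Jk] := eqVneq (J n) k.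
    have nk : sigma'.-negligible (m' @^-1` [set k]) by apply/(negligibleP _ (mm' k)).
    apply: dom; apply/(negligibleP _ (mF n)); apply: negligibleS nk => t [_ /=].
    by rewrite Jk.
  have lt : (exists2 k', k = Some k' & below k' (J n)) \/
            (exists2 j, J n = Some j & below j k).
    case: n {dom mF F} Jk => [|j] /=; case: k {k0 kn0 E mE EmN} => [k'|] //= Jk.
    - by left; exists k'.
    - have [kj|jk|kj] := ltngtP k' j; [by left; exists k'|by right; exists j|].
      by rewrite kj eqxx in Jk.
    - by right; exists j.
  case: lt => [[k' kk' lt]|[j Jj lt]].
    apply: dom; apply: (multiplicity_le sq sq' iP iP' (j := k')) => //.
      by move=> t [-> _].
    by move=> t [_ /= ->].
  apply: (multiplicity_le sq' sq iP' iP (j := j)) => //.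
    by move=> t [_ /= ->].
  by move=> t [/= -> _].
apply/(negligibleP _ mE).
have h n : sigma.-negligible (F n) by apply/(negligibleP _ (mF n)); exact: F0.
apply: negligibleS (negligible_bigcup h) => t tE.
by case Em : (m' t) => [j|]; [exists j.+1|exists 0%N].
Qed.

End SpectralMeasureUniqueness.

(** * Weak compactness of measures on the torus *)

Lemma ultra_fmap {T U : Type} (f : T -> U) (F : set_system T) :
  UltraFilter F -> UltraFilter (f @ F).
Proof.
move=> uF; apply: Build_UltraFilter => G pG FG; apply/seteqP; split => [A GA|//].
have [//|FA] := in_ultra_setVsetC (f @^-1` A) uF.
have /filter_ex[y [h /h]//] : G (~` A `&` A) by apply: filterI => //; exact: FG.
Qed.

Section WeakCompactness.
Context {R : realType}.
Local Notation dual := (measurableTypeR R * measurableTypeR R)%type.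
Local Notation square := (`[0%R, 1%R[%classic `*` `[0%R, 1%R[%classic : set dual).

Definition dist1 (x y : R * R) : R := `|x.1 - y.1| + `|x.2 - y.2|.

(* The cells of the k-th dyadic subdivision of the square are numbered in base 4, so that the cell
   [i] of level [k.+1] lies in the cell [i %/ 4] of level [k]. *)
Fixpoint cell_corner (k i : nat) : R * R :=
  if k is k'.+1 then
    let c := cell_corner k' (i %/ 4) in
    (c.1 + (odd (i %% 4)./2)%:R * 2^-1 ^+ k, c.2 + (odd (i %% 4))%:R * 2^-1 ^+ k)
  else (0, 0).

Fixpoint cell (k : nat) (x : R * R) : nat :=
  if k is k'.+1 then
    let i := cell k' x in let c := cell_corner k' i in
    (4 * i + (2 * (c.1 + 2^-1 ^+ k <= x.1)%R + (c.2 + 2^-1 ^+ k <= x.2)%R))%N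
  else 0%N.

Lemma half_pow k : 2^-1 ^+ k = 2^-1 ^+ k.+1 + 2^-1 ^+ k.+1 :> R.
Proof. by rewrite exprS; field. Qed.

Lemma cell_div k x : (cell k.+1 x %/ 4)%N = cell k x.
Proof. by rewrite /= ; case: (_ <= _)%R; case: (_ <= _)%R; lia. Qed.

Lemma cell_lt k x : (cell k x < 4 ^ k)%N.
Proof.
elim: k => [//|k IH]; rewrite expnS /=.
by case: (_ <= _)%R; case: (_ <= _)%R; lia.
Qed.

Lemma cell_corner_step k (i q1 q2 : nat) : (q1 < 2)%N -> (q2 < 2)%N ->
  cell_corner k.+1 (4 * i + (2 * q1 + q2)) =
  ((cell_corner k i).1 + q1%:R * 2^-1 ^+ k.+1, (cell_corner k i).2 + q2%:R * 2^-1 ^+ k.+1).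
Proof.
move=> h1 h2 /=.
have -> : ((4 * i + (2 * q1 + q2)) %/ 4 = i)%N by lia.
have -> : ((4 * i + (2 * q1 + q2)) %% 4 = 2 * q1 + q2)%N by lia.
by move: q1 q2 h1 h2 => [|[|//]] [|[|//]] _ _.
Qed.

Lemma cell_cornerP k x : square x ->
  let c := cell_corner k (cell k x) in
  (c.1 <= x.1 < c.1 + 2^-1 ^+ k) && (c.2 <= x.2 < c.2 + 2^-1 ^+ k).
Proof.
move=> [/=]; rewrite !in_itv /= => h1 h2; elim: k => [|k]; first by rewrite /= expr0 !add0r h1 h2.
rewrite /= -/(cell_corner _ _); set i := cell k x; set c := cell_corner k i => IH.
have lt2 (b : bool) : (b < 2)%N by case: b.
have := @cell_corner_step k i _ _ (lt2 (c.1 + 2^-1 ^+ k.+1 <= x.1)%R) (lt2 (c.2 + 2^-1 ^+ k.+1 <= x.2)%R).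
rewrite /= -/i -/c => -[-> ->].
have hp := half_pow k.
by move: IH; case: (lerP (c.1 + 2^-1 ^+ k.+1) x.1) => k1; case: (lerP (c.2 + 2^-1 ^+ k.+1) x.2) => k2;
  rewrite ?mul1r ?mul0r ?addr0; lra.
Qed.

Lemma cell_corner_dist k x : square x ->
  dist1 x (cell_corner k (cell k x)) <= 2 * 2^-1 ^+ k.
Proof.
move=> /(cell_cornerP k) /=; rewrite /dist1; set c := cell_corner _ _ => h.
by rewrite !ger0_norm; lra.
Qed.

Lemma cell_corner_incr k i :
  [/\ (cell_corner k (i %/ 4)).1 <= (cell_corner k.+1 i).1 <= (cell_corner k (i %/ 4)).1 + 2^-1 ^+ k.+1
   & (cell_corner k (i %/ 4)).2 <= (cell_corner k.+1 i).2 <= (cell_corner k (i %/ 4)).2 + 2^-1 ^+ k.+1].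
Proof.
have h : 0 < 2^-1 ^+ k.+1 :> R by rewrite exprn_gt0.
by move=> /=; case: (odd _); case: (odd _); rewrite ?mul1r ?mul0r ?addr0; split; lra.
Qed.

Lemma cvg_sum_ord (F : set_system nat) {FF : Filter F} n (f : nat -> nat -> R) (l : nat -> R) :
  (forall i, f i @ F --> l i) ->
  (fun N => \sum_(i < n) f i N) @ F --> \sum_(i < n) l i.
Proof.
move=> h; elim: n => [|n IH].
  by rewrite big_ord0; under eq_fun do rewrite big_ord0; exact: cvg_cst.
by rewrite big_ord_recr /=; under eq_fun do rewrite big_ord_recr /=; apply: cvgD.
Qed.

Section Limit.
Variables (n : nat -> nat) (x : nat -> nat -> dual) (p : nat -> nat -> R) (c0 : R).
Hypothesis p_ge0 : forall N j, 0 <= p N j.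
Hypothesis p_sum : forall N, \sum_(j < n N) p N j = c0.
Hypothesis x_square : forall N j, square (x N j).

Definition cell_mass N k i := \sum_(j < n N | cell k (x N j) == i) p N j.

Lemma cell_mass_itv N k i : 0 <= cell_mass N k i <= c0.
Proof.
rewrite /cell_mass sumr_ge0//= -(p_sum N) [leRHS](bigID (fun j : 'I_(n N) => cell k (x N j) == i)) /=.
by rewrite lerDl sumr_ge0.
Qed.

Lemma cell_mass_split N k i :
  cell_mass N k i = cell_mass N k.+1 (4 * i) + cell_mass N k.+1 (4 * i).+1
    + cell_mass N k.+1 (4 * i).+2 + cell_mass N k.+1 (4 * i).+3.
Proof.
rewrite /cell_mass ![X in X = _]big_mkcond ![X in _ = X + _ + _ + _]big_mkcond.
rewrite ![X in _ = _ + X + _ + _]big_mkcond ![X in _ = _ + X + _]big_mkcond ![X in _ = _ + X]big_mkcond.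
rewrite -!big_split /=; apply: eq_bigr => j _.
have := cell_div k (x N j); set a := cell k.+1 _; set b := cell k _ => ab.
have -> : (b == i) = [|| a == 4 * i, a == (4 * i).+1, a == (4 * i).+2 | a == (4 * i).+3]%N by lia.
by case: eqP => h1; case: eqP => h2; case: eqP => h3; case: eqP => h4 /=;
  rewrite ?addr0 ?add0r//; lia.
Qed.

Lemma cell_mass_sum N k (phi : R * R -> R) :
  \sum_(i < 4 ^ k) cell_mass N k i * phi (cell_corner k i) =
  \sum_(j < n N) p N j * phi (cell_corner k (cell k (x N j))).
Proof.
rewrite /cell_mass; under eq_bigr do rewrite mulr_suml big_mkcond.
rewrite exchange_big /=; apply: eq_bigr => j _.
rewrite (bigD1 (Ordinal (cell_lt k (x N j)))) //= eqxx big1 ?addr0// => i.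
by rewrite -val_eqE /= eq_sym => /negbTE ->.
Qed.

Section Ultra.
Variable F : set_system nat.
Hypothesis uF : UltraFilter F.
Hypothesis Foo : \oo `<=` F.

(** The masses stay in the compact interval from 0 to [c0]. A single ultrafilter gives the limits
    for all cells at once, with no diagonal extraction. *)
Lemma cell_limit k i : exists l : R, 0 <= l /\ (fun N => cell_mass N k i) @ F --> l.
Proof.
have := @segment_compact R 0 c0; rewrite compact_ultra => /(_ ((fun N => cell_mass N k i) @ F)).
case.
- exact: ultra_fmap.
- rewrite /= /nbhs /=; apply: filterE => N /=.
  by rewrite in_itv /= cell_mass_itv.
- move=> l [/=]; rewrite in_itv /= => /andP[l0 _] h; exists l; split => //.
Qed.

Definition limit_mass k i : R := projT1 (cid (cell_limit k i)).

Lemma limit_mass_ge0 k i : 0 <= limit_mass k i.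
Proof. by rewrite /limit_mass; case: cid => l []. Qed.

Lemma limit_massP k i : (fun N => cell_mass N k i) @ F --> limit_mass k i.
Proof. by rewrite /limit_mass; case: cid => l []. Qed.

Lemma limit_mass_split k i :
  limit_mass k i = limit_mass k.+1 (4 * i) + limit_mass k.+1 (4 * i).+1
    + limit_mass k.+1 (4 * i).+2 + limit_mass k.+1 (4 * i).+3.
Proof.
apply: (@cvg_unique _ (@norm_hausdorff R R^o) ((fun N => cell_mass N k i) @ F)) => /=.
  exact: limit_massP.
under eq_fun do rewrite cell_mass_split.
by do 3 ?apply: cvgD; exact: limit_massP.
Qed.

Lemma limit_mass_total : limit_mass 0 0 = c0.
Proof.
apply: (@cvg_unique _ (@norm_hausdorff R R^o) ((fun N => cell_mass N 0 0) @ F)) => /=.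
  exact: limit_massP.
rewrite (_ : (fun N => _) = cst c0); first exact: cvg_cst.
by apply/funext => N; rewrite /cell_mass /=; under eq_bigl do rewrite eqxx; exact: p_sum.
Qed.

(** Moving each point to the corner of its cell changes [phi] by at most [L * (2 * 2^-1 ^+ k)],
    uniformly in [N], so the estimate survives the limit along [F]. *)
Lemma limit_mass_approx k (phi : R * R -> R) (L c : R) :
  (forall y z, `|phi y - phi z| <= L * dist1 y z) ->
  (fun N => \sum_(j < n N) p N j * phi (x N j)) @ \oo --> c ->
  `|\sum_(i < 4 ^ k) limit_mass k i * phi (cell_corner k i) - c| <= L * (2 * 2^-1 ^+ k) * c0.
Proof.
move=> lip cvg1.
have L0 : 0 <= L.
  have := lip (1, 0) (0, 0); rewrite /dist1 /= subr0 subrr normr0 addr0 normr1 mulr1.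
  by apply: le_trans.
have h : (fun N => \sum_(i < 4 ^ k) cell_mass N k i * phi (cell_corner k i) -
      \sum_(j < n N) p N j * phi (x N j)) @ F -->
    \sum_(i < 4 ^ k) limit_mass k i * phi (cell_corner k i) - c.
  apply: cvgB; last by apply: cvg_trans cvg1; exact: cvg_app.
  apply: (cvg_sum_ord (f := fun i N => cell_mass N k i * phi (cell_corner k i))
    (l := fun i => limit_mass k i * phi (cell_corner k i))) => i.
  by apply: cvgMl; exact: limit_massP.
apply: (cvgr_to_le (cvg_norm h)); apply: nearW => N.
rewrite cell_mass_sum -sumrB -(p_sum N) mulr_sumr.
apply: le_trans (ler_norm_sum _ _ _) _; apply: ler_sum => j _.
rewrite -mulrBr normrM ger0_norm// mulrC ler_wpM2r// distrC (le_trans (lip _ _))//.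
by rewrite ler_wpM2l// cell_corner_dist.
Qed.

(* The limit masses of the cells cut [0, c0[ into consecutive intervals. Mapping each interval into
   its cell and letting k grow transports Lebesgue measure to the weak limit. *)
Definition cumul k i : R := \sum_(l < i) limit_mass k l.

Lemma cumul0 k : cumul k 0 = 0.
Proof. by rewrite /cumul big_ord0. Qed.

Lemma cumulS k i : cumul k i.+1 = cumul k i + limit_mass k i.
Proof. by rewrite /cumul big_ord_recr. Qed.

Lemma cumul_le k i j : (i <= j)%N -> cumul k i <= cumul k j.
Proof.
move/subnK => <-; elim: (j - i)%N => [//|m IH]; rewrite addSn cumulS.
by rewrite (le_trans IH)// lerDl limit_mass_ge0.
Qed.

(** The four subcells of a cell have consecutive numbers, so the intervals of level [k.+1] subdivide
    those of level [k]. *)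
Lemma cumul_step k i : cumul k.+1 (4 * i) = cumul k i.
Proof.
elim: i => [|i IH]; first by rewrite muln0 !cumul0.
rewrite (_ : (4 * i.+1 = (4 * i).+4)%N); last by lia.
by rewrite !cumulS IH (limit_mass_split k i) !addrA.
Qed.

Lemma cumul_total k : cumul k (4 ^ k) = c0.
Proof.
elim: k => [|k IH]; first by rewrite expn0 cumulS cumul0 add0r limit_mass_total.
by rewrite expnS cumul_step.
Qed.

Definition cell_itv k i (t : R) := cumul k i <= t < cumul k i.+1.

Lemma cell_itv_uniq k i j t : cell_itv k i t -> cell_itv k j t -> i = j.
Proof.
have h a b : cell_itv k a t -> cell_itv k b t -> (a < b)%N -> False.
  move=> /andP[_ h1] /andP[h2 _] ab; have := cumul_le k ab.
  by rewrite leNgt (le_lt_trans h2 h1).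
move=> ti tj; have [ij|ji|//] := ltngtP i j.
  by case: (h _ _ ti tj ij).
by case: (h _ _ tj ti ji).
Qed.

Lemma cell_itv_ex k t : 0 <= t < c0 -> exists2 i, (i < 4 ^ k)%N & cell_itv k i t.
Proof.
move=> /andP[t0 tc]; rewrite -(cumul_total k) in tc.
elim: (4 ^ k)%N tc => [|N IH] tN; first by move: tN; rewrite cumul0 ltNge t0.
have [h|h] := ltP t (cumul k N); last by exists N => //; rewrite /cell_itv h tN.
by have [i iN ti] := IH h; exists i => //; rewrite ltnS ltnW.
Qed.

Lemma cell_itv_div k i t : cell_itv k.+1 i t -> cell_itv k (i %/ 4) t.
Proof.
move=> /andP[h1 h2]; rewrite /cell_itv -(cumul_step k (i %/ 4)) -(cumul_step k (i %/ 4).+1).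
rewrite (le_trans _ h1) ?cumul_le//=; last by lia.
by rewrite (lt_le_trans h2)// cumul_le//; lia.
Qed.

(** Exactly one interval contains a point of [[0, c0[], so the sum picks its number, in a form whose
    measurability is direct. The value 0 elsewhere falls on a null set of [base_measure]. *)
Definition cell_index k t : nat :=
  if (0 <= t < c0) then (\sum_(i < 4 ^ k | cell_itv k i t) i)%N else 0%N.

Lemma cell_indexE k i t : 0 <= t < c0 -> (i < 4 ^ k)%N -> cell_itv k i t ->
  cell_index k t = i.
Proof.
move=> tc ik ti; rewrite /cell_index tc (bigD1 (Ordinal ik)) //= big1 ?addn0// => j /andP[tj].
by rewrite -val_eqE /= (cell_itv_uniq tj ti) eqxx.
Qed.

Lemma cell_index_div k t : (cell_index k.+1 t %/ 4)%N = cell_index k t.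
Proof.
have [tc|/negbTE tc] := boolP (0 <= t < c0); last by rewrite /cell_index tc.
have [i ik ti] := cell_itv_ex k.+1 tc; rewrite (cell_indexE tc ik ti).
rewrite (cell_indexE tc _ (cell_itv_div ti))//.
by move: ik; rewrite expnS; lia.
Qed.

Definition approx_point k t : R * R := cell_corner k (cell_index k t).

(** Refining a cell can only move its lower left corner right or up, so both coordinates increase,
    by geometrically small amounts. *)
Lemma approx_point_incr k t :
  [/\ (approx_point k t).1 <= (approx_point k.+1 t).1 <= (approx_point k t).1 + 2^-1 ^+ k.+1
   & (approx_point k t).2 <= (approx_point k.+1 t).2 <= (approx_point k t).2 + 2^-1 ^+ k.+1].
Proof. by rewrite /approx_point -(cell_index_div k); exact: cell_corner_incr. Qed.

Lemma geometric_limit (u : nat -> R) :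
  (forall k, u k <= u k.+1 <= u k + 2^-1 ^+ k.+1) ->
  exists l, u @ \oo --> l /\ forall k, u k <= l <= u k + 2^-1 ^+ k.
Proof.
move=> h.
have hk k m : u k <= u (m + k)%N <= u k + 2^-1 ^+ k - 2^-1 ^+ (m + k).
  elim: m => [|m IH]; first by rewrite add0n; lra.
  by rewrite addSn; have := h (m + k)%N; have := half_pow (m + k); lra.
have homo k m : (k <= m)%N -> u k <= u m.
  by move=> /subnK <-; have /andP[] := hk k (m - k)%N.
have pos k : 0 < 2^-1 ^+ k :> R by rewrite exprn_gt0.
have cu : cvgn u.
  apply: nondecreasing_is_cvgn => [k m|]; first exact: homo.
  exists (u 0%N + 1) => _ [k _ <-]; have := hk 0%N k; rewrite addn0 expr0.
  by have := pos k; lra.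
exists (limn u); split => // k; apply/andP; split.
  by apply: (nondecreasing_cvgn_le (u_ := u)) => // a b; exact: homo.
apply: (cvgr_to_le cu); near=> m.
have km : (k <= m)%N by near: m; exists k.
by rewrite -(subnK km); have := hk k (m - k)%N; have := pos (m - k + k)%N; lra.
Unshelve. all: by end_near. Qed.

Lemma limit_point_ex t : exists l : R * R,
  [/\ (fun k => (approx_point k t).1) @ \oo --> l.1,
      (fun k => (approx_point k t).2) @ \oo --> l.2,
      forall k, dist1 l (approx_point k t) <= 2 * 2^-1 ^+ k
    & 0 <= l.1 <= 1 /\ 0 <= l.2 <= 1].
Proof.
have [l1 [c1 b1]] := @geometric_limit (fun k => (approx_point k t).1)
  (fun k => let: conj h _ := approx_point_incr k t in h).
have [l2 [c2 b2]] := @geometric_limit (fun k => (approx_point k t).2)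
  (fun k => let: conj _ h := approx_point_incr k t in h).
exists (l1, l2); split => //=.
- move=> k; rewrite /dist1 /=; have := b1 k; have := b2 k => h1 h2.
  by rewrite !ger0_norm; lra.
- by have := b1 0%N; have := b2 0%N; rewrite /= expr0 /=; lra.
Qed.

Definition limit_point t : dual := projT1 (cid (limit_point_ex t)).

Lemma limit_pointP t :
  [/\ (fun k => (approx_point k t).1) @ \oo --> (limit_point t).1,
      (fun k => (approx_point k t).2) @ \oo --> (limit_point t).2,
      forall k, dist1 (limit_point t) (approx_point k t) <= 2 * 2^-1 ^+ k
    & 0 <= (limit_point t).1 <= 1 /\ 0 <= (limit_point t).2 <= 1].
Proof. by rewrite /limit_point; case: cid. Qed.

Lemma measurable_cell_index k : measurable_fun setT (cell_index k : measurableTypeR R -> nat).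
Proof.
have mc i : measurable_fun setT (fun t : measurableTypeR R => cell_itv k i t).
  apply: measurable_and; first exact: measurable_fun_ler.
  exact: measurable_fun_ltr.
have ms N : measurable_fun setT (fun t : measurableTypeR R =>
    \sum_(i < N) (if ((0 <= t < c0)%R && cell_itv k i t) then i : nat else 0))%N.
  elim: N => [|N IH]; first by under eq_fun do rewrite big_ord0; exact: measurable_cst.
  under eq_fun do rewrite big_ord_recr /=; apply: measurable_fun_addn => //.
  apply: measurable_fun_ifT => //.
  apply: measurable_and => //; apply: measurable_and; first exact: measurable_fun_ler.
  exact: measurable_fun_ltr.
rewrite (_ : cell_index k = fun t => \sum_(i < 4 ^ k) (if ((0 <= t < c0)%R && cell_itv k i t) then i : nat else 0))%N//.
apply/funext => t; rewrite /cell_index; case: ifP => _ /=; first by rewrite big_mkcond.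
by rewrite big1.
Qed.

Lemma measurable_limit_point :
  measurable_fun setT (limit_point : measurableTypeR R -> dual).
Proof.
have h (f : R * R -> R) : (forall t, (fun k => f (approx_point k t)) @ \oo --> f (limit_point t)) ->
    measurable_fun setT (fun t : measurableTypeR R => f (limit_point t)).
  move=> cf; apply: (measurable_fun_cvg (h := fun k t => f (approx_point k t))) => // k.
  apply: (measurableT_comp (f := fun i => f (cell_corner k i))) => //.
  exact: measurable_cell_index.
rewrite (_ : limit_point = fun t => ((limit_point t).1, (limit_point t).2)).
  by apply: measurable_fun_pair; [apply: (h fst)|apply: (h snd)] => t; have [] := limit_pointP t.
by apply/funext => t; case: (limit_point t).
Qed.

Definition base_measure : {measure set (measurableTypeR R) -> \bar R} :=
  mrestr lebesgue_measure (measurable_itv `[0, c0[).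

Lemma base_itv (a b : R) : 0 <= a -> a <= b -> b <= c0 ->
  base_measure `[a, b[%classic = (b - a)%:E.
Proof.
move=> a0 ab bc; rewrite /base_measure /= /mrestr (_ : _ `&` _ = `[a, b[%classic).
  rewrite lebesgue_measure_itv /= lte_fin -EFinB; case: ltP => // ba.
  by rewrite (_ : b = a) ?subrr//; apply/le_anti/andP.
apply/seteqP; split => [t []//|t /= tab]; split => //; move: tab.
by rewrite /= !in_itv /=; lra.
Qed.

Lemma base_total : 0 <= c0 -> base_measure setT = c0%:E.
Proof.
move=> c00; rewrite /base_measure /= /mrestr setTI lebesgue_measure_itv /= lte_fin -EFinB subr0.
by case: ltP => // h; congr EFin; lra.
Qed.

Lemma base_fin : 0 <= c0 -> fin_num_fun base_measure.
Proof.
move=> c00; apply: lty_fin_num_fun; by rewrite /= base_total// ltry.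
Qed.

(** [approx_point k] is constant on each interval, and the length of the interval is the limit mass
    of the cell. *)
Lemma approx_integral k (phi : R * R -> R) : 0 <= c0 ->
  \int[base_measure]_t phi (approx_point k t) =
  \sum_(i < 4 ^ k) limit_mass k i * phi (cell_corner k i).
Proof.
move=> c00.
have mphi : measurable_fun setT (fun t : measurableTypeR R => phi (approx_point k t)).
  apply: (measurableT_comp (f := fun i => phi (cell_corner k i))) => //.
  exact: measurable_cell_index.
have bphi : exists M : R, forall t : R, `|phi (approx_point k t)| <= M.
  exists (\sum_(i < 4 ^ k) `|phi (cell_corner k i)| + `|phi (cell_corner k 0)|) => t.
  rewrite /approx_point; have [tc|/negbTE tc] := boolP (0 <= t < c0).
    have [i ik ti] := cell_itv_ex k tc; rewrite (cell_indexE tc ik ti).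
    rewrite (bigD1 (Ordinal ik)) //= -addrA lerDl addr_ge0// sumr_ge0// => j _.
  by rewrite /cell_index tc lerDr sumr_ge0.
have iphi A : measurable A -> base_measure.-integrable A (EFin \o (fun t => phi (approx_point k t))).
  move=> mA; apply: measurable_bounded_integrable => //.
  - by rewrite ltey_eq (base_fin c00)//.
  - exact: measurable_funS mphi.
  - case: bphi => M hM; exists M; split; [exact: num_real|move=> M' /ltW MM' t _ /=; exact: le_trans (hM t) MM'].
have main N : (N <= 4 ^ k)%N ->
    \int[base_measure]_(t in `[0, cumul k N[%classic) phi (approx_point k t) =
    \sum_(i < N) limit_mass k i * phi (cell_corner k i).
  elim: N => [|N IH] Nk.
    by rewrite cumul0 set_itvco0 Rintegral_set0 big_ord0.
  have cN : 0 <= cumul k N by rewrite -(cumul0 k) cumul_le.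
  have cNS : cumul k N <= cumul k N.+1 by exact: cumul_le.
  have cSc : cumul k N.+1 <= c0 by rewrite -(cumul_total k) cumul_le.
  rewrite big_ord_recr /= -(IH (ltnW Nk)).
  have -> : `[0, cumul k N.+1[%classic = `[0, cumul k N[%classic `|` `[cumul k N, cumul k N.+1[%classic.
    apply/seteqP; split => t /=; rewrite !in_itv /=.
      by move=> /andP[h1 h2]; case: (ltP t (cumul k N)) => h3; [left|right]; rewrite ?h1 ?h2 ?h3.
    by case=> /andP[h1 h2]; apply/andP; split; lra.
  rewrite Rintegral_setU//=.
  - congr (_ + _).
    rewrite (@eq_Rintegral _ _ _ _ _ (fun=> phi (cell_corner k N))); last first.
      move=> t; rewrite inE /= in_itv /= => tN; rewrite /approx_point (@cell_indexE k N)//.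
      by have := tN; lra.
    by rewrite Rintegral_cst//= base_itv//= cumulS mulrC; congr (_ * _); lra.
  - by apply: iphi; exact: measurableU.
  - rewrite disj_set2E; apply/eqP/seteqP; split => // t [] /=; rewrite !in_itv /= => /andP[_ h1] /andP[h2 _].
    by move: h1; rewrite ltNge h2.
rewrite -(main _ (leqnn _)) cumul_total.
rewrite -[in LHS](setUv `[0, c0[%classic) Rintegral_setU//=.
- rewrite [X in _ + X](_ : _ = 0) ?addr0//.
  rewrite /Rintegral null_set_integral//=; first exact: measurableC.
    by apply/measurable_EFinP; exact: measurable_funS mphi.
  by rewrite /base_measure /mrestr /= setICl measure0.
- exact: measurableC.
- by apply: iphi; rewrite setUv.
- by rewrite disj_set2E setICr.
Qed.

(** Two errors of the same order are added: from [limit_point] to the corner of its cell, and from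
    the sum over corners to the limit [c]. Both vanish as [k] grows. *)
Lemma limit_integral (phi : dual -> R) (L K c : R) : 0 <= c0 ->
  measurable_fun setT phi -> (forall y, `|phi y| <= K) ->
  (forall y z, `|phi y - phi z| <= L * dist1 y z) ->
  (fun N => \sum_(j < n N) p N j * phi (x N j)) @ \oo --> c ->
  \int[base_measure]_t phi (limit_point t) = c.
Proof.
move=> c00 mphi bphi lip cvgc.
have L0 : 0 <= L.
  have := lip (1, 0) (0, 0); rewrite /dist1 /= subr0 subrr normr0 addr0 normr1 mulr1.
  by apply: le_trans.
have mphik k : measurable_fun setT (fun t : measurableTypeR R => phi (approx_point k t)).
  apply: (measurableT_comp (f := fun i => phi (cell_corner k i))) => //.
  exact: measurable_cell_index.
have mphil : measurable_fun setT (fun t => phi (limit_point t)).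
  exact: measurableT_comp mphi measurable_limit_point.
have ibd (f : measurableTypeR R -> R) M : measurable_fun setT f -> (forall t, `|f t| <= M) ->
    base_measure.-integrable setT (EFin \o f).
  move=> mf hM; apply: measurable_bounded_integrable => //.
    by rewrite ltey_eq (base_fin c00)//.
  by exists M; split; [exact: num_real|move=> M' /ltW MM' t _ /=; exact: le_trans (hM t) MM'].
have close k : `|\int[base_measure]_t phi (limit_point t) - c| <= (4 * L * c0) * 2^-1 ^+ k.
  have -> : \int[base_measure]_t phi (limit_point t) - c =
      (\int[base_measure]_t phi (limit_point t) - \int[base_measure]_t phi (approx_point k t)) +
      (\int[base_measure]_t phi (approx_point k t) - c) by rewrite addrA subrK.
  rewrite (le_trans (ler_normD _ _))//.
  have h1 := limit_mass_approx k lip cvgc; rewrite -(approx_integral k _ c00) in h1.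
  have h2 : `|\int[base_measure]_t phi (limit_point t) - \int[base_measure]_t phi (approx_point k t)|
      <= L * (2 * 2^-1 ^+ k) * c0.
    have -> : \int[base_measure]_t phi (limit_point t) - \int[base_measure]_t phi (approx_point k t) =
        \int[base_measure]_t (1 * phi (limit_point t) + (-1) * phi (approx_point k t)).
      rewrite Rintegral_lin ?mul1r ?mulN1r//; first exact: (ibd _ K).
      by apply: (ibd _ K) => // t; exact: bphi.
    have m12 : measurable_fun setT (fun t => 1 * phi (limit_point t) + (-1) * phi (approx_point k t)).
      under eq_fun do rewrite mul1r mulN1r.
      exact: measurable_funB mphil (mphik k).
    have le12 t : `|1 * phi (limit_point t) + (-1) * phi (approx_point k t)| <= L * (2 * 2^-1 ^+ k).
      rewrite mul1r mulN1r (le_trans (lip _ _))// ler_wpM2l//.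
      by have [_ _ h _] := limit_pointP t; exact: h.
    apply: (le_trans (le_normr_Rintegral _ _)) => //; first exact: (ibd _ _ m12 le12).
    apply: (@le_trans _ _ (\int[base_measure]_t (cst (L * (2 * 2^-1 ^+ k)) t))).
      apply: le_Rintegral => //.
        apply: (ibd _ (L * (2 * 2^-1 ^+ k))); first exact: measurableT_comp.
        by move=> t; rewrite normr_id; exact: le12.
      apply: (ibd _ `|L * (2 * 2^-1 ^+ k)|) => // t; exact: lexx.
    by rewrite Rintegral_cst//= base_total.
  by rewrite (le_trans (lerD h2 h1))// (_ : _ + _ = 4 * L * c0 * 2^-1 ^+ k)//; ring.
have c4 : 0 <= 4 * L * c0 by rewrite !mulr_ge0.
apply/eqP; rewrite -subr_eq0 -normr_le0; apply/ler_addgt0Pr => e e0; rewrite add0r.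
have [k hk] : exists k, (4 * L * c0) * 2^-1 ^+ k <= e.
  have := @cvg_geometric R (4 * L * c0) 2^-1.
  rewrite ger0_norm ?invr_ge0// => /(_ _)/cvgr_le /(_ e e0)[]; first lra.
  by move=> k _ /(_ k (leqnn k)) h; exists k.
exact: le_trans (close k) hk.
Qed.

End Ultra.

(** The limit is asserted only for test functions whose sums converge along the whole sequence, so
    the choice of the ultrafilter leaves no trace. The support is the closed square because points
    of the half-open one may accumulate at 1. *)
Lemma weak_compactness : 0 <= c0 -> exists sigma : {finite_measure set dual -> \bar R},
  sigma (~` (`[0, 1] `*` `[0, 1])) = 0%E /\
  forall (phi : dual -> R) (L K c : R),
    measurable_fun setT phi -> (forall y, `|phi y| <= K) ->
    (forall y z, `|phi y - phi z| <= L * dist1 y z) ->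
    (fun N => \sum_(j < n N) p N j * phi (x N j)) @ \oo --> c ->
    \int[sigma]_t phi t = c.
Proof.
move=> c00; have [F [uF Foo]] := @ultraFilterLemma nat \oo _.
have ml := @measurable_limit_point F uF.
have fin : fin_num_fun (image_measure base_measure ml).
  by apply: lty_fin_num_fun; rewrite /= /pushforward preimage_setT base_total// ltry.
exists (finite_measure_of fin); split.
  rewrite -[LHS]/(base_measure (limit_point uF @^-1` (~` (`[0, 1] `*` `[0, 1])))).
  rewrite (_ : limit_point uF @^-1` _ = set0) ?measure0//.
  apply/seteqP; split => // t; apply => /=; have [_ _ _ [h1 h2]] := @limit_pointP F uF t.
  by rewrite !in_itv.
move=> phi L K c mphi bphi lip cvgc.
rewrite -(@limit_integral F uF Foo phi L K c c00 mphi bphi lip cvgc).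
rewrite /Rintegral; congr fine.
rewrite [LHS](@integral_pushforward _ _ (measurableTypeR R) dual _ _ ml base_measure setT (EFin \o phi))//.
- exact/measurable_EFinP.
- rewrite preimage_setT; apply: measurable_bounded_integrable => //.
  + by rewrite ltey_eq (base_fin c00)//.
  + exact: measurableT_comp mphi ml.
  + by exists K; split; [exact: num_real|move=> M' /ltW MM' t _ /=; exact: le_trans (bphi _) MM'].
Qed.

End Limit.
End WeakCompactness.

(** * The Bochner-Herglotz theorem *)

Section FiniteFourier.
Context {R : realType}.
Local Notation dual := (measurableTypeR R * measurableTypeR R)%type.
Local Notation square := (`[0%R, 1%R[%classic `*` `[0%R, 1%R[%classic : set dual).
Implicit Types (M N : nat) (a : int).

Lemma norm_sinB_le (x y : R) : `|sin x - sin y| <= `|x - y|.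
Proof.
wlog xy : x y / x <= y.
  by move=> h; have [/h//|/ltW /h] := leP x y; rewrite distrC [leRHS]distrC.
have h1 z : z \in `]x, y[ -> is_derive z (1 : R) sin (cos z) by move=> _; exact: is_derive_sin.
have h2 : {within `[x, y], continuous (sin : R -> R)}.
  by apply: continuous_subspaceT => z; exact: continuous_sin.
have [c _ hc] := MVT_segment xy h1 h2.
by rewrite distrC hc [leRHS]distrC normrM ler_piMl// cos_max.
Qed.

Lemma norm_cosB_le (x y : R) : `|cos x - cos y| <= `|x - y|.
Proof.
rewrite -!sinDpihalf (le_trans (norm_sinB_le _ _))//.
by rewrite (_ : x + pi / 2 - (y + pi / 2) = x - y)//; ring.
Qed.

Definition cis (x : R) : R[i] := cos (2 * pi * x) +i* sin (2 * pi * x).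

Lemma characterE z (t : dual) : character z t = cis (z.1%:~R * t.1 + z.2%:~R * t.2).
Proof. by []. Qed.

Lemma cisD x y : cis (x + y) = cis x * cis y.
Proof.
rewrite /cis mulrDr cosD sinD; apply/eqP; rewrite eq_complex /=; apply/andP; split; apply/eqP => //.
by rewrite addrC.
Qed.

Lemma cis0 : cis 0 = 1.
Proof. by rewrite /cis mulr0 cos0 sin0. Qed.

Lemma cis_nat n x : cis (n%:R * x) = cis x ^+ n.
Proof.
elim: n => [|n IH]; first by rewrite mul0r cis0 expr0.
by rewrite exprS -IH -cisD; congr cis; rewrite mulrS mulrDl mul1r.
Qed.

Lemma cis1 : cis 1 = 1.
Proof. by rewrite /cis mulr1 [2 * pi]mulrC mulr_natr cos2pi sin2pi. Qed.

Lemma cisN x : cis (- x) * cis x = 1.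
Proof. by rewrite -cisD addNr cis0. Qed.

Lemma cis_int (k : int) : cis k%:~R = 1.
Proof.
case: k => n; first by rewrite -[_%:~R]mulr1 cis_nat cis1 expr1n.
rewrite NegzE mulrNz; have := cisN n.+1%:R.
by rewrite -{2}[n.+1%:R]mulr1 cis_nat cis1 expr1n mulr1.
Qed.

Lemma cis_neq1 x : 0 < `|x| < 1 -> cis x != 1.
Proof.
move=> /andP[x0 x1]; apply/eqP => /(congr1 (@cRe _)) /= h.
have : cos (2 * pi * `|x|) = 1 by rewrite -[RHS]h; case: (ger0P x) => _ //; rewrite -[RHS]cosN; congr cos; ring.
have := @cos_2pi_lt R 0 `|x|; rewrite mulr0 cos0 subr0 => /(_ (lexx _) x0 x1).
by move=> /[swap] ->; rewrite ltxx.
Qed.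

(** The base [M] digits of [j] are the two coordinates, so that a double sum over the grid is a
    single one ([big_grid]). *)
Definition grid_point (M : nat) (j : nat) : dual :=
  ((j %/ M)%:R / M%:R, (j %% M)%:R / M%:R).

Lemma grid_point_square M j : (j < M * M)%N -> square (grid_point M j).
Proof.
move=> jM; have M0 : (0 < M)%N by case: M jM.
rewrite /grid_point; split; rewrite /= in_itv /= divr_ge0//= ltr_pdivrMr ?ltr0n// mul1r ltr_nat.
  by rewrite ltn_divLR.
by rewrite ltn_mod.
Qed.

Lemma big_grid (T : Type) (idx : T) (op : Monoid.law idx) m M (F : nat -> nat -> T) :
  \big[op/idx]_(j < m * M) F (j %/ M)%N (j %% M)%N =
  \big[op/idx]_(a < m) \big[op/idx]_(b < M) F a b.
Proof.
elim: m => [|m IH]; first by rewrite !big_ord0.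
rewrite (_ : (m.+1 * M = m * M + M)%N); last by rewrite mulSn addnC.
rewrite big_split_ord /= IH big_ord_recr /=; congr (op _ _).
apply: eq_bigr => b _; have bM := ltn_ord b; have M0 : (0 < M)%N by lia.
by rewrite divnMDl// divn_small// addn0 modnMDl modn_small.
Qed.

Lemma root_of_unity_sum M a : (a != 0) -> `|a| < M%:Z ->
  \sum_(j < M) cis (a%:~R / M%:R) ^+ j = 0.
Proof.
move=> a0 aM; have M0 : 0 < M%:R :> R by rewrite ltr0n; lia.
have M1 : cis (a%:~R / M%:R) ^+ M = 1.
  by rewrite -cis_nat mulrCA mulfV ?mulr1 ?cis_int// gt_eqF.
have n1 : cis (a%:~R / M%:R) != 1.
  apply: cis_neq1; rewrite normrM normfV (gtr0_norm M0) -intr_norm.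
  by rewrite divr_gt0 ?ltr0z ?normr_gt0//= ltr_pdivrMr// mul1r -[M%:R]/(M%:Z%:~R) ltr_int.
have := subrX1 (cis (a%:~R / M%:R)) M; rewrite M1 subrr => /esym/eqP.
by rewrite mulf_eq0 subr_eq0 (negbTE n1) => /eqP.
Qed.

Lemma character_grid v M (a b : nat) : (0 < M)%N ->
  character v ((a%:R / M%:R, b%:R / M%:R) : dual) =
  cis (v.1%:~R / M%:R) ^+ a * cis (v.2%:~R / M%:R) ^+ b.
Proof.
by move=> M0; rewrite characterE -!cis_nat -cisD /=; congr cis; ring.
Qed.

(** The sum factors into two sums of powers of roots of unity. A nonzero component of absolute value
    below [M] gives a root different from 1, hence a zero sum. *)
Lemma grid_orthogonality M v : `|v.1| < M%:Z -> `|v.2| < M%:Z ->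
  \sum_(j < M * M) character v (grid_point M j) = if v == 0 then (M * M)%:R else 0.
Proof.
move=> v1 v2; have M0 : (0 < M)%N by lia.
case: eqP => [->|v0].
  under eq_bigr do rewrite character0.
  by rewrite sumr_const card_ord.
rewrite (big_grid _ M M (fun a b : nat => character v ((a%:R / M%:R, b%:R / M%:R) : dual))).
under eq_bigr do under eq_bigr do rewrite character_grid//.
under eq_bigr do rewrite -mulr_sumr.
rewrite -mulr_suml; have [v10|v10] := eqVneq v.1 0; last first.
  by rewrite root_of_unity_sum// mul0r.
rewrite [X in _ * X]root_of_unity_sum ?mulr0//; apply: contra_notN v0 => /eqP v20.
by case: v v10 v20 {v1 v2} => p q /= -> ->.
Qed.

(** Its value is [N - |a|], the triangular weight of the Fejer kernel. *)
Definition difference_count N (a : int) : nat :=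
  (\sum_(i < N) \sum_(j < N) (i%:Z - j%:Z == a)%R)%N.

Lemma sum_delta K N m (P : nat -> bool) : (forall j, (j < K)%N -> P j = (j + m == N)%N) ->
  (\sum_(j < K) P j = (m <= N) && (N - m < K))%N.
Proof.
move=> h; case: (leqP m N) => mN /=; last first.
  by rewrite big1// => i _; rewrite h//; lia.
case: ltnP => kN; last by rewrite big1// => i _; rewrite h//; have := ltn_ord i; lia.
rewrite (bigD1 (Ordinal kN)) //= h// subnK// eqxx big1 // => i.
by rewrite h// -val_eqE /=; lia.
Qed.

Lemma difference_countE N a : difference_count N a = (N - `|a|)%N.
Proof.
elim: N => [|N IH]; first by rewrite /difference_count big_ord0.
(* The new row and column contain one more pair of difference [a] when [|a| <= N], and none
   otherwise. *)
have -> : difference_count N.+1 a = (difference_count N a + (`|a| <= N)%N)%N.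
  rewrite /difference_count big_ord_recr /=.
  under eq_bigr do rewrite big_ord_recr /=.
  rewrite big_split /= -addnA; congr (_ + _)%N.
  have [a0|a0] := leP 0 a.
    rewrite big1 ?add0n; last by move=> i _; have := ltn_ord i; lia.
    by rewrite (@sum_delta _ N `|a| (fun j => (N%:Z - j%:Z == a)%R)) => [|j jN]; lia.
  rewrite [X in (_ + X)%N]big1 ?addn0; last by move=> i _; have := ltn_ord i; lia.
  by rewrite (@sum_delta _ N `|a| (fun j => (j%:Z - N%:Z == a)%R)) => [|j jN]; lia.
by rewrite IH; lia.
Qed.

Lemma cvg_difference_count a :
  (fun N => (difference_count N.+1 a)%:R / N.+1%:R) @ \oo --> (1 : R).
Proof.
have h0 : (fun N => 1 - `|a|%N%:R * N.+1%:R^-1) @ \oo --> (1 : R).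
  rewrite -[X in _ --> X]subr0 -[X in _ - X](mulr0 (`|a|%N%:R : R)).
  apply: cvgB; first exact: cvg_cst.
  by apply: cvgMr; exact: cvg_harmonic.
apply: (@squeeze_cvgr _ _ _ _ (fun N => 1 - `|a|%N%:R * N.+1%:R^-1) (cst 1)) => //; last first.
  exact: cvg_cst.
apply: nearW => N; have N0 : 0 < N.+1%:R :> R by rewrite ltr0n.
rewrite difference_countE ler_pdivrMr// mul1r ler_nat leq_subr andbT.
rewrite ler_pdivlMr// mulrBl mul1r mulrVK ?unitfE ?gt_eqF//.
by rewrite lerBlDr -natrD ler_nat; lia.
Qed.

Lemma character_lip z : exists L : R, forall s t : R * R,
  `|cRe (character z (s : dual)) - cRe (character z (t : dual))| <= L * dist1 s t /\
  `|cIm (character z (s : dual)) - cIm (character z (t : dual))| <= L * dist1 s t.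
Proof.
exists (2 * pi * (`|z.1%:~R| + `|z.2%:~R|)) => s t /=.
have h : `|2 * pi * (z.1%:~R * s.1 + z.2%:~R * s.2) - 2 * pi * (z.1%:~R * t.1 + z.2%:~R * t.2)| <=
    2 * pi * (`|z.1%:~R| + `|z.2%:~R|) * dist1 s t.
  rewrite -mulrBr normrM ger0_norm ?mulr_ge0 ?pi_ge0// -mulrA ler_wpM2l ?mulr_ge0 ?pi_ge0//.
  rewrite (_ : _ - _ = z.1%:~R * (s.1 - t.1) + z.2%:~R * (s.2 - t.2)); last by ring.
  rewrite (le_trans (ler_normD _ _))// !normrM /dist1 mulrDl !mulrDr.
  by rewrite lerD// ?lerDl ?lerDr mulr_ge0.
by split; [exact: le_trans (norm_cosB_le _ _) h|exact: le_trans (norm_sinB_le _ _) h].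
Qed.

End FiniteFourier.

(** * Fejer means and their limit measure *)

Section Herglotz.
Context {R : realType} {d : measure_display} {X : measurableType d}.
Variable mu : {measure set X -> \bar R}.
Local Notation dual := (measurableTypeR R * measurableTypeR R)%type.
Local Notation square := (`[0%R, 1%R[%classic `*` `[0%R, 1%R[%classic : set dual).
Variables (e : int * int -> X -> R[i]) (c : int * int -> R[i]).
Hypothesis Le : forall z, L2 mu (e z).
Hypothesis gram : forall z w, inner mu (e z) (e w) = c (z - w).

Definition box_point (N l : nat) : int * int := ((l %/ N)%N%:Z, (l %% N)%N%:Z).

(** By [gram], its squared norm is a double sum of values of [c] against characters at [t]. This is
    how positive definiteness of [c] becomes nonnegativity of the weights. *)
Definition fejer_vector N (t : dual) : X -> R[i] :=
  comb e [seq (character (- box_point N l) t, box_point N l) | l <- iota 0 (N * N)].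

(* A discrete version of the Fejer means of the Fourier series with coefficients c. *)
Definition fejer_weight N j : R :=
  nrm2 mu (fejer_vector N (grid_point (2 * N) j)) / ((N * N)%:R * (2 * N * (2 * N))%:R).

Lemma nrm2_fejer N t : (nrm2 mu (fejer_vector N t))%:C =
  \sum_(l < N * N) \sum_(k < N * N)
    character (- (box_point N l - box_point N k)) t * c (box_point N l - box_point N k).
Proof.
rewrite /fejer_vector; have -> : iota 0 (N * N) = index_iota 0 (N * N) by rewrite /index_iota subn0.
rewrite -(inner_norm (L2_comb _ Le)) inner_comb// big_map big_mkord.
apply: eq_bigr => l _; rewrite big_map big_mkord; apply: eq_bigr => k _ /=.
by rewrite gram -characterB opprK opprB addrC.
Qed.

Lemma box_point_lt N l : (l < N * N)%N ->
  0 <= (box_point N l).1 < N%:Z /\ 0 <= (box_point N l).2 < N%:Z.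
Proof.
move=> lN; have N0 : (0 < N)%N by case: N lN.
rewrite /box_point /=; split; rewrite /= ltz_nat; first by rewrite ltn_divLR.
by rewrite ltn_mod.
Qed.

(** The grid has [2 * N] points on a side because [w] and the differences of box points have
    components below [N], so the characters being summed have components below [2 * N].
    Orthogonality keeps the pairs of box points with difference [w]. *)
Lemma fejer_moment N w : `|w.1| < N%:Z -> `|w.2| < N%:Z ->
  \sum_(j < 2 * N * (2 * N)) (fejer_weight N j)%:C * character w (grid_point (2 * N) j) =
  c w * ((difference_count N w.1)%:R / N%:R * ((difference_count N w.2)%:R / N%:R)).
Proof.
move=> w1 w2; have N0 : (0 < N)%N by lia.
have NC : (N%:R : R[i]) != 0 by rewrite pnatr_eq0 -lt0n.
have -> : \sum_(j < 2 * N * (2 * N)) (fejer_weight N j)%:C * character w (grid_point (2 * N) j) =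
   \sum_(l < N * N) \sum_(k < N * N) (((N * N)%:R * (2 * N * (2 * N))%:R)^-1 *
     c (box_point N l - box_point N k) *
    \sum_(j < 2 * N * (2 * N)) character (w - (box_point N l - box_point N k)) (grid_point (2 * N) j)).
  have hw j : (fejer_weight N j)%:C = (\sum_(l < N * N) \sum_(k < N * N)
      character (- (box_point N l - box_point N k)) (grid_point (2 * N) j) *
      c (box_point N l - box_point N k)) * ((N * N)%:R * (2 * N * (2 * N))%:R)^-1.
    by rewrite -nrm2_fejer /fejer_weight rmorphM fmorphV rmorphM !rmorph_nat.
  under eq_bigr do rewrite hw mulr_suml mulr_suml.
  rewrite exchange_big /=; apply: eq_bigr => l _.
  under eq_bigr do rewrite mulr_suml mulr_suml.
  rewrite exchange_big /=; apply: eq_bigr => k _; rewrite mulr_sumr; apply: eq_bigr => j _.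
  by rewrite characterD; ring.
have key (l k : 'I_(N * N)) : \sum_(j < 2 * N * (2 * N))
     character (w - (box_point N l - box_point N k)) (grid_point (2 * N) j) =
   ((box_point N l - box_point N k == w) * (2 * N * (2 * N)))%:R.
  have [l1 l2] := box_point_lt (ltn_ord l); have [k1 k2] := box_point_lt (ltn_ord k).
  rewrite grid_orthogonality; first last.
  - change (`|w.2 - ((box_point N l).2 - (box_point N k).2)| < (2 * N)%N%:Z).
    by move: l2 k2 w2; move: (_.2) (_.2) (_.2) => p q r; lia.
  - change (`|w.1 - ((box_point N l).1 - (box_point N k).1)| < (2 * N)%N%:Z).
    by move: l1 k1 w1; move: (_.1) (_.1) (_.1) => p q r; lia.
  by rewrite subr_eq0 eq_sym; case: eqP => _; rewrite ?mul1n ?mul0n.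
under eq_bigr do under eq_bigr do rewrite key.
have -> : (difference_count N w.1)%:R / N%:R * ((difference_count N w.2)%:R / N%:R) =
   \sum_(l < N * N) \sum_(k < N * N) (N * N)%:R^-1 * (box_point N l - box_point N k == w)%:R :> R[i].
  under eq_bigr do rewrite -mulr_sumr.
  rewrite -mulr_sumr natrM mulf_div mulrC; congr (_ * _).
  rewrite -natrM; under eq_bigr do rewrite -natr_sum.
  rewrite -natr_sum; congr (_%:R).
  rewrite (big_grid _ N N (fun a b => \sum_(k < N * N) ((a%:Z, b%:Z) - box_point N k == w)%R)%N).
  under eq_bigr => a _ do under eq_bigr => b _ do
    rewrite (big_grid _ N N (fun a' b' => ((a%:Z, b%:Z) - (a'%:Z, b'%:Z) == w)%R : nat)).
  rewrite /difference_count big_distrl /=; apply: eq_bigr => a _.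
  rewrite big_distrr /=; apply: eq_bigr => b _.
  rewrite big_distrl /=; apply: eq_bigr => a' _.
  rewrite big_distrr /=; apply: eq_bigr => b' _.
  by rewrite -mulnb; congr (_ * _)%N.
rewrite mulr_sumr; apply: eq_bigr => l _; rewrite mulr_sumr; apply: eq_bigr => k _.
case: eqP => [->|_]; rewrite ?mul0n ?mulr0// mul1n mulr1.
have MC : ((2 * N * (2 * N))%:R : R[i]) != 0 by rewrite pnatr_eq0; lia.
by rewrite invfM -!mulrA [_^-1 * (c w * _)]mulrCA mulVf// mulr1 mulrC.
Qed.

(* The limit measure lives on the closed square, in which 1 has to be identified with 0. *)
Definition wrap (x : R) : R := if x < 1 then x else 0.

Lemma measurable_wrap : measurable_fun setT (wrap : measurableTypeR R -> measurableTypeR R).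
Proof.
apply: measurable_fun_ifT => //.
exact: measurable_fun_ltr.
Qed.

Lemma wrap_square x : 0 <= x <= 1 -> 0 <= wrap x < 1.
Proof. by rewrite /wrap; case: ltP; lra. Qed.

Lemma character_wrap z (t : dual) : t.1 <= 1 -> t.2 <= 1 ->
  character z ((wrap t.1, wrap t.2) : dual) = character z t.
Proof.
move=> t1 t2; rewrite !characterE !cisD /=.
have h (k : int) x : x <= 1 -> cis (k%:~R * wrap x) = cis (k%:~R * x).
  move=> x1; rewrite /wrap; case: ltP => // x1'.
  have -> : x = 1 by apply/le_anti/andP.
  by rewrite mulr0 mulr1 cis0 cis_int.
by rewrite !h.
Qed.

Lemma cRe_inner_cst (sigma : {finite_measure set dual -> \bar R}) z :
  inner sigma (@character R z) (cst 1) =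
  (\int[sigma]_t cRe (character z t)) +i* (\int[sigma]_t cIm (character z t)).
Proof.
rewrite /inner /cintegral; congr (_ +i* _); apply: eq_Rintegral => t _;
by rewrite /cst rmorph1 mulr1.
Qed.

Lemma herglotz : exists sigma : {finite_measure set dual -> \bar R},
  sigma (~` square) = 0%E /\
  forall z w, inner sigma (@character R z) (character w) = c (z - w).
Proof.
(* Indices beyond the grid get weight 0 and the point 0, because [weak_compactness] speaks of all
   indices. The shift to [N.+1] avoids the empty box. *)
pose p N j := if (j < 2 * N.+1 * (2 * N.+1))%N then fejer_weight N.+1 j else 0.
pose x N j : dual := if (j < 2 * N.+1 * (2 * N.+1))%N then grid_point (2 * N.+1) j else (0, 0).
have p0 N j : 0 <= p N j.
  by rewrite /p; case: ifP => // _; rewrite divr_ge0// nrm2_ge0.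
have xs N j : square (x N j).
  rewrite /x; case: ifP => [|_]; first exact: grid_point_square.
  by split; rewrite /= in_itv /= lexx ltr01.
have moment N w : `|w.1| < N.+1%:Z -> `|w.2| < N.+1%:Z ->
    \sum_(j < 2 * N.+1 * (2 * N.+1)) (p N j)%:C * character w (x N j) =
    c w * ((difference_count N.+1 w.1)%:R / N.+1%:R * ((difference_count N.+1 w.2)%:R / N.+1%:R)).
  move=> w1 w2; rewrite -fejer_moment//; apply: eq_bigr => j _.
  by rewrite /p /x ltn_ord.
(* The moment at 0 carries no Fejer factor, so all the discrete measures have the same mass. *)
have psum N : \sum_(j < 2 * N.+1 * (2 * N.+1)) p N j = cRe (c 0).
  have := moment N 0; rewrite !difference_countE /= !subn0 divff ?mulr1 ?pnatr_eq0// => /(_ isT isT).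
  move=> /(congr1 (@cRe _)); rewrite cRe_sum => <-; apply: eq_bigr => j _.
  by rewrite character0 mulr1.
have c00 : 0 <= cRe (c 0).
  by rewrite -{1}(subrr (0 : int * int)) -gram inner_norm//= nrm2_ge0.
have [sigma [s0 hs]] := @weak_compactness R (fun N => 2 * N.+1 * (2 * N.+1))%N x p _ p0 psum xs c00.
have lim (f : R[i] -> R) w : (forall (a : R) z, f (a%:C * z) = a * f z) ->
   (forall I (r : seq I) (F : I -> R[i]), f (\sum_(i <- r) F i) = \sum_(i <- r) f (F i)) ->
   (fun N => \sum_(j < 2 * N.+1 * (2 * N.+1)) p N j * f (character w (x N j))) @ \oo --> f (c w).
  move=> fZ fS.
  have h : (fun N => ((difference_count N.+1 w.1)%:R / N.+1%:R *
      ((difference_count N.+1 w.2)%:R / N.+1%:R)) * f (c w)) @ \oo --> f (c w).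
    have {2}-> : f (c w) = 1 * 1 * f (c w) by rewrite !mul1r.
    by apply: cvgMl; rewrite -[_ * 1]mul1r; apply: cvgM; rewrite ?mul1r; exact: cvg_difference_count.
  apply: cvg_trans h; apply: near_eq_cvg; near=> N.
  rewrite -fZ rmorphM !fmorph_div !rmorph_nat mulrC -moment.
  - by rewrite fS; apply: eq_bigr => j _; rewrite fZ.
  - have wN : (`|w.1| <= N)%N by near: N; exists `|w.1|%N.
    by rewrite -lez_nat abszE in wN; apply: le_lt_trans wN _; rewrite ltz_nat.
  - have wN : (`|w.2| <= N)%N by near: N; exists `|w.2|%N.
    by rewrite -lez_nat abszE in wN; apply: le_lt_trans wN _; rewrite ltz_nat.
(* Pushing the limit forward by [wrap] brings it to the half-open square without changing the values
   of the characters. *)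
have mw : measurable_fun setT (fun t : dual => (wrap t.1, wrap t.2) : dual).
  by apply: measurable_fun_pair; apply: measurableT_comp => //; exact: measurable_wrap.
have fin : fin_num_fun (image_measure sigma mw).
  apply: lty_fin_num_fun; rewrite /= /pushforward preimage_setT.
  by rewrite ltey_eq fin_num_measure.
exists (finite_measure_of fin); split.
  rewrite -[LHS]/(sigma ((fun t : dual => (wrap t.1, wrap t.2) : dual) @^-1` (~` square))).
  apply: (subset_measure0 _ _ _ s0).
  - rewrite -[X in measurable X]setTI; apply: (mw) => //; apply: measurableC; exact: measurable_square.
  - by apply: measurableC; apply: measurableX.
  - move=> t /= h [h1 h2]; apply: h; move: h1 h2; rewrite /= !in_itv /= => h1 h2.
    by split; exact: wrap_square.
have main (f : R[i] -> R) z (L : R) : (forall (a : R) z, f (a%:C * z) = a * f z) ->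
   (forall I (r : seq I) (F : I -> R[i]), f (\sum_(i <- r) F i) = \sum_(i <- r) f (F i)) ->
   measurable_fun setT (fun t : dual => f (character z t)) ->
   (forall t : dual, `|f (character z t)| <= 1) ->
   (forall s t : R * R, `|f (character z (s : dual)) - f (character z (t : dual))| <= L * dist1 s t) ->
   \int[finite_measure_of fin]_t f (character z t) = f (c z).
  move=> fZ fS mf bf lipf; rewrite -(hs _ _ _ _ mf bf lipf (lim _ _ fZ fS)); congr fine.
  rewrite [LHS](@integral_pushforward _ _ dual dual _ _ mw sigma setT
    (fun t => (f (character z t))%:E))//; last 2 first.
  - exact/measurable_EFinP.
  - rewrite preimage_setT; apply: measurable_bounded_integrable => //.
    + by rewrite ltey_eq fin_num_measure.
    + exact: measurableT_comp mf mw.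
    + by exists 1; split; [exact: num_real|move=> M' /ltW MM' t _ /=; exact: le_trans (bf _) MM'].
  rewrite preimage_setT; apply: ae_eq_integral => //.
  - by apply/measurable_EFinP; exact: measurableT_comp mf mw.
  - exact/measurable_EFinP.
  exists (~` (`[0, 1] `*` `[0, 1])); split => //; first by apply: measurableC; exact: measurableX.
  move=> t /= h [h1 h2]; apply: h => _; move: h1 h2; rewrite /= !in_itv /= => /andP[_ h1] /andP[_ h2].
  by congr EFin; rewrite -[LHS]/(f (character z ((wrap t.1, wrap t.2) : dual))) character_wrap.
move=> z w; rewrite (_ : inner _ _ _ = inner (finite_measure_of fin) (@character R (z - w)) (cst 1)).
  rewrite cRe_inner_cst; have [L hL] := @character_lip R (z - w).
  have [m1 m2] := @cmeasurable_character R (z - w).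
  apply: ceqP => /=.
  - apply: (main (@cRe R) (z - w) L) => //; [exact: cReZ|by move=> *; exact: cRe_sum| |].
    + by move=> t; rewrite cos_max.
    + by move=> s t; have [] := hL s t.
  - apply: (main (@cIm R) (z - w) L) => //; [|by move=> *; exact: cIm_sum| |].
    + by move=> a [p1 p2] /=; rewrite mul0r addr0.
    + by move=> t; rewrite sin_max.
    + by move=> s t; have [] := hL s t.
by congr cintegral; apply/funext => t; rewrite characterB /cst rmorph1 mulr1.
Unshelve. all: by end_near. Qed.

End Herglotz.

(** * Products *)

Section MeasurePreservingMaps.
Context {R : realType} {d d' : measure_display} {A : measurableType d} {B : measurableType d'}.
Variables (P : {measure set A -> \bar R}) (Q : {measure set B -> \bar R}).

Definition transports (f : A -> B) : Prop :=
  measurable_fun setT f /\ forall D, measurable D -> P (f @^-1` D) = Q D.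

Variable f : A -> B.
Hypothesis tf : transports f.

Let mf : measurable_fun setT f. Proof. by case: tf. Qed.

Lemma transports_ae (p : B -> Prop) : {ae Q, forall y, p y} -> {ae P, forall x, p (f x)}.
Proof.
case=> N [mN N0 sN]; exists (f @^-1` N); split.
- by rewrite -[X in measurable X]setTI; exact: mf.
- by case: tf => _ ->.
- by move=> x /= h; exact: (sN (f x)).
Qed.

Lemma transports_integral (g : B -> \bar R) : measurable_fun setT g ->
  (forall y, 0 <= g y)%E -> (\int[P]_x g (f x) = \int[Q]_y g y)%E.
Proof.
move=> mg g0; rewrite (@eq_measure_integral _ _ _ _ (pushforward P f)); last first.
  by move=> D mD _; case: tf => _ <-.
by rewrite (ge0_integral_pushforward mf)//= preimage_setT.
Qed.

Lemma transports_sqnorm (g : B -> R[i]) : cmeasurable g ->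
  sqnorm P (g \o f) = sqnorm Q g.
Proof.
move=> mg; rewrite /sqnorm -transports_integral//; first exact: measurable_sqnormCE.
by move=> y; rewrite lee_fin sqnormC_ge0.
Qed.

Lemma transports_L2 (g : B -> R[i]) : L2 Q g -> L2 P (g \o f).
Proof.
move=> [mg h]; split; first exact: cmeasurable_comp.
by rewrite transports_sqnorm.
Qed.

Lemma transports_Rintegral (g : B -> R) : measurable_fun setT g ->
  \int[P]_x g (f x) = \int[Q]_y g y.
Proof.
move=> mg; rewrite /Rintegral; congr fine.
have mE : measurable_fun setT (EFin \o g) by exact/measurable_EFinP.
rewrite integralE [RHS]integralE; congr (_ - _)%E.
  rewrite -(transports_integral (measurable_funepos mE) (funepos_ge0 _)).
  by apply: eq_integral => x _; rewrite !funeposE.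
rewrite -(transports_integral (measurable_funeneg mE) (funeneg_ge0 _)).
by apply: eq_integral => x _; rewrite !funenegE.
Qed.

Lemma transports_inner (g h : B -> R[i]) : cmeasurable g -> cmeasurable h ->
  inner P (g \o f) (h \o f) = inner Q g h.
Proof.
move=> mg mh; rewrite /inner /cintegral.
have [m1 m2] : cmeasurable (fun y => g y * (h y)^*) by apply: cmeasurableM => //; exact: cmeasurableJ.
by rewrite -(transports_Rintegral m1) -(transports_Rintegral m2).
Qed.

Lemma transports_nrm2 (g : B -> R[i]) : cmeasurable g -> nrm2 P (g \o f) = nrm2 Q g.
Proof. by move=> mg; rewrite /nrm2 transports_sqnorm. Qed.

End MeasurePreservingMaps.

Section Products.
Context {R : realType} {d d' : measure_display} {A : measurableType d} {B : measurableType d'}.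
Variables (P : probability A R) (Q : probability B R).
Local Notation PQ := (product_probability P Q).

Lemma product_rect D E : measurable D -> measurable E -> PQ (D `*` E) = (P D * Q E)%E.
Proof. exact: product_measure1E. Qed.

Lemma product_unique (mu : {measure set (A * B) -> \bar R}) :
  (forall D E, measurable D -> measurable E -> mu (D `*` E) = (P D * Q E)%E) ->
  forall D, measurable D -> PQ D = mu D.
Proof. by move=> h D mD; apply: product_measure_unique => // *; exact: h. Qed.

(** Dynkin's theorem: rectangles are stable under intersection, and the sets with indicator in [C]
    are stable under complement and countable disjoint union. *)
Lemma product_total_indic C : closed_subspace PQ C ->
  (forall D E, measurable D -> measurable E -> C (fun p => (\1_(D `*` E) p)%:C)) ->
  L2 PQ `<=` C.
Proof.
move=> cC rC; apply: L2_total_indic => // D mD.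
have gen : measurable = <<s [set D | exists D1 D2, [/\ measurable D1, measurable D2 & D = D1 `*` D2]] >> :> set (set (A * B)).
  rewrite measurable_prod_measurableType; congr (<<s _ >>).
  by apply/seteqP; split => [F [D1 m1 [D2 m2 <-]]|F [D1 [D2 [m1 m2 ->]]]];
    [exists D1, D2|exists D1 => //; exists D2].
have mD' := mD; rewrite gen in mD.
apply: (@dynkin_induction _ _ _ (fun D => C (fun p => (\1_D p)%:C)) gen _ _ _ _ _ D mD).
- move=> _ _ [D1 [D2 [m1 m2 ->]]] [E1 [E2 [n1 n2 ->]]];
  rewrite -setXI; exists (D1 `&` E1), (D2 `&` E2); by split => //; exact: measurableI.
- by rewrite -setXTT; apply: rC.
- by move=> F [D1 [D2 [m1 m2 ->]]]; exact: rC.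
- move=> F mF CF; rewrite (_ : (fun p => _) = (fun p => (\1_(setT `*` setT) p)%:C - (\1_F p)%:C)).
    exact: (closed_subspaceB cC (rC _ _ measurableT measurableT) CF).
  apply/funext => p; rewrite setXTT !indicE in_setT in_setC.
  by case: (p \in F); rewrite /= ?subrr ?subr0.
- move=> F mF tF CF.
  (* By disjointness a partial sum of the indicators is 0 or 1, hence dominated by 1. *)
  have sumE n x : (\sum_(k <- iota 0 n) (\1_(F k) x)%:C : R[i]) =
      (has (fun k => x \in F k) (iota 0 n))%:R.
    elim: n => [|n IH]; first by rewrite big_nil.
    rewrite -addn1 iotaD big_cat IH has_cat /= big_seq1 add0n orbF indicE.
    case: hasP => [[k] | _] /=; last by rewrite add0r; case: (_ \in _).
    rewrite mem_iota => /andP[_ kn] xk; rewrite memNset ?addr0//.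
    move=> xn; have := tF k n Logic.I Logic.I; rewrite add0n in kn.
    have ne : F k `&` F n !=set0 by exists x; split => //; exact/set_mem.
    by move=> /(_ ne) kn'; rewrite kn' ltnn in kn.
  apply: (@closed_dominated_cvg _ _ _ PQ C (fun n x => \sum_(k <- iota 0 n) (\1_(F k) x)%:C) _ (cst 1)) => //.
  - by move=> n; exact: (closed_subspace_sum (F := fun k p => (\1_(F k) p)%:C) (iota 0 n) cC CF).
  - by apply: cmeasurable_indic; exact: bigcupT_measurable.
  - exact: finite_measure_integrable_cst.
  - by move=> n x; rewrite sumE; case: has; rewrite ?sqnormC1 ?sqnormC0.
  - move=> x; apply: cvg_near_cst; have [[N _ FN]|nF] := pselect ((\bigcup_n F n) x).
      exists N.+1 => // n /= Nn; rewrite sumE indicE mem_set; last by exists N.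
      rewrite (_ : has _ _ = true) ?subrr ?sqnormC0//; apply/hasP; exists N; first by rewrite mem_iota.
      exact/mem_set.
    apply: nearW => n; rewrite sumE indicE memNset// (_ : has _ _ = false) ?subrr ?sqnormC0//.
    by apply/negP => /hasP[k _ /set_mem xk]; apply: nF; exists k.
Qed.

Definition tensor (f : A -> R[i]) (g : B -> R[i]) (p : A * B) : R[i] := f p.1 * g p.2.

Lemma cmeasurable_tensor f g : cmeasurable f -> cmeasurable g -> cmeasurable (tensor f g).
Proof.
move=> mf mg; apply: cmeasurableM.
  exact: (cmeasurable_comp mf measurable_fst).
exact: (cmeasurable_comp mg measurable_snd).
Qed.

Lemma sqnorm_tensor f g : cmeasurable f -> cmeasurable g ->
  sqnorm PQ (tensor f g) = (sqnorm P f * sqnorm Q g)%E.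
Proof.
move=> mf mg; rewrite /sqnorm (fubini_tonelli1 (fun p => (sqnormC (tensor f g p))%:E)); first last.
- by move=> p; rewrite lee_fin sqnormC_ge0.
- by apply: measurable_sqnormCE; exact: cmeasurable_tensor.
rewrite /fubini_F; transitivity (\int[P]_x ((sqnormC (f x))%:E * sqnorm Q g))%E.
  apply: eq_integral => x _; rewrite -ge0_integralZl//.
  - by apply: eq_integral => y _; rewrite /tensor sqnormCM EFinM.
  - exact: measurable_sqnormCE.
  - by move=> y _; rewrite lee_fin sqnormC_ge0.
  - by rewrite lee_fin sqnormC_ge0.
rewrite ge0_integralZr//; first exact: measurable_sqnormCE.
- by move=> x _; rewrite lee_fin sqnormC_ge0.
- by apply: integral_ge0 => y _; rewrite lee_fin sqnormC_ge0.
Qed.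

Lemma L2_tensor f g : L2 P f -> L2 Q g -> L2 PQ (tensor f g).
Proof.
move=> Lf Lg; split; first by apply: cmeasurable_tensor; [case: Lf|case: Lg].
rewrite sqnorm_tensor; [|by case: Lf|by case: Lg].
by rewrite !L2_sqnormE// -EFinM ltry.
Qed.

Lemma nrm2_tensor f g : L2 P f -> L2 Q g -> nrm2 PQ (tensor f g) = nrm2 P f * nrm2 Q g.
Proof.
move=> Lf Lg; rewrite /nrm2 sqnorm_tensor; [|by case: Lf|by case: Lg].
by rewrite !L2_sqnormE.
Qed.

Lemma transports_fst : transports PQ P fst.
Proof.
split; first exact: measurable_fst.
move=> D mD; rewrite (_ : _ @^-1` _ = D `*` setT); last by rewrite setXT.
by rewrite [LHS](product_rect mD measurableT) probability_setT mule1.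
Qed.

Lemma transports_snd : transports PQ Q snd.
Proof.
split; first exact: measurable_snd.
move=> D mD; rewrite (_ : _ @^-1` _ = setT `*` D); last by rewrite setTX.
by rewrite [LHS](product_rect measurableT mD) probability_setT mul1e.
Qed.

Lemma integrable_tensor (a : A -> R) (b : B -> R) :
  P.-integrable setT (EFin \o a) -> Q.-integrable setT (EFin \o b) ->
  PQ.-integrable setT (EFin \o (fun p => a p.1 * b p.2)).
Proof.
move=> /integrableP[/measurable_EFinP ma ia] /integrableP[/measurable_EFinP mb ib].
have mab : measurable_fun setT (fun p : A * B => a p.1 * b p.2).
  apply: measurable_funM.
    exact: (measurableT_comp ma measurable_fst).
  exact: (measurableT_comp mb measurable_snd).
apply/integrableP; split; first exact/measurable_EFinP.
rewrite [X in (X < _)%E](fubini_tonelli1 (fun p => `|(a p.1 * b p.2)%:E|)%E)//; last first.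
  by apply: measurableT_comp => //; exact/measurable_EFinP.
rewrite /fubini_F (_ : \int[P]_x _ = \int[P]_x (`|(a x)%:E| * \int[Q]_y `|(b y)%:E|))%E; last first.
  apply: eq_integral => x _; rewrite -ge0_integralZl//.
    by apply: eq_integral => y _; rewrite EFinM abseM.
  by apply: measurableT_comp => //; exact/measurable_EFinP.
rewrite ge0_integralZr//; last 2 first.
- by apply: measurableT_comp => //; exact/measurable_EFinP.
- exact: integral_ge0.
by apply: lte_mul_pinfty => //; [exact: integral_ge0|rewrite ge0_fin_numE//; exact: integral_ge0].
Qed.

Lemma Rintegral_tensor (a : A -> R) (b : B -> R) :
  P.-integrable setT (EFin \o a) -> Q.-integrable setT (EFin \o b) ->
  \int[PQ]_p (a p.1 * b p.2) = (\int[P]_x a x) * (\int[Q]_y b y).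
Proof.
move=> ia ib; have iab := integrable_tensor ia ib.
have fa := integrable_fin_num measurableT ia; have fb := integrable_fin_num measurableT ib.
rewrite /Rintegral -fineM//; congr fine.
rewrite -[LHS](integral12_prod_meas1 iab) /fubini_F.
rewrite (_ : \int[P]_x _ = \int[P]_x ((a x)%:E * \int[Q]_y (b y)%:E))%E; last first.
  by apply: eq_integral => x _; rewrite -integralZl.
by rewrite -{1}(fineK fb) integralZr// fineK.
Qed.

Lemma inner_tensor f f' g g' : L2 P f -> L2 P f' -> L2 Q g -> L2 Q g' ->
  inner PQ (tensor f g) (tensor f' g') = inner P f f' * inner Q g g'.
Proof.
move=> Lf Lf' Lg Lg'.
have [iF1 iF2] := L2_cintegrable Lf Lf'; have [iG1 iG2] := L2_cintegrable Lg Lg'.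
rewrite /inner /cintegral.
move: iF1 iF2 iG1 iG2; set F := (fun x => f x * (f' x)^*); set G := (fun y => g y * (g' y)^*).
move=> iF1 iF2 iG1 iG2.
have E p : tensor f g p * (tensor f' g' p)^* = F p.1 * G p.2.
  by rewrite /tensor /F /G rmorphM; ring.
under eq_Rintegral do rewrite E cReM.
under [X in _ +i* X]eq_Rintegral do rewrite E cImM.
have h := integrable_tensor; apply: ceqP => /=.
  transitivity (\int[PQ]_p (1 * (cRe (F p.1) * cRe (G p.2)) + (-1) * (cIm (F p.1) * cIm (G p.2)))).
    by apply: eq_Rintegral => p _; rewrite mul1r mulN1r.
  rewrite (Rintegral_lin 1 (-1) (h _ _ iF1 iG1) (h _ _ iF2 iG2)).
  by rewrite (Rintegral_tensor iF1 iG1) (Rintegral_tensor iF2 iG2) mul1r mulN1r.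
transitivity (\int[PQ]_p (1 * (cRe (F p.1) * cIm (G p.2)) + 1 * (cIm (F p.1) * cRe (G p.2)))).
  by apply: eq_Rintegral => p _; rewrite !mul1r.
rewrite (Rintegral_lin 1 1 (h _ _ iF1 iG2) (h _ _ iF2 iG1)).
by rewrite (Rintegral_tensor iF1 iG2) (Rintegral_tensor iF2 iG1) !mul1r.
Qed.

Lemma ae_product_fst (p : A -> Prop) : {ae P, forall x, p x} -> {ae PQ, forall z, p z.1}.
Proof. exact: (transports_ae (p := p) transports_fst). Qed.

Lemma ae_product_snd (p : B -> Prop) : {ae Q, forall x, p x} -> {ae PQ, forall z, p z.2}.
Proof. exact: (transports_ae (p := p) transports_snd). Qed.

Lemma tensor_indic D E : tensor (fun x => (\1_D x)%:C) (fun y => (\1_E y)%:C) =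
  (fun p => (\1_(D `*` E) p)%:C).
Proof.
apply/funext => p; rewrite /tensor -rmorphM !indicE; congr (_%:C).
have -> : (p \in D `*` E) = (p.1 \in D) && (p.2 \in E).
  apply/idP/andP => [/set_mem [h1 h2]|[/set_mem h1 /set_mem h2]]; first by split; exact/mem_set.
  by apply/mem_set.
by case: (_ \in D); case: (_ \in E); rewrite ?mulr1 ?mulr0.
Qed.

Lemma tensor_total C : closed_subspace PQ C ->
  (forall f g, L2 P f -> L2 Q g -> C (tensor f g)) -> L2 PQ `<=` C.
Proof.
move=> cC tC; apply: product_total_indic => // D E mD mE.
by rewrite -tensor_indic; apply: tC; exact: L2_indic.
Qed.

End Products.

Section ProductMaps.
Context {R : realType} {d1 d2 d3 d4 : measure_display}.
Context {A : measurableType d1} {B : measurableType d2} {A' : measurableType d3} {B' : measurableType d4}.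
Variables (P : probability A R) (Q : probability B R) (P' : probability A' R) (Q' : probability B' R).

Lemma transports_product (f : A -> A') (g : B -> B') : transports P P' f -> transports Q Q' g ->
  transports (product_probability P Q) (product_probability P' Q') (fun p => (f p.1, g p.2)).
Proof.
move=> [mf hf] [mg hg].
have mfg : measurable_fun setT (fun p : A * B => (f p.1, g p.2)).
  apply: measurable_fun_pair.
    exact: (measurableT_comp mf measurable_fst).
  exact: (measurableT_comp mg measurable_snd).
split => // D mD.
apply/esym; apply: (product_unique (mu := image_measure (product_probability P Q) mfg)) mD => D1 D2 m1 m2.
rewrite -hf// -hg//; apply: (product_rect P Q (D := f @^-1` D1) (E := g @^-1` D2)).
- by rewrite -[X in measurable X]setTI; exact: mf.
- by rewrite -[X in measurable X]setTI; exact: mg.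
Qed.

Lemma transports_swap : transports (product_probability P Q) (product_probability Q P) (fun p => (p.2, p.1)).
Proof.
have msw : measurable_fun setT (fun p : A * B => (p.2, p.1)).
  by apply: measurable_fun_pair; [exact: measurable_snd|exact: measurable_fst].
split => // D mD.
apply/esym; apply: (product_unique (mu := image_measure (product_probability P Q) msw)) mD => D1 D2 m1 m2.
rewrite muleC -[RHS](product_rect P Q m2 m1); congr (product_probability P Q _).
by apply/seteqP; split => p /= [].
Qed.

(** Inner products of tensors factor, so the families of tensors on both sides have the same Gram
    matrix; both are total. The index type carries the proofs of integrability. *)
Lemma tensor_unitary V W : unitary_iso P P' V -> unitary_iso Q Q' W ->
  exists2 T, unitary_iso (product_probability P Q) (product_probability P' Q') T
  & forall f g, L2 P f -> L2 Q g ->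
    {ae product_probability P' Q', forall p, T (tensor f g) p = tensor (V f) (W g) p}.
Proof.
move=> uV uW.
pose I := {p : (A -> R[i]) * (B -> R[i]) | L2 P p.1 /\ L2 Q p.2}.
pose e (i : I) := tensor (sval i).1 (sval i).2.
pose e' (i : I) := tensor (V (sval i).1) (W (sval i).2).
have Le i : L2 (product_probability P Q) (e i).
  by case: i => -[f g] [Lf Lg]; exact: L2_tensor.
have Le' i : L2 (product_probability P' Q') (e' i).
  by case: i => -[f g] [Lf Lg]; apply: L2_tensor; [exact: (unitary_L2 uV)|exact: (unitary_L2 uW)].
have gram i j : inner (product_probability P Q) (e i) (e j) =
    inner (product_probability P' Q') (e' i) (e' j).
  case: i => -[f g] [Lf Lg]; case: j => -[f' g'] [Lf' Lg']; rewrite /e /e' /= in Lf Lg Lf' Lg' *.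
  rewrite !inner_tensor//; [|exact: (unitary_L2 uV)|exact: (unitary_L2 uV)|exact: (unitary_L2 uW)|exact: (unitary_L2 uW)].
  by case: uV uW => _ -> // _ [_ -> //].
have tot : L2 (product_probability P Q) `<=` closed_span (product_probability P Q) (range e).
  apply: tensor_total; first exact: closed_span_closed.
  move=> f g Lf Lg; exact: (closed_span_sub (exist _ (f, g) (conj Lf Lg) : I) Le).
have tot' : L2 (product_probability P' Q') `<=` closed_span (product_probability P' Q') (range e').
  have cC := closed_span_closed Le'.
  apply: tensor_total => // f g Lf Lg.
  have [f0 Lf0 ff0] : exists2 f0, L2 P f0 & {ae P', forall y, V f0 y = f y} by case: uV => _ _; exact.
  have [g0 Lg0 gg0] : exists2 g0, L2 Q g0 & {ae Q', forall y, W g0 y = g y} by case: uW => _ _; exact.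
  apply: (closed_subspace_ae cC (closed_span_sub (exist _ (f0, g0) (conj Lf0 Lg0) : I) Le')).
    by case: (L2_tensor Lf Lg).
  move: (ae_product_fst Q' ff0) (ae_product_snd P' gg0); apply: filterS2 => p h1 h2.
  by rewrite /e' /tensor /= h1 h2.
have [T uT hT] := unitary_iso_of_total Le Le' gram tot tot'.
exists T => // f g Lf Lg; exact: (hT (exist _ (f, g) (conj Lf Lg))).
Qed.

End ProductMaps.

(** * Weak convergence of bounded sequences *)

Section WeakLimits.
Context {R : realType}.

Definition weakly_cvg {d} {A : measurableType d} (mu : {measure set A -> \bar R})
    (b_ : nat -> A -> R[i]) (b : A -> R[i]) :=
  forall g, L2 mu g -> forall e : R, 0 < e ->
    \forall n \near \oo, sqnormC (inner mu (b_ n) g - inner mu b g) < e.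

Lemma cvg_sqnormC (u : nat -> R[i]) (l : R[i]) :
  (fun n => u n : R[i]^o) @ \oo --> (l : R[i]^o) ->
  forall e : R, 0 < e -> \forall n \near \oo, sqnormC (u n - l) < e.
Proof.
move=> /cvgrPdist_lt h e e0.
have s0 : 0 < (Num.sqrt e)%:C :> R[i] by rewrite ltcR sqrtr_gt0.
apply: filterS (h _ s0) => n; rewrite distrC normc_def ltcR ltr_sqrt//.
Qed.

Section Closed.
Context {d : measure_display} {A : measurableType d} (mu : {measure set A -> \bar R}).

(** The bound [K] makes the cost of replacing a test function by a nearby one uniform in [n]. Weak
    convergence thus need only be tested on a total set. *)
Lemma weakly_cvg_closed (b_ : nat -> A -> R[i]) b (K : R) :
  (forall n, L2 mu (b_ n)) -> L2 mu b -> (forall n, nrm2 mu (b_ n) <= K) -> nrm2 mu b <= K ->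
  closed_subspace mu [set g | L2 mu g /\ forall e : R, 0 < e ->
    \forall n \near \oo, sqnormC (inner mu (b_ n) g - inner mu b g) < e].
Proof.
move=> Lb_ Lb b_K bK; split.
- by move=> g [].
- split; first exact: L2_0.
  by move=> e e0; apply: nearW => n; rewrite !inner0r subrr sqnormC0.
- move=> c f g [Lf hf] [Lg hg]; split; first exact: L2lin.
  move=> e e0; have c0 : 0 < 4 * (sqnormC c + 1) by rewrite mulr_gt0// ltr_wpDl// sqnormC_ge0.
  have ec : 0 < e / (4 * (sqnormC c + 1)) by exact: divr_gt0.
  move: (hf _ ec) (hg _ ec); apply: filterS2 => n; rewrite !ltr_pdivlMr// => h1 h2.
  rewrite !inner_linr//.
  rewrite (_ : _ - _ = c^* * (inner mu (b_ n) f - inner mu b f) + (inner mu (b_ n) g - inner mu b g)); last by ring.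
  apply: (le_lt_trans (sqnormCD_le _ _)); rewrite sqnormCM sqnormCJ.
  move: h1 h2 (sqnormC_ge0 c); move: (sqnormC c) (sqnormC_ge0 (inner mu (b_ n) f - inner mu b f)) (sqnormC_ge0 (inner mu (b_ n) g - inner mu b g)).
  move: (sqnormC (inner mu (b_ n) f - _)) (sqnormC (inner mu (b_ n) g - _)) => x y c' x0 y0 h1 h2 c'0.
  have := mulr_ge0 c'0 y0; have := mulr_ge0 c'0 x0; lra.
- move=> f Lf hf; split => // e e0.
  have K0 : 0 <= K by apply: le_trans bK; exact: nrm2_ge0.
  (* By the Cauchy-Schwarz inequality the replacement then costs at most [e / 16] in each of the two
     squared inner products. *)
  have d0 : 0 < e / (16 * (K + 1)) by rewrite divr_gt0// mulr_gt0// ltr_wpDl.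
  have [g [Lg hg] fg] := hf _ d0; have Lfg := L2B Lf Lg.
  have e4 : 0 < e / 4 by exact: divr_gt0.
  apply: filterS (hg _ e4) => n hn.
  have hb k : L2 mu k -> nrm2 mu k <= K -> sqnormC (inner mu k (fun x => f x - g x)) <= e / 16.
    move=> Lk kK; apply: (le_trans (cauchy_schwarz Lk Lfg)).
    move: fg; rewrite ltr_pdivlMr ?mulr_gt0 ?ltr_wpDl// => fg.
    have := ler_wpM2r (nrm2_ge0 mu (fun x => f x - g x)) kK.
    move: fg (nrm2_ge0 mu (fun x => f x - g x)); move: (nrm2 mu (fun x => f x - g x)) => q h1 h2 h3.
    by apply: (le_trans h3); lra.
  have h1 := hb _ (Lb_ n) (b_K n); have h2 := hb _ Lb bK.
  rewrite !innerBr// in h1 h2.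
  rewrite (_ : _ - _ = (inner mu (b_ n) g - inner mu b g) + ((inner mu (b_ n) f - inner mu (b_ n) g) - (inner mu b f - inner mu b g))); last by ring.
  have := sqnormCD_le (inner mu (b_ n) g - inner mu b g) ((inner mu (b_ n) f - inner mu (b_ n) g) - (inner mu b f - inner mu b g)).
  have := sqnormCB_le (inner mu (b_ n) f - inner mu (b_ n) g) (inner mu b f - inner mu b g).
  move: hn h1 h2; lra.
Qed.

Lemma weakly_cvg_total (b_ : nat -> A -> R[i]) b (K : R) (G : set (A -> R[i])) :
  (forall n, L2 mu (b_ n)) -> L2 mu b -> (forall n, nrm2 mu (b_ n) <= K) -> nrm2 mu b <= K ->
  (forall C, closed_subspace mu C -> G `<=` C -> L2 mu `<=` C) -> G `<=` L2 mu ->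
  (forall g, G g -> forall e : R, 0 < e ->
    \forall n \near \oo, sqnormC (inner mu (b_ n) g - inner mu b g) < e) ->
  weakly_cvg mu b_ b.
Proof.
move=> Lb_ Lb b_K bK tot GL hG g Lg.
have [_] := tot _ (weakly_cvg_closed Lb_ Lb b_K bK) (fun g Gg => conj (GL _ Gg) (hG _ Gg)) g Lg.
exact.
Qed.

End Closed.

Context {d d' : measure_display} {A : measurableType d} {B : measurableType d'}.
Variables (P : probability A R) (Q : probability B R).

Lemma weakly_cvg_tensor a_ a b_ b (K : R) :
  (forall n, L2 P (a_ n)) -> L2 P a -> (forall n, L2 Q (b_ n)) -> L2 Q b ->
  (forall n, nrm2 P (a_ n) <= K) -> nrm2 P a <= K ->
  (forall n, nrm2 Q (b_ n) <= K) -> nrm2 Q b <= K ->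
  weakly_cvg P a_ a -> weakly_cvg Q b_ b ->
  weakly_cvg (product_probability P Q) (fun n => tensor (a_ n) (b_ n)) (tensor a b).
Proof.
move=> La_ La Lb_ Lb a_K aK b_K bK wa wb.
have K0 : 0 <= K by apply: le_trans aK; exact: nrm2_ge0.
apply: (@weakly_cvg_total _ _ _ _ _ (K * K) [set h | exists f g, [/\ L2 P f, L2 Q g & h = tensor f g]]).
- by move=> n; exact: L2_tensor.
- exact: L2_tensor.
- by move=> n; rewrite nrm2_tensor// ler_pM ?nrm2_ge0.
- by rewrite nrm2_tensor// ler_pM ?nrm2_ge0.
- move=> C cC GC; apply: tensor_total => // f g Lf Lg; apply: GC; by exists f, g.
- by move=> _ [f [g [Lf Lg ->]]]; exact: L2_tensor.
move=> _ [f [g [Lf Lg ->]]] e e0; rewrite inner_tensor//.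
have F0 := nrm2_ge0 P f; have G0 := nrm2_ge0 Q g.
have q0 : 0 < 4 * (K * nrm2 P f + K * nrm2 Q g + 1).
  by rewrite mulr_gt0// ltr_wpDl// addr_ge0// mulr_ge0.
have d0 : 0 < e / (4 * (K * nrm2 P f + K * nrm2 Q g + 1)) by exact: divr_gt0.
move: (wa _ Lf _ d0) (wb _ Lg _ d0); apply: filterS2 => n.
rewrite !ltr_pdivlMr// inner_tensor//; have := cauchy_schwarz (La_ n) Lf; have := cauchy_schwarz Lb Lg.
rewrite (_ : inner P (a_ n) f * inner Q (b_ n) g - inner P a f * inner Q b g =
  inner P (a_ n) f * (inner Q (b_ n) g - inner Q b g) + (inner P (a_ n) f - inner P a f) * inner Q b g); last by ring.
move=> h1 h2 h3 h4; apply: (le_lt_trans (sqnormCD_le _ _)); rewrite !sqnormCM.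
have h1' : sqnormC (inner Q b g) <= K * nrm2 Q g by apply: le_trans h1 _; rewrite ler_wpM2r.
have h2' : sqnormC (inner P (a_ n) f) <= K * nrm2 P f by apply: le_trans h2 _; rewrite ler_wpM2r.
move: h1' h2' h3 h4 (sqnormC_ge0 (inner P (a_ n) f)) (sqnormC_ge0 (inner Q b g)).
move: (sqnormC_ge0 (inner P (a_ n) f - inner P a f)) (sqnormC_ge0 (inner Q (b_ n) g - inner Q b g)).
move: (sqnormC (inner P (a_ n) f - inner P a f)) (sqnormC (inner Q (b_ n) g - inner Q b g)) => x y.
move: (sqnormC (inner P (a_ n) f)) (sqnormC (inner Q b g)) => p q x0 y0 qG pF h3 h4 p0 q0'.
have := ler_wpM2r y0 pF; have := ler_wpM2r x0 qG.
have := mulr_ge0 (mulr_ge0 K0 F0) x0; have := mulr_ge0 (mulr_ge0 K0 G0) y0.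
by move: h3 h4; lra.
Qed.

End WeakLimits.

(** * Koopman operators and ergodicity *)

Section KoopmanSystems.
Context {R : realType}.

(** A form of [Z2_action] in which inverses come from the group law: [S (- z)] inverts [S z] up to a
    null set. *)
Definition system {d} {A : measurableType d} (P : probability A R) (S : int * int -> A -> A) :=
  [/\ forall z, transports P P (S z),
      forall z w, {ae P, forall x, S z (S w x) = S (z + w) x}
    & {ae P, forall x, S 0 x = x}].

Section System.
Context {d : measure_display} {A : measurableType d} {P : probability A R} {S : int * int -> A -> A}.
Hypothesis sS : system P S.

Lemma koopman_transports z : transports P P (S z).
Proof. by case: sS. Qed.

Lemma koopman_L2 z f : L2 P f -> L2 P (koopman S z f).
Proof. exact: (transports_L2 (koopman_transports z)). Qed.

Lemma koopmanD z w (f : A -> R[i]) : {ae P, forall x, koopman S w (koopman S z f) x = koopman S (z + w) f x}.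
Proof. by case: sS => _ /(_ z w) + _; apply: aeS => x; rewrite /koopman /= => ->. Qed.

Lemma koopman0 (f : A -> R[i]) : {ae P, forall x, koopman S 0 f x = f x}.
Proof. by case: sS => _ _; apply: aeS => x; rewrite /koopman /= => ->. Qed.

Lemma koopman_inner z f g : L2 P f -> L2 P g ->
  inner P (koopman S z f) (koopman S z g) = inner P f g.
Proof. by move=> [mf _] [mg _]; exact: (transports_inner (koopman_transports z)). Qed.

Lemma koopman_nrm2 z f : L2 P f -> nrm2 P (koopman S z f) = nrm2 P f.
Proof. by move=> [mf _]; exact: (transports_nrm2 (koopman_transports z)). Qed.

Lemma koopman_innerB z w f g : L2 P f -> L2 P g ->
  inner P (koopman S z f) (koopman S w g) = inner P (koopman S (z - w) f) g.
Proof.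
move=> Lf Lg; rewrite -[RHS](koopman_inner w (koopman_L2 _ Lf) Lg).
apply: eq_inner; try by [do ?apply: koopman_L2|exact: aeW].
by move: (koopmanD (z - w) w f); rewrite subrK; apply: aeS => x ->.
Qed.

Lemma koopman_adj z f g : L2 P f -> L2 P g ->
  inner P (koopman S z f) g = inner P f (koopman S (- z) g).
Proof.
move=> Lf Lg; rewrite -[RHS](koopman_inner z Lf (koopman_L2 _ Lg)).
apply: eq_inner; try by [do ?apply: koopman_L2|exact: aeW].
by move: (koopmanD (- z) z g) (koopman0 g); rewrite addNr; apply: filterS2 => x -> ->.
Qed.

Lemma koopman_bounded_op z : bounded_op P (koopman S z).
Proof.
split; [exact: koopman_L2|by []|exists 1 => f Lf].
by rewrite koopman_nrm2// mul1r.
Qed.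

Lemma koopman_span z f i : L2 P f -> closed_span P (range (fun w => koopman S w f)) i ->
  closed_span P (range (fun w => koopman S w f)) (koopman S z i).
Proof.
move=> Lf; have Le w : L2 P (koopman S w f) by exact: koopman_L2.
have cC := closed_span_closed Le.
pose D := [set i | L2 P i /\ closed_span P (range (fun w => koopman S w f)) (koopman S z i)].
suff cD : closed_subspace P D.
  move=> Ci; suff [] : D i by [].
  apply: closed_span_min Ci => // w; split => //.
  apply: (closed_subspace_ae cC (closed_span_sub (w + z) Le)); first by case: (koopman_L2 z (Le w)).
  by apply: aeS (koopmanD w z f) => x ->.
have [CL C0 Clin Ccl] := cC.
split; first by move=> k [].
- by split; [exact: L2_0|exact: C0].
- by move=> c g h [Lg Cg] [Lh Ch]; split; [exact: L2lin|exact: Clin].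
- move=> g Lg hg; split=> //; apply: Ccl; first exact: koopman_L2.
  move=> e e0; have [h [Lh Ch] gh] := hg e e0; exists (koopman S z h) => //.
  by rewrite (koopman_nrm2 z (L2B Lg Lh)).
Qed.

End System.

(** By the group law [S 0] is idempotent; being invertible, it is the identity almost everywhere. *)
Lemma Z2_action_system d (A : measurableType d) (P : probability A R) S :
  Z2_action P S -> system P S.
Proof.
move=> [aS gS]; have tS z : transports P P (S z) by have [[mS hS] _] := aS z; split.
split => //; have [_ [g _ gK]] := aS 0.
move: (gS 0 0) gK (transports_ae (tS 0) gK); rewrite addr0.
by apply: filterS3 => x h [h1 _] [h2 _]; rewrite -h2 h h1.
Qed.

Lemma system_product d d' (A : measurableType d) (B : measurableType d') (P : probability A R)
    (Q : probability B R) S T : system P S -> system Q T ->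
  system (product_probability P Q) (product_action S T).
Proof.
move=> [tS gS S0] [tT gT T0]; split.
- move=> z; exact: (transports_product (tS z) (tT z)).
- move=> z w; move: (ae_product_fst Q (gS z w)) (ae_product_snd P (gT z w)).
  by apply: filterS2 => p; rewrite /product_action /= => -> ->.
- move: (ae_product_fst Q S0) (ae_product_snd P T0).
  by apply: filterS2 => -[x y]; rewrite /product_action /= => -> ->.
Qed.

(** * Invariant functions of an ergodic map *)

Section Ergodicity.
Context {d : measure_display} {A : measurableType d} {P : probability A R} {T : A -> A}.
Hypothesis tT : transports P P T.
Hypothesis eT : ergodic P T.

Lemma ergodic_level (g : A -> R) (E : set R) : measurable_fun setT g -> measurable E ->
  {ae P, forall x, g (T x) = g x} -> P (g @^-1` E) = 0%E \/ P (g @^-1` E) = 1%E.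
Proof.
move=> mg mE gT.
have mD : measurable (g @^-1` E) by rewrite -[X in measurable X]setTI; exact: mg.
have mTD : measurable (T @^-1` (g @^-1` E)).
  by rewrite -[X in measurable X]setTI; case: tT => mT _; exact: mT.
apply: eT => //; apply/negligibleP.
  by apply: measurableU; exact: measurableD.
apply: negligibleS gT => x /= h hx; case: h => -[/= h1 h2]; apply: h2.
  by rewrite /= -hx.
by rewrite /= hx.
Qed.

Lemma Rintegral_lt (g : A -> R) m : P.-integrable setT (EFin \o g) ->
  P [set x | g x < m] = 1%E -> \int[P]_x g x < m.
Proof.
move=> ig Pm; rewrite ltNge; apply/negP => mg.
have /integrableP[/measurable_EFinP mgf _] := ig.
have mlt : measurable [set x | g x < m].
  have : measurable (g @^-1` `]-oo, m[%classic) by rewrite -[X in measurable X]setTI; exact: (mgf).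
    by rewrite preimage_itvNyo.
have ae1 : {ae P, forall x, g x < m}.
  exists (~` [set x | g x < m]); split => //; first exact: measurableC.
  by rewrite probability_setC// Pm subee.
pose h x := Num.max (m - g x) 0.
have mh : measurable_fun setT h by apply: measurable_maxr => //; exact: measurable_funB.
have icst : P.-integrable setT (EFin \o (cst m)) by exact: finite_measure_integrable_cst.
have hE : {ae P, forall x, h x = 1 * m + (-1) * g x}.
  by apply: aeS ae1 => x gx; rewrite /h max_l ?subr_ge0 ?ltW// mul1r mulN1r.
have h0 : (\int[P]_x `|(h x)%:E| = 0)%E.
  apply/eqP; rewrite eq_le; apply/andP; split; last exact: integral_ge0.
  rewrite (@ae_eq_integral _ _ _ P setT (fun x => (1 * m + (-1) * g x)%:E)) => //.
  - have := Rintegral_lin 1 (-1) icst ig.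
    have ii := integrable_lin 1 (-1) icst ig.
    have cE : \int[P]_x (cst m x) = m.
      rewrite [LHS](Rintegral_cst P measurableT m) -[RHS]mulr1; congr (_ * _).
      exact: (congr1 fine (probability_setT P)).
    move=> hlin0; have hlin : \int[P]_x (1 * cst m x + -1 * g x) = m - \int[P]_x g x.
      by rewrite hlin0 cE mulN1r [1 * m]mul1r.
    have -> : (\int[P]_x (1 * m + -1 * g x)%:E)%E = (\int[P]_x (1 * cst m x + -1 * g x))%:E.
      by rewrite /Rintegral fineK//; exact: (integrable_fin_num measurableT ii).
    by rewrite hlin lee_fin subr_le0.
  - by apply: measurableT_comp => //; exact/measurable_EFinP.
  - by have /integrableP[] := integrable_lin 1 (-1) icst ig.
  - apply: aeS hE => x hx _; rewrite gee0_abs ?hx// lee_fin -hx.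
    by rewrite /h le_max lexx orbT.
have : {ae P, forall x, False}.
  have /ae_eq_integral_abs : measurable_fun setT (EFin \o h) by exact/measurable_EFinP.
  move=> /(_ P measurableT)[/(_ h0) h1 _].
  move: ae1 h1; apply: filterS2 => x h1 /(_ Logic.I) [] h2.
  by move: h2; rewrite /h max_l ?subr_ge0 ?ltW// => /eqP; rewrite subr_eq0 => /eqP h3; rewrite h3 ltxx in h1.
move=> [N [mN N0 sN]]; have NT : N = setT by apply/seteqP; split => // x _; apply: sN.
by move: N0; rewrite NT probability_setT => /eqP; rewrite onee_eq0.
Qed.

(** The set where [g] is below its mean is invariant, so it is null or of full measure, and full
    measure would make the mean smaller than itself. The opposite function gives the other
    inequality. *)
Lemma ergodic_real_const (g : A -> R) : P.-integrable setT (EFin \o g) ->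
  {ae P, forall x, g (T x) = g x} -> {ae P, forall x, g x = \int[P]_x g x}.
Proof.
have half (k : A -> R) : P.-integrable setT (EFin \o k) -> {ae P, forall x, k (T x) = k x} ->
    {ae P, forall x, \int[P]_x k x <= k x}.
  move=> ik kT; have /integrableP[/measurable_EFinP mk _] := ik.
  set m := \int[P]_x k x.
  have mlt : measurable [set x | k x < m].
    have : measurable (k @^-1` `]-oo, m[%classic) by rewrite -[X in measurable X]setTI; exact: (mk).
    by rewrite preimage_itvNyo.
  have [h|h] := ergodic_level mk (measurable_itv `]-oo, m[) kT; last first.
    by have := Rintegral_lt ik (m := m); rewrite ltxx preimage_itvNyo in h * => /(_ h).
  rewrite preimage_itvNyo in h.
  by exists [set x | k x < m]; split => // x /= /negP; rewrite -ltNge.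
move=> ig gT; have ing : P.-integrable setT (EFin \o (fun x => 0 * g x + (-1) * g x)).
  exact: integrable_lin.
have h2 := half _ ing; have h1 := half _ ig gT.
have : {ae P, forall x, \int[P]_x (0 * g x + -1 * g x) <= 0 * g x + -1 * g x}.
  by apply: h2; apply: aeS gT => x ->.
rewrite Rintegral_lin// mul0r add0r mulN1r; move: h1; apply: filterS2 => x.
rewrite mul0r add0r mulN1r lerN2 => h h'; apply/eqP; rewrite eq_le h'.
by rewrite h.
Qed.

Lemma ergodic_const f : L2 P f -> {ae P, forall x, f (T x) = f x} ->
  {ae P, forall x, f x = inner P f (cst 1)}.
Proof.
move=> Lf fT; have [i1 i2] := L2_cintegrable Lf (L2_cst P 1).
have E x : f x * (cst 1 x)^* = f x by rewrite /cst rmorph1 mulr1.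
have h1 : {ae P, forall x, cRe (f x * (cst 1 x)^*) = \int[P]_x cRe (f x * (cst 1 x)^*)}.
  by apply: (ergodic_real_const i1); apply: aeS fT => x; rewrite !E => ->.
have h2 : {ae P, forall x, cIm (f x * (cst 1 x)^*) = \int[P]_x cIm (f x * (cst 1 x)^*)}.
  by apply: (ergodic_real_const i2); apply: aeS fT => x; rewrite !E => ->.
move: h1 h2; apply: filterS2 => x; rewrite E => h1 h2.
by apply: ceqP.
Qed.

End Ergodicity.

Lemma ergodic_fst d d' (A : measurableType d) (B : measurableType d') (P : probability A R)
    (Q : probability B R) (f : A -> A) (g : B -> B) : measurable_fun setT f ->
  ergodic (product_probability P Q) (fun p => (f p.1, g p.2)) -> ergodic P f.
Proof.
move=> mf e D mD D0.
have mDT : measurable (D `*` [set: B]) by exact: measurableX.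
have hT C : measurable C -> product_probability P Q (C `*` setT) = P C.
  by move=> mC; rewrite [LHS](product_rect P Q mC measurableT) probability_setT mule1.
have := e _ mDT; rewrite hT// (_ : _ `+` _ = ((f @^-1` D) `+` D) `*` setT).
  rewrite hT ?D0; first exact.
  have mfD : measurable (f @^-1` D) by rewrite -[X in measurable X]setTI; exact: mf.
  by apply: measurableU; exact: measurableD.
by apply/seteqP; split => -[x y] /=; rewrite /setD /setU /setX /=; tauto.
Qed.

Lemma ergodic_snd d d' (A : measurableType d) (B : measurableType d') (P : probability A R)
    (Q : probability B R) (f : A -> A) (g : B -> B) : measurable_fun setT g ->
  ergodic (product_probability P Q) (fun p => (f p.1, g p.2)) -> ergodic Q g.
Proof.
move=> mg e D mD D0.
have mDT : measurable ([set: A] `*` D) by exact: measurableX.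
have hT C : measurable C -> product_probability P Q (setT `*` C) = Q C.
  by move=> mC; rewrite [LHS](product_rect P Q measurableT mC) probability_setT mul1e.
have := e _ mDT; rewrite hT// (_ : _ `+` _ = setT `*` ((g @^-1` D) `+` D)).
  rewrite hT ?D0; first exact.
  have mgD : measurable (g @^-1` D) by rewrite -[X in measurable X]setTI; exact: mg.
  by apply: measurableU; exact: measurableD.
by apply/seteqP; split => -[x y] /=; rewrite /setD /setU /setX /=; tauto.
Qed.

End KoopmanSystems.

(** * Spectral models *)

Section IsometricImages.
Context {R : realType} {d d' : measure_display} {A : measurableType d} {B : measurableType d'}.
Variables (mu : {measure set A -> \bar R}) (nu : {measure set B -> \bar R}).

(** The image is taken up to almost everywhere equality, which makes it closed: preimages of a fast
    convergent sequence are Cauchy because [J] is isometric. *)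
Lemma isometric_image_closed (J : (A -> R[i]) -> B -> R[i]) :
  (forall f, L2 mu f -> L2 nu (J f)) ->
  (forall c f g, J (fun x => c * f x + g x) = fun y => c * J f y + J g y) ->
  (forall f, L2 mu f -> nrm2 nu (J f) = nrm2 mu f) ->
  closed_subspace nu [set F | L2 nu F /\ exists2 f, L2 mu f & {ae nu, forall y, F y = J f y}].
Proof.
move=> JL Jlin Jn.
have JB f g : J (fun x => f x - g x) = fun y => J f y - J g y.
  have := Jlin (-1) g f; rewrite (_ : (fun x => -1 * g x + f x) = (fun x => f x - g x)).
    by move=> ->; apply/funext => y; rewrite mulN1r addrC.
  by apply/funext => x; rewrite mulN1r addrC.
split.
- by move=> F [].
- split; first exact: L2_0.
  exists (cst 0); first exact: L2_0.
  have := JB (cst 0) (cst 0); rewrite (_ : (fun x => cst 0 x - cst 0 x) = cst 0 :> (A -> R[i])).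
    by move=> ->; apply: aeW => y; rewrite subrr.
  by apply/funext => x; rewrite /cst subrr.
- move=> c F G [LF [f Lf Ff]] [LG [g Lg Gg]]; split; first exact: L2lin.
  exists (fun x => c * f x + g x); first exact: L2lin.
  by rewrite Jlin; move: Ff Gg; apply: filterS2 => y -> ->.
- move=> F LF h; split => //.
  have /choice[f_ hf] n : exists f, L2 mu f /\ nrm2 nu (fun y => F y - J f y) < 8^-1 ^+ n / 4.
    have [G [LG [f Lf Gf]] FG] := h _ (divr_gt0 (@pow8_gt0 R n) (ltr0n _ 4)).
    exists f; split => //; rewrite (eq_nrm2 (g := fun y => F y - G y)) //.
    + by case: (L2B LF (JL _ Lf)).
    + by case: (L2B LF LG).
    + by apply: aeS Gf => y ->.
  have Lf n : L2 mu (f_ n) by case: (hf n).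
  have [||f Lf' ff] := @riesz_fischer _ _ _ mu f_ => //.
    move=> n m nm; rewrite -Jn; last exact: L2B.
    rewrite JB; apply: (le_trans (nrm2B_le (JL _ (Lf n)) (JL _ (Lf m)) LF)).
    rewrite nrm2_sym; have [_ h1] := hf n; have [_ h2] := hf m.
    by have := @pow8_le R _ _ nm; lra.
  exists f => //; apply: (nrm2B0 LF (JL _ Lf')); apply/le_anti; rewrite nrm2_ge0 andbT.
  apply: (@small_le0 R _ 4) => n.
  apply: (le_trans (nrm2B_le LF (JL _ Lf') (JL _ (Lf n)))).
  rewrite -JB Jn; last exact: L2B.
  by have := ff n; have [_] := hf n; have := @pow8_gt0 R n; lra.
Qed.

End IsometricImages.

Lemma probability_inner1 {R : realType} {d : measure_display} {X : measurableType d}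
    (mu : probability X R) : inner mu (cst 1) (cst 1) = 1.
Proof.
rewrite inner_norm; last exact: L2_cst.
rewrite /nrm2 /sqnorm (_ : (fun x => _) = cst 1%E); last by apply/funext => x; rewrite sqnormC1.
rewrite integral_cst// mul1e.
exact: (congr1 (fun x => (fine x)%:C) (probability_setT mu)).
Qed.

Section CyclicVector.
Context {R : realType} {d : measure_display} {X : measurableType d}.
Variables (mu : probability X R) (S : int * int -> X -> X).
Hypothesis sS : system mu S.
Hypothesis eS : forall z, z != 0 -> ergodic (product_probability mu mu) (product_action S S z).
Hypothesis hS2 : symmetric_square_simple_spectrum mu S.
Local Notation mu2 := (product_probability mu mu).
Local Notation S2 := (product_action S S).

Let sS2 : system mu2 S2. Proof. exact: system_product. Qed.
Let L1 : L2 mu (cst 1). Proof. exact: L2_cst. Qed.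
Let L2fst f : L2 mu f -> L2 mu2 (f \o fst). Proof. exact: (transports_L2 (transports_fst mu mu)). Qed.
Let L2snd f : L2 mu f -> L2 mu2 (f \o snd). Proof. exact: (transports_L2 (transports_snd mu mu)). Qed.

(** The difference between [f] and its translate lies in the cyclic space of [h] and is orthogonal
    to the whole orbit, hence null. Ergodicity then makes the invariant function [f] constant. *)
Lemma symmetric_cyclic_total (h : X * X -> R[i]) (f : X * X -> R[i]) :
  L2 mu2 h -> closed_span mu2 (range (fun z => koopman S2 z h)) f ->
  (forall z w, inner mu2 f (koopman S2 z h) = inner mu2 f (koopman S2 w h)) ->
  {ae mu2, forall p, f p = inner mu2 f (cst 1)}.
Proof.
move=> Lh Cf fh; have Lf : L2 mu2 f by case: Cf.
have n10 : ((1, 0) : int * int) != 0 by [].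
apply: (ergodic_const (koopman_transports sS2 (1, 0)) (eS n10) Lf).
have LU : forall z, L2 mu2 (koopman S2 z h) by move=> z; exact: koopman_L2.
apply: (nrm2B0 (koopman_L2 sS2 (1, 0) Lf) Lf).
apply: (orth_total LU).
  apply: (closed_subspaceB (closed_span_closed LU)) => //.
  exact: (koopman_span sS2 (1, 0) Lh Cf).
move=> z; rewrite innerBl//; last exact: koopman_L2.
rewrite (koopman_adj sS2)//.
rewrite (eq_inner Lf Lf (koopman_L2 sS2 _ (LU z)) (LU (z - (1, 0)))); first by rewrite (fh _ z) subrr.
- exact: aeW.
- exact: (koopmanD sS2 z (- (1, 0)) h).
Qed.

(* If a(x) is the projection of the cyclic symmetric vector h on the functions of x, then 1 + a is
   cyclic: when g is orthogonal to its orbit and has mean gam, the symmetric function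
   (g - gam)(x) + (g - gam)(y) has the same inner product with all translates of h, so it is
   invariant, hence zero by ergodicity. *)
Lemma cyclic_vector : exists2 k, L2 mu k &
  L2 mu `<=` closed_span mu (range (fun z => koopman S z k)) /\ nrm2 mu k = 1.
Proof.
have [h [[Lh symh] [_ h0]] Hh] := hS2.
pose J (f : X -> R[i]) : X * X -> R[i] := f \o fst.
have cJ := @isometric_image_closed R _ _ _ _ mu mu2 J (@L2fst) (fun c f g => erefl)
  (fun f Lf => transports_nrm2 (transports_fst mu mu) Lf.1).
have [p [Lp [a La pa]] hp] := projection cJ Lh.
(* [a] represents the inner product with [h] on functions of the first coordinate. *)
have ha f : L2 mu f -> inner mu2 (f \o fst) h = inner mu f a.
  move=> Lf; have LJ := L2fst Lf.
  have h1 := hp _ (conj LJ (ex_intro2 _ _ f Lf (aeW _ (fun y => erefl)))).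
  rewrite -[RHS](transports_inner (transports_fst mu mu) Lf.1 La.1).
  rewrite (eq_inner LJ LJ (L2fst La) Lp (aeW _ (fun=> erefl))); last by apply: aeS pa => y ->.
  apply/eqP; rewrite -subr_eq0 -innerBr// (innerJ (L2B Lh Lp) LJ) h1 conjC0//.
have haz f z : L2 mu f -> inner mu2 (f \o fst) (koopman S2 z h) = inner mu f (koopman S z a).
  move=> Lf; rewrite -[z]opprK -(koopman_adj sS2 _ (L2fst Lf) Lh) -(koopman_adj sS)//.
  exact: (ha _ (koopman_L2 sS _ Lf)).
(* By symmetry of [h], functions of the second coordinate give the same values. *)
have hsnd f z : L2 mu f -> inner mu2 (f \o snd) (koopman S2 z h) = inner mu f (koopman S z a).
  move=> Lf; rewrite -haz//.
  have Lz := koopman_L2 sS2 z Lh.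
  rewrite -(transports_inner (transports_swap mu mu) (L2snd Lf).1 Lz.1).
  apply: eq_inner; [exact: L2fst|exact: L2fst| | exact: Lz|exact: aeW|].
    exact: (transports_L2 (transports_swap mu mu) Lz).
  move: (transports_ae (koopman_transports sS2 z) symh); apply: aeS => -[x y] /=.
  by rewrite /koopman /product_action /= => ->.
have a1 : inner mu a (cst 1) = 0.
  rewrite (innerJ L1 La) -ha// (innerJ Lh (L2fst L1)).
  by rewrite -[cst 1 \o fst]/(cst 1 : X * X -> R[i]) h0 !conjC0.
pose k x := a x + 1; have Lk : L2 mu k by exact: (L2D La L1).
have LUk z : L2 mu (koopman S z k) by exact: koopman_L2.
have cCk := closed_span_closed LUk.
have tot : L2 mu `<=` closed_span mu (range (fun z => koopman S z k)).
  apply: closed_subspace_total => // g Lg gk.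
  set gam := inner mu g (cst 1).
  have ga z : inner mu g (koopman S z a) = - gam.
    have := gk _ (closed_span_sub z LUk).
    rewrite (_ : koopman S z k = fun x => koopman S z a x + cst 1 x)//.
    rewrite innerDr//; last exact: koopman_L2.
    by move/eqP; rewrite addr_eq0 => /eqP.
  have i11 : inner mu (cst 1) (cst 1) = 1.
    exact: probability_inner1.
  pose g0 x := g x - gam * cst 1 x.
  have Lg0 : L2 mu g0 by apply: L2B => //; exact: L2Z.
  have g01 : inner mu g0 (cst 1) = 0 by rewrite innerBl ?innerZl ?i11 ?mulr1 ?subrr//; exact: L2Z.
  have g0a z : inner mu g0 (koopman S z a) = - gam.
    rewrite innerBl ?innerZl//; [|exact: koopman_L2|exact: L2Z|exact: koopman_L2].
    rewrite ga -[z]opprK -(koopman_adj sS)// (innerJ La (koopman_L2 sS (- z) L1)).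
    by rewrite -[koopman S (- z) (cst 1)]/(cst 1 : X -> R[i]) a1 conjC0 mulr0 subr0.
  pose f p := (g0 \o fst) p + (g0 \o snd) p.
  have Lf : L2 mu2 f by apply: L2D; [exact: L2fst|exact: L2snd].
  have f1 : inner mu2 f (cst 1) = 0.
    rewrite innerDl; [|exact: L2fst|exact: L2snd|exact: L2_cst].
    rewrite -[X in inner _ _ X + _]/(cst 1 \o fst : X * X -> R[i]).
    rewrite (transports_inner (transports_fst mu mu) Lg0.1 L1.1) g01 add0r.
    rewrite -[X in inner _ _ X]/(cst 1 \o snd : X * X -> R[i]).
    by rewrite (transports_inner (transports_snd mu mu) Lg0.1 L1.1).
  have fU z : inner mu2 f (koopman S2 z h) = - (gam + gam).
    rewrite innerDl; [|exact: L2fst|exact: L2snd|exact: koopman_L2].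
    by rewrite haz// hsnd// g0a opprD.
  have Cf : closed_span mu2 (range (fun z => koopman S2 z h)) f.
    rewrite -Hh; split; split => //.
      by apply: aeW => q; rewrite /f /= addrC.
    move=> c; rewrite (_ : cst c = fun p => c * cst 1 p :> R[i]).
      by rewrite innerZr ?f1 ?mulr0//; exact: L2_cst.
    by apply/funext => q; rewrite mulr1.
  have fc := symmetric_cyclic_total Lh Cf (fun z w => etrans (fU z) (esym (fU w))).
  have f0 : {ae mu2, forall p, f p = 0} by apply: aeS fc => q ->.
  have gam0 : gam = 0.
    have := fU 0; rewrite (eq_inner Lf (@L2_0 _ _ _ mu2) (koopman_L2 sS2 0 Lh) (koopman_L2 sS2 0 Lh)); last 2 first.
    - by apply: aeS f0 => q ->.
    - exact: aeW.
    rewrite inner0l => /esym/eqP; rewrite oppr_eq0 -mulr2n mulrn_eq0 => /eqP//.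
  have n0 : nrm2 mu2 f = 0 by apply: nrm2_ae0 f0; exact: Lf.1.
  (* The cross term vanishes because [g0] has mean 0, so the squared norm of [f] is twice that of
     [g0]. *)
  move: n0; rewrite nrm2D; [|exact: L2fst|exact: L2snd].
  rewrite (transports_nrm2 (transports_fst mu mu) Lg0.1) (transports_nrm2 (transports_snd mu mu) Lg0.1).
  rewrite (_ : g0 \o fst = tensor g0 (cst 1)); last by apply/funext => q; rewrite /tensor /cst mulr1.
  rewrite (_ : g0 \o snd = tensor (cst 1) g0); last by apply/funext => q; rewrite /tensor /cst mul1r.
  rewrite inner_tensor// g01 mul0r /= mulr0 addr0 => n0.
  have -> : g = g0 by apply/funext => x; rewrite /g0 gam0 mul0r subr0.
  by have := nrm2_ge0 mu g0; lra.
have k0 : 0 < nrm2 mu k.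
  rewrite lt_def nrm2_ge0 andbT; apply/eqP => kn.
  have kae := nrm2_eq0 Lk kn.
  have : inner mu k (cst 1) = 1.
    by rewrite (innerDl La L1 L1) a1 add0r probability_inner1.
  rewrite (eq_inner Lk (@L2_0 _ _ _ mu) L1 L1 kae (aeW _ (fun=> erefl))) inner0l.
  by move/eqP; rewrite eq_sym oner_eq0.
pose c : R[i] := (Num.sqrt (nrm2 mu k))^-1%:C.
have c0 : c != 0 by rewrite /c fmorph_eq0 invr_eq0 sqrtr_eq0 -ltNge.
exists (fun x => c * k x); first exact: L2Z.
split; last first.
  by rewrite nrm2Z// /c sqnormC_real exprVn sqr_sqrtr ?nrm2_ge0// mulVf// gt_eqF.
have LUc z : L2 mu (koopman S z (fun x => c * k x)) by apply: koopman_L2 => //; exact: L2Z.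
move=> f /tot; apply: closed_span_min; first exact: closed_span_closed.
move=> z; have := closed_subspaceZ c^-1 (closed_span_closed LUc) (closed_span_sub z LUc).
rewrite (_ : (fun x => c^-1 * koopman S z (fun x0 : X => c * k x0) x) = koopman S z k)//.
by apply/funext => x; rewrite /koopman /= mulrA mulVf ?mul1r.
Qed.

End CyclicVector.

Section ProbabilityOf.
Context {R : realType} {d : measure_display} {X : measurableType d}.
Variables (mu : {measure set X -> \bar R}) (muT : mu setT = 1%E).

Definition probability_copy : set X -> \bar R := mu.

Let probability_copy0 : probability_copy set0 = 0%E. Proof. exact: measure0. Qed.
Let probability_copy_ge0 A : (0 <= probability_copy A)%E. Proof. exact: measure_ge0. Qed.
Let probability_copy_additive : semi_sigma_additive probability_copy.
Proof. exact: measure_semi_sigma_additive. Qed.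

HB.instance Definition _ := isMeasure.Build _ _ _ probability_copy
  probability_copy0 probability_copy_ge0 probability_copy_additive.

HB.instance Definition _ := Measure_isProbability.Build _ _ _ probability_copy muT.

Definition probability_of : probability X R := probability_copy.

End ProbabilityOf.

Section SpectralModel.
Context {R : realType} {d : measure_display} {X : measurableType d}.
Variables (mu : probability X R) (S : int * int -> X -> X).
Local Notation dual := (measurableTypeR R * measurableTypeR R)%type.
Local Notation square := (`[0%R, 1%R[%classic `*` `[0%R, 1%R[%classic : set dual).

Definition intertwines {d'} {B : measurableType d'} (s : probability B R) (tau : B -> dual)
    (V : (X -> R[i]) -> B -> R[i]) :=
  forall z f, L2 mu f -> {ae s, forall t, V (koopman S z f) t = character z (tau t) * V f t}.

Lemma character_bounded_op d' (B : measurableType d') (s : probability B R) (tau : B -> dual) z :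
  measurable_fun setT tau -> bounded_op s (fun f t => character z (tau t) * f t).
Proof.
move=> mtau; have mc : cmeasurable (fun t => character z (tau t)).
  exact: (cmeasurable_comp (cmeasurable_character z) mtau).
have b1 t : sqnormC (character z (tau t)) <= 1 by rewrite sqnormC_character.
split.
- by move=> f Lf; exact: (L2_bounded_mul mc b1 Lf).
- by move=> c f g; apply/funext => t; ring.
- exists 1 => f _; rewrite mul1r le_eqVlt; apply/orP; left; apply/eqP; congr fine.
  by apply: eq_integral => t _; rewrite sqnormCM sqnormC_character mul1r.
Qed.

(** The Gram matrix of the orbit of [k] depends on differences only, so [herglotz] realises it by
    characters. The norm 1 of [k] makes the measure a probability. *)
Theorem spectral_model : system mu S ->
  (exists2 k, L2 mu k & L2 mu `<=` closed_span mu (range (fun z => koopman S z k)) /\ nrm2 mu k = 1) ->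
  exists (s : probability dual R) V,
    [/\ s (~` square) = 0%E, unitary_iso mu s V & intertwines s id V].
Proof.
move=> sS [k Lk [tot n1]].
have LU z : L2 mu (koopman S z k) by exact: koopman_L2.
have gram z w : inner mu (koopman S z k) (koopman S w k) = inner mu (koopman S (z - w) k) k.
  exact: koopman_innerB.
have [sigma [s0 hs]] := herglotz (e := fun z => koopman S z k) (c := fun z => inner mu (koopman S z k) k) LU gram.
have sT : sigma setT = 1%E.
  have : inner sigma (@character R 0) (character 0) = 1.
    by rewrite hs -gram (koopman_inner sS)// (inner_norm Lk) n1.
  rewrite (_ : inner _ _ _ = (nrm2 sigma (cst 1))%:C); last first.
    rewrite -inner_norm; last exact: L2_cst.
    by congr (inner _ _ _); apply/funext => t; rewrite character0.
  move=> /complexI; rewrite /nrm2 /sqnorm (_ : (fun x => _) = cst 1%E); last first.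
    by apply/funext => x; rewrite sqnormC1.
  rewrite integral_cst// mul1e => h.
  by rewrite -[LHS]fineK ?fin_num_measure// h.
pose s := probability_of sT.
have hs' z w : inner mu (koopman S z k) (koopman S w k) = inner s (@character R z) (character w).
  by rewrite gram -hs.
have [V uV hV] := unitary_iso_of_total LU (L2_character s) hs' tot (characters_total (s0 : s _ = 0%E)).
exists s, V; split => // z.
have bc : bounded_op s (fun f t => character z t * f t).
  have mid : measurable_fun setT (id : dual -> dual) by exact: measurable_id.
  have bc := character_bounded_op s z mid.
  exact: bc.
apply: (unitary_intertwine (e := fun w => koopman S w k) uV (koopman_bounded_op sS z) bc LU tot).
move=> w.
move: (unitary_ae uV (koopman_L2 sS z (LU w)) (LU (w + z)) (koopmanD sS w z k)) (hV w) (hV (w + z)).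
by apply: filterS3 => t -> -> ->; rewrite characterD mulrC.
Qed.

End SpectralModel.

(** * Functions in a cyclic subspace *)

Lemma measurable_inv {R : realType} : measurable_fun setT (fun x : measurableTypeR R => x^-1 : measurableTypeR R).
Proof.
have m0 : measurable [set 0 : measurableTypeR R] by exact: measurable_set1.
rewrite -(setvU [set 0]).
apply/measurable_funU => //; first exact: measurableC.
split; last exact: measurable_fun_set1.
apply: open_continuous_measurable_fun; first by apply: closed_openC; exact: closed_eq.
by move=> x; rewrite inE => /= /eqP x0; exact: inv_continuous.
Qed.

Section AlmostEverywhereConvergence.
Context {R : realType} {d : measure_display} {A : measurableType d}.
Variable mu : {measure set A -> \bar R}.

(** The sum of the [4 ^+ n * |f_ n - f|^2] is integrable, so its terms are bounded almost everywhere
    and the squared distances decay like [4^-1 ^+ n]. *)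
Lemma fast_cvg_ae (f_ : nat -> A -> R[i]) f : (forall n, L2 mu (f_ n)) -> L2 mu f ->
  (forall n, nrm2 mu (fun x => f_ n x - f x) <= 8^-1 ^+ n) ->
  {ae mu, forall x, (fun n => sqnormC (f_ n x - f x)) @ \oo --> (0 : R)}.
Proof.
move=> Lf_ Lf hf.
have LB n : L2 mu (fun x => f_ n x - f x) by exact: L2B.
pose D n x := (4 ^+ n * sqnormC (f_ n x - f x))%:E.
have mD n : measurable_fun setT (D n).
  apply/measurable_EFinP; apply: measurable_funM => //.
  by apply: measurable_sqnormC; case: (LB n).
have D0 n x : (0 <= D n x)%E by rewrite lee_fin mulr_ge0 ?exprn_ge0 ?sqnormC_ge0.
have iD : mu.-integrable setT (fun x => \sum_(n <oo) D n x)%E.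
  apply/integrableP; split; first by apply: ge0_emeasurable_sum => // *; exact: D0.
  under eq_integral do rewrite gee0_abs ?nneseries_ge0//.
  rewrite integral_nneseries//; apply: (@le_lt_trans _ _ 2%:E); last by rewrite ltry.
  apply: lime_le.
    by apply: is_cvg_ereal_nneg_natsum_cond => k _ _; apply: integral_ge0.
  apply: nearW => N; apply: (@le_trans _ _ (\sum_(0 <= k < N) (geometric 1 2^-1 k)%:E)%E).
    apply: lee_sum => n _.
    under eq_integral do rewrite /D EFinM.
    rewrite ge0_integralZl//; last 2 first.
    - by apply: measurable_sqnormCE; case: (LB n).
    - by move=> x _; rewrite lee_fin sqnormC_ge0.
    rewrite -/(sqnorm mu (fun x => f_ n x - f x)) L2_sqnormE// -EFinM lee_fin.
    apply: (le_trans (ler_wpM2l _ (hf n))); first by rewrite exprn_ge0.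
    by rewrite /= mul1r -exprMn (_ : 4 * 8^-1 = 2^-1 :> R)//; field.
  rewrite sumEFin lee_fin.
  have h2 : 0 < 2^-1 :> R by lra.
  have h3 : `|2^-1| < 1 :> R by rewrite ger0_norm; lra.
  rewrite (le_trans (geometric_le_lim N ler01 h2 h3))//.
  by rewrite (_ : 1 - 2^-1 = 2^-1 :> R) ?invrK ?mul1r//; lra.
have := integrable_ae measurableT iD; apply: aeS => x /(_ Logic.I) fx.
have [M hM] : exists M : R, forall n, 4 ^+ n * sqnormC (f_ n x - f x) <= M.
  exists (fine (\sum_(n <oo) D n x)%E) => n; rewrite -lee_fin fineK//.
  rewrite -/(D n x); apply: le_trans (nneseries_lim_ge n.+1 _); last by move=> k _ _; exact: D0.
  by rewrite big_nat_recr//= leeDr// sume_ge0// => k _; exact: D0.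
apply: (@squeeze_cvgr _ _ _ _ (cst 0) (fun n => M * 4^-1 ^+ n)).
- apply: nearW => n; rewrite sqnormC_ge0/= exprVn ler_pdivlMr ?exprn_gt0// mulrC; exact: hM.
- exact: cvg_cst.
- by apply: cvg_geometric; rewrite ger0_norm ?invr_ge0// invf_lt1// ltr1n.
Qed.

End AlmostEverywhereConvergence.

Section CyclicModel.
Context {R : realType} {d : measure_display} {B : measurableType d}.
Local Notation dual := (measurableTypeR R * measurableTypeR R)%type.
Variables (P : probability B R) (tau : B -> dual).
Hypothesis mtau : measurable_fun setT tau.

Lemma L2_character_comp z H : L2 P H -> L2 P (fun t => character z (tau t) * H t).
Proof. by case: (character_bounded_op P z mtau) => + _ _; apply. Qed.

(** [F] is a fast limit of products [g n (tau t) * H t] with trigonometric polynomials [g n]. Where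
    [H] is not 0, [g n (tau t)] converges to the quotient of [F] by [H]; where [H] is 0, so is
    [F]. *)
Lemma cyclic_span_factor H F : L2 P H ->
  closed_span P (range (fun z t => character z (tau t) * H t)) F ->
  exists2 G : dual -> R[i], cmeasurable G & {ae P, forall t, F t = G (tau t) * H t}.
Proof.
move=> LH CF; have Le z := L2_character_comp z LH.
have [LF hF] : L2 P F /\ forall eps : R, 0 < eps -> exists s,
    nrm2 P (fun t => F t - comb (fun z t => character z (tau t) * H t) s t) < eps.
  by apply/closed_spanP.
have /choice[s_ hs] n : exists s, nrm2 P (fun t => F t - comb (fun z t => character z (tau t) * H t) s t) < 8^-1 ^+ n.
  by apply: hF; exact: pow8_gt0.
pose g n := comb (@character R) (s_ n).
have mg n : cmeasurable (g n).
  by apply: cmeasurable_sum => p; apply: cmeasurableZ; exact: cmeasurable_character.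
(* Convergence is known only at [tau t] for almost every [t]. The upper limit is defined and
   measurable everywhere, and agrees with the limit where there is one. *)
pose L (u : nat -> R) := fine (limn_esup (fun n => (u n)%:E)).
pose G t := L (fun n => cRe (g n t)) +i* L (fun n => cIm (g n t)).
have mL (u : nat -> dual -> R) : (forall n, measurable_fun setT (u n)) ->
    measurable_fun setT (fun t => L (fun n => u n t)).
  move=> mu; apply: (measurableT_comp (f := fine)); first exact: fine_measurable.
  apply: measurable_fun_limn_esup => n; apply/measurable_EFinP; exact: mu.
have LE (u : nat -> R) l : u @ \oo --> l -> L u = l.
  move=> ul; rewrite /L.
  have ul' : (fun n => (u n)%:E) @ \oo --> l%:E by apply: cvg_EFin => //; exact: nearW.
  by have [_ ->] := cvg_limn_einf_sup ul'.
exists G.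
  by split; [apply: (mL (fun n t => cRe (g n t)))|apply: (mL (fun n t => cIm (g n t)))] => n; case: (mg n).
have Lc n : L2 P (comb (fun z t => character z (tau t) * H t) (s_ n)) by exact: L2_comb.
have small n : nrm2 P (fun t => comb (fun z t => character z (tau t) * H t) (s_ n) t - F t) <= 8^-1 ^+ n.
  by rewrite nrm2_sym; exact: ltW.
have := fast_cvg_ae Lc LF small; apply: aeS => t.
have -> : (fun n => sqnormC (comb (fun z t => character z (tau t) * H t) (s_ n) t - F t)) =
    (fun n => sqnormC (g n (tau t) * H t - F t)).
  apply/funext => n; congr (sqnormC (_ - _)); rewrite /g /comb mulr_suml.
  by apply: eq_bigr => p _; rewrite mulrA.
move=> h; have [H0|H0] := eqVneq (H t) 0.
  rewrite H0 mulr0; apply/eqP; rewrite -sqnormC_eq0; apply/eqP.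
  apply: (@cvg_unique _ (@norm_hausdorff R R^o) (cst (sqnormC (F t)) @ \oo)); first exact: cvg_cst.
  by move: h; rewrite H0; under eq_fun do rewrite mulr0 sub0r sqnormCN.
have sH : 0 < sqnormC (H t) by rewrite lt_def sqnormC_ge0 sqnormC_eq0 H0.
have hq : (fun n => sqnormC (g n (tau t) - F t / H t)) @ \oo --> (0 : R).
  have -> : (fun n => sqnormC (g n (tau t) - F t / H t)) =
      (fun n => sqnormC (g n (tau t) * H t - F t) * (sqnormC (H t))^-1).
    apply/funext => n; apply: (mulIf (lt0r_neq0 sH)).
    by rewrite mulfVK ?lt0r_neq0// -sqnormCM mulrBl mulfVK.
  by rewrite -[X in _ --> X](mul0r (sqnormC (H t))^-1); apply: cvgMl.
have comp (f : R[i] -> R) : (forall z w, f (z - w) = f z - f w) ->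
    (forall z, f z ^+ 2 <= sqnormC z) -> (fun n => f (g n (tau t))) @ \oo --> f (F t / H t).
  move=> fB fS; apply/cvgrPdist_lt => e e0.
  have e2 : 0 < e ^+ 2 by rewrite exprn_gt0.
  have := hq; move/cvgrPdist_lt => /(_ _ e2); apply: filterS => n.
  rewrite sub0r normrN (ger0_norm (sqnormC_ge0 _)) => hn.
  rewrite distrC -fB -(ltr_pXn2r (n := 2))// ?nnegrE ?normr_ge0 ?ltW//.
  by rewrite real_normK ?num_real// (le_lt_trans (fS _)).
have h1 := comp (@cRe R) (fun z w => etrans (cReD _ _) (congr1 _ (cReN w))) (@sqr_cRe_le R).
have h2 := comp (@cIm R) (fun z w => etrans (cImD _ _) (congr1 _ (cImN w))) (@sqr_cIm_le R).
have -> : G (tau t) = F t / H t by apply: ceqP => /=; exact: LE.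
by rewrite mulfVK.
Qed.

End CyclicModel.

(** * Addition on the torus *)

Section UnitaryMore.
Context {R : realType} {d d' : measure_display} {A : measurableType d} {B : measurableType d'}.
Variables (mu : {measure set A -> \bar R}) (nu : {measure set B -> \bar R}).
Variable V : (A -> R[i]) -> B -> R[i].
Hypothesis uV : unitary_iso mu nu V.

Lemma unitary0 : {ae nu, forall y, V (cst 0) y = 0}.
Proof.
have L0 := @L2_0 _ _ _ mu.
apply: (nrm2_eq0 (unitary_L2 uV L0)); rewrite (unitary_nrm2 uV L0).
by apply: nrm2_ae0; [case: L0|exact: aeW].
Qed.

Lemma unitaryZ c f : L2 mu f -> {ae nu, forall y, V (fun x => c * f x) y = c * V f y}.
Proof.
move=> Lf; have := unitary_lin uV c Lf (@L2_0 _ _ _ mu).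
rewrite (_ : (fun x => c * f x + cst 0 x) = (fun x => c * f x)); last first.
  by apply/funext => x; rewrite /cst addr0.
by move: unitary0; apply: filterS2 => y -> ->; rewrite addr0.
Qed.

Lemma unitary_surj F : L2 nu F -> exists2 f, L2 mu f & {ae nu, forall y, V f y = F y}.
Proof. by case: uV => _ _; apply. Qed.

Lemma unitary_inner f g : L2 mu f -> L2 mu g -> inner nu (V f) (V g) = inner mu f g.
Proof. by case: uV => _ + _; apply. Qed.

Lemma unitary_preimage_closed C : closed_subspace nu C ->
  closed_subspace mu [set f | L2 mu f /\ C (V f)].
Proof.
move=> cC; have [CL C0 Clin Ccl] := cC; split.
- by move=> f [].
- split; first exact: L2_0.
  apply: (closed_subspace_ae cC C0); first by case: (unitary_L2 uV (@L2_0 _ _ _ mu)).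
  by apply: aeS unitary0 => y ->.
- move=> c f g [Lf Cf] [Lg Cg]; split; first exact: L2lin.
  apply: (closed_subspace_ae cC (Clin c _ _ Cf Cg)).
    by case: (unitary_L2 uV (L2lin c Lf Lg)).
  by apply: aeS (unitary_lin uV c Lf Lg) => y ->.
- move=> f Lf h; split => //; apply: Ccl; first exact: (unitary_L2 uV).
  move=> e e0; have [g [Lg Cg] fg] := h e e0; exists (V g) => //.
  by rewrite (unitary_nrm2B uV).
Qed.

End UnitaryMore.

Section Torus.
Context {R : realType}.
Local Notation dual := (measurableTypeR R * measurableTypeR R)%type.
Local Notation square := (`[0%R, 1%R[%classic `*` `[0%R, 1%R[%classic : set dual).

(** One subtraction suffices: the arguments are sums of two numbers of [[0, 1[]. *)
Definition fract (x : R) : R := if x < 1 then x else x - 1.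

Definition tadd (t u : dual) : dual := (fract (t.1 + u.1), fract (t.2 + u.2)).

Definition tzero : dual := (0, 0).

Lemma squareP t : square t <-> (0 <= t.1 < 1) /\ (0 <= t.2 < 1).
Proof. by split => -[h1 h2]; split; move: h1 h2; rewrite /= ?in_itv /=. Qed.

Lemma taddC t u : tadd t u = tadd u t.
Proof. by rewrite /tadd addrC [t.2 + _]addrC. Qed.

Lemma tadd_square t u : square t -> square u -> square (tadd t u).
Proof.
move=> /squareP[t1 t2] /squareP[u1 u2]; apply/squareP; rewrite /tadd /fract /=.
by split; case: ltP; lra.
Qed.

Lemma tadd00 : tadd tzero tzero = tzero.
Proof. by rewrite /tadd /fract /= addr0 ltr01. Qed.

Lemma character_tadd z t u : character z (tadd t u) = character z t * character z u.
Proof.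
rewrite !characterE -cisD /tadd /=.
have h (k : int) (x y : R) : cis (k%:~R * fract (x + y)) = cis (k%:~R * x + k%:~R * y).
  rewrite /fract -mulrDr; case: ifP => // _.
  by rewrite mulrBr mulr1 -[RHS]mulr1 -(cis_int (- k)) -cisD mulrNz.
rewrite [LHS]cisD; transitivity (cis (z.1%:~R * t.1 + z.1%:~R * u.1) * cis (z.2%:~R * t.2 + z.2%:~R * u.2)).
  by congr (_ * _); exact: h.
by rewrite -cisD; congr cis; ring.
Qed.

Lemma measurable_fract : measurable_fun setT (fract : measurableTypeR R -> measurableTypeR R).
Proof.
apply: measurable_fun_ifT => //; first exact: measurable_fun_ltr.
exact: measurable_funB.
Qed.

Lemma measurable_tadd d (A : measurableType d) (f g : A -> dual) :
  measurable_fun setT f -> measurable_fun setT g -> measurable_fun setT (fun x => tadd (f x) (g x)).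
Proof.
move=> mf mg; apply: measurable_fun_pair; apply: measurableT_comp measurable_fract _.
  by apply: measurable_funD; exact: (measurableT_comp measurable_fst).
by apply: measurable_funD; exact: (measurableT_comp measurable_snd).
Qed.

Lemma character_fixed t : square t -> (forall z, character z t = 1) -> t = tzero.
Proof.
move=> /squareP[t1 t2] h; case: t t1 t2 h => x y /= x1 y1 h.
have c (u : R) : 0 <= u < 1 -> cis u = 1 -> u = 0.
  move=> /andP[u0 u1] cu; apply/eqP; apply: contraT => un0.
  have : cis u != 1 by apply: cis_neq1; rewrite normr_gt0 un0 ger0_norm.
  by rewrite cu eqxx.
congr pair; apply: c => //.
  by have := h (1, 0); rewrite characterE /= mul1r mul0r addr0.
by have := h (0, 1); rewrite characterE /= mul1r mul0r add0r.
Qed.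

Lemma measurable_point (t : dual) : measurable [set t].
Proof.
rewrite (_ : [set t] = [set t.1] `*` [set t.2]).
  by apply: measurableX; exact: measurable_set1.
by case: t => t1 t2; apply/seteqP; split => [t -> //|[x y] [/= -> ->]//].
Qed.

Lemma measurable_tzero : measurable [set tzero].
Proof. exact: measurable_point. Qed.

Section Invariant.
Context {d : measure_display} {B : measurableType d} (P : probability B R) (tau : B -> dual).
Hypothesis sq : {ae P, forall t, square (tau t)}.

(** Where [F] is not 0 the two coordinate characters are 1 at [tau t], hence all characters are, and
    only the origin of the square has this property. *)
Lemma invariant_vanishes F : (forall z, {ae P, forall t, character z (tau t) * F t = F t}) ->
  {ae P, forall t, tau t <> tzero -> F t = 0}.
Proof.
move=> h; move: (h (1, 0)) (h (0, 1)) sq.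
apply: filterS3 => t h1 h2 sqt nz; apply/eqP; apply: contraT => F0; exfalso; apply: nz.
have one z : character z (tau t) * F t = F t -> character z (tau t) = 1.
  by rewrite -{2}[F t]mul1r => /(mulIf F0).
have h10 := one _ h1; have h01 := one _ h2.
apply: character_fixed => // z; move: h10 h01; rewrite !characterE /= !mul1r !mul0r addr0 add0r => c1 c2.
have c k u : cis u = 1 -> cis (k%:~R * u) = 1.
  move=> cu; case: k => m; first by rewrite cis_nat cu expr1n.
  have := cisN (m.+1%:R * u); rewrite cis_nat cu expr1n mulr1.
  by rewrite NegzE mulrNz mulNr.
by rewrite cisD !c// mulr1.
Qed.

End Invariant.

Section PointMass.
Context {dB : measure_display} {B : measurableType dB}.
Variables (s : probability B R) (o : B).
Hypothesis mo : measurable [set o].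

Lemma inner_point F G : L2 s F -> L2 s G -> {ae s, forall t, t <> o -> F t = 0} ->
  inner s F G = F o * (G o)^* * (fine (s [set o]))%:C.
Proof.
move=> LF LG F0; pose e t : R[i] := (\1_[set o] t)%:C.
have Le : L2 s e by apply: L2_indic; exact: mo.
have e0 : e o = 1 by rewrite /e indicE mem_set.
have en t : t <> o -> e t = 0 by move=> h; rewrite /e indicE memNset.
rewrite (eq_inner LF (L2Z (F o) Le) LG LG _ (aeW _ (fun=> erefl))); last first.
  apply: aeS F0 => t h; case: (pselect (t = o)) => [->|tn]; first by rewrite e0 mulr1.
  by rewrite h// en// mulr0.
rewrite innerZl// -mulrA; congr (_ * _).
have -> : inner s e G = inner s e (fun t => G o * e t).
  congr cintegral; apply/funext => t; case: (pselect (t = o)) => [->|tn]; first by rewrite e0 mulr1.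
  by rewrite en// !mul0r.
rewrite innerZr// inner_norm//; congr (_ * _%:C).
rewrite /nrm2 /sqnorm; congr fine.
transitivity (\int[s]_t (\1_[set o] t)%:E)%E; last first.
  by rewrite integral_indic ?setIT//; exact: mo.
by apply: eq_integral => t _; rewrite /e sqnormC_real indicE; case: (_ \in _); rewrite ?expr1n ?expr0n.
Qed.

End PointMass.

Section TwoPoint.
Variable s : probability dual R.

Lemma ae_fst_snd_zero : {ae s, forall t, square t} ->
  {ae product_probability s s, forall p, square p.1 /\ square p.2}.
Proof.
move=> sq; move: (ae_product_fst s sq) (ae_product_snd s sq).
by apply: filterS2.
Qed.

End TwoPoint.

End Torus.

Section TensorModels.
Context {R : realType}.

Definition swap {T : Type} (p : T * T) := (p.2, p.1).

Lemma swap_bounded_op d' (A : measurableType d') (P : probability A R) :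
  bounded_op (product_probability P P) (fun F => F \o swap).
Proof.
split; [|by []|exists 1].
  by move=> F; exact: (transports_L2 (transports_swap P P)).
by move=> F LF; rewrite mul1r (transports_nrm2 (transports_swap P P) LF.1).
Qed.

Lemma tensor_span_total d1 d2 (A : measurableType d1) (B : measurableType d2)
    (P : probability A R) (Q : probability B R) :
  let I := {p : (A -> R[i]) * (B -> R[i]) | L2 P p.1 /\ L2 Q p.2} in
  let e (i : I) := tensor (sval i).1 (sval i).2 in
  (forall i, L2 (product_probability P Q) (e i)) /\
  L2 (product_probability P Q) `<=` closed_span (product_probability P Q) (range e).
Proof.
move=> I e; have Le i : L2 (product_probability P Q) (e i).
  by case: i => -[f g] [Lf Lg]; exact: L2_tensor.
split => //; apply: tensor_total; first exact: closed_span_closed.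
move=> f g Lf Lg; exact: (closed_span_sub (exist _ (f, g) (conj Lf Lg) : I) Le).
Qed.

(** On tensors the two characters multiply, and a product of values at two points is the value at
    their sum in the torus; tensors are total. *)
Lemma tensor_intertwines d1 d2 d3 d4 (X : measurableType d1) (Y : measurableType d2)
    (B : measurableType d3) (C : measurableType d4) (mu : probability X R) (nu : probability Y R)
    (P : probability B R) (Q : probability C R) S T tau theta V W :
  system mu S -> system nu T -> measurable_fun setT tau -> measurable_fun setT theta ->
  unitary_iso mu P V -> unitary_iso nu Q W -> intertwines mu S P tau V -> intertwines nu T Q theta W ->
  exists VW, [/\ unitary_iso (product_probability mu nu) (product_probability P Q) VW,
    intertwines (product_probability mu nu) (product_action S T) (product_probability P Q)
      (fun p => tadd (tau p.1) (theta p.2)) VW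
  & forall f g, L2 mu f -> L2 nu g ->
      {ae product_probability P Q, forall p, VW (tensor f g) p = tensor (V f) (W g) p}].
Proof.
move=> sS sT mtau mtheta uV uW iV iW; have [VW uVW tVW] := tensor_unitary uV uW.
have [Le tot] := tensor_span_total mu nu.
have msum : measurable_fun setT (fun p => tadd (tau p.1) (theta p.2)).
  by apply: measurable_tadd; [exact: (measurableT_comp mtau measurable_fst)|exact: (measurableT_comp mtheta measurable_snd)].
exists VW; split => // z; have bc := character_bounded_op (product_probability P Q) z msum.
apply: (unitary_intertwine uVW (koopman_bounded_op (system_product sS sT) z) bc Le tot) => -[[f g] [/= Lf Lg]].
have h := tVW _ _ (koopman_L2 sS z Lf) (koopman_L2 sT z Lg).
move: (ae_product_fst Q (iV z _ Lf)) (ae_product_snd P (iW z _ Lg)) => h1 h2.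
have h12 : {ae product_probability P Q, forall p,
    V (koopman S z f) p.1 = character z (tau p.1) * V f p.1 /\
    W (koopman T z g) p.2 = character z (theta p.2) * W g p.2}.
  by move: h1 h2; apply: filterS2.
move: h h12 (tVW _ _ Lf Lg); apply: filterS3 => p hp [h3 h4] h5.
transitivity (tensor (V (koopman S z f)) (W (koopman T z g)) p); first exact: hp.
by rewrite /tensor h3 h4 character_tadd h5 /tensor; ring.
Qed.

End TensorModels.

Section ModelFacts.
Context {R : realType} {d : measure_display} {X : measurableType d}.
Local Notation dual := (measurableTypeR R * measurableTypeR R)%type.
Local Notation square := (`[0%R, 1%R[%classic `*` `[0%R, 1%R[%classic : set dual).
Variables (mu : probability X R) (S : int * int -> X -> X).
Variables (s : probability dual R) (V : (X -> R[i]) -> dual -> R[i]).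
Hypothesis sS : system mu S.
Hypothesis s_square : s (~` square) = 0%E.
Hypothesis uV : unitary_iso mu s V.
Hypothesis iV : intertwines mu S s id V.
Local Notation tzero := (@tzero R).

Let sq : {ae s, forall t, square t}. Proof. exact: ae_square. Qed.
Let L1 : L2 mu (cst 1). Proof. exact: L2_cst. Qed.
Let v := V (cst 1).
Let Lv : L2 s v. Proof. exact: (unitary_L2 uV). Qed.

Lemma model_one_support : {ae s, forall t, t <> tzero -> v t = 0}.
Proof.
apply: (invariant_vanishes (tau := id) sq) => z.
by move: (iV z L1); apply: aeS => t h; rewrite -[LHS]h.
Qed.

(** The constant 1 is an invariant unit vector, so its model lives at the origin. The spectral
    measure therefore has an atom there. *)
Lemma model_one_mass : v tzero * (v tzero)^* * (fine (s [set tzero]))%:C = 1.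
Proof.
rewrite -(inner_point measurable_tzero Lv Lv model_one_support).
by case: uV => _ -> //; rewrite probability_inner1.
Qed.

Lemma model_zero_gt0 : 0 < fine (s [set tzero]).
Proof.
rewrite lt_def fine_ge0// andbT; apply/eqP => h; have := model_one_mass.
by rewrite h mulr0 => /eqP; rewrite eq_sym oner_eq0.
Qed.

(** Weak operator convergence is read on the vector modelled by 1. [Theta] becomes the restriction
    to the origin, because the model of the constants is carried by that atom. [Op] stands for the
    identity or for a Koopman operator. *)
Lemma model_weak_limit (w : nat -> int * int) z0 (b : R) (Op : (X -> R[i]) -> X -> R[i]) :
  (forall f, L2 mu f -> L2 mu (Op f)) ->
  (forall f, L2 mu f -> {ae s, forall t, V (Op f) t = character z0 t * V f t}) ->
  weak_operator_cvg mu (fun i => koopman S (w i))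
    (fun f x => b%:C * Op f x + (1 - b)%:C * Theta mu f x) ->
  weakly_cvg s (fun i => character (w i))
    (fun t => b%:C * character z0 t + (1 - b)%:C * (\1_[set tzero] t)%:C).
Proof.
move=> LOp hOp hw G LG e e0.
have surj F : L2 s F -> exists2 f, L2 mu f & {ae s, forall t, V f t = F t} by case: uV => _ _; exact.
have [g Lg Vg] := surj _ LG; have [f Lf Vf] := surj _ (L2_cst s 1).
apply: filterS (cvg_sqnormC (hw f g Lf Lg) e0) => n.
have LVf := unitary_L2 uV Lf; have LVg := unitary_L2 uV Lg.
have inn h k : L2 mu h -> L2 mu k -> inner s (V h) (V k) = inner mu h k by case: uV => _ + _; exact.
have E1 : inner mu (koopman S (w n) f) g = inner s (character (w n)) G.
  rewrite -inn//; last exact: koopman_L2.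
  apply: eq_inner => //; [exact/(unitary_L2 uV)/koopman_L2|exact: L2_character|].
  by move: (iV (w n) Lf) Vf; apply: filterS2 => t -> ->; rewrite mulr1.
have E2 : inner mu (fun x => b%:C * Op f x + (1 - b)%:C * Theta mu f x) g =
   inner s (fun t => b%:C * character z0 t + (1 - b)%:C * (\1_[set tzero] t)%:C) G.
  have LT : L2 mu (Theta mu f) by exact: L2_cst.
  have Li : L2 s (fun t => (\1_[set tzero] t)%:C) by apply: L2_indic; exact: measurable_tzero.
  have LO := LOp _ Lf; have Lc : L2 s (character z0) by exact: L2_character.
  rewrite innerDl//; [|exact: L2Z|exact: L2Z].
  rewrite [RHS]innerDl//; [|exact: L2Z|exact: L2Z].
  rewrite !innerZl//; congr (_ * _ + _ * _).
    rewrite -inn//; apply: eq_inner => //; first exact: (unitary_L2 uV).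
    by move: (hOp f Lf) Vf; apply: filterS2 => t -> ->; rewrite mulr1.
  have -> : inner mu (Theta mu f) g = inner mu f (cst 1) * inner mu (cst 1) g.
    rewrite -innerZl//; congr inner; apply/funext => x; by rewrite /Theta /cst mulr1.
  have -> : inner mu f (cst 1) = inner s (cst 1) v.
    by rewrite -inn//; apply: eq_inner => //; [exact: L2_cst|exact: aeW].
  have -> : inner mu (cst 1) g = inner s v G.
    by rewrite -inn//; apply: eq_inner => //; exact: aeW.
  rewrite (innerJ Lv (L2_cst s 1)) (inner_point measurable_tzero Lv (L2_cst s 1) model_one_support).
  rewrite (inner_point measurable_tzero Lv LG model_one_support) [RHS](inner_point measurable_tzero Li LG); last first.
    by apply: aeW => t h; rewrite indicE memNset.
  have -> : ((\1_[set tzero] tzero)%:C : R[i]) = 1 by rewrite indicE mem_set.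
  have -> : (cst 1 tzero : R[i])^* = 1 by rewrite /cst rmorph1.
  have cM (z y : R[i]) : (z * y)^* = z^* * y^* by rewrite rmorphM.
  have := model_one_mass; rewrite mulr1 cM mul1r.
  have -> : ((fine (s [set tzero]))%:C)^* = (fine (s [set tzero]))%:C :> R[i].
    by apply: ceqP; rewrite cE /= ?oppr0.
  move: (v tzero) ((v tzero)^*) (_%:C) => a a' c aac.
  move: ((G tzero)^*) => g'; rewrite -[RHS]mul1r -aac !mulrA; congr (_ * _).
  by rewrite mulrAC mulrC !mulrA.
by rewrite E1 E2.
Qed.

Section Square.
Hypothesis eS : forall z, z != 0 -> ergodic (product_probability mu mu) (product_action S S z).
Local Notation mu2 := (product_probability mu mu).
Local Notation s2 := (product_probability s s).

Let sS2 : system mu2 (product_action S S). Proof. exact: system_product. Qed.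

Let sq2 : {ae s2, forall p, square (tadd p.1 p.2)}.
Proof. by apply: aeS (ae_fst_snd_zero sq) => p [h1 h2]; exact: tadd_square. Qed.

Let msum : measurable_fun setT (fun p : dual * dual => tadd p.1 p.2).
Proof. by apply: measurable_tadd; [exact: measurable_fst|exact: measurable_snd]. Qed.

(** The model of the square commutes with the swap, so symmetric functions correspond to symmetric
    functions. *)
Lemma square_model : exists V2, [/\ unitary_iso mu2 s2 V2,
  intertwines mu2 (product_action S S) s2 (fun p => tadd p.1 p.2) V2,
  forall f g, L2 mu f -> L2 mu g -> {ae s2, forall p, V2 (tensor f g) p = tensor (V f) (V g) p}
  & forall F, L2 mu2 F -> {ae s2, forall p, V2 (F \o swap) p = V2 F (swap p)}].
Proof.
have mid : measurable_fun setT (id : dual -> dual) by exact: measurable_id.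
have [V2 [uV2 iV2 tV2]] := tensor_intertwines sS sS mid mid uV uV iV iV.
have [Le tot] := tensor_span_total mu mu.
exists V2; split => //.
have bs := swap_bounded_op s; have bm := swap_bounded_op mu.
  apply: (unitary_intertwine uV2 bm bs Le tot) => -[[f g] [/= Lf Lg]].
  move: (tV2 _ _ Lg Lf) (transports_ae (transports_swap s s) (tV2 _ _ Lf Lg)).
  apply: filterS2 => p h1 h2; rewrite -[RHS]/(V2 (tensor f g) (swap p)) h2.
  rewrite (_ : tensor f g \o swap = tensor g f); last by apply/funext => q; rewrite /tensor /= mulrC.
  by rewrite h1 /tensor /= mulrC.
Qed.

Lemma square_one_support V2 : unitary_iso mu2 s2 V2 ->
  intertwines mu2 (product_action S S) s2 (fun p => tadd p.1 p.2) V2 ->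
  (forall f g, L2 mu f -> L2 mu g -> {ae s2, forall p, V2 (tensor f g) p = tensor (V f) (V g) p}) ->
  {ae s2, forall p, p <> (tzero, tzero) -> V2 (cst 1) p = 0}.
Proof.
move=> uV2 iV2 tV2; move: (tV2 _ _ L1 L1) (ae_product_fst s model_one_support) (ae_product_snd s model_one_support).
rewrite (_ : tensor (cst 1) (cst 1) = cst 1); last by apply/funext => p; rewrite /tensor /cst mulr1.
apply: filterS3 => -[x y] -> /= h1 h2 nz; rewrite /tensor /=.
rewrite -/v; case: (pselect (x = tzero)) => [x0|xn]; last by rewrite h1// mul0r.
by rewrite h2 ?mulr0// => y0; apply: nz; rewrite x0 y0.
Qed.

(** Characters are 1 at the origin, so the indicator of [E] is the model of an invariant function.
    By ergodicity that function is constant, and the model of a constant vanishes on [E]. *)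
Lemma sum_zero_only : {ae s2, forall p, tadd p.1 p.2 = tzero -> p = (tzero, tzero)}.
Proof.
have [V2 [uV2 iV2 tV2 _]] := square_model.
have m00 : measurable [set (tzero, tzero)].
  rewrite (_ : [set _] = [set tzero] `*` [set tzero]).
    by apply: measurableX; exact: measurable_tzero.
  by apply/seteqP; split => [t -> //|[x y] [/= -> ->]].
pose E := ((fun p : dual * dual => tadd p.1 p.2) @^-1` [set tzero]) `\` [set (tzero, tzero)].
have mE : measurable E.
  apply: measurableD => //; rewrite -[X in measurable X]setTI; apply: msum => //.
  exact: measurable_tzero.
pose F p : R[i] := (\1_E p)%:C.
have LF : L2 s2 F by exact: L2_indic.
have [f Lf Vf] : exists2 f, L2 mu2 f & {ae s2, forall p, V2 f p = F p} by case: uV2 => _ _; exact.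
have finv : {ae mu2, forall p, f p = inner mu2 f (cst 1)}.
  have n10 : ((1, 0) : int * int) != 0 by [].
  apply: (ergodic_const (koopman_transports sS2 (1, 0)) (eS n10) Lf).
  apply: (unitary_inj uV2 (koopman_L2 sS2 _ Lf) Lf).
  move: (iV2 (1, 0) f Lf) Vf; apply: filterS2 => p -> ->.
  rewrite /F indicE; have [pE|] := boolP (p \in E); last by rewrite mulr0.
  have [/= -> _] := set_mem pE.
  by rewrite character_at0 mul1r.
have L1' : L2 mu2 (cst 1) by exact: L2_cst.
have h1 : {ae s2, forall p, V2 f p = inner mu2 f (cst 1) * V2 (cst 1) p}.
  have Lc : L2 mu2 (fun p => inner mu2 f (cst 1) * cst 1 p) by exact: L2Z.
  have e1 : {ae mu2, forall p, f p = inner mu2 f (cst 1) * cst 1 p}.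
    by apply: aeS finv => p {1}->; rewrite /cst mulr1.
  by move: (unitary_ae uV2 Lf Lc e1) (unitaryZ uV2 (inner mu2 f (cst 1)) L1'); apply: filterS2 => p -> ->.
move: h1 (square_one_support uV2 iV2 tV2) Vf; apply: filterS3 => p h2 h3 h4 p0.
apply: contrapT => pn; have : F p = 0 by rewrite -h4 h2 h3// mulr0.
rewrite /F indicE mem_set; last by split.
by move/eqP; rewrite /= -[_%:C]/(1 : R[i]) oner_eq0.
Qed.

(** An atom yields an eigenfunction [f], and [f x] times the conjugate of [f y] is invariant, hence
    equal to its mean. That mean is 0 because [f] is orthogonal to the constants. *)
Lemma point_mass_zero t0 : t0 <> tzero -> s [set t0] = 0%E.
Proof.
move=> t0n; pose F t : R[i] := (\1_[set t0] t)%:C.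
have LF : L2 s F by apply: L2_indic; exact: measurable_point.
have [f Lf Vf] := unitary_surj uV LF.
have ef z : {ae mu, forall x, koopman S z f x = character z t0 * f x}.
  apply: (unitary_inj uV (koopman_L2 sS z Lf) (L2Z _ Lf)).
  move: (iV z Lf) (unitaryZ uV (character z t0) Lf) Vf; apply: filterS3 => t -> -> ->.
  rewrite /F indicE; have [/set_mem/= ->//|_] := boolP (t \in _).
  by rewrite !mulr0.
have Lfb := L2J Lf.
pose g := tensor f (fun x => (f x)^*).
have Lg : L2 mu2 g by exact: L2_tensor.
have n10 : ((1, 0) : int * int) != 0 by [].
have gc : {ae mu2, forall p, g p = inner mu2 g (cst 1)}.
  apply: (ergodic_const (koopman_transports sS2 (1, 0)) (eS n10) Lg).
  move: (ae_product_fst mu (ef (1, 0))) (ae_product_snd mu (ef (1, 0))); apply: filterS2 => p.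
  rewrite /koopman /g /tensor /= => -> ->; rewrite rmorphM mulrACA mulcJ sqnormC_character.
  by rewrite mul1r.
have f1 : inner mu f (cst 1) = 0.
  rewrite -(unitary_inner uV Lf L1) (eq_inner (unitary_L2 uV Lf) LF Lv Lv Vf (aeW _ (fun=> erefl))).
  rewrite (innerJ Lv LF) (inner_point measurable_tzero Lv LF model_one_support) /F indicE memNset; last by move=> /= h; apply: t0n.
  by rewrite conjC0 mulr0 mul0r conjC0.
have g0 : nrm2 mu2 g = 0.
  apply: nrm2_ae0; first by case: Lg.
  apply: aeS gc => p ->; rewrite (_ : cst 1 = tensor (cst 1) (cst 1)); last first.
    by apply/funext => q; rewrite /tensor /cst mulr1.
  by rewrite inner_tensor// f1 mul0r.
have nb : nrm2 mu (fun x => (f x)^*) = nrm2 mu f.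
  by rewrite /nrm2 /sqnorm; congr fine; apply: eq_integral => x _; rewrite sqnormCJ.
have : nrm2 s F = 0.
  rewrite -(eq_nrm2 (unitary_L2 uV Lf).1 LF.1 Vf) (unitary_nrm2 uV Lf).
  by apply/eqP; rewrite -sqrf_eq0 expr2 -{2}nb -nrm2_tensor// -/g g0.
move=> nF; have := nrm2_eq0 LF nF => F0.
have [N [mN N0 sN]] := F0.
apply: (subset_measure0 (measurable_point t0) mN _ N0) => t /= ->; apply: sN => /=.
by rewrite /F indicE mem_set// => /eqP; rewrite -[_%:C]/(1 : R[i]) oner_eq0.
Qed.

(** By Fubini: the section of the diagonal over a point off the origin is that point, which is null.
    The complex function [F] encodes the two real equations of the diagonal. *)
Lemma diagonal_null : {ae s2, forall p, p.1 = p.2 -> p.1 = tzero}.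
Proof.
pose F (p : dual * dual) : R[i] := (p.1.1 - p.2.1) +i* (p.1.2 - p.2.2).
have mF : cmeasurable F.
  split => /=; apply: measurable_funB.
  - exact: (measurableT_comp measurable_fst measurable_fst).
  - exact: (measurableT_comp measurable_fst measurable_snd).
  - exact: (measurableT_comp measurable_snd measurable_fst).
  - exact: (measurableT_comp measurable_snd measurable_snd).
pose D := [set p | F p = 0] `\` (fst @^-1` [set tzero]).
have mD : measurable D.
  apply: measurableD; first exact: measurable_ceq0.
  rewrite -[X in measurable X]setTI; apply: measurable_fst => //; exact: measurable_tzero.
exists D; split => //; last first.
  move=> [[x1 x2] [y1 y2]] /= h; split; last by move=> /= h'; apply: h.
  rewrite /F /=; have [e1|ne] := pselect ((x1, x2) = (y1, y2)); last by exfalso; apply: h.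
  by case: e1 => -> ->; rewrite !subrr.
rewrite -[LHS]/(\int[s]_x (s \o xsection D) x)%E; apply: integral0_eq => x _ /=.
have [->|xn] := pselect (x = tzero).
  rewrite (_ : xsection D tzero = set0) ?measure0//; apply/seteqP; split => // y.
  by rewrite /xsection /= inE => -[_]; apply.
apply: (subset_measure0 (measurable_xsection _ mD) (measurable_point x) _ (point_mass_zero xn)).
move=> y; rewrite /xsection /= inE => -[+ _].
case: x {xn} => x1 x2; case: y => y1 y2 /= /eqP; rewrite eq_complex /= !subr_eq0 => /andP[/eqP -> /eqP ->].
by [].
Qed.

End Square.

End ModelFacts.

(** * Sorted pairs as functions of the sum *)

Section SortedPairs.
Context {R : realType}.
Local Notation dual := (measurableTypeR R * measurableTypeR R)%type.

(** A measurable total order on the dual gives a measurable choice between the two orderings of a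
    pair. *)
Definition lexle (t u : dual) : bool := (t.1 < u.1) || ((t.1 == u.1) && (t.2 <= u.2)).

Definition lexsort (p : dual * dual) : dual * dual := if lexle p.1 p.2 then p else swap p.

Lemma lexle_total t u : lexle t u || lexle u t.
Proof. by rewrite /lexle; case: ltgtP => //= _; case: ltgtP. Qed.

Lemma lexle_anti t u : lexle t u -> lexle u t -> t = u.
Proof.
case: t u => t1 t2 [u1 u2]; rewrite /lexle /=; case: ltgtP => //= -> h1 h2.
by congr pair; apply/le_anti; rewrite h1.
Qed.

Lemma lexle_refl t : lexle t t.
Proof. by rewrite /lexle eqxx lexx orbT. Qed.

Lemma lexsort_swap p : lexsort (swap p) = lexsort p.
Proof.
case: p => t u; rewrite /lexsort /swap /=.
have := lexle_total t u; case: (boolP (lexle t u)) => tu; case: (boolP (lexle u t)) => ut //= _.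
by rewrite (lexle_anti tu ut).
Qed.

Lemma lexsort_cases p : lexsort p = p \/ lexsort p = swap p.
Proof. by rewrite /lexsort; case: ifP; [left|right]. Qed.

Lemma measurable_lexle d (A : measurableType d) (f g : A -> dual) :
  measurable_fun setT f -> measurable_fun setT g -> measurable_fun setT (fun x => lexle (f x) (g x)).
Proof.
move=> mf mg.
have mf1 := measurableT_comp measurable_fst mf; have mf2 := measurableT_comp measurable_snd mf.
have mg1 := measurableT_comp measurable_fst mg; have mg2 := measurableT_comp measurable_snd mg.
apply: measurable_or; first exact: measurable_fun_ltr.
apply: measurable_and; last exact: measurable_fun_ler.
exact: measurable_fun_eqr.
Qed.

Lemma measurable_lexsort : measurable_fun setT lexsort.
Proof.
apply: measurable_fun_ifT => //.
  by apply: measurable_lexle; [exact: measurable_fst|exact: measurable_snd].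
by apply: measurable_fun_pair; [exact: measurable_snd|exact: measurable_fst].
Qed.

End SortedPairs.

Section SquareFactor.
Context {R : realType} {d : measure_display} {X : measurableType d}.
Local Notation dual := (measurableTypeR R * measurableTypeR R)%type.
Local Notation square := (`[0%R, 1%R[%classic `*` `[0%R, 1%R[%classic : set dual).
Variables (mu : probability X R) (S : int * int -> X -> X).
Variables (s : probability dual R) (V : (X -> R[i]) -> dual -> R[i]).
Hypothesis sS : system mu S.
Hypothesis s_square : s (~` square) = 0%E.
Hypothesis uV : unitary_iso mu s V.
Hypothesis iV : intertwines mu S s id V.
Hypothesis eS : forall z, z != 0 -> ergodic (product_probability mu mu) (product_action S S z).
Hypothesis hS2 : symmetric_square_simple_spectrum mu S.
Local Notation tzero := (@tzero R).
Local Notation mu2 := (product_probability mu mu).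
Local Notation s2 := (product_probability s s).
Let sum2 (p : dual * dual) : dual := tadd p.1 p.2.

Let msum : measurable_fun setT sum2.
Proof. by apply: measurable_tadd; [exact: measurable_fst|exact: measurable_snd]. Qed.

Let sq2 : {ae s2, forall p, square p.1 /\ square p.2}.
Proof. by apply: ae_fst_snd_zero; exact: ae_square. Qed.

(** Swap invariance and vanishing at the origin mean that the vector modelled by [F] is symmetric
    and orthogonal to the constants, so it lies in the cyclic space of [h]; [H] is the model of
    [h]. *)
Lemma symmetric_span : exists2 H, L2 s2 H & forall F, L2 s2 F ->
  (forall p, F (swap p) = F p) -> F (tzero, tzero) = 0 ->
  closed_span s2 (range (fun z p => character z (sum2 p) * H p)) F.
Proof.
have sS2 : system mu2 (product_action S S) by exact: system_product.
have [V2 [uV2 iV2 tV2 fV2]] := square_model sS uV iV.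
have [h [[Lh symh] [_ h0]] Hh] := hS2.
exists (V2 h); first exact: (unitary_L2 uV2).
move=> F LF symF F0.
have LH := unitary_L2 uV2 Lh.
have Le z : L2 s2 (fun p => character z (sum2 p) * V2 h p) by exact: L2_character_comp.
have cC := closed_span_closed Le.
have [f Lf Vf] := unitary_surj uV2 LF.
have Cf : closed_span mu2 (range (fun z => koopman (product_action S S) z h)) f.
  rewrite -Hh; split; split => //.
    have Lfs : L2 mu2 (f \o swap) by exact: (transports_L2 (transports_swap mu mu) Lf).
    have : {ae mu2, forall p, f p = (f \o swap) p}.
      apply: (unitary_inj uV2 Lf Lfs).
      move: (fV2 f Lf) Vf (transports_ae (transports_swap s s) Vf); apply: filterS3 => p h1 h2 h3.
      by rewrite h2 -[RHS]/(V2 (f \o swap) p) h1 -symF -h3.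
    by apply: aeS => -[x y].
  move=> c; rewrite -(unitary_inner uV2 Lf (L2_cst _ c)).
  have L1 : L2 mu2 (cst 1) by exact: L2_cst.
  have Vc : {ae s2, forall p, V2 (cst c) p = c * V2 (cst 1) p}.
    by rewrite (_ : cst c = (fun x => c * cst 1 x)); [exact: (unitaryZ uV2)|apply/funext => x; rewrite /cst mulr1].
  have z : {ae s2, forall p, V2 f p * (V2 (cst c) p)^* = 0}.
    move: (square_one_support s_square iV uV2 iV2 tV2) Vc Vf; apply: filterS3 => p h1 h2 h3.
    have [p0|pn] := pselect (p = (tzero, tzero)); first by rewrite h3 p0 F0 mul0r.
    by rewrite h2 h1// mulr0 conjC0 mulr0.
  have LVf := unitary_L2 uV2 Lf; have LVc := unitary_L2 uV2 (L2_cst mu2 c).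
  rewrite -[LHS]mulr1 -[X in _ * X]conjC1.
  have m0 : cmeasurable (fun p => V2 f p * (V2 (cst c) p)^*).
    by apply: cmeasurableM; [case: LVf|apply: cmeasurableJ; case: LVc].
  have Lp : L2 s2 (fun p => V2 f p * (V2 (cst c) p)^*).
    by apply: (L2_ae (@L2_0 _ _ _ s2) m0); apply: aeS z => p ->.
  have L1' : L2 s2 (cst 1) by exact: L2_cst.
  have : inner s2 (fun p => V2 f p * (V2 (cst c) p)^*) (cst 1) = 0.
    by rewrite (eq_inner Lp (@L2_0 _ _ _ s2) L1' L1' z (aeW _ (fun=> erefl))) inner0l.
  rewrite conjC1 mulr1 => <-; congr cintegral; apply/funext => p.
  by rewrite /cst rmorph1 mulr1.
have CV : closed_span s2 (range (fun z p => character z (sum2 p) * V2 h p)) (V2 f).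
  have [//|_ //] := closed_span_min (unitary_preimage_closed uV2 cC) _ Cf.
  move=> z; split; first exact: koopman_L2.
  apply: (closed_subspace_ae cC (closed_span_sub z Le)).
    by case: (unitary_L2 uV2 (koopman_L2 sS2 z Lh)).
  by apply: aeS (iV2 z h Lh) => p ->.
by apply: (closed_subspace_ae cC CV LF.1).
Qed.

(* The symmetric functions are the multiples of H by functions of the sum; a quotient of two of
   them, such as a coordinate of the sorted pair, is therefore a function of the sum. *)
Lemma sorted_pair_factor : exists2 zeta : dual -> dual * dual, measurable_fun setT zeta &
  {ae s2, forall p, zeta (sum2 p) = lexsort p}.
Proof.
have [H LH symspan] := symmetric_span.
(* On the square the coordinates are bounded, and removing the origin brings the cut functions
   within the scope of [symmetric_span]. *)
pose ok (p : dual * dual) := [/\ square p.1, square p.2 & p <> (tzero, tzero)].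
have mok : measurable [set p | ok p].
  have -> : [set p | ok p] = (square `*` square) `\` ([set tzero] `*` [set tzero]).
    apply/seteqP; split => -[t u].
      by move=> [/= h1 h2 h3]; split; [split|move=> [/= h4 h5]; apply: h3; rewrite h4 h5].
    by move=> [[/= h1 h2] h3]; split => //= h4; apply: h3; case: h4 => -> ->.
  apply: measurableD; apply: measurableX; try exact: measurable_square; exact: measurable_tzero.
have ok_swap p : ok (swap p) <-> ok p.
  case: p => t u; rewrite /ok /swap /=; split => -[h1 h2 h3]; split => // h4; apply: h3; by case: h4 => -> ->.
pose cut (k : dual * dual -> R) p : R[i] := (\1_[set p | ok p] p * k (lexsort p))%:C.
have cutE k p : ok p -> cut k p = (k (lexsort p))%:C.
  by move=> h; rewrite /cut indicE mem_set// mul1r.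
have cut0 k p : ~ ok p -> cut k p = 0 by move=> h; rewrite /cut indicE memNset// mul0r.
have fac (k : dual * dual -> R) : measurable_fun setT k ->
    (forall p, square p.1 -> square p.2 -> `|k p| <= 1) ->
    exists2 G : dual -> R[i], cmeasurable G & {ae s2, forall p, cut k p = G (sum2 p) * H p}.
  move=> mk bk; apply: (cyclic_span_factor msum LH); apply: symspan.
  - apply: (@L2_bounded _ _ _ s2 _ 1).
      apply: cmeasurable_real; apply: measurable_funM; first exact: measurable_indic.
      by apply: measurableT_comp => //; exact: measurable_lexsort.
    move=> p; have [h|h] := pselect (ok p); last by rewrite cut0// sqnormC0.
    have [h1 h2 _] := h.
    have bs : `|k (lexsort p)| <= 1 by case: (lexsort_cases p) => ->; exact: bk.
    by rewrite cutE// sqnormC_real -real_normK ?num_real// exprn_ile1.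
  - move=> p; have [h|h] := pselect (ok p); last by rewrite !cut0// ok_swap.
    by rewrite !cutE ?lexsort_swap ?ok_swap.
  - by rewrite cut0// => -[].
(* The factor of the constant 1 serves as denominator: on [ok] its product with [H] is 1, so neither
   vanishes. *)
have [G0 mG0 hG0] := fac (cst 1) (@measurable_cst _ _ _ _ _ _) (fun p _ _ => ltac:(by rewrite normr1)).
have coord (k : dual * dual -> R) : measurable_fun setT k ->
    (forall p, square p.1 -> square p.2 -> 0 <= k p < 1) ->
    exists2 g : dual -> R, measurable_fun setT g & {ae s2, forall p, ok p -> g (sum2 p) = k (lexsort p)}.
  move=> mk bk.
  have [|G mG hG] := fac k mk; first by move=> p h1 h2; rewrite ger0_norm; have := bk p h1 h2; lra.
  exists (fun t => cRe (G t * (G0 t)^*) * (sqnormC (G0 t))^-1).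
    apply: measurable_funM.
      by case: (cmeasurableM mG (cmeasurableJ mG0)).
    apply: (measurableT_comp measurable_inv); exact: measurable_sqnormC.
  move: hG hG0; apply: filterS2 => p h1 h2 okp; move: h1 h2; rewrite !cutE// => h1 h2.
  have H0 : H p != 0.
    by apply: contra_eq_neq h2 => ->; rewrite mulr0 -[_%:C]/(1 : R[i]) oner_neq0.
  have G00 : sqnormC (G0 (sum2 p)) != 0.
    rewrite sqnormC_eq0; apply: contra_eq_neq h2 => ->.
    by rewrite mul0r -[_%:C]/(1 : R[i]) oner_neq0.
  have h3 : G (sum2 p) * (G0 (sum2 p))^* = (k (lexsort p) * sqnormC (G0 (sum2 p)))%:C.
    have cM (a b : R) : (a * b)%:C = a%:C * b%:C :> R[i] by rewrite rmorphM.
    apply: (mulIf H0); rewrite mulrAC -h1 cM -mulrA; congr (_ * _).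
    by rewrite -mulcJ mulrAC -h2 -[(cst 1 _)%:C]/(1 : R[i]) mul1r.
  by rewrite h3 /= mulfK.
have m11 : measurable_fun setT (fun p : dual * dual => p.1.1) by exact: (measurableT_comp measurable_fst measurable_fst).
have m12 : measurable_fun setT (fun p : dual * dual => p.1.2) by exact: (measurableT_comp measurable_snd measurable_fst).
have m21 : measurable_fun setT (fun p : dual * dual => p.2.1) by exact: (measurableT_comp measurable_fst measurable_snd).
have m22 : measurable_fun setT (fun p : dual * dual => p.2.2) by exact: (measurableT_comp measurable_snd measurable_snd).
have [|g11 mg11 h11] := coord _ m11; first by move=> p /squareP[].
have [|g12 mg12 h12] := coord _ m12; first by move=> p /squareP[].
have [|g21 mg21 h21] := coord _ m21; first by move=> p _ /squareP[].
have [|g22 mg22 h22] := coord _ m22; first by move=> p _ /squareP[].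
pose g t : dual * dual := ((g11 t, g12 t), (g21 t, g22 t)).
have mg : measurable_fun setT g by do 2 ?apply: measurable_fun_pair.
(* By [sum_zero_only], almost every pair of sum 0 is the origin, the one case left out by [ok]. *)
exists (fun t => if (t.1 == 0) && (t.2 == 0) then (tzero, tzero) else g t).
  apply: measurable_fun_ifT => //; apply: measurable_and; apply: measurable_fun_eqr => //.
have h1 : {ae s2, forall p, ok p -> g (sum2 p) = lexsort p}.
  move: h11 h12 => e1 e2; have e12 : {ae s2, forall p, ok p -> (g11 (sum2 p), g12 (sum2 p)) = (lexsort p).1}.
    move: e1 e2; apply: filterS2 => p e1 e2 okp; rewrite e1// e2//; by case: (lexsort p) => -[].
  move: h21 h22 e12; apply: filterS3 => p e3 e4 e5 okp; rewrite /g e3// e4// e5//.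
  by case: (lexsort p) => a [].
move: h1 sq2 (sum_zero_only sS s_square uV iV eS); apply: filterS3 => p e1 [e2 e3] e4.
case: ifP => [/andP[/eqP s1 /eqP s2']|ne].
  have p0 : p = (tzero, tzero) by apply: e4; rewrite -/(sum2 p); case: (sum2 p) s1 s2' => a b /= -> ->.
  by rewrite p0 /lexsort /swap; case: ifP.
apply: e1; split => // p0; move: ne.
by rewrite (_ : sum2 p = tzero) ?eqxx// /sum2 p0; exact: tadd00.
Qed.

Hypothesis hmu : lebesgue_space mu.

(** Cut at 1/2, the two halves of [I0] have measure at most 1/2 each and total measure 1. *)
Lemma half_set : exists2 D : set X, measurable D & fine (mu D) = 2^-1.
Proof.
have [X0 [I0 [phi [_ [mI0 I01 lI0] _ hphi _]]]] := hmu.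
pose B1 := I0 `&` `[0, 2^-1]; pose B2 := I0 `&` `]2^-1, 1].
have mB1 : measurable B1 by apply: measurableI => //; exact: measurable_itv.
have mB2 : measurable B2 by apply: measurableI => //; exact: measurable_itv.
have I0E : I0 = B1 `|` B2.
  apply/seteqP; split => [x xI|x [[]|[]]//].
  have := I01 _ xI; rewrite /= in_itv /= => /andP[x0 x1].
  by case: (leP x 2^-1) => h; [left|right]; split => //=; rewrite in_itv /= ?x0 ?h.
have dB : B1 `&` B2 = set0.
  apply/seteqP; split => // x [[_ /= h1] [_ /= h2]]; move: h1 h2; rewrite !in_itv /=; lra.
have l1 : (lebesgue_measure B1 <= (2^-1)%:E :> \bar R)%E.
  apply: (@le_trans _ _ (lebesgue_measure (`[0, 2^-1]%classic : set R))).
    by apply: le_measure; rewrite ?inE//; apply: subIsetr.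
  by rewrite lebesgue_measure_itv /= lte_fin invr_gt0 ltr0n -EFinB subr0.
have l2 : (lebesgue_measure B2 <= (2^-1)%:E :> \bar R)%E.
  apply: (@le_trans _ _ (lebesgue_measure (`]2^-1, 1]%classic : set R))).
    by apply: le_measure; rewrite ?inE//; apply: subIsetr.
  rewrite lebesgue_measure_itv /= lte_fin invf_lt1// ltr1n -EFinB lee_fin.
  by lra.
have l12 : (lebesgue_measure B1 + lebesgue_measure B2 = 1 :> \bar R)%E.
  by rewrite -measureU// -I0E.
have [mA muA] := hphi B1 mB1 (@subIsetl _ _ _).
exists (X0 `&` phi @^-1` B1) => //; rewrite muA.
have f1 : (lebesgue_measure B1 \is a fin_num :> Prop).
  by rewrite ge0_fin_numE// (le_lt_trans l1)// ltry.
have f2 : (lebesgue_measure B2 \is a fin_num :> Prop).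
  by rewrite ge0_fin_numE// (le_lt_trans l2)// ltry.
move: l1 l2 l12; rewrite -(fineK f1) -(fineK f2) !lee_fin -EFinD => h1 h2 [h3].
by rewrite /=; lra.
Qed.

(** If all the mass were at the origin, every vector of mean 0 would have a null model. A set of
    measure 1/2 provides a function of mean 0 with no zeros. *)
Lemma model_nonzero_gt0 : 0 < fine (s (~` [set tzero])).
Proof.
rewrite lt_def fine_ge0// andbT; apply/eqP => h.
have s0 : s (~` [set tzero]) = 0%E.
  by rewrite -[LHS]fineK ?h// fin_num_measure//; apply: measurableC; exact: measurable_tzero.
have sae : {ae s, forall t, t = tzero}.
  by exists (~` [set tzero]); split => //; apply: measurableC; exact: measurable_tzero.
have [D mD muD] := half_set.
pose g x : R[i] := (\1_D x)%:C - (2^-1)%:C * cst 1 x.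
have L1 : L2 mu (cst 1) by exact: L2_cst.
have LD : L2 mu (fun x => (\1_D x)%:C) by exact: L2_indic.
have Lg : L2 mu g by apply: L2B => //; exact: L2Z.
have g1 : inner mu g (cst 1) = 0.
  rewrite innerBl//; last exact: L2Z.
  rewrite innerZl// probability_inner1 mulr1.
  have -> : inner mu (fun x => (\1_D x)%:C) (cst 1) = inner mu (fun x => (\1_D x)%:C) (fun x => (\1_D x)%:C).
    congr cintegral; apply/funext => x; rewrite /cst rmorph1 mulr1 mulcJ sqnormC_real indicE.
    by case: (_ \in _); rewrite ?expr1n ?expr0n.
  rewrite inner_norm// (_ : nrm2 mu _ = 2^-1) ?subrr// -muD /nrm2 /sqnorm; congr fine.
  transitivity (\int[mu]_x (\1_D x)%:E)%E; last by rewrite integral_indic ?setIT.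
  by apply: eq_integral => x _; rewrite sqnormC_real indicE; case: (_ \in _); rewrite ?expr1n ?expr0n.
have LV := unitary_L2 uV Lg; have Lv := unitary_L2 uV L1.
have V0 : V g tzero = 0.
  have vsup := model_one_support s_square iV.
  have := inner_point measurable_tzero Lv LV vsup; rewrite (innerJ LV Lv) (unitary_inner uV Lg L1) g1 conjC0.
  move=> /esym/eqP; rewrite !mulf_eq0 => /orP[/orP[/eqP v0|]|].
  - have := model_one_mass s_square uV iV; rewrite v0 !mul0r => /eqP.
    by rewrite eq_sym oner_eq0.
  - by rewrite conjC_eq0 => /eqP.
  - have := model_zero_gt0 s_square uV iV => p0.
    by rewrite fmorph_eq0 => /eqP p1; rewrite p1 ltxx in p0.
have : nrm2 mu g = 0.
  rewrite -(unitary_nrm2 uV Lg); apply: nrm2_ae0; first by case: LV.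
  by apply: aeS sae => t ->.
move=> /(nrm2_eq0 Lg) [N [mN N0 sN]].
have NT : N = setT.
  apply/seteqP; split => // x _; apply: sN => /= /eqP.
  rewrite /g /cst mulr1 subr_eq0 indicE => /eqP/complexI.
  by case: (x \in D) => /= h'; lra.
have := probability_setT mu; rewrite -NT N0 => /eqP.
by rewrite eq_sym onee_eq0.
Qed.

End SquareFactor.

(** * Partial sums as functions of the total sum *)

Section Argument.
Context {R : realType}.

(* The tangent half-angle formula: [-(1 + cos) / sin = tan ((x - pi) / 2)], and
   [0 / 0 = 0] gives the right value at [x = pi]. *)
Definition arg (c : R[i]) : R :=
  if cRe c == 1 then 0 else 2^-1 + atan (- (1 + cRe c) * (cIm c)^-1) / pi.

Lemma arg_cis (p : R) : 0 <= p < 1 -> arg (cis p) = p.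
Proof.
move=> /andP[p0 p1]; rewrite /arg; case: ifP => [/eqP h|h].
  apply/esym/eqP; apply: contraT => pn.
  have : cis p != 1 by apply: cis_neq1; rewrite normr_gt0 pn ger0_norm.
  apply: contra_neqT => _.
  have s0 : cIm (cis p) = 0.
    apply/eqP; rewrite -sqrf_eq0; apply/eqP; move: h; rewrite /= => h.
    by have := cos2Dsin2 (2 * pi * p); rewrite h; lra.
  by apply: ceqP; rewrite ?h ?s0.
have pp : 0 < pi :> R := pi_gt0 R.
have {}p0 : 0 < p.
  rewrite lt_def p0 andbT; apply/eqP => pE; move/eqP: h; apply.
  by rewrite pE cis0.
(* This half angle lies strictly between [- pi / 2] and [pi / 2], where [atan] inverts [tan]. *)
pose th := pi * p - pi / 2.
have thE : 2 * pi * p = th *+ 2 + pi by rewrite /th mulr2n; field.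
have hc : cRe (cis p) = 1 - cos th ^+ 2 *+ 2.
  by rewrite /= thE cosDpi cos_mulr2n opprB.
have hs : cIm (cis p) = - (cos th * sin th *+ 2).
  by rewrite /= thE sinDpi sin_mulr2n.
have th1 : - (pi / 2) < th < pi / 2.
  by rewrite /th; apply/andP; split; nra.
have c0 : 0 < cos th by exact: cos_gt0_pihalf.
have tE : - (1 + cRe (cis p)) * (cIm (cis p))^-1 = tan th.
  have cs := cos2Dsin2 th.
  rewrite hc hs /tan; have [s0|sn] := eqVneq (sin th) 0.
    by rewrite s0 mulr0 mul0rn oppr0 invr0 mulr0 mul0r.
  have -> : 1 + (1 - cos th ^+ 2 *+ 2) = sin th ^+ 2 *+ 2 by rewrite -cs; ring.
  by field; rewrite sn gt_eqF.
rewrite tE tanK; last by rewrite in_itv.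
have pn : pi != 0 :> R by rewrite gt_eqF.
by rewrite /th mulrBl mulrAC divff// mul1r mulrAC divff// mul1r addrCA subrr addr0.
Qed.

Lemma measurable_arg d (A : measurableType d) (g : A -> R[i]) : cmeasurable g ->
  measurable_fun setT (fun x => arg (g x) : measurableTypeR R).
Proof.
move=> [g1 g2]; apply: measurable_fun_ifT => //; first exact: measurable_fun_eqr.
apply: measurable_funD => //; apply: measurable_funM => //.
apply: (@measurableT_comp _ _ _ _ _ _ (atan : measurableTypeR R -> measurableTypeR R)).
  by apply: continuous_measurable_fun => x; exact: continuous_atan.
apply: measurable_funM; last exact: (measurableT_comp measurable_inv).
by apply: measurableT_comp => //; exact: measurable_funD.
Qed.

End Argument.

Section SumFactors.
Context {R : realType}.
Local Notation dual := (measurableTypeR R * measurableTypeR R)%type.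
Local Notation square := (`[0%R, 1%R[%classic `*` `[0%R, 1%R[%classic : set dual).
Local Notation tzero := (@tzero R).
Local Notation pp := product_probability.

Lemma weakly_cvg_tensor1 d d' (A : measurableType d) (B : measurableType d')
    (P : probability A R) (Q : probability B R) a_ a b_ b :
  (forall n, L2 P (a_ n)) -> L2 P a -> (forall n, L2 Q (b_ n)) -> L2 Q b ->
  (forall n, nrm2 P (a_ n) <= 1) -> (forall n, nrm2 Q (b_ n) <= 1) ->
  weakly_cvg P a_ a -> weakly_cvg Q b_ b ->
  weakly_cvg (pp P Q) (fun n => tensor (a_ n) (b_ n)) (tensor a b).
Proof.
move=> La_ La Lb_ Lb a1 b1; have na := nrm2_ge0 P a; have nb := nrm2_ge0 Q b.
apply: (@weakly_cvg_tensor _ _ _ _ _ _ _ _ _ _ _ (1 + nrm2 P a + nrm2 Q b)) => //; try lra.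
  by move=> n; have := a1 n; lra.
by move=> n; have := b1 n; lra.
Qed.

Lemma nrm2_character_comp d (A : measurableType d) (P : probability A R) (f : A -> dual) z :
  nrm2 P (fun x => character z (f x)) <= 1.
Proof.
rewrite /nrm2 /sqnorm (_ : (fun x => _) = cst 1%E); last first.
  by apply/funext => x; rewrite sqnormC_character.
rewrite integral_cst// mul1e le_eqVlt; apply/orP; left; apply/eqP.
exact: (congr1 fine (probability_setT P)).
Qed.

Variables (s r : probability dual R).
Hypothesis s_square : s (~` square) = 0%E.
Hypothesis r_square : r (~` square) = 0%E.
Local Notation P := (pp (pp s s) (pp r r)).
Local Notation Om := ((dual * dual) * (dual * dual))%type.

Definition total_sum (p : Om) : dual := tadd (tadd p.1.1 p.1.2) (tadd p.2.1 p.2.2).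

Lemma measurable_total_sum : measurable_fun setT total_sum.
Proof.
apply: measurable_tadd; apply: measurable_tadd.
- exact: (measurableT_comp measurable_fst measurable_fst).
- exact: (measurableT_comp measurable_snd measurable_fst).
- exact: (measurableT_comp measurable_fst measurable_snd).
- exact: (measurableT_comp measurable_snd measurable_snd).
Qed.

Lemma ae_squares : {ae P, forall p : Om, [/\ square p.1.1, square p.1.2, square p.2.1 & square p.2.2]}.
Proof.
have h1 := ae_product_fst (pp r r) (ae_fst_snd_zero (ae_square s_square)).
have h2 := ae_product_snd (pp s s) (ae_fst_snd_zero (ae_square r_square)).
by move: h1 h2; apply: filterS2 => p [? ?] [? ?]; split.
Qed.

Local Notation limit z0 b := (fun t : dual => b%:C * character z0 t + (1 - b)%:C * (\1_[set tzero] t)%:C).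

(** Off the origin the limit is [b] times the character; at the origin the two weights add up to 1,
    the value of the character there. So the phase survives everywhere. *)
Lemma limit_polar z0 (b : R) : 0 < b -> exists2 k : dual -> R, (forall t, 0 < k t) &
  forall t, limit z0 b t = (k t)%:C * character z0 t.
Proof.
move=> b0; have cD (x y : R) : (x + y)%:C = x%:C + y%:C :> R[i] by rewrite rmorphD.
exists (fun t => if t == tzero then 1 else b) => t; case: ifP => // /eqP h; rewrite indicE.
  by rewrite h mem_set//= character_at0 !mulr1 -cD addrC subrK.
by rewrite memNset//= mulr0 addr0.
Qed.

Lemma L2_limit (q : probability dual R) z0 b : L2 q (limit z0 b).
Proof.
apply: L2D; apply: L2Z; first exact: L2_character.
by apply: L2_indic; exact: measurable_tzero.
Qed.

(* The weak limit of the characters of the total sum is a positive multiple of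
   [character z0 (tadd p.2.1 p.2.2)]; lying in the closed span of these characters, it is a function
   of the total sum. *)
Lemma phase_factor (w : nat -> int * int) z0 (a b : R) : 0 < a -> 0 < b ->
  weakly_cvg s (fun i => character (w i)) (limit 0 a) ->
  weakly_cvg r (fun i => character (w i)) (limit z0 b) ->
  exists2 G : dual -> R[i], cmeasurable G &
    {ae P, forall p : Om, G (total_sum p) = character z0 (tadd p.2.1 p.2.2)}.
Proof.
move=> a0 b0 ws wr.
have mtau := measurable_total_sum.
pose K := tensor (tensor (limit 0 a) (limit 0 a)) (tensor (limit z0 b) (limit z0 b)).
have Ls := L2_limit s 0 a; have Lr := L2_limit r z0 b.
have LK : L2 P K by apply: L2_tensor; exact: L2_tensor.
have L1 : L2 P (cst 1) by exact: L2_cst.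
have wK : weakly_cvg P (fun i p => character (w i) (total_sum p) * cst 1 p) K.
  rewrite (_ : (fun i => _) = (fun i => tensor (tensor (character (w i)) (character (w i)))
      (tensor (character (w i)) (character (w i))))); last first.
    by apply/funext => i; apply/funext => p; rewrite /tensor /cst mulr1 !character_tadd.
  have n1 (q : probability dual R) n : nrm2 q (character (w n)) <= 1.
    exact: (@nrm2_character_comp _ _ q id (w n)).
  have n2 (q : probability dual R) n : nrm2 (pp q q) (tensor (character (w n)) (character (w n))) <= 1.
    rewrite (_ : tensor _ _ = (fun p => character (w n) (tadd p.1 p.2))).
      exact: nrm2_character_comp.
    by apply/funext => p; rewrite character_tadd.
  have Lc (q : probability dual R) n : L2 q (character (w n)) by exact: L2_character.
  have wss := weakly_cvg_tensor1 (Lc s) Ls (Lc s) Ls (n1 s) (n1 s) ws ws.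
  have wrr := weakly_cvg_tensor1 (Lc r) Lr (Lc r) Lr (n1 r) (n1 r) wr wr.
  exact: (weakly_cvg_tensor1 (fun n => L2_tensor (Lc s n) (Lc s n)) (L2_tensor Ls Ls)
    (fun n => L2_tensor (Lc r n) (Lc r n)) (L2_tensor Lr Lr) (n2 s) (n2 r) wss wrr).
have Le z := L2_character_comp mtau z L1.
have CK : closed_span P (range (fun z p => character z (total_sum p) * cst 1 p)) K.
  apply: (weak_closed (closed_span_closed Le) (fun n => closed_span_sub (w n) Le) LK) => f Lf e e0.
  by have [N _ hN] := wK f Lf e e0; exists N; exact: hN (leqnn N).
have [G0 mG0 hG0] := cyclic_span_factor mtau L1 CK.
have [ka ka0 hka] := limit_polar 0 a0; have [kb kb0 hkb] := limit_polar z0 b0.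
(* Dividing by the modulus removes the positive factor and keeps the phase. *)
exists (fun t => ((Num.sqrt (sqnormC (G0 t)))^-1)%:C * G0 t).
  apply: cmeasurableM => //; apply: cmeasurable_real; apply: (measurableT_comp measurable_inv).
  apply: (@measurableT_comp _ _ _ _ _ _ (Num.sqrt : measurableTypeR R -> measurableTypeR R)).
    by apply: continuous_measurable_fun; exact: sqrt_continuous.
  exact: measurable_sqnormC.
apply: aeS hG0 => p; rewrite /cst mulr1 => hp.
pose k := (ka p.1.1 * ka p.1.2) * (kb p.2.1 * kb p.2.2).
have k0 : 0 < k by rewrite !mulr_gt0.
have cM (x y : R) : (x * y)%:C = x%:C * y%:C :> R[i] by rewrite rmorphM.
have KE : K p = k%:C * character z0 (tadd p.2.1 p.2.2).
  by rewrite /K /tensor !hka !hkb !character0 character_tadd /k !cM; ring.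
rewrite -hp KE sqnormCM sqnormC_character mulr1 sqnormC_real sqrtr_sqr gtr0_norm//.
by rewrite mulrA -cM mulVf ?gt_eqF// mul1r.
Qed.

Lemma arg_character z (c : R) t : z.1%:~R * t.1 + z.2%:~R * t.2 = c -> 0 <= c < 1 ->
  arg (character z t) = c.
Proof. by move=> h c1; rewrite characterE h arg_cis. Qed.

Variables (w u : nat -> int * int) (a1 a2 b1 b2 : R).
Hypotheses (ha1 : 0 < a1) (ha2 : 0 < a2) (hb1 : 0 < b1) (hb2 : 0 < b2).
Hypothesis sw : weakly_cvg s (fun i => character (w i)) (limit 0 a1).
Hypothesis rw : weakly_cvg r (fun i => character (w i)) (limit (1, 0) b1).
Hypothesis su : weakly_cvg s (fun i => character (u i)) (limit 0 a2).
Hypothesis ru : weakly_cvg r (fun i => character (u i)) (limit (0, 1) b2).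

Lemma sum_factors : exists xi eta : dual -> dual,
  [/\ measurable_fun setT xi, measurable_fun setT eta &
    {ae P, forall p : Om, xi (total_sum p) = tadd p.1.1 p.1.2 /\ eta (total_sum p) = tadd p.2.1 p.2.2}].
Proof.
have [G1 mG1 h1] := phase_factor ha1 hb1 sw rw.
have [G2 mG2 h2] := phase_factor ha2 hb2 su ru.
pose eta t : dual := (arg (G1 t), arg (G2 t)).
(* The character of the first partial sum is that of the total times the conjugate of that of the
   second. *)
pose xi t : dual := (arg (character (1, 0) t * (G1 t)^*), arg (character (0, 1) t * (G2 t)^*)).
exists xi, eta; split.
- apply: measurable_fun_pair; apply: measurable_arg; apply: cmeasurableM;
    by [exact: cmeasurable_character|exact: cmeasurableJ].
- by apply: measurable_fun_pair; exact: measurable_arg.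
move: h1 h2 ae_squares; apply: filterS3 => p e1 e2 [s1 s2 s3 s4].
have E z t t' : character z (tadd t t') * (character z t')^* = character z t.
  by rewrite character_tadd -mulrA mulcJ sqnormC_character mulr1.
have A1 t : square t -> arg (character (1, 0) t) = t.1.
  by move=> /squareP[t1 _]; apply: arg_character => //=; rewrite mul1r mul0r addr0.
have A2 t : square t -> arg (character (0, 1) t) = t.2.
  by move=> /squareP[_ t1]; apply: arg_character => //=; rewrite mul1r mul0r add0r.
have sx := tadd_square s1 s2; have sy := tadd_square s3 s4.
by rewrite /xi /eta e1 e2 [in X in X /\ _]/total_sum !E !A1// !A2//.
Qed.

End SumFactors.

(** * Multiplicity of a countable-to-one factor *)

Section RestrictedMeasures.
Context {R : realType} {d : measure_display} {X : measurableType d}.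

Lemma eq_measure_sqnorm (mu nu : {measure set X -> \bar R}) f :
  (forall A, measurable A -> mu A = nu A) -> sqnorm mu f = sqnorm nu f.
Proof. by move=> h; apply: eq_measure_integral => A mA _; exact: h. Qed.

Lemma sqnorm_mrestr (mu : {measure set X -> \bar R}) A (mA : measurable A) f : cmeasurable f ->
  sqnorm mu (fun x => (\1_A x)%:C * f x) = sqnorm (mrestr mu mA) f.
Proof.
move=> mf; have mAc : measurable (~` A) by exact: measurableC.
have mg : cmeasurable (fun x => (\1_A x)%:C * f x).
  by apply: cmeasurableM => //; exact: cmeasurable_indic.
have E (B : set X) (h : measurable B) (g : X -> R[i]) : (forall x, B x -> (\1_A x)%:C * f x = g x) ->
    {ae mrestr mu h, forall x, (\1_A x)%:C * f x = g x}.
  move=> hg; exists (~` B); split => //; first exact: measurableC.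
    by rewrite /mrestr /= setICl measure0.
  by move=> x /= nx xB; apply: nx; exact: hg.
rewrite (@eq_measure_sqnorm mu (measure_add (mrestr mu mA) (mrestr mu mAc))); last first.
  move=> B mB; rewrite [RHS]measure_addE.
  transitivity (mu (B `&` A) + mu (B `&` ~` A))%E => //.
  rewrite -{1}(setIT B) -(setUv A) setIUr measureU//.
  - exact: measurableI.
  - exact: measurableI.
  - by rewrite setIACA setICr setI0.
rewrite (sqnorm_add _ _ mg) [X in (_ + X)%E](ae_sqnorm0 mg) ?adde0; last first.
  by apply: E => x xA; rewrite indicE memNset//= mul0r.
apply: (eq_sqnorm mg mf); apply: E => x xA.
by rewrite indicE mem_set//= mul1r.
Qed.

End RestrictedMeasures.

Section MultiplicityModel.
Context {R : realType} {d : measure_display} {B : measurableType d}.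
Local Notation dual := (measurableTypeR R * measurableTypeR R)%type.
Variables (P : probability B R) (tau : B -> dual) (D : nat -> set B) (rho : nat -> dual -> B).
Variables (sigma : {finite_measure set dual -> \bar R}) (m : dual -> option nat) (N : nat).
Hypothesis mtau : measurable_fun setT tau.
Hypothesis mD : forall n, measurable (D n).
Hypothesis mrho : forall n, measurable_fun setT (rho n).
Local Notation support n := [set t | below n (m t)].
Hypothesis mb : forall n, measurable (support n).
Hypothesis hD : forall n A, measurable A -> P (D n `&` tau @^-1` A) = sigma (A `&` support n).
Hypothesis rhoD : forall n, {ae P, forall x, D n x -> rho n (tau x) = x}.
Hypothesis dD : forall n k x, D n x -> D k x -> n = k.
Hypothesis DN : forall n, (N <= n)%N -> D n = set0.

(** [rho n t] is the point of the sheet [D n] above [t], and [support n] carries the image of [P]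
    restricted to that sheet. The values of [F] along the sheets above [t] thus become coordinates
    in a fibre of dimension [m t]. *)
Definition fiber_coordinates (F : B -> R[i]) (n : nat) (t : dual) : R[i] :=
  (\1_(support n) t)%:C * F (rho n t).

(** By [hD] the complement of [Q] has the same mass in [support n] as its preimage has in [D n]. *)
Lemma transfer_ae n (Q : set dual) : measurable Q ->
  {ae P, forall x, D n x -> Q (tau x)} -> {ae sigma, forall t, support n t -> Q t}.
Proof.
move=> mQ [M [mM M0 sM]]; exists (~` Q `&` support n); split.
- by apply: measurableI => //; exact: measurableC.
- rewrite -hD; last exact: measurableC.
  apply: (subset_measure0 _ mM _ M0) => [|x [xD xQ]].
    apply: measurableI => //; rewrite -[X in measurable X]setTI; apply: mtau => //.
    exact: measurableC.
  by apply: sM => /= h; exact/xQ/h.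
- by move=> t /= h; split => [Qt|]; [exact: h|apply: contrapT => nb; apply: h].
Qed.

Lemma sqnorm_fiber n G : cmeasurable G ->
  sqnorm sigma (fun t => (\1_(support n) t)%:C * G t) = sqnorm P (fun x => (\1_(D n) x)%:C * G (tau x)).
Proof.
move=> mG; rewrite (sqnorm_mrestr sigma (mb n) mG) (sqnorm_mrestr P (mD n) (cmeasurable_comp mG mtau)).
rewrite -(sqnorm_image (mrestr P (mD n)) mtau mG); apply: eq_measure_sqnorm => A mA.
by transitivity (sigma (A `&` support n)) => //; rewrite -hD// setIC.
Qed.

Lemma cmeasurable_fiber_coordinates F n : cmeasurable F -> cmeasurable (fiber_coordinates F n).
Proof.
move=> mF; apply: cmeasurableM; first exact: cmeasurable_indic.
exact: (cmeasurable_comp mF).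
Qed.

Lemma fiber_coordinates_ae F F' n : cmeasurable F -> cmeasurable F' -> {ae P, forall x, F x = F' x} ->
  {ae sigma, forall t, fiber_coordinates F n t = fiber_coordinates F' n t}.
Proof.
move=> mF mF' FF'; have := @transfer_ae n [set t | F (rho n t) = F' (rho n t)].
have mQ : measurable [set t | F (rho n t) = F' (rho n t)].
  rewrite (_ : [set t | _] = [set t | F (rho n t) - F' (rho n t) = 0]).
    apply: measurable_ceq0; apply: cmeasurableB; exact: cmeasurable_comp.
  by apply/seteqP; split => t /= => [->|/eqP]; rewrite ?subrr// subr_eq0 => /eqP.
move=> /(_ mQ) h; have {h} : {ae sigma, forall t, support n t -> F (rho n t) = F' (rho n t)}.
  by apply: h; move: (rhoD n) FF'; apply: filterS2 => x h1 h2 /h1 /= ->.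
apply: aeS => t h; rewrite /fiber_coordinates indicE.
by have [/set_mem/h ->|] := boolP (t \in _) => //; rewrite !mul0r.
Qed.

Lemma fiber_coordinates_character z F n : cmeasurable F ->
  {ae sigma, forall t, fiber_coordinates (fun x => character z (tau x) * F x) n t =
    character z t * fiber_coordinates F n t}.
Proof.
move=> mF; have := @transfer_ae n [set t | character z (tau (rho n t)) - character z t = 0].
have mQ : measurable [set t | character z (tau (rho n t)) - character z t = 0].
  apply: measurable_ceq0; apply: cmeasurableB; last exact: cmeasurable_character.
  apply: (cmeasurable_comp (cmeasurable_character z)); exact: measurableT_comp.
move=> /(_ mQ) h; have {h} : {ae sigma, forall t, support n t -> character z (tau (rho n t)) - character z t = 0}.
  by apply: h; move: (rhoD n); apply: aeS => x h1 /h1 /= ->; rewrite subrr.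
apply: aeS => t h; rewrite /fiber_coordinates indicE.
have [/set_mem/h/eqP|_] := boolP (t \in _); last by rewrite !mul0r mulr0.
by rewrite subr_eq0 => /eqP ->; rewrite mulrCA.
Qed.

Lemma sqnorm_fiber_coordinates F n : cmeasurable F ->
  sqnorm sigma (fiber_coordinates F n) = sqnorm P (fun x => (\1_(D n) x)%:C * F x).
Proof.
move=> mF; have mFr : cmeasurable (fun t => F (rho n t)) by exact: cmeasurable_comp.
rewrite [LHS](sqnorm_fiber n mFr); apply: eq_sqnorm.
- apply: cmeasurableM; first exact: cmeasurable_indic.
  exact: (cmeasurable_comp mFr mtau).
- by apply: cmeasurableM => //; exact: cmeasurable_indic.
move: (rhoD n); apply: aeS => x h; rewrite indicE.
by have [/set_mem/h ->|] := boolP (x \in _) => //; rewrite !mul0r.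
Qed.

Let covered : set B := [set x | exists n, D n x].

Lemma fiber_coordinates_sqnorm F : cmeasurable F -> {ae P, forall x, ~ covered x -> F x = 0} ->
  direct_integral_sqnorm sigma (fiber_coordinates F) = sqnorm P F.
Proof.
move=> mF F0; have mi n : cmeasurable (fun x => (\1_(D n) x)%:C * F x).
  by apply: cmeasurableM => //; exact: cmeasurable_indic.
rewrite /direct_integral_sqnorm (finite_eseries (N := N)); first last.
- move=> k /DN h; rewrite sqnorm_fiber_coordinates//; apply: ae_sqnorm0 => //.
  by apply: aeW => x; rewrite h indic0 mul0r.
- by move=> k; exact: sqnorm_ge0.
transitivity (\sum_(k < N) sqnorm P (fun x => (\1_(D k) x)%:C * F x)%R)%E.
  by apply: eq_bigr => k _; rewrite sqnorm_fiber_coordinates.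
rewrite /sqnorm -ge0_integral_sum//; first last.
- by move=> k x _; rewrite lee_fin sqnormC_ge0.
- by move=> k; exact: measurable_sqnormCE.
apply: ae_eq_integral => //.
- apply: emeasurable_sum => k; exact: measurable_sqnormCE.
- exact: measurable_sqnormCE.
apply: aeS F0 => x h _; rewrite sumEFin; congr _%:E.
have [[n xn]|/h ->] := pselect (covered x); last first.
  by rewrite sqnormC0 big1// => k _; rewrite mulr0 sqnormC0.
have nN : (n < N)%N by rewrite ltnNge; apply/negP => /DN h'; move: xn; rewrite h'.
rewrite (bigD1 (Ordinal nN))//= indicE mem_set// mul1r big1 ?addr0// => k kn.
rewrite indicE memNset ?mul0r ?sqnormC0//= => xk; move/eqP: kn; apply.
by apply: val_inj => /=; exact: (dD xk xn).
Qed.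

Lemma fiber_coordinates_surj G : direct_integral sigma m G ->
  exists2 F, L2 P F /\ (forall x, ~ covered x -> F x = 0) &
    forall n, {ae sigma, forall t, fiber_coordinates F n t = G n t}.
Proof.
move=> [mG G0 nG].
pose F x : R[i] := \sum_(k < N) (\1_(D k) x)%:C * G k (tau x).
have mF : cmeasurable F.
  apply: cmeasurable_sum => k; apply: cmeasurableM; first exact: cmeasurable_indic.
  exact: (cmeasurable_comp (mG k) mtau).
have FD n x : D n x -> F x = G n (tau x).
  move=> xn; have nN : (n < N)%N by rewrite ltnNge; apply/negP => /DN h'; move: xn; rewrite h'.
  rewrite /F (bigD1 (Ordinal nN))//= indicE mem_set// mul1r big1 ?addr0// => k kn.
  rewrite indicE memNset ?mul0r//= => xk; move/eqP: kn; apply.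
  by apply: val_inj => /=; exact: (dD xk xn).
have F0 x : ~ covered x -> F x = 0.
  move=> h; apply: big1 => k _; rewrite indicE memNset ?mul0r//= => xk; apply: h; by exists k.
have FG n : {ae sigma, forall t, fiber_coordinates F n t = G n t}.
  have h : {ae sigma, forall t, support n t -> F (rho n t) - G n t = 0}.
    apply: (@transfer_ae n [set t | F (rho n t) - G n t = 0]).
      by apply: measurable_ceq0; apply: cmeasurableB => //; exact: cmeasurable_comp.
    move: (rhoD n); apply: aeS => x h1 xD /=; rewrite h1// (FD _ _ xD) subrr//.
  move: h (G0 n); apply: filterS2 => t h1 h2; rewrite /fiber_coordinates indicE.
  have [/set_mem/h1/eqP|tn] := boolP (t \in _); first by rewrite subr_eq0 mul1r => /eqP.
  rewrite mul0r h2//; apply/negP => ht; move/negP: tn; apply; exact/mem_set.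
exists F => //; split => //; split => //.
rewrite -(fiber_coordinates_sqnorm mF (aeW _ F0)); apply: le_lt_trans nG.
rewrite le_eqVlt; apply/orP; left; apply/eqP; apply: eq_eseriesr => n _.
exact: (eq_sqnorm (cmeasurable_fiber_coordinates n mF) (mG n) (FG n)).
Qed.

Context {d' : measure_display} {X : measurableType d'}.
Variables (mu : probability X R) (S : int * int -> X -> X) (V : (X -> R[i]) -> B -> R[i]).
Hypothesis sS : system mu S.
Hypothesis uV : unitary_iso mu P V.
Hypothesis iV : intertwines mu S P tau V.
Variable H : set (X -> R[i]).
Hypothesis HV : forall f, H f <-> L2 mu f /\ {ae P, forall x, ~ covered x -> V f x = 0}.
Hypothesis sq : sigma (~` (`[0, 1[ `*` `[0, 1[)) = 0%E.
Hypothesis mm : forall k, measurable (m @^-1` [set k]).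
Hypothesis m0 : sigma (m @^-1` [set Some 0%N]) = 0%E.

(** The vectors of [H] are those whose model vanishes off the sheets, hence those determined by
    their coordinates along the sheets. *)
Lemma fiber_representation : spectral_representation mu H (koopman S) sigma m.
Proof.
split => //; exists (fun f => fiber_coordinates (V f)).
have LV f : H f -> L2 P (V f) by move=> /HV[Lf _]; exact: (unitary_L2 uV Lf).
have nV f : H f -> direct_integral_sqnorm sigma (fiber_coordinates (V f)) = sqnorm mu f.
  move=> Hf; have [Lf f0] := (HV f).1 Hf.
  rewrite fiber_coordinates_sqnorm//; last by case: (LV _ Hf).
  by rewrite (L2_sqnormE (LV _ Hf)) (unitary_nrm2 uV Lf) -L2_sqnormE.
split => //.
- move=> f Hf; split.
  + by move=> n; apply: cmeasurable_fiber_coordinates; case: (LV _ Hf).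
  + move=> n; apply: aeW => t tb; rewrite /fiber_coordinates indicE memNset ?mul0r//=.
    exact/negP.
  + by rewrite nV//; have [[_ ->]] := (HV f).1 Hf.
- move=> c f g Hf Hg n; have [Lf _] := (HV f).1 Hf; have [Lg _] := (HV g).1 Hg.
  have Lfg := unitary_L2 uV (L2lin c Lf Lg); have LVfg := L2lin c (LV _ Hf) (LV _ Hg).
  have := fiber_coordinates_ae n Lfg.1 LVfg.1 (unitary_lin uV c Lf Lg).
  by apply: aeS => t ->; rewrite /fiber_coordinates mulrDr mulrCA.
- move=> G dG; have [F [LF F0] FG] := fiber_coordinates_surj dG.
  have [f Lf Vf] := unitary_surj uV LF.
  have Hf : H f by apply/HV; split => //; apply: aeS Vf => x -> ; exact: F0.
  exists f => // n; have := fiber_coordinates_ae n (LV _ Hf).1 LF.1 Vf.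
  by move: (FG n); apply: filterS2 => t -> ->.
- move=> z f Hf n; have [Lf _] := (HV f).1 Hf.
  have L1 := unitary_L2 uV (koopman_L2 sS z Lf).
  have := fiber_coordinates_ae n L1.1 (L2_character_comp mtau z (LV _ Hf)).1 (iV z Lf).
  by move: (fiber_coordinates_character z n (LV _ Hf).1); apply: filterS2 => t -> ->.
Qed.

End MultiplicityModel.

(** * Sheets of the total sum *)

Lemma measurable_pred d (A : measurableType d) (q : A -> bool) :
  measurable_fun setT q -> measurable [set x | q x].
Proof.
move=> mq; rewrite (_ : [set x | q x] = setT `&` q @^-1` [set true]); first exact: mq.
by rewrite setTI; apply/seteqP; split => x.
Qed.

Lemma ae_measure_eq {R : realType} {d} {A : measurableType d} (P : {measure set A -> \bar R}) (C D : set A) :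
  measurable C -> measurable D -> {ae P, forall x, C x <-> D x} -> P C = P D.
Proof.
move=> mC mD [N [mN N0 sN]].
rewrite -(measureU0 mC mN N0) -(measureU0 mD mN N0); congr (P _).
apply/seteqP; split => x [h|h]; try by right.
  have [xN|xN] := pselect (N x); first by right.
  left; apply/(_ : C x <-> D x) => //; apply: contrapT => h'; apply: xN; exact: sN.
have [xN|xN] := pselect (N x); first by right.
left; apply/(_ : C x <-> D x) => //; apply: contrapT => h'; apply: xN; exact: sN.
Qed.

Section Sheets.
Context {R : realType}.
Local Notation dual := (measurableTypeR R * measurableTypeR R)%type.
Local Notation square := (`[0%R, 1%R[%classic `*` `[0%R, 1%R[%classic : set dual).
Local Notation tzero := (@tzero R).
Local Notation pp := product_probability.
Local Notation Om := ((dual * dual) * (dual * dual))%type.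
Variables (s r : probability dual R).
Hypothesis s_square : s (~` square) = 0%E.
Hypothesis r_square : r (~` square) = 0%E.
Local Notation P := (pp (pp s s) (pp r r)).

Definition tie (p : dual * dual) : bool := lexle p.1 p.2 && lexle p.2 p.1.

Lemma tie_eq p : tie p -> p.1 = p.2.
Proof. by move=> /andP[]; exact: lexle_anti. Qed.

Lemma tie_refl t : tie (t, t).
Proof. by rewrite /tie lexle_refl. Qed.

Definition flip_fst (w : Om) : Om := (swap w.1, w.2).
Definition flip_snd (w : Om) : Om := (w.1, swap w.2).

Lemma transports_flip_fst : transports P P flip_fst.
Proof. exact: (transports_product (transports_swap s s) (conj (@measurable_id _ _ _) (fun _ _ => erefl))). Qed.

Lemma transports_flip_snd : transports P P flip_snd.
Proof. exact: (transports_product (conj (@measurable_id _ _ _) (fun _ _ => erefl)) (transports_swap r r)). Qed.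

Lemma total_sum_flip_fst w : total_sum (flip_fst w) = total_sum w.
Proof. by rewrite /total_sum /= [tadd w.1.2 _]taddC. Qed.

Lemma total_sum_flip_snd w : total_sum (flip_snd w) = total_sum w.
Proof. by rewrite /total_sum /= [tadd w.2.2 _]taddC. Qed.

(* Off the pairs of ties, [total_sum] is injective on each sheet. The fibre of a point meets the
   first two sheets if it contains a tie and all four otherwise. *)
Definition sheet (n : nat) (w : Om) : bool :=
  let: (p, q) := w in let x := lexle p.1 p.2 in let y := lexle q.1 q.2 in
  match n with
  | 0 => [&& x, ~~ tie p & y] || [&& tie p, y & ~~ tie q]
  | 1 => (~~ x && y) || (tie p && ~~ y)
  | 2 => [&& x, ~~ tie p & ~~ y]
  | 3 => ~~ x && ~~ y
  | _ => false
  end.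

Lemma sheet_disjoint n k w : sheet n w -> sheet k w -> n = k.
Proof.
case: w => p q; rewrite /sheet /tie.
have := lexle_total p.1 p.2; have := lexle_total q.1 q.2.
case: (lexle p.1 p.2); case: (lexle p.2 p.1); case: (lexle q.1 q.2); case: (lexle q.2 q.1) => //= _ _;
  by move: n k => [|[|[|[|n]]]] [|[|[|[|k]]]].
Qed.

Lemma sheet_cover w : (exists n, sheet n w) <-> ~~ (tie w.1 && tie w.2).
Proof.
case: w => p q; split.
  move=> [n]; rewrite /sheet /tie /=.
  case: (lexle p.1 p.2); case: (lexle p.2 p.1); case: (lexle q.1 q.2); case: (lexle q.2 q.1) => //=;
    by move: n => [|[|[|[|n]]]].
rewrite /tie /= => h; have := lexle_total p.1 p.2; have := lexle_total q.1 q.2.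
have e0 : sheet 0 (p, q) -> exists n, sheet n (p, q) by exists 0%N.
have e1 : sheet 1 (p, q) -> exists n, sheet n (p, q) by exists 1%N.
have e2 : sheet 2 (p, q) -> exists n, sheet n (p, q) by exists 2%N.
have e3 : sheet 3 (p, q) -> exists n, sheet n (p, q) by exists 3%N.
move: h e0 e1 e2 e3; rewrite /sheet /tie.
by case: (lexle p.1 p.2); case: (lexle p.2 p.1); case: (lexle q.1 q.2); case: (lexle q.2 q.1) => //= _ e0 e1 e2 e3 _ _;
  by [exact: e0|exact: e1|exact: e2|exact: e3].
Qed.

Let measurable_sorted_fst : measurable_fun setT (fun w : Om => lexle w.1.1 w.1.2).
Proof.
apply: measurable_lexle; first exact: (measurableT_comp measurable_fst measurable_fst).
exact: (measurableT_comp measurable_snd measurable_fst).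
Qed.

Let measurable_sorted_snd : measurable_fun setT (fun w : Om => lexle w.2.1 w.2.2).
Proof.
apply: measurable_lexle; first exact: (measurableT_comp measurable_fst measurable_snd).
exact: (measurableT_comp measurable_snd measurable_snd).
Qed.

Lemma measurable_tie d (A : measurableType d) (f : A -> dual * dual) : measurable_fun setT f ->
  measurable_fun setT (fun x => tie (f x)).
Proof.
move=> mf; have m1 := measurableT_comp measurable_fst mf; have m2 := measurableT_comp measurable_snd mf.
by apply: measurable_and; exact: measurable_lexle.
Qed.

Let measurable_tie_fst : measurable_fun setT (fun w : Om => tie w.1).
Proof. exact: measurable_tie. Qed.

Let measurable_tie_snd : measurable_fun setT (fun w : Om => tie w.2).
Proof. exact: measurable_tie. Qed.

Lemma measurable_sheet n : measurable_fun setT (sheet n).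
Proof.
rewrite (_ : sheet n = fun w : Om => sheet n (w.1, w.2)); last by apply/funext => -[].
rewrite /sheet; move: n => [|[|[|[|n]]]] //=.
- apply: measurable_or; (apply: measurable_and => //; apply: measurable_and => //).
    by apply: measurable_neg.
  by apply: measurable_neg.
- by apply: measurable_or; apply: measurable_and => //; apply: measurable_neg.
- by apply: measurable_and => //; apply: measurable_and; apply: measurable_neg.
- by apply: measurable_and; apply: measurable_neg.
Qed.

Let mtau := @measurable_total_sum R.
Local Notation tau := (@total_sum R).

Definition fiber_mass (q : Om -> bool) (A : set dual) : \bar R := P ([set w | q w] `&` tau @^-1` A).

Lemma eq_fiber_mass q q' A : q =1 q' -> fiber_mass q A = fiber_mass q' A.
Proof. by move=> /funext ->. Qed.

Lemma measurable_fiber_set (q : Om -> bool) A : measurable_fun setT q -> measurable A -> measurable ([set w | q w] `&` tau @^-1` A).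
Proof.
move=> mq mA; apply: measurableI; first exact: measurable_pred.
by rewrite -[X in measurable X]setTI; exact: mtau.
Qed.

(** A map preserving [P] and the total sum gives a region and its preimage the same image measure.
    The flips are such maps, and they exchange the sheets. *)
Lemma fiber_mass_flip phi q A : transports P P phi -> (forall w, tau (phi w) = tau w) -> measurable_fun setT q ->
  measurable A -> fiber_mass (fun w => q (phi w)) A = fiber_mass q A.
Proof.
move=> [_ tphi] htau mq mA; rewrite -[RHS]tphi; last exact: measurable_fiber_set.
by congr (P _); apply/seteqP; split => w /= [h1 h2]; split => //; move: h2; rewrite /= htau.
Qed.

Lemma fiber_massU (q q' : Om -> bool) A : measurable_fun setT q -> measurable_fun setT q' -> measurable A ->
  (forall w, q w -> q' w -> False) -> fiber_mass (fun w => q w || q' w) A = (fiber_mass q A + fiber_mass q' A)%E.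
Proof.
move=> mq mq' mA dq; rewrite /fiber_mass -measureU; [|exact: measurable_fiber_set|exact: measurable_fiber_set|].
  congr (P _); apply/seteqP; split => w /=.
    by move=> [/orP[h|h] hA]; [left|right].
  by move=> [[h hA]|[h hA]]; rewrite h ?orbT.
by apply/seteqP; split => // w [[h _] [h' _]]; exact: (dq w).
Qed.

Definition strictly_sorted (p : dual * dual) := lexle p.1 p.2 && ~~ tie p.

Let measurable_strict_fst : measurable_fun setT (fun w : Om => strictly_sorted w.1).
Proof. by apply: measurable_and => //; apply: measurable_neg. Qed.

Let measurable_strict_snd : measurable_fun setT (fun w : Om => strictly_sorted w.2).
Proof. by apply: measurable_and => //; apply: measurable_neg. Qed.

Lemma strictly_sorted_swap p : strictly_sorted (swap p) = ~~ lexle p.1 p.2.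
Proof.
rewrite /strictly_sorted /tie /swap /=; have := lexle_total p.1 p.2.
by case: (lexle p.1 p.2); case: (lexle p.2 p.1).
Qed.

Lemma tie_swap p : tie (swap p) = tie p.
Proof. by rewrite /tie andbC. Qed.

Lemma sheet1_measure A : measurable A -> fiber_mass (sheet 1) A = fiber_mass (sheet 0) A.
Proof.
move=> mA; have m1 : measurable_fun setT (fun w : Om => strictly_sorted w.1 && lexle w.2.1 w.2.2) by exact: measurable_and.
have m2 : measurable_fun setT (fun w : Om => tie w.1 && strictly_sorted w.2) by exact: measurable_and.
have m3 : measurable_fun setT (fun w : Om => ~~ lexle w.1.1 w.1.2 && lexle w.2.1 w.2.2).
  by apply: measurable_and => //; apply: measurable_neg.
have m4 : measurable_fun setT (fun w : Om => tie w.1 && ~~ lexle w.2.1 w.2.2).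
  by apply: measurable_and => //; apply: measurable_neg.
(* Sheet 0 is split into the part where the first pair is strict and the part where it is a tie. The
   flip of the first pair carries the former to sheet 1, the flip of the second pair the latter. *)
transitivity (fiber_mass (fun w => strictly_sorted w.1 && lexle w.2.1 w.2.2) A + fiber_mass (fun w => tie w.1 && strictly_sorted w.2) A)%E.
  have e1 : fiber_mass (fun w : Om => ~~ lexle w.1.1 w.1.2 && lexle w.2.1 w.2.2) A =
      fiber_mass (fun w => strictly_sorted w.1 && lexle w.2.1 w.2.2) A.
    rewrite -(fiber_mass_flip transports_flip_fst total_sum_flip_fst m1 mA).
    by apply: eq_fiber_mass => -[p q]; rewrite /flip_fst /= strictly_sorted_swap.
  have e2 : fiber_mass (fun w : Om => tie w.1 && ~~ lexle w.2.1 w.2.2) A =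
      fiber_mass (fun w => tie w.1 && strictly_sorted w.2) A.
    rewrite -(fiber_mass_flip transports_flip_snd total_sum_flip_snd m2 mA).
    by apply: eq_fiber_mass => -[p q]; rewrite /flip_snd /= strictly_sorted_swap.
  rewrite -e1 -e2 -(fiber_massU m3 m4 mA).
    by apply: eq_fiber_mass => -[p q].
  by move=> [p q] /= /andP[/negPf h _] /andP[]; rewrite /tie h.
rewrite -(fiber_massU m1 m2 mA); last by move=> [p q] /= /andP[/andP[_ /negPf ->]].
by apply: eq_fiber_mass => -[p q]; rewrite /sheet /strictly_sorted /= !andbA.
Qed.

Lemma sheet2_measure A : measurable A -> fiber_mass (sheet 2) A = fiber_mass (fun w => strictly_sorted w.1 && strictly_sorted w.2) A.
Proof.
move=> mA; have m : measurable_fun setT (fun w : Om => strictly_sorted w.1 && strictly_sorted w.2) by exact: measurable_and.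
rewrite -(fiber_mass_flip transports_flip_snd total_sum_flip_snd m mA).
by apply: eq_fiber_mass => -[p q]; rewrite /sheet /= strictly_sorted_swap andbA.
Qed.

Lemma sheet3_measure A : measurable A -> fiber_mass (sheet 3) A = fiber_mass (fun w => strictly_sorted w.1 && strictly_sorted w.2) A.
Proof.
move=> mA; have m : measurable_fun setT (fun w : Om => strictly_sorted w.1 && strictly_sorted w.2) by exact: measurable_and.
rewrite -(fiber_mass_flip transports_flip_snd total_sum_flip_snd m mA).
have m' : measurable_fun setT (fun w : Om => strictly_sorted (flip_snd w).1 && strictly_sorted (flip_snd w).2).
  rewrite (_ : (fun w => _) = (fun w : Om => strictly_sorted w.1 && ~~ lexle w.2.1 w.2.2)).
    by apply: measurable_and => //; apply: measurable_neg.
  by apply/funext => -[p q]; rewrite /= strictly_sorted_swap.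
rewrite -(fiber_mass_flip transports_flip_fst total_sum_flip_fst m' mA).
by apply: eq_fiber_mass => -[p q]; rewrite /sheet /= !strictly_sorted_swap.
Qed.

Variable merge : dual -> Om.
Hypothesis mmerge : measurable_fun setT merge.
Hypothesis merge_sort : {ae P, forall w : Om, merge (tau w) = (lexsort w.1, lexsort w.2)}.

(** [merge t] is the sorted point of the fibre. The point on sheet 1 comes from flipping the first
    pair, unless that pair is a tie and only the second can be flipped. *)
Definition sheet_section (n : nat) (t : dual) : Om :=
  let w := merge t in
  match n with
  | 0 => w
  | 1 => if tie w.1 then flip_snd w else flip_fst w
  | 2 => flip_snd w
  | _ => flip_fst (flip_snd w)
  end.

Definition has_tie (t : dual) : bool := tie (merge t).1 || tie (merge t).2.
Definition sheet_number (t : dual) : option nat := if has_tie t then Some 2%N else Some 4%N.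

Lemma measurable_has_tie : measurable_fun setT has_tie.
Proof.
apply: measurable_or; apply: measurable_tie.
  exact: (measurableT_comp measurable_fst mmerge).
exact: (measurableT_comp measurable_snd mmerge).
Qed.

Lemma measurable_flip_fst : measurable_fun setT flip_fst. Proof. by case: transports_flip_fst. Qed.
Lemma measurable_flip_snd : measurable_fun setT flip_snd. Proof. by case: transports_flip_snd. Qed.

Lemma measurable_sheet_section n : measurable_fun setT (sheet_section n).
Proof.
have m1 := measurableT_comp measurable_flip_fst mmerge.
have m2 := measurableT_comp measurable_flip_snd mmerge.
move: n => [|[|[|n]]] //.
- apply: measurable_fun_ifT => //; apply: measurable_tie.
  exact: (measurableT_comp measurable_fst mmerge).
- exact: (measurableT_comp measurable_flip_fst m2).
Qed.

Lemma swapK (p : dual * dual) : swap (swap p) = p. Proof. by case: p. Qed.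

Lemma sheet_sectionK n : {ae P, forall w : Om, sheet n w -> sheet_section n (tau w) = w}.
Proof.
apply: aeS merge_sort => -[p q] h; rewrite /sheet_section h /lexsort /= => {h}.
move: n => [|[|[|[|n]]]] //=.
- by move=> /orP[/and3P[-> _ ->]//|/and3P[/andP[-> _] -> _]].
- move=> /orP[/andP[/negPf x ->]|/andP[t /negPf ->]].
    by rewrite x tie_swap /tie x /= /flip_fst /= swapK.
  by case/andP: (t) => -> _; rewrite t /flip_snd /= swapK.
- by move=> /and3P[-> _ /negPf ->]; rewrite /flip_snd /= swapK.
- by move=> /andP[/negPf -> /negPf ->]; rewrite /flip_fst /flip_snd /= !swapK.
Qed.

Lemma measurable_sheet0 : measurable [set w | sheet 0 w].
Proof. by apply: measurable_pred; exact: measurable_sheet. Qed.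

Let pushed := image_measure (mrestr P measurable_sheet0) mtau.

Lemma image_sheet0_fin : fin_num_fun pushed.
Proof.
move=> A mA; have mB : measurable (tau @^-1` A) by rewrite -[X in measurable X]setTI; exact: mtau.
exact: (fin_num_measure P _ (measurableI _ _ mB measurable_sheet0)).
Qed.

(** The sorted point of a fibre lies on sheet 0 unless both pairs are ties, so the image of this
    sheet has the maximal spectral type. *)
Definition sheet_measure : {finite_measure set dual -> \bar R} := finite_measure_of image_sheet0_fin.

Lemma sheet_measureE A : sheet_measure A = fiber_mass (sheet 0) A.
Proof. by rewrite /fiber_mass setIC. Qed.

Lemma sheet_number_preimage k : sheet_number @^-1` [set k] =
  if k == Some 2%N then [set t | has_tie t] else if k == Some 4%N then [set t | ~~ has_tie t] else set0.
Proof.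
apply/seteqP; split => t /=; rewrite /sheet_number.
  by case: ifP => h <- /=; rewrite ?h.
by case: eqP => [-> /= ->//|_]; case: eqP => [-> /= /negPf ->|].
Qed.

Lemma measurable_sheet_number k : measurable (sheet_number @^-1` [set k]).
Proof.
rewrite sheet_number_preimage; case: ifP => _; first exact: (measurable_pred measurable_has_tie).
case: ifP => _ //; apply: measurable_pred.
by apply: measurable_neg; exact: measurable_has_tie.
Qed.

Lemma measurable_support n : measurable [set t | below n (sheet_number t)].
Proof.
apply: measurable_pred; rewrite (_ : (fun t => _) = (fun t => if has_tie t then below n (Some 2%N) else below n (Some 4%N))).
  by apply: measurable_fun_ifT => //; exact: measurable_has_tie.
by apply/funext => t; rewrite /sheet_number; case: ifP.
Qed.

(** On sheet 0 the point is already sorted, so it equals [merge] of its sum, and both pairs are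
    strict exactly when the fibre has no tie. *)
Lemma strict_measure A : measurable A ->
  fiber_mass (fun w => strictly_sorted w.1 && strictly_sorted w.2) A = fiber_mass (sheet 0) (A `&` sheet_number @^-1` [set Some 4%N]).
Proof.
move=> mA; have mA4 := measurableI _ _ mA (measurable_sheet_number (Some 4%N)).
apply: ae_measure_eq.
- by apply: measurable_fiber_set => //; exact: measurable_and.
- by apply: measurable_fiber_set => //; exact: measurable_sheet.
apply: aeS merge_sort => -[p q] h; rewrite sheet_number_preimage /= /has_tie h /=.
split => [[/andP[/andP[h1 h2] /andP[h3 h4]] hA]|[h1 [hA]]].
  by rewrite h1 h2 h3 /= /lexsort h1 h3 negb_or h2 h4.
move: h1; rewrite /lexsort /strictly_sorted => /orP[/and3P[-> -> ->]|/and3P[t _ _]].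
  by rewrite negb_or => /andP[_ ->].
by case: ifP; rewrite ?tie_swap t.
Qed.

Lemma sheet_measure_eq n A : measurable A ->
  P ([set w | sheet n w] `&` tau @^-1` A) = sheet_measure (A `&` [set t | below n (sheet_number t)]).
Proof.
move=> mA; rewrite sheet_measureE -/(fiber_mass (sheet n) A).
have lt2 k : (k < 2)%N -> [set t | below k (sheet_number t)] = setT.
  by move=> k2; apply/seteqP; split => // t _ /=; rewrite /sheet_number; case: ifP => _ //=; rewrite (leq_trans k2).
have lt4 k : (2 <= k < 4)%N -> [set t | below k (sheet_number t)] = sheet_number @^-1` [set Some 4%N].
  move=> /andP[k2 k4]; rewrite sheet_number_preimage /=; apply/seteqP; split => t /=; rewrite /sheet_number.
    by case: ifP => //=; rewrite ltnNge k2.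
  by move=> /negPf ->.
move: n => [|[|[|[|n]]]].
- by rewrite (lt2 0%N isT) setIT.
- by rewrite (lt2 1%N isT) setIT; exact: sheet1_measure.
- by rewrite (lt4 2%N isT) (sheet2_measure mA); exact: strict_measure.
- by rewrite (lt4 3%N isT) (sheet3_measure mA); exact: strict_measure.
rewrite (_ : [set t | _] = set0); last first.
  by apply/seteqP; split => // t /=; rewrite /sheet_number; case: ifP.
by rewrite setI0 /fiber_mass preimage_set0 setI0 measure0 (_ : [set w | _] = set0) ?set0I ?measure0//;
  apply/seteqP; split => // -[].
Qed.

Lemma sheet_measure_square : sheet_measure (~` square) = 0%E.
Proof.
have [N [mN N0 sN]] := ae_squares s_square r_square.
have ms : measurable (~` square) by apply: measurableC; exact: measurable_square.
rewrite sheet_measureE; apply: (subset_measure0 _ mN _ N0); first by apply: measurable_fiber_set => //; exact: measurable_sheet.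
move=> w [_ /= wA]; apply: sN => /= -[h1 h2 h3 h4]; apply: wA.
exact: (tadd_square (tadd_square h1 h2) (tadd_square h3 h4)).
Qed.

Context {d : measure_display} {X : measurableType d}.
Variables (mu : probability X R) (S : int * int -> X -> X) (V : (X -> R[i]) -> Om -> R[i]).
Hypothesis sS : system mu S.
Hypothesis uV : unitary_iso mu P V.
Hypothesis iV : intertwines mu S P tau V.
Variable H : set (X -> R[i]).
Hypothesis HV : forall f, H f <-> L2 mu f /\ {ae P, forall w : Om, tie w.1 -> tie w.2 -> V f w = 0}.

Lemma sheet_representation : spectral_representation mu H (koopman S) sheet_measure sheet_number.
Proof.
apply: (@fiber_representation R _ _ P tau (fun n => [set w | sheet n w]) sheet_section sheet_measure
  sheet_number 4 mtau _ measurable_sheet_section measurable_support sheet_measure_eq sheet_sectionK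
  sheet_disjoint _ _ _ mu S V sS uV iV H) => //.
- by move=> n; apply: measurable_pred; exact: measurable_sheet.
- by move=> n n4; apply/seteqP; split => // -[p q]; move: n4; move: n => [|[|[|[|n]]]].
- move=> f; rewrite HV; split => -[Lf h]; split => //; apply: aeS h => w h.
    move=> hw; have /negPn/andP[t1 t2] : ~~ ~~ (tie w.1 && tie w.2).
      by apply/negP => /sheet_cover.
    exact: h.
  by move=> t1 t2; apply: h => /= /sheet_cover; rewrite t1 t2.
- exact: sheet_measure_square.
- exact: measurable_sheet_number.
- by rewrite sheet_number_preimage; exact: measure0.
Qed.

Hypothesis s0 : (0 < s [set tzero])%E.
Hypothesis s1 : (0 < s (~` [set tzero]))%E.
Hypothesis r0 : (0 < r [set tzero])%E.
Hypothesis r1 : (0 < r (~` [set tzero]))%E.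

Lemma lexle_tzero t : square t -> lexle tzero t.
Proof.
move=> /squareP[/andP[t1 _] /andP[t2 _]]; rewrite /lexle /=.
by move: t1; rewrite le_eqVlt => /orP[/eqP <-|->//]; rewrite eqxx ltxx.
Qed.

Lemma strictly_sorted_tzero t : square t -> t <> tzero -> strictly_sorted (tzero, t).
Proof.
move=> ts tn; rewrite /strictly_sorted /= lexle_tzero//=; apply/negP => /tie_eq /= h; exact: tn.
Qed.

(** The region contains, up to a null set, a product of four sets of positive measure. *)
Lemma fiber_mass_gt0 (A1 A2 A3 A4 C : set dual) (q : Om -> bool) : measurable A1 -> measurable A2 ->
  measurable A3 -> measurable A4 -> (0 < s A1)%E -> (0 < s A2)%E -> (0 < r A3)%E -> (0 < r A4)%E ->
  measurable_fun setT q -> measurable C ->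
  {ae P, forall w : Om, A1 w.1.1 -> A2 w.1.2 -> A3 w.2.1 -> A4 w.2.2 -> q w /\ C (tau w)} ->
  (0 < fiber_mass q C)%E.
Proof.
move=> m1 m2 m3 m4 p1 p2 p3 p4 mq mC [N [mN N0 sN]].
have mB : measurable ((A1 `*` A2) `*` (A3 `*` A4)) by do 2 ?apply: measurableX.
have PB : P ((A1 `*` A2) `*` (A3 `*` A4)) = ((s A1 * s A2) * (r A3 * r A4))%E.
  transitivity (pp s s (A1 `*` A2) * pp r r (A3 `*` A4))%E.
    exact: (product_rect _ _ (measurableX m1 m2) (measurableX m3 m4)).
  by congr (_ * _)%E; exact: product_rect.
apply: (@lt_le_trans _ _ (P ((A1 `*` A2) `*` (A3 `*` A4)))).
  by rewrite PB !mule_gt0.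
rewrite /fiber_mass -(measureU0 (measurable_fiber_set mq mC) mN N0); apply: le_measure; rewrite ?inE//.
  by apply: measurableU => //; exact: measurable_fiber_set.
move=> w [[/= h1 h2] [/= h3 h4]]; have [wN|wN] := pselect (N w); [by right|left].
have [] : q w /\ C (tau w) => //.
apply: contrapT => h; apply: wN; apply: sN => /= h'; apply: h; exact: h'.
Qed.

(** Three coordinates at the origin and the last one off it give exactly one tie; one coordinate of
    each pair at the origin and the other off it give none. Each configuration has positive mass. *)
Lemma sheet_number_essential k : k = Some 2%N \/ k = Some 4%N ->
  (0 < sheet_measure (sheet_number @^-1` [set k]))%E.
Proof.
have m0 := @measurable_tzero R; have m1 := measurableC m0.
have sq4 := ae_squares s_square r_square.
case=> ->; rewrite sheet_measureE.
  apply: (fiber_mass_gt0 m0 m0 m0 m1) => //; first exact: measurable_sheet.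
    exact: measurable_sheet_number.
  move: sq4 merge_sort; apply: filterS2 => -[[x x'] [y y']] [/= _ _ _ hy] h x0 x'0 y0 yn.
  rewrite /= in x0 x'0 y0; subst x x' y.
  have /andP[hl ht] := strictly_sorted_tzero hy yn.
  rewrite tie_refl lexle_refl hl ht /sheet_number /has_tie h /=; split => //.
  by rewrite /lexsort lexle_refl tie_refl.
rewrite -[_ @^-1` _](setTI) -strict_measure//.
apply: (fiber_mass_gt0 m0 m1 m0 m1) => //; first exact: measurable_and.
by apply: aeS sq4 => -[[x x'] [y y']] [/= _ hx _ hy] -> xn -> yn; rewrite !strictly_sorted_tzero.
Qed.

End Sheets.

Section ProductModel.
Context {R : realType} {d1 d2 : measure_display} {X : measurableType d1} {Y : measurableType d2}.
Local Notation dual := (measurableTypeR R * measurableTypeR R)%type.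
Local Notation square := (`[0%R, 1%R[%classic `*` `[0%R, 1%R[%classic : set dual).
Local Notation tzero := (@tzero R).
Local Notation pp := product_probability.
Local Notation Om := ((dual * dual) * (dual * dual))%type.
Variables (mu : probability X R) (nu : probability Y R).
Variables (S : int * int -> X -> X) (T : int * int -> Y -> Y).
Variables (s r : probability dual R) (V : (X -> R[i]) -> dual -> R[i]) (W : (Y -> R[i]) -> dual -> R[i]).
Hypothesis sS : system mu S.
Hypothesis sT : system nu T.
Hypothesis s_square : s (~` square) = 0%E.
Hypothesis r_square : r (~` square) = 0%E.
Hypothesis uV : unitary_iso mu s V.
Hypothesis uW : unitary_iso nu r W.
Hypothesis iV : intertwines mu S s id V.
Hypothesis iW : intertwines nu T r id W.
Hypothesis eS : forall z, z != 0 -> ergodic (pp mu mu) (product_action S S z).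
Hypothesis eT : forall z, z != 0 -> ergodic (pp nu nu) (product_action T T z).
Local Notation mu4 := (pp (pp mu mu) (pp nu nu)).
Local Notation action4 := (product_action (product_action S S) (product_action T T)).
Local Notation P := (pp (pp s s) (pp r r)).
Local Notation origin := (((tzero, tzero), (tzero, tzero)) : Om).

Lemma product_model : exists VV, [/\ unitary_iso mu4 P VV,
  intertwines mu4 action4 P (@total_sum R) VV
  & {ae P, forall w : Om, w <> origin -> VV (cst 1) w = 0}].
Proof.
have [V2 [uV2 iV2 tV2 _]] := square_model sS uV iV.
have [W2 [uW2 iW2 tW2 _]] := square_model sT uW iW.
have m2 : measurable_fun setT (fun p : dual * dual => tadd p.1 p.2).
  by apply: measurable_tadd; [exact: measurable_fst|exact: measurable_snd].
have [VV [uVV iVV tVV]] := tensor_intertwines (system_product sS sS) (system_product sT sT)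
  m2 m2 uV2 uW2 iV2 iW2.
exists VV; split => //.
have L1 : L2 (pp mu mu) (cst 1) by exact: L2_cst.
have L1' : L2 (pp nu nu) (cst 1) by exact: L2_cst.
have h1 := ae_product_fst (pp r r) (square_one_support s_square iV uV2 iV2 tV2).
have h2 := ae_product_snd (pp s s) (square_one_support r_square iW uW2 iW2 tW2).
have := tVV _ _ L1 L1'; rewrite (_ : tensor (cst 1) (cst 1) = cst 1); last first.
  by apply/funext => w; rewrite /tensor /cst mulr1.
move: h1 h2; apply: filterS3 => -[p q] /= h1 h2 -> pq; rewrite /tensor /=.
have [p0|pn] := pselect (p = (tzero, tzero)); last by rewrite h1// mul0r.
by rewrite h2 ?mulr0// => q0; apply: pq; rewrite p0 q0.
Qed.

Lemma measurable_origin : measurable [set origin].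
Proof.
have m2 : measurable [set (tzero, tzero)].
  rewrite (_ : [set _] = [set tzero] `*` [set tzero]).
    by apply: measurableX; exact: measurable_tzero.
  by apply/seteqP; split => [t -> //|[x y] [/= -> ->]].
rewrite (_ : [set _] = [set (tzero, tzero)] `*` [set (tzero, tzero)]).
  exact: measurableX.
by apply/seteqP; split => [t -> //|[x y] [/= -> ->]].
Qed.

(** The model of 1 is carried by the atom at [origin], so orthogonality to the constants is
    vanishing there. Almost every double tie is the origin, because both diagonals are null off
    it. *)
Lemma orthocomp_constants_model VV : unitary_iso mu4 P VV ->
  {ae P, forall w : Om, w <> origin -> VV (cst 1) w = 0} -> forall f, orthocomp_constants mu4 f <->
  L2 mu4 f /\ {ae P, forall w : Om, tie w.1 -> tie w.2 -> VV f w = 0}.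
Proof.
move=> uVV v0 f; have L1 : L2 mu4 (cst 1) by exact: L2_cst.
have Lv := unitary_L2 uVV L1.
have cst_inner : L2 mu4 f -> (forall c, inner mu4 f (cst c) = 0) <-> inner mu4 f (cst 1) = 0.
  move=> Lf; split => [|h c]; first exact.
  rewrite (_ : cst c = (fun x => c * cst 1 x)); last by apply/funext => x; rewrite /cst mulr1.
  by rewrite innerZr// h mulr0.
have massE := inner_point measurable_origin Lv Lv v0.
rewrite (unitary_inner uVV L1 L1) probability_inner1 in massE.
have ties : {ae P, forall w : Om, tie w.1 -> tie w.2 -> w = origin}.
  have h1 := ae_product_fst (pp r r) (diagonal_null sS s_square uV iV eS).
  have h2 := ae_product_snd (pp s s) (diagonal_null sT r_square uW iW eT).
  move: h1 h2; apply: filterS2 => -[[x x'] [y y']] /= h1 h2 /tie_eq /= e1 /tie_eq /= e2.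
  by rewrite -e1 -e2 (h1 e1) (h2 e2).
have E : L2 mu4 f -> inner mu4 f (cst 1) = 0 <-> VV f origin = 0.
  move=> Lf; have LVf := unitary_L2 uVV Lf.
  rewrite -(unitary_inner uVV Lf L1) (innerJ Lv LVf) (inner_point measurable_origin Lv LVf v0).
  split => [/eqP|->]; last by rewrite conjC0 mulr0 mul0r conjC0.
  rewrite conjC_eq0 !mulf_eq0 conjC_eq0 => /orP[/orP[/eqP h|/eqP//]|/eqP h].
    by move: massE; rewrite h !mul0r => /eqP; rewrite oner_eq0.
  by move: massE; rewrite h mulr0 => /eqP; rewrite oner_eq0.
split => [[Lf h]|[Lf h]]; split => //.
  have f0 := (E Lf).1 ((cst_inner Lf).1 h).
  by apply: aeS ties => w hw t1 t2; rewrite hw.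
apply/cst_inner/E => //; apply/eqP; apply: contraT => /eqP fn.
have [N [mN N0 sN]] := h.
have P0 : P [set origin] = 0%E.
  apply: (subset_measure0 measurable_origin mN _ N0) => w /= ->; apply: sN => /= h'.
  by apply: fn; apply: h'; exact: tie_refl.
by move: massE; rewrite P0 mulr0 => /eqP; rewrite oner_eq0.
Qed.

End ProductModel.

Section OrthocompConstants.
Context {R : realType} {d : measure_display} {X : measurableType d}.
Variables (mu : probability X R) (S : int * int -> X -> X).
Hypothesis sS : system mu S.

Lemma orthocomp_constants_lin c f g : orthocomp_constants mu f -> orthocomp_constants mu g ->
  orthocomp_constants mu (fun x => c * f x + g x).
Proof.
move=> [Lf hf] [Lg hg]; split; first exact: L2lin.
by move=> k; rewrite inner_linl ?hf ?hg ?mulr0 ?addr0//; exact: L2_cst.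
Qed.

Lemma orthocomp_constants_koopman z f : orthocomp_constants mu f ->
  orthocomp_constants mu (koopman S z f).
Proof.
move=> [Lf hf]; split; first exact: koopman_L2.
by move=> c; rewrite -(hf c) -[RHS](koopman_inner sS z Lf (L2_cst mu c)).
Qed.

End OrthocompConstants.

Lemma simple_square_model {R : realType} {d} {X : measurableType d} (mu : probability X R) S :
  system mu S ->
  (forall z, z != 0 -> ergodic (product_probability mu mu) (product_action S S z)) ->
  symmetric_square_simple_spectrum mu S ->
  exists (s : probability (measurableTypeR R * measurableTypeR R)%type R) V,
    [/\ s (~` (`[0, 1[ `*` `[0, 1[)) = 0%E, unitary_iso mu s V & intertwines mu S s id V].
Proof. by move=> sS eS hS2; apply: spectral_model => //; exact: cyclic_vector. Qed.

Lemma fine_gt0_measure {R : realType} {d} {A : measurableType d} (P : probability A R) D :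
  measurable D -> 0 < fine (P D) -> (0 < P D)%E.
Proof. by move=> mD h; rewrite -(fineK (fin_num_measure P _ mD)) lte_fin. Qed.

Theorem mainTheorem2 (R : realType) (d1 d2 : measure_display)
    (X : measurableType d1) (Y : measurableType d2)
    (mu : probability X R) (nu : probability Y R)
    (S : int * int -> X -> X) (T : int * int -> Y -> Y)
    (w u : nat -> int * int) (a1 a2 b1 b2 : R)
    (hmu : lebesgue_space mu) (hnu : lebesgue_space nu)
    (hS : Z2_action mu S) (hT : Z2_action nu T)
    (herg : totally_ergodic
       (product_probability (product_probability mu mu) (product_probability nu nu))
       (product_action (product_action S S) (product_action T T)))
    (hS2 : symmetric_square_simple_spectrum mu S)
    (hT2 : symmetric_square_simple_spectrum nu T)
    (ha1 : 0 < a1) (ha2 : 0 < a2) (hb1 : 0 < b1) (hb2 : 0 < b2)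
    (hSw : weak_operator_cvg mu (fun i => koopman S (w i))
       (fun f x => a1%:C * f x + (1 - a1)%:C * Theta mu f x))
    (hTw : weak_operator_cvg nu (fun i => koopman T (w i))
       (fun f y => b1%:C * koopman T (1, 0) f y + (1 - b1)%:C * Theta nu f y))
    (hSu : weak_operator_cvg mu (fun i => koopman S (u i))
       (fun f x => a2%:C * f x + (1 - a2)%:C * Theta mu f x))
    (hTu : weak_operator_cvg nu (fun i => koopman T (u i))
       (fun f y => b2%:C * koopman T (0, 1) f y + (1 - b2)%:C * Theta nu f y)) :
  spectral_multiplicities
    (product_probability (product_probability mu mu) (product_probability nu nu))
    (product_action (product_action S S) (product_action T T))
  = [set Some 2%N; Some 4%N].
Proof.
have sS := Z2_action_system hS; have sT := Z2_action_system hT.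
have sS2 := system_product sS sS; have sT2 := system_product sT sT.
(* Ergodicity passes from the full product to each factor through cylinder sets. *)
have eS z : z != 0 -> ergodic (product_probability mu mu) (product_action S S z).
  by move=> z0; apply: (ergodic_fst _ (herg z z0)); case: (koopman_transports sS2 z).
have eT z : z != 0 -> ergodic (product_probability nu nu) (product_action T T z).
  by move=> z0; apply: (ergodic_snd _ (herg z z0)); case: (koopman_transports sT2 z).
have [s [V [s_square uV iV]]] := simple_square_model sS eS hS2.
have [r [W [r_square uW iW]]] := simple_square_model sT eT hT2.
have id_limit (v : nat -> int * int) (a : R) :
    weak_operator_cvg mu (fun i => koopman S (v i)) (fun f x => a%:C * f x + (1 - a)%:C * Theta mu f x) ->
    weakly_cvg s (fun i => character (v i))
      (fun t => a%:C * character 0 t + (1 - a)%:C * (\1_[set tzero] t)%:C).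
  move=> h; apply: (model_weak_limit sS s_square uV iV (Op := id)) => // f Lf.
  by apply: aeW => t; rewrite character0 mul1r.
have shift_limit (v : nat -> int * int) z (b : R) :
    weak_operator_cvg nu (fun i => koopman T (v i))
      (fun f y => b%:C * koopman T z f y + (1 - b)%:C * Theta nu f y) ->
    weakly_cvg r (fun i => character (v i))
      (fun t => b%:C * character z t + (1 - b)%:C * (\1_[set tzero] t)%:C).
  move=> h; apply: (model_weak_limit sT r_square uW iW (Op := koopman T z)) => //.
    by move=> f; exact: koopman_L2.
  by move=> f Lf; exact: iW.
have [xi [eta [mxi meta xi_eta]]] := sum_factors s_square r_square ha1 ha2 hb1 hb2
  (id_limit _ _ hSw) (shift_limit _ _ _ hTw) (id_limit _ _ hSu) (shift_limit _ _ _ hTu).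
have [zx mzx zxE] := sorted_pair_factor sS s_square uV iV eS hS2.
have [zy mzy zyE] := sorted_pair_factor sT r_square uW iW eT hT2.
(* From the total sum to the two partial sums, then from each partial sum to its sorted pair. *)
pose merge t := (zx (xi t), zy (eta t)).
have mmerge : measurable_fun setT merge.
  by apply: measurable_fun_pair; exact: measurableT_comp.
have merge_sort : {ae product_probability (product_probability s s) (product_probability r r),
    forall p, merge (total_sum p) = (lexsort p.1, lexsort p.2)}.
  have h1 := ae_product_fst (product_probability r r) zxE.
  have h2 := ae_product_snd (product_probability s s) zyE.
  by move: xi_eta h1 h2; apply: filterS3 => p [e1 e2] h1 h2; rewrite /merge e1 e2 h1 h2.
have [VV [uVV iVV v0]] := product_model sS sT s_square r_square uV uW iV iW.
have HVV := orthocomp_constants_model sS sT s_square r_square uV uW iV iW eS eT uVV v0.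
have rep := sheet_representation s_square r_square mmerge merge_sort
  (system_product sS2 sT2) uVV iVV HVV.
have m0 := @measurable_tzero R; have m1 := measurableC m0.
have ess k := sheet_number_essential s_square r_square mmerge merge_sort
  (fine_gt0_measure m0 (model_zero_gt0 s_square uV iV))
  (fine_gt0_measure m1 (model_nonzero_gt0 s_square uV iV hmu))
  (fine_gt0_measure m0 (model_zero_gt0 r_square uW iW))
  (fine_gt0_measure m1 (model_nonzero_gt0 r_square uW iW hnu)) (k := k).
apply/seteqP; split => k; last first.
  by move=> hk; eexists; eexists; split; [exact: rep|apply: ess; case: hk => ->; [left|right]].
(* A value other than 2 and 4 has an empty level set for [sheet_number]; by uniqueness its level set
   is null in every other model. *)
move=> [sigma [m [rep' gt0]]]; apply: contrapT => hk.
move: gt0; rewrite (spectral_multiplicity_unique _ _ _ rep' rep) ?ltxx//.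
- by move=> f [].
- by move=> c f g; exact: orthocomp_constants_lin.
- by move=> z f; apply: orthocomp_constants_koopman; exact: system_product.
rewrite sheet_number_preimage; case: eqP => [k2|_]; first by case: hk; left.
by case: eqP => [k4|_]; [case: hk; right|exact: measure0].
Qed.
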